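(* Let $\{X(t), t\in\mathbb{R}\}$ be a $2\pi$-periodic real-valued centered mean-square continuous stationary Gaussian process, with spectral measure $(\mu_k)_{k\in\mathbb{Z}}$. Assume that, for some $r>1$ and $M>0$, $$\mu_k \sim M|k|^{-r},\qquad |k|\to\infty .$$ Let $q\in L_1[0,2\pi]$ be a non-negative weight that is not almost everywhere zero. Then, as $\varepsilon\to 0^+$, $$\ln \mathbb{P}\left(\int_0^{2\pi} q(t)|X(t)|^2\,dt\le \varepsilon^2\right)\sim -\left(\frac{M^{1/r}}{r\sin(\pi/r)}\int_0^{2\pi} q(t)^{1/r}\,dt\right)^{\frac{r}{r-1}}\frac{(r-1)(2\pi)^{\frac1{r-1}}}{2\,\varepsilon^{\frac{2}{r-1}}}.$$
   Context: The spectral measure of a $2\pi$-periodic centered mean-square continuous stationary process $X$ is the finite non-negative measure $(\mu_k)_{k\in\mathbb{Z}}$ on $\mathbb{Z}$ determined by $\operatorname{cov}(X(s),X(t))=\sum_{k\in\mathbb{Z}}\mu_k e^{\mathbf{i}k(s-t)}$ for all $s,t\in\mathbb{R}$. (For real $X$ it is symmetric, $\mu_{-k}=\mu_k$.) The notation $f\sim g$ means that $f/g\to1$ in the indicated limit. The process is considered as a random element of $L_2$ over $[0,2\pi]$ (i.e. a measurable version is used), so that the integral is a well-defined random variable. *)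

(* Defs.v *)
From HB Require Import structures.
From mathcomp Require Import all_boot all_order all_algebra complex.
From mathcomp Require Import all_classical all_reals all_analysis.
Set Implicit Arguments.
Unset Strict Implicit.
Unset Printing Implicit Defensive.
Import Order.TTheory GRing.Theory Num.Theory.
Import numFieldNormedType.Exports.
Local Open Scope classical_set_scope.
Local Open Scope ring_scope.

Definition asymp_equiv (T : Type) (R : realType) (F : set_system T)
    (f g : T -> R) : Prop :=
  f x / g x @[x --> F] --> (1 : R).

Definition absz_infty : set_system int :=
  filter_from [set: nat] (fun N => [set k : int | (N <= `|k|)%N]).

Global Instance absz_infty_proper : ProperFilter absz_infty.
Proof.
apply: filter_from_proper; last by move=> N _; exists N%:Z => /=.
apply: filter_from_filter; first by exists 0%N.
move=> M N _ _; exists (maxn M N) => // k /=.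
by rewrite geq_max => /andP[].
Qed.

Section process.
Context {d : measure_display} {T : measurableType d} {R : realType}.
Variable P : probability T R.

(* Constants count as Gaussian.  The case s = 0 is separate because
   normal_prob m 0 is by convention the uniform law on [0, 1]. *)
Definition gaussian_rv (Y : T -> R) : Prop :=
  measurable_fun [set: T] Y /\
  exists m s : R, 0 <= s /\
    forall A : set R, measurable A ->
      pushforward P Y A = if s == 0 then dirac m A else normal_prob m s A.

Implicit Types X : R -> {RV P >-> R}.

Definition gaussian_process X : Prop :=
  forall (n : nat) (t a : 'I_n -> R),
    gaussian_rv (fun w => \sum_(i < n) a i * X (t i) w).

Definition centered_process X : Prop := forall t, 'E_P[X t]%E = 0%E.

(* Wide-sense stationarity, under which spectral measures are defined; for
   Gaussian processes it is equivalent to strict stationarity. *)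
Definition stationary_process X : Prop :=
  [/\ forall t, (X t : T -> R) \in Lfun P 2%:E,
      forall s t, 'E_P[X s]%E = 'E_P[X t]%E &
      forall h s t,
        covariance P (X (s + h)) (X (t + h)) = covariance P (X s) (X t)].

Definition periodic_process (p : R) X : Prop :=
  forall t, {ae P, forall w, X (t + p) w = X t w}.

Definition ms_continuous X : Prop :=
  forall t, 'E_P[(fun w => (X s w - X t w) ^+ 2)%R]%E @[s --> t] --> 0%E.

Definition jointly_measurable X : Prop :=
  measurable_fun [set: T * R] (fun z : T * R => X z.2 z.1).

(* e^{ix}, by Euler's formula *)
Definition expi (x : R) : R[i] := Complex (cos x) (sin x).

(* The bilateral series converges absolutely since mu is summable, so summing
   over -n <= k <= n is no restriction. *)
Definition spectral_measure X (mu : int -> R) : Prop :=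
  [/\ forall k, 0 <= mu k,
      summable [set: int] (fun k => (mu k)%:E) &
      forall s t,
        (\sum_(j < n.*2.+1)
           let k := j%:Z - n%:Z in
           real_complex R (mu k) * expi (k%:~R * (s - t)) : R[i]^o)
          @[n --> \oo] -->
        (real_complex R (fine (covariance P (X s) (X t))) : R[i]^o)].

End process.

(* Main.v *)
Require Import Defs.
From HB Require Import structures.
From mathcomp Require Import all_boot all_order all_algebra complex.
From mathcomp Require Import all_classical all_reals all_analysis.
From mathcomp Require Import measurable_realfun perm zify ring lra.
Set Implicit Arguments.
Unset Strict Implicit.
Unset Printing Implicit Defensive.
Import Order.TTheory GRing.Theory Num.Theory.
Import numFieldNormedType.Exports.
Local Open Scope classical_set_scope.
Local Open Scope ring_scope.

(** The weighted integral [V] of the squared process is studied through its Laplace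
    transform [L s], the expectation of [exp (- s V)]. Put [a = 1 / r]. The theorem
    follows from [ln (L s) ~ - A s^a] with an explicit constant [A], by a Tauberian
    theorem ([tauberian_real]): the upper bound is Markov's inequality at the saddle
    point, the lower bound says that the law tilted by [exp (- s V)] concentrates
    there.

    On a grid of [m] points the integral becomes a finite quadratic form in a
    Gaussian vector, with the masses of the grid cells as weights. Its Laplace
    transform is the inverse square root of the determinant of [1 + 2 s W S], where
    [W] is the diagonal matrix of the weights and [S] the covariance matrix of the
    process on the grid ([laplace_gaussian], [laplace_grid]). Mean-square continuity
    makes the discretization error vanish as the grid is refined
    ([laplace_discretization]). Everything therefore rests on half the logarithm of
    this determinant, [logdet], for which bounds that do not depend on the grid are
    needed.

    [logdet] is monotone and subadditive in the weights. Decomposing the covariance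
    into frequencies yields an upper bound by a sum of [ln (1 + x mu_k)] that sees
    only the total mass of the weights, and for uniform weights the orthogonality of
    trigonometric functions on the grid yields a matching lower bound. As
    [mu_k ~ M |k|^(-r)], both sums grow as [(2 M x)^a] times the integral of
    [ln (1 + y^(-r))] over the positive half-line, which is [pi / sin (pi a)] by
    Euler's reflection formula. The latter is proved here by a maximum principle:
    both sides satisfy the same triplication identity and have the same pole
    ([reflection_intE]).

    The passage to other weights relies on the almost independence of the process
    on separated arcs ([logdet_localize]). Multiplying the covariance function by a
    positive definite cutoff supported near zero makes distant arcs exactly
    independent, at the price of averaging the spectral measure over nearby
    frequencies; because [mu] is regularly varying this changes high frequencies by
    a factor close to one, and low frequencies only matter logarithmically. So the
    circle can be cut into [n] arcs, each accounting for one [n]-th of the growth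
    for the uniform weight ([arc_bounds]). A step function with values [q_i] then
    yields the mean of the [q_i^a] ([step_bounds]), and approximation in mean
    extends this to integrable weights ([logdet_asymptotics],
    [step_approximation]): [A] is a multiple of the integral of [q^a]. *)

(** * Determinants of the identity plus a positive semidefinite matrix *)

(** Sylvester's identity, by eliminating a block of [[1, -A], [B, 1]] from the
    left or from the right. *)
Lemma det1_mulmxC (K : comNzRingType) m n (A : 'M[K]_(m, n)) (B : 'M[K]_(n, m)) :
  \det (1%:M + A *m B) = \det (1%:M + B *m A).
Proof.
have e1 : block_mx 1%:M (- A) B 1%:M *m block_mx 1%:M A 0 1%:M =
    block_mx 1%:M 0 B (1%:M + B *m A).
  rewrite mulmx_block !mulmx1 !mulmx0 !mul1mx ?addr0.
  by rewrite subrr [B *m A + _]addrC.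
have e2 : block_mx 1%:M A 0 1%:M *m block_mx 1%:M (- A) B 1%:M =
    block_mx (1%:M + A *m B) 0 B 1%:M.
  by rewrite mulmx_block !mulmx1 !mul1mx !mul0mx addNr !add0r.
have := det_mulmx (block_mx 1%:M (- A) B 1%:M) (block_mx 1%:M A 0 1%:M).
rewrite e1 det_lblock det1 mul1r det_ublock !det1 !mulr1 => ->.
have := det_mulmx (block_mx 1%:M A 0 1%:M) (block_mx 1%:M (- A) B 1%:M).
by rewrite e2 det_lblock det1 mulr1 det_ublock !det1 !mul1r.
Qed.

Section Psd.
Context {R : rcfType}.

Definition bilin n (A : 'M[R]_n) (x y : 'cV[R]_n) : R := (x^T *m A *m y) 0 0.

Definition psd n (A : 'M[R]_n) := A^T = A /\ forall x, 0 <= bilin A x x.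

Lemma bilinE n (A : 'M[R]_n) x y :
  bilin A x y = \sum_i \sum_j x i 0 * A i j * y j 0.
Proof.
rewrite /bilin mxE exchange_big /=; apply: eq_bigr => j _.
by rewrite mxE mulr_suml; apply: eq_bigr => i _; rewrite mxE.
Qed.

Lemma bilinC n (A : 'M[R]_n) x y : A^T = A -> bilin A x y = bilin A y x.
Proof.
move=> sA; rewrite /bilin -[in LHS](trmxK (x^T *m A *m y)) mxE.
by rewrite !trmx_mul trmxK sA mulmxA.
Qed.

Lemma bilinDm n (A B : 'M[R]_n) x y : bilin (A + B) x y = bilin A x y + bilin B x y.
Proof. by rewrite /bilin mulmxDr mulmxDl mxE. Qed.

Lemma bilinZm n (A : 'M[R]_n) c x y : bilin (c *: A) x y = c * bilin A x y.
Proof. by rewrite /bilin -scalemxAr -scalemxAl mxE. Qed.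

Lemma bilinDr n (A : 'M[R]_n) x y z : bilin A x (y + z) = bilin A x y + bilin A x z.
Proof. by rewrite /bilin mulmxDr mxE. Qed.

Lemma bilinDl n (A : 'M[R]_n) x y z : bilin A (y + z) x = bilin A y x + bilin A z x.
Proof. by rewrite /bilin linearD /= !mulmxDl mxE. Qed.

Lemma bilinZr n (A : 'M[R]_n) c x y : bilin A x (c *: y) = c * bilin A x y.
Proof. by rewrite /bilin -scalemxAr mxE. Qed.

Lemma bilinZl n (A : 'M[R]_n) c x y : bilin A (c *: x) y = c * bilin A x y.
Proof. by rewrite /bilin linearZ /= -!scalemxAl mxE. Qed.

Lemma psd0 n : psd (0 : 'M[R]_n).
Proof. by split=> [|x]; rewrite ?trmx0// /bilin mulmx0 mul0mx mxE. Qed.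

Lemma psdD n (A B : 'M[R]_n) : psd A -> psd B -> psd (A + B).
Proof.
move=> [sA pA] [sB pB]; split=> [|x]; first by rewrite linearD /= sA sB.
by rewrite bilinDm addr_ge0.
Qed.

Lemma psdZ n (A : 'M[R]_n) c : 0 <= c -> psd A -> psd (c *: A).
Proof.
move=> c0 [sA pA]; split=> [|x]; first by rewrite linearZ /= sA.
by rewrite bilinZm mulr_ge0.
Qed.

Lemma dotmx_ge0 n (y : 'cV[R]_n) : 0 <= (y^T *m y) 0 0.
Proof. by rewrite mxE sumr_ge0// => i _; rewrite mxE -expr2 sqr_ge0. Qed.

Lemma psd_congr n k (B : 'M[R]_(n, k)) (A : 'M[R]_k) :
  psd A -> psd (B *m A *m B^T).
Proof.
move=> [sA pA]; split=> [|x].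
  by rewrite !trmx_mul trmxK sA mulmxA.
have := pA (B^T *m x); congr (_ <= _).
by rewrite /bilin trmx_mul trmxK !mulmxA.
Qed.

Lemma psd1 n : psd (1%:M : 'M[R]_n).
Proof. by split=> [|x]; rewrite ?trmx1// /bilin mulmx1 dotmx_ge0. Qed.

Lemma psd_gram n k (B : 'M[R]_(n, k)) : psd (B *m B^T).
Proof. by have := psd_congr B (psd1 k); rewrite mulmx1. Qed.

(** Cholesky factorization: one row is eliminated at a time, and a zero
    diagonal entry of a positive semidefinite matrix forces a zero row. *)
Lemma psd_factor n (A : 'M[R]_n) : psd A -> exists B : 'M[R]_n, A = B *m B^T.
Proof.
elim: n A => [|n IH] A; first by move=> _; exists 0; apply/matrixP => -[].
rewrite -(@submxK _ 1 n 1 n A).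
set a := ulsubmx _; set b := ursubmx _; set b' := dlsubmx _; set C := drsubmx _.
change (@psd (1 + n) (block_mx a b b' C) ->
  exists B : 'M[R]_(1 + n), block_mx a b b' C = B *m B^T).
move=> [sA pA].
have eb : b' = b^T.
  by move: sA; rewrite tr_block_mx => /eq_block_mx [_ _ <- _].
have sC : C^T = C by move: sA; rewrite tr_block_mx => /eq_block_mx [].
have ea : a = (a 0 0)%:M by rewrite -mx11_scalar.
have qA (t : R) (y : 'cV[R]_n) :
    0 <= a 0 0 * t ^+ 2 + (b *m y) 0 0 * t *+ 2 + bilin C y y.
  have := pA (col_mx t%:M y); congr (_ <= _).
  rewrite /bilin -mulmxA mul_block_col tr_col_mx mul_row_col tr_scalar_mx eb.
  rewrite {1}ea !mul_scalar_mx mul_mx_scalar (mulmxDr y^T) -scalemxAr -trmx_mul.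
  rewrite mulmxA; move: (b *m y) (y^T *m C *m y) => u v.
  rewrite !mxE eqxx /= mulr1n.
  ring.
have a0 : 0 <= a 0 0.
  by have := qA 1 0; rewrite mulmx0 /bilin mulmx0 !mxE expr1n mulr1 mul0r mul0rn !addr0.
have [az|anz] := eqVneq (a 0 0) 0.
  have b0 : b = 0.
    apply/rowP => j; rewrite [RHS]mxE.
    have ej t : 0 <= b 0 j * t *+ 2 + C j j.
      have := qA t (delta_mx j 0); rewrite az mul0r add0r.
      rewrite -colE mxE /bilin trmx_delta -rowE -colE !mxE; exact.
    have := ej 0; rewrite mulr0 mul0rn add0r => C0.
    have := ej (- (C j j + 1) / b 0 j); have [->//|bn0] := eqVneq (b 0 j) 0.
    rewrite mulrC divfK// => h; lra.
  have [|B eB] := IH C; first by split=> // y; have := qA 0 y; rewrite az; congr (_ <= _); ring.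
  exists (block_mx 0 0 0 B).
  rewrite (tr_block_mx 0 0 0 B) mulmx_block !trmx0 !mulmx0 !mul0mx !add0r.
  by rewrite -eB eb b0 trmx0 ea az raddf0.
have ap : 0 < a 0 0 by rewrite lt_def anz.
pose C' := C - (a 0 0)^-1 *: (b^T *m b).
have [|B eB] := IH C'.
  split=> [|y].
    by rewrite /C' linearB /= linearZ /= trmx_mul trmxK sC.
  have := qA (- (b *m y) 0 0 / a 0 0) y; congr (_ <= _).
  rewrite /C' bilinDm -scaleNr bilinZm.
  have -> : bilin (b^T *m b) y y = (b *m y) 0 0 ^+ 2.
    by rewrite /bilin mulmxA -trmx_mul -mulmxA [LHS]mxE big_ord1 mxE expr2.
  by field.
exists (block_mx (Num.sqrt (a 0 0))%:M 0 ((Num.sqrt (a 0 0))^-1 *: b^T) B).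
rewrite (tr_block_mx (_%:M) 0 _ B) mulmx_block !trmx0 !mulmx0 !mul0mx !addr0.
rewrite -eB tr_scalar_mx linearZ /= trmxK.
rewrite !mul_scalar_mx mul_mx_scalar -scalemxAl -scalemxAr !scalerA.
have s0 : Num.sqrt (a 0 0) != 0 by rewrite gt_eqF// sqrtr_gt0.
rewrite divff// !scale1r eb /C' -invfM -expr2 sqr_sqrtr//.
rewrite addrC subrK; congr block_mx.
by rewrite {1}ea -mul_scalar_mx -scalar_mxM -expr2 sqr_sqrtr.
Qed.

Lemma psd_unit n (A : 'M[R]_n) : psd A -> 1%:M + A \in unitmx.
Proof.
move=> [sA pA]; rewrite -row_free_unit -kermx_eq0.
apply/eqP/row_matrixP => i; rewrite row0.
have : row i (kermx (1%:M + A)) *m (1%:M + A) = 0.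
  by apply/eqP; rewrite -sub_kermx row_sub.
move: (row i _) => u hu.
have h : (u *m u^T) 0 0 + bilin A u^T u^T = 0.
  have := congr1 (fun M : 'rV_n => (M *m u^T) 0 0) hu.
  by rewrite mul0mx mulmxDr mulmx1 mulmxDl /bilin trmxK !mxE.
have := pA u^T; have := dotmx_ge0 u^T; rewrite trmxK => u0 A0.
have {h u0 A0}/eqP : (u *m u^T) 0 0 = 0 by lra.
rewrite mxE psumr_eq0 => [/allP h|j _]; last by rewrite [u^T _ _]mxE -expr2 sqr_ge0.
apply/rowP => j; have /= := h j (mem_index_enum _).
by rewrite [u^T _ _]mxE [RHS]mxE -expr2 sqrf_eq0 => /eqP.
Qed.

(** [v^T (1 + A)^-1 v], the relative increase of [det (1 + A)] when
    [v v^T] is added to [A]. *)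
Definition resolv n (A : 'M[R]_n) (v : 'cV[R]_n) := bilin (invmx (1%:M + A)) v v.

(** The matrix determinant lemma. *)
Lemma det_rank1 n (A : 'M[R]_n) (v : 'cV[R]_n) : psd A ->
  \det (1%:M + A + v *m v^T) = \det (1%:M + A) * (1 + resolv A v).
Proof.
move=> pA; have uA := psd_unit pA.
rewrite -{1}[1%:M + A]mulmx1 -[v *m v^T](mulKVmx uA) -mulmxDr det_mulmx.
congr (_ * _); rewrite mulmxA det1_mulmxC det_mx11 /resolv /bilin mxE.
by rewrite mulmxA mxE eqxx.
Qed.

Lemma resolvE n (A : 'M[R]_n) v : psd A ->
  let y := invmx (1%:M + A) *m v in
  resolv A v = (y^T *m v) 0 0 /\ resolv A v = bilin (1%:M + A) y y.
Proof.
move=> pA y; have uA := psd_unit pA; have sA := pA.1.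
have ey : (1%:M + A) *m y = v by rewrite /y mulKVmx.
have e1 : resolv A v = (v^T *m y) 0 0 by rewrite /resolv /bilin mulmxA.
have e2 (u z : 'cV[R]_n) : (u^T *m z) 0 0 = (z^T *m u) 0 0.
  by rewrite !mxE; apply: eq_bigr => i _; rewrite !mxE mulrC.
by rewrite e1 e2 /bilin -mulmxA ey.
Qed.

Lemma resolv_ge0 n (A : 'M[R]_n) v : psd A -> 0 <= resolv A v.
Proof. by move=> pA; rewrite (resolvE v pA).2; have [_ ->] := psdD (psd1 n) pA. Qed.

(** The resolvent form is the maximum of [2 x.v - x^T (1 + A) x] over [x],
    hence decreases when [A] grows. *)
Lemma resolv_anti n (A B : 'M[R]_n) v : psd A -> psd B ->
  resolv (A + B) v <= resolv B v.
Proof.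
move=> pA pB; have pAB := psdD pA pB.
have [e1 e2] := resolvE v pAB; have [f1 f2] := resolvE v pB.
set y := invmx (1%:M + (A + B)) *m v in e1 e2.
set z := invmx (1%:M + B) *m v in f1 f2.
have h := (psdD (psd1 n) pB).2 (y - z).
have e3 : bilin (1%:M + B) y z = (y^T *m v) 0 0.
  by rewrite /bilin -mulmxA /z mulKVmx// psd_unit.
have e4 : bilin (1%:M + (A + B)) y y = bilin (1%:M + B) y y + bilin A y y.
  by rewrite -bilinDm -addrA [B + A]addrC.
move: h; rewrite -scaleN1r bilinDr bilinDl bilinDl bilinZl bilinZr bilinZr.
rewrite bilinZl (bilinC z y (psdD (psd1 n) pB).1) e3 -e1 -f2 => h.
have := pA.2 y; lra.
Qed.

(** Writing [R0 = B B^T] and adding one column of [B] at a time multiplies the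
    determinant by factors [1 + resolv], which are at least one and, by
    [resolv_anti], at most those met when the same columns are added to [0]. *)
Lemma det1_ge1_ub n (A R0 : 'M[R]_n) : psd A -> psd R0 ->
  1 <= \det (1%:M + A) /\
  \det (1%:M + A) <= \det (1%:M + A + R0) <= \det (1%:M + A) * \det (1%:M + R0).
Proof.
move=> pA /psd_factor[B ->].
suff main (k' : nat) (B1 : 'M[R]_(n, k')) A' : psd A' -> 1 <= \det (1%:M + A') ->
  (\det (1%:M + A') <= \det (1%:M + A' + B1 *m B1^T)
     <= \det (1%:M + A') * \det (1%:M + B1 *m B1^T)) /\
  1 <= \det (1%:M + B1 *m B1^T).
  suff A1 : 1 <= \det (1%:M + A) by split=> //; have [] := main _ B _ pA A1.
  have [C eC] := psd_factor pA; rewrite eC.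
  by have [] := main _ C 0 (psd0 n); rewrite ?addr0 ?det1.
move=> {}pA A1; elim: k' B1 => [|k' IH] B1.
  by rewrite [B1]thinmx0 mul0mx !addr0 det1 mulr1 lexx.
pose v : 'cV[R]_n := @lsubmx _ n 1 k' B1.
pose B' : 'M[R]_(n, k') := @rsubmx _ n 1 k' B1.
have -> : B1 *m B1^T = B' *m B'^T + v *m v^T.
  transitivity (row_mx v B' *m (row_mx v B')^T); first by rewrite hsubmxK.
  by rewrite tr_row_mx mul_row_col addrC.
rewrite !addrA.
have pB' := psd_gram B'; have pAB := psdD pA pB'.
have [/andP[h1 h2] h3] := IH B'.
rewrite -(addrA _ A') !det_rank1// addrA.
have h4 := resolv_anti v pA pB'; have h5 := resolv_ge0 v pB'.
have h6 := resolv_ge0 v pAB.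
have h7 : 0 <= \det (1%:M + A' + B' *m B'^T) by lra.
split; last by rewrite (le_trans h3)// ler_peMr; lra.
apply/andP; split.
  by rewrite (le_trans h1)// ler_peMr; lra.
by rewrite mulrA ler_pM//; lra.
Qed.


(** When [S] is the covariance matrix of a centered Gaussian vector, the inverse
    square root of [wdet w S] is the expectation of [exp (- sum_i w_i X_i^2 / 2)].
    By Sylvester's identity weights and covariance play symmetric roles, so bounds
    come in pairs. *)
Definition wdet n (w : 'rV[R]_n) (S : 'M[R]_n) := \det (1%:M + diag_mx w *m S).

Definition nneg n (w : 'rV[R]_n) := forall i, 0 <= w 0 i.

Lemma nneg0 n : nneg (0 : 'rV[R]_n).
Proof. by move=> i; rewrite mxE. Qed.

Lemma nnegD n (w w' : 'rV[R]_n) : nneg w -> nneg w' -> nneg (w + w').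
Proof. by move=> h h' i; rewrite mxE addr_ge0. Qed.

Lemma nnegZ n (w : 'rV[R]_n) c : 0 <= c -> nneg w -> nneg (c *: w).
Proof. by move=> h h' i; rewrite mxE mulr_ge0. Qed.

Lemma nneg_sum n (I : eqType) (s : seq I) (w : I -> 'rV[R]_n) :
  (forall i, i \in s -> nneg (w i)) -> nneg (\sum_(i <- s) w i).
Proof.
move=> h; rewrite big_seq; elim/big_ind: _ => //; [exact: nneg0|exact: nnegD].
Qed.

Lemma psd_sum n (I : eqType) (s : seq I) (S : I -> 'M[R]_n) :
  (forall i, i \in s -> psd (S i)) -> psd (\sum_(i <- s) S i).
Proof.
move=> h; rewrite big_seq; elim/big_ind: _ => //; [exact: psd0|exact: psdD].
Qed.

Lemma diag_mx_sqrt n (w : 'rV[R]_n) : nneg w ->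
  let D := diag_mx (\row_i Num.sqrt (w 0 i)) in diag_mx w = D *m D.
Proof.
move=> w0 /=; rewrite mulmx_diag; congr diag_mx; apply/rowP => i.
by rewrite !mxE -expr2 sqr_sqrtr.
Qed.

Lemma wdet_sqrt n (w : 'rV[R]_n) S : nneg w ->
  let D := diag_mx (\row_i Num.sqrt (w 0 i)) in
  wdet w S = \det (1%:M + D *m S *m D^T).
Proof.
move=> w0 D; have tD : D^T = D by rewrite /D tr_diag_mx.
by rewrite /wdet diag_mx_sqrt// -/D tD -(mulmxA D D) det1_mulmxC.
Qed.

Lemma wdet_gram n k (w : 'rV[R]_n) (B : 'M[R]_(n, k)) :
  wdet w (B *m B^T) = \det (1%:M + B^T *m diag_mx w *m B).
Proof. by rewrite /wdet mulmxA det1_mulmxC mulmxA. Qed.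

Lemma psd_diag n (w : 'rV[R]_n) : nneg w -> psd (diag_mx w).
Proof.
move=> w0; rewrite diag_mx_sqrt//.
by have := psd_gram (diag_mx (\row_i Num.sqrt (w 0 i))); rewrite tr_diag_mx.
Qed.

Lemma wdetDS_bounds n (w : 'rV[R]_n) S S' : nneg w -> psd S -> psd S' ->
  wdet w S <= wdet w (S + S') <= wdet w S * wdet w S'.
Proof.
move=> w0 pS pS'; rewrite !wdet_sqrt// mulmxDr mulmxDl addrA.
pose D := diag_mx (\row_i Num.sqrt (w 0 i)).
by have [] := det1_ge1_ub (psd_congr D pS) (psd_congr D pS').
Qed.

Lemma wdet_ge1 n (w : 'rV[R]_n) S : nneg w -> psd S -> 1 <= wdet w S.
Proof.
move=> w0 pS; rewrite wdet_sqrt//.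
pose D := diag_mx (\row_i Num.sqrt (w 0 i)).
by have [] := det1_ge1_ub (psd_congr D pS) (psd0 n).
Qed.

Lemma wdet_gt0 n (w : 'rV[R]_n) S : nneg w -> psd S -> 0 < wdet w S.
Proof. by move=> w0 pS; apply: lt_le_trans (wdet_ge1 w0 pS). Qed.

Lemma wdetDw_bounds n (w w' : 'rV[R]_n) S : nneg w -> nneg w' -> psd S ->
  wdet w S <= wdet (w + w') S <= wdet w S * wdet w' S.
Proof.
move=> w0 w0' /psd_factor[B ->].
rewrite !wdet_gram linearD /= mulmxDr mulmxDl addrA.
have := det1_ge1_ub (psd_congr B^T (psd_diag w0)) (psd_congr B^T (psd_diag w0')).
by rewrite trmxK => -[].
Qed.

Lemma wdet_monoS n (w : 'rV[R]_n) S S' : nneg w -> psd S -> psd (S' - S) ->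
  wdet w S <= wdet w S'.
Proof.
by move=> w0 pS pS'; have /andP[] := wdetDS_bounds w0 pS pS'; rewrite addrC subrK.
Qed.

Lemma wdet_monow n (w w' : 'rV[R]_n) S : nneg w -> (forall i, w 0 i <= w' 0 i) ->
  psd S -> wdet w S <= wdet w' S.
Proof.
move=> w0 ww' pS; have w0' : nneg (w' - w) by move=> i; rewrite !mxE subr_ge0.
by have /andP[] := wdetDw_bounds w0 w0' pS; rewrite addrC subrK.
Qed.

Lemma wdetw0 n (S : 'M[R]_n) : wdet 0 S = 1.
Proof. by rewrite /wdet linear0 mul0mx addr0 det1. Qed.

Lemma wdetS0 n (w : 'rV[R]_n) : wdet w 0 = 1.
Proof. by rewrite /wdet mulmx0 addr0 det1. Qed.

Lemma wdet_sumS_le n (w : 'rV[R]_n) (I : eqType) (s : seq I) (S : I -> 'M[R]_n) :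
  nneg w -> (forall i, i \in s -> psd (S i)) ->
  wdet w (\sum_(i <- s) S i) <= \prod_(i <- s) wdet w (S i).
Proof.
move=> w0; elim: s => [|i s IH] h; first by rewrite !big_nil wdetS0.
have h' j : j \in s -> psd (S j) by move=> js; apply: h; rewrite inE js orbT.
have pi := h i (mem_head _ _); rewrite !big_cons.
have /andP[_ /le_trans->//] := wdetDS_bounds w0 pi (psd_sum h').
by rewrite ler_pM2l ?IH// wdet_gt0.
Qed.

(** Blocks that [S] does not couple decouple in the determinant, since then
    [(1 + W S) (1 + W' S) = 1 + (W + W') S]. *)
Lemma wdet_blockw n (w w' : 'rV[R]_n) (S : 'M[R]_n) :
  (forall i j, w 0 i * S i j * w' 0 j = 0) ->
  wdet (w + w') S = wdet w S * wdet w' S.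
Proof.
move=> h; rewrite /wdet -det_mulmx mulmxDl !mulmxDr !mul1mx mulmx1.
have -> : diag_mx w *m S *m (diag_mx w' *m S) = 0.
  rewrite mulmxA (_ : _ *m _ *m diag_mx w' = 0) ?mul0mx//.
  by apply/matrixP => i j; rewrite mul_mx_diag mul_diag_mx !mxE h.
by rewrite addr0 linearD /= mulmxDl -addrA [_ *m S + _]addrC.
Qed.

Lemma wdet_sumw_block n (S : 'M[R]_n) (I : eqType) (s : seq I) (w : I -> 'rV[R]_n) :
  uniq s ->
  (forall a b, a \in s -> b \in s -> a != b ->
     forall i j, w a 0 i * S i j * w b 0 j = 0) ->
  wdet (\sum_(a <- s) w a) S = \prod_(a <- s) wdet (w a) S.
Proof.
elim: s => [|a s IH] /= => [_ _|/andP[as_ us] h]; first by rewrite !big_nil wdetw0.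
rewrite !big_cons wdet_blockw ?IH// => [b c bs cs|i j].
  by apply: h; rewrite inE ?bs ?cs orbT.
rewrite summxE mulr_sumr big_seq big1// => b bs.
apply: h; rewrite ?mem_head//; first by rewrite inE bs orbT.
by apply: contraNneq as_ => ->.
Qed.

(** The same decoupling for a sum of covariances acting on orthogonal
    spaces. *)
Lemma wdet_orthS n (w : 'rV[R]_n) (S S' : 'M[R]_n) :
  S *m diag_mx w *m S' = 0 -> wdet w (S + S') = wdet w S * wdet w S'.
Proof.
move=> h; rewrite /wdet -det_mulmx mulmxDl !mulmxDr !mul1mx mulmx1.
have -> : diag_mx w *m S *m (diag_mx w *m S') = 0.
  by rewrite -mulmxA [S *m _]mulmxA h mulmx0.
by rewrite addr0 -addrA [diag_mx w *m S + _]addrC.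
Qed.

Lemma wdet_sumS_orth n (w : 'rV[R]_n) (I : eqType) (s : seq I) (S : I -> 'M[R]_n) :
  uniq s ->
  (forall a b, a \in s -> b \in s -> a != b -> S a *m diag_mx w *m S b = 0) ->
  wdet w (\sum_(a <- s) S a) = \prod_(a <- s) wdet w (S a).
Proof.
elim: s => [|a s IH] /= => [_ _|/andP[as_ us] h]; first by rewrite !big_nil wdetS0.
rewrite !big_cons wdet_orthS ?IH// => [b c bs cs|].
  by apply: h; rewrite inE ?bs ?cs orbT.
rewrite mulmx_sumr big_seq big1// => b bs.
apply: h; rewrite ?mem_head//; first by rewrite inE bs orbT.
by apply: contraNneq as_ => ->.
Qed.

Lemma wdet_rank1 n (w : 'rV[R]_n) (v : 'cV[R]_n) :
  wdet w (v *m v^T) = 1 + \sum_i w 0 i * v i 0 ^+ 2.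
Proof.
rewrite wdet_gram det_mx11 mxE mxE eqxx; congr (_ + _).
rewrite mxE; apply: eq_bigr => i _.
by rewrite mul_mx_diag !mxE expr2; ring.
Qed.

Lemma wdetZ n c (w : 'rV[R]_n) (S : 'M[R]_n) : wdet (c *: w) S = wdet w (c *: S).
Proof. by rewrite /wdet linearZ /= -scalemxAl scalemxAr. Qed.

Lemma wdet_perm n (s : {perm 'I_n}) (w w' : 'rV[R]_n) (S S' : 'M[R]_n) :
  (forall i, w' 0 i = w 0 (s i)) -> (forall i j, S' i j = S (s i) (s j)) ->
  wdet w' S' = wdet w S.
Proof.
move=> hw hS; rewrite /wdet.
have -> : 1%:M + diag_mx w' *m S' =
    row_perm s (col_perm s (1%:M + diag_mx w *m S)).
  apply/matrixP => i j; rewrite !mul_diag_mx !mxE hw hS.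
  by rewrite (inj_eq perm_inj).
rewrite row_permE col_permE !det_mulmx !det_perm mulrCA -signr_addb.
by rewrite odd_permV addbb expr0 mulr1.
Qed.

End Psd.

(** * A primitive of [e^(b t) / (1 + e^t)] *)

Section Primitive.
Context {R : realType}.
Implicit Types (f df : R -> R) (a b x y u : R).

Lemma continuous_EFin_measurable (D : set R) f : measurable D -> continuous f ->
  measurable_fun D (EFin \o f).
Proof.
move=> mD cf; apply/measurable_EFinP; apply: measurable_funTS.
exact: continuous_measurable_fun.
Qed.

Lemma is_derive_derivable f x d : is_derive x 1 f d -> derivable f x 1.
Proof. by move=> h; exact: ex_derive. Qed.

Lemma der_ge0_le f df a b : a <= b ->
  (forall x, a <= x <= b -> is_derive x 1 f (df x)) ->
  (forall x, a <= x <= b -> 0 <= df x) -> f a <= f b.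
Proof.
move=> ab fd d0.
have [x||c cab e] := @MVT_segment R f df a b ab.
- by rewrite in_itv /= => /andP[/ltW ax /ltW xb]; apply: fd; rewrite ax xb.
- apply: derivable_within_continuous => x; rewrite in_itv /= => xab.
  exact: is_derive_derivable (fd _ xab).
- by rewrite -subr_ge0 e mulr_ge0 ?subr_ge0// d0.
Qed.

Lemma der0_cst f x y : (forall t : R, is_derive t 1 f 0) -> f x = f y.
Proof.
move=> fd; wlog xy : x y / x <= y.
  by move=> W; have [/W//|/ltW/W->] := leP x y.
apply/eqP; rewrite eq_le; apply/andP; split.
  by apply: (@der_ge0_le f (fun=> 0)).
rewrite -lerN2; apply: (@der_ge0_le (fun t => - f t) (fun=> 0)) => // t _.
by apply: is_derive_eq; rewrite ?oppr0.
Qed.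

(** Identities between integrals from minus infinity are proved below by comparing
    derivatives; the constant of integration vanishes by decay at minus infinity. *)
Lemma expR_small_eq0 (D C c : R) : 0 < c ->
  (forall u, u <= 0 -> `|D| <= C * expR (c * u)) -> D = 0.
Proof.
move=> c0 h; apply/eqP/negPn/negP => D0.
have D1 : 0 < `|D| by rewrite normr_gt0.
have C0 : 0 < C by have := h 0 (lexx _); rewrite mulr0 expR0 mulr1; exact: lt_le_trans.
pose v := C / (`|D| * c).
have v0 : 0 < v by rewrite divr_gt0// mulr_gt0.
have := h (- v); rewrite oppr_le0 => /(_ (ltW v0)).
rewrite mulrN expRN => h1.
have h2 := expR_ge1Dx (c * v).
have h3 : c * v = C / `|D| by rewrite /v; field; rewrite !gt_eqF.
have h4 : 0 < expR (c * v) := expR_gt0 _.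
have : `|D| * expR (c * v) <= C by rewrite -ler_pdivlMr.
have : `|D| * (1 + c * v) <= `|D| * expR (c * v) by rewrite ler_pM2l.
rewrite h3 mulrDr mulr1 (mulrCA `|D|) divff ?gt_eqF// mulr1.
by move=> {h h1 h2 h3 h4}; lra.
Qed.

Definition logistic b t : R := expR (b * t) / (1 + expR t).

Lemma D1exp_gt0 t : 0 < 1 + expR t :> R.
Proof. by rewrite ltr_wpDr ?expR_ge0. Qed.

Lemma logistic_ge0 b t : 0 <= logistic b t.
Proof. by rewrite divr_ge0 ?expR_ge0// ltW// D1exp_gt0. Qed.

Lemma logistic_le b t : logistic b t <= expR (b * t).
Proof. by rewrite ler_pdivrMr ?D1exp_gt0// ler_peMr ?expR_ge0// lerDl expR_ge0. Qed.

Lemma is_derive_expM b x : is_derive x 1 (fun t : R => expR (b * t)) (b * expR (b * x)).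
Proof.
have h : is_derive x 1 (fun t : R => b * t) b.
  by apply: is_derive_eq; rewrite -[RHS]mulr1.
have := @is_derive1_comp R expR ( *%R b) x _ _ _ h.
by move=> /(_ _ (is_derive_expR (b * x))); rewrite mulrC.
Qed.

Lemma continuous_expM b : continuous (fun t : R => expR (b * t)).
Proof.
move=> x; apply/differentiable_continuous/derivable1_diffP.
exact: (is_derive_derivable (is_derive_expM b x)).
Qed.

Lemma continuous_logistic b : continuous (logistic b).
Proof.
move=> x; apply: cvgM; first exact: continuous_expM.
apply: cvgV; first by rewrite gt_eqF// D1exp_gt0.
by apply: cvgD; [exact: cvg_cst|exact: continuous_expR].
Qed.

Local Notation mu := (@lebesgue_measure R).

Lemma integral_expM b u : 0 < b ->
  (\int[mu]_(t in `]-oo, u]) (expR (b * t))%:E = (b^-1 * expR (b * u))%:E)%E.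
Proof.
move=> b0; rewrite -[u]opprK ge0_integration_by_substitutionNy; last 2 first.
- exact/continuous_subspaceT/continuous_expM.
- by move=> x _; exact: expR_ge0.
have eN : (fun t => expR (b * t)) \o -%R = (fun t => expR (- b * t)).
  by apply/funext => t /=; rewrite mulrN mulNr.
have dN (x : R) : is_derive x 1 (fun x => - (b^-1 * expR (- b * x))) (expR (- b * x)).
  have h := is_derive_expM (- b) x; apply: is_derive_eq.
  by rewrite -[_ *: _]/(_ * _) mulNr mulrN opprK mulKf ?gt_eqF.
have eN' : (fun x => - (b^-1 * expR (b * - x))) =
    (fun x => - (b^-1 * expR (- b * x))).
  by apply/funext => t /=; rewrite mulrN mulNr.
rewrite (@ge0_continuous_FTC2y _ _ (fun x => - (b^-1 * expR (b * - x))) _ 0).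
- by rewrite EFinN oppeK add0e.
- by move=> x _; exact: expR_ge0.
- by rewrite eN; apply: continuous_subspaceT; exact: continuous_expM.
- rewrite -oppr0; apply: cvgN; rewrite -(mulr0 b^-1); apply: cvgMr.
  have -> : (fun x => expR (b * - x)) = (fun x => expR (- x)) \o (fun x => b * x).
    by apply/funext => t /=; rewrite mulrN.
  apply: (@cvg_comp _ _ _ (fun x : R => b * x) (fun x => expR (- x)) _ (pinfty_nbhs R)).
    by apply: gt0_cvgMry => //; exact: cvg_id.
  exact: cvgr_expR.
- by rewrite eN' => x _; apply: is_derive_derivable (dN x).
- rewrite eN'; apply: cvg_at_right_filter.
  have -> : - (b^-1 * expR (b * - - u)) = - (b^-1 * expR (- b * - u)).
    by rewrite mulrN mulNr.
  by apply: cvgN; apply: cvgMr; exact: continuous_expM.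
- move=> x _; rewrite eN' /= derive1E (@derive_val _ _ _ _ _ _ _ (dN x)).
  by rewrite mulNr mulrN.
Qed.

Lemma integrable_logistic b u : 0 < b -> mu.-integrable `]-oo, u] (EFin \o logistic b).
Proof.
move=> b0; have m1 : mu.-integrable `]-oo, u] (EFin \o (fun t : R => expR (b * t))).
  apply/integrableP; split.
    by apply: continuous_EFin_measurable => //; exact: continuous_expM.
  under eq_integral => t _ do rewrite /= ger0_norm ?expR_ge0//.
  by rewrite integral_expM// ltry.
apply: le_integrable m1 => //.
  by apply: continuous_EFin_measurable => //; exact: continuous_logistic.
by move=> t _ /=; rewrite lee_fin !ger0_norm ?logistic_ge0 ?expR_ge0// logistic_le.
Qed.

Definition logistic_int b u := \int[mu]_(t in `]-oo, u]) logistic b t.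

Lemma logistic_int_der b u : 0 < b -> is_derive u 1 (logistic_int b) (logistic b u).
Proof.
move=> b0.
have uu1 : u < u + 1 by rewrite ltrDl.
have [h1 h2] := continuous_FTC1 uu1 (integrable_logistic (u + 1) b0) (ltNyr u)
  (@continuous_logistic b u).
by apply: DeriveDef; [exact: h1|rewrite -derive1E; exact: h2].
Qed.

Lemma logistic_int_ge0 b u : 0 <= logistic_int b u.
Proof. by apply: Rintegral_ge0 => x _; exact: logistic_ge0. Qed.

Lemma logistic_int_le b u : 0 < b -> logistic_int b u <= b^-1 * expR (b * u).
Proof.
move=> b0; rewrite -lee_fin -integral_expM// /logistic_int /Rintegral fineK; last first.
  by apply: integrable_fin_num => //; exact: integrable_logistic.
apply: ge0_le_integral => //.
- by move=> x _; rewrite lee_fin logistic_ge0.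
- by apply: continuous_EFin_measurable => //; exact: continuous_logistic.
- by apply: continuous_EFin_measurable => //; exact: continuous_expM.
- by move=> x _; rewrite lee_fin logistic_le.
Qed.

Local Opaque logistic_int.

(** The two integrands add up to [e^(b t)]. *)
Lemma logistic_int_rec b u : 0 < b -> logistic_int b u + logistic_int (b + 1) u = b^-1 * expR (b * u).
Proof.
move=> b0; have b1 : 0 < b + 1 by rewrite addr_gt0.
pose D u := logistic_int b u + logistic_int (b + 1) u - b^-1 * expR (b * u).
suff : D u = 0 by rewrite /D => /eqP; rewrite subr_eq0 => /eqP.
have dD (t : R) : is_derive t 1 D 0.
  have h1 := logistic_int_der t b0; have h2 := logistic_int_der t b1; have h3 := is_derive_expM b t.
  apply: is_derive_eq; rewrite -[_ *: _]/(_ * _) mulKf ?gt_eqF// /logistic mulrDl expRD mul1r.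
  have := D1exp_gt0 t; move: (expR t) (expR (b * t)) => x y x0.
  by field; rewrite gt_eqF.
apply: (@expR_small_eq0 _ (2 * b^-1 + (b + 1)^-1) b) => // v v0.
rewrite (der0_cst u v dD) /D.
have h1 := logistic_int_le v b0; have h2 := logistic_int_le v b1.
have h3 := logistic_int_ge0 b v; have h4 := logistic_int_ge0 (b + 1) v.
have h5 : expR ((b + 1) * v) <= expR (b * v) by rewrite ler_expR mulrDl; lra.
have h6 : 0 < b^-1 by rewrite invr_gt0.
have h7 : 0 < (b + 1)^-1 by rewrite invr_gt0.
have h8 : (b + 1)^-1 * expR ((b + 1) * v) <= (b + 1)^-1 * expR (b * v).
  by rewrite ler_pM2l.
have h9 : 0 <= b^-1 * expR (b * v) by rewrite mulr_ge0 ?expR_ge0// ltW.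
by rewrite ler_norml; apply/andP; split; nra.
Qed.

(** Substituting [t = 3 s] on the right, this is
    [(1 - y + y^2) / (1 + y^3) = 1 / (1 + y)] with [y = e^s]. *)
Lemma logistic_int_tri b v : 0 < b ->
  3 * logistic_int (3 * b) v =
  logistic_int b (3 * v) - logistic_int (b + 1 / 3) (3 * v) + logistic_int (b + 2 / 3) (3 * v).
Proof.
move=> b0; have b1 : 0 < b + 1 / 3 by lra.
have b2 : 0 < b + 2 / 3 by lra.
have b3 : 0 < 3 * b by lra.
pose D v := 3 * logistic_int (3 * b) v -
  (logistic_int b (3 * v) - logistic_int (b + 1 / 3) (3 * v) + logistic_int (b + 2 / 3) (3 * v)).
suff : D v = 0 by rewrite /D => /eqP; rewrite subr_eq0 => /eqP.
have dc c (t : R) : 0 < c ->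
    is_derive t 1 (fun v => logistic_int c (3 * v)) (3 * logistic c (3 * t)).
  move=> c0; have h : is_derive t 1 (fun t : R => 3 * t) 3.
    by apply: is_derive_eq; rewrite -[RHS]mulr1.
  have := @is_derive1_comp R (logistic_int c) ( *%R 3) t _ _ _ h.
  by move=> /(_ _ (logistic_int_der (3 * t) c0)); rewrite mulrC.
have dD (t : R) : is_derive t 1 D 0.
  have h1 := dc _ t b0; have h2 := dc _ t b1; have h3 := dc _ t b2.
  have h4 := logistic_int_der t b3.
  apply: is_derive_eq; rewrite -[_ *: _]/(_ * _) /logistic.
  have -> : (b + 1 / 3) * (3 * t) = 3 * b * t + t by field.
  have -> : (b + 2 / 3) * (3 * t) = 3 * b * t + t + t by field.
  have -> : b * (3 * t) = 3 * b * t by ring.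
  have -> : 3 * t = t + t + t by ring.
  rewrite !expRD.
  have := expR_gt0 t; move: (expR t) (expR (3 * b * t)) => x y x0.
  by field; rewrite !gt_eqF//; nra.
apply: (@expR_small_eq0 _ (3 * (3 * b)^-1 + b^-1 + (b + 1/3)^-1 + (b + 2/3)^-1) (3 * b)) => // w w0.
rewrite (der0_cst v w dD) /D.
have g1 := logistic_int_le w b3; have g2 := logistic_int_ge0 (3 * b) w.
have aux c : 0 < c -> b <= c -> 0 <= logistic_int c (3 * w) <= c^-1 * expR (3 * b * w).
  move=> c0 bc; rewrite logistic_int_ge0 /=; apply: le_trans (logistic_int_le _ c0) _.
  rewrite ler_pM2l ?invr_gt0// ler_expR; nra.
have /andP[g3 g4] := aux _ b0 (lexx _).
have /andP[g5 g6] : 0 <= logistic_int (b + 1/3) (3 * w) <= (b + 1/3)^-1 * expR (3 * b * w).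
  by apply: aux; rewrite // lerDl divr_ge0.
have /andP[g7 g8] : 0 <= logistic_int (b + 2/3) (3 * w) <= (b + 2/3)^-1 * expR (3 * b * w).
  by apply: aux; rewrite // lerDl divr_ge0.
move: g1 g2 g3 g4 g5 g6 g7 g8; clear.
move: (logistic_int _ _) (logistic_int _ _) (logistic_int _ _) (logistic_int _ _) (expR _) => k1 k2 k3 k4 e.
move: (_^-1) (b^-1) (_^-1) (_^-1) => i1 i2 i3 i4 *.
by rewrite ler_norml; apply/andP; split; lra.
Qed.

(** The substitution [t -> - t] exchanges the exponents [a] and [1 - a], so the
    left-hand side does not depend on [v]. *)
Lemma logistic_int_refl a v : 0 < a < 1 ->
  logistic_int a v + logistic_int (1 - a) (- v) = logistic_int a 0 + logistic_int (1 - a) 0.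
Proof.
move=> /andP[a0 a1]; have b0 : 0 < 1 - a by lra.
pose D v := logistic_int a v + logistic_int (1 - a) (- v).
suff -> : logistic_int a 0 + logistic_int (1 - a) 0 = D 0.
  apply: (@der0_cst D) => t.
  have h1 := logistic_int_der t a0.
  have h : is_derive t 1 (fun t : R => - t) (- 1) by apply: is_derive_eq.
  have := @is_derive1_comp R (logistic_int (1 - a)) (fun t => - t) t _ _ _ h.
  move=> /(_ _ (logistic_int_der (- t) b0)) h2.
  apply: is_derive_eq.
  rewrite /logistic mulrN1 (_ : (1 - a) * - t = a * t - t); last by ring.
  rewrite expRD expRN; have := expR_gt0 t.
  move: (expR t) (expR (a * t)) => x y x0.
  by field; rewrite !gt_eqF//; lra.
by rewrite /D oppr0.
Qed.

Lemma logistic_int0_anti b c : 0 < b -> b <= c -> logistic_int c 0 <= logistic_int b 0.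
Proof.
move=> b0 bc; have c0 : 0 < c by lra.
have h u : u <= 0 -> logistic_int c 0 - logistic_int b 0 <= c^-1 * expR (c * u).
  move=> u0; apply: (@le_trans _ _ (logistic_int c u - logistic_int b u)); last first.
    by have := logistic_int_le u c0; have := logistic_int_ge0 b u; lra.
  suff : logistic_int b u - logistic_int c u <= logistic_int b 0 - logistic_int c 0.
    by move: (logistic_int b u) (logistic_int c u) (logistic_int b 0) (logistic_int c 0) => k1 k2 k3 k4; lra.
  apply: (@der_ge0_le (fun u => logistic_int b u - logistic_int c u) (fun u => logistic b u - logistic c u)) => //.
  - move=> x _; have h1 := logistic_int_der x b0; have h2 := logistic_int_der x c0.
    exact: is_derive_eq.
  - move=> x /andP[_ x0]; rewrite subr_ge0 /logistic ler_pM2r ?invr_gt0 ?D1exp_gt0//.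
    by rewrite ler_expR; nra.
rewrite -subr_le0 leNgt; apply/negP => d0.
suff e : logistic_int c 0 - logistic_int b 0 = 0 by rewrite e ltxx in d0.
apply: (@expR_small_eq0 (logistic_int c 0 - logistic_int b 0) c^-1 c) => // u u0.
by rewrite gtr0_norm//; exact: h.
Qed.

End Primitive.

(** * Euler's reflection integral and the sums it governs *)

Section Reflection.
Context {R : realType}.
Implicit Types (a b x y : R).

Local Opaque logistic_int.

(** The integral of [e^(a t) / (1 + e^t)] over the real line, its positive half
    being folded onto the negative one by [t -> - t]. *)
Definition reflection_int a : R := logistic_int a 0 + logistic_int (1 - a) 0.

Lemma reflection_int_tri a : 0 < a < 1 ->
  3 * reflection_int a = reflection_int (a / 3) - reflection_int ((a + 1) / 3) + reflection_int ((a + 2) / 3).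
Proof.
move=> /andP[a0 a1].
have h1 := @logistic_int_tri R (a / 3) 0; have h2 := @logistic_int_tri R ((1 - a) / 3) 0.
rewrite /reflection_int mulrDr.
have -> : 1 - a / 3 = (1 - a) / 3 + 2 / 3 by field.
have -> : 1 - (a + 1) / 3 = (1 - a) / 3 + 1 / 3 by field.
have -> : 1 - (a + 2) / 3 = (1 - a) / 3 by field.
have -> : (a + 1) / 3 = a / 3 + 1 / 3 by field.
have -> : (a + 2) / 3 = a / 3 + 2 / 3 by field.
have e1 : 3 * (a / 3) = a by field.
have e2 : 3 * ((1 - a) / 3) = 1 - a by field.
rewrite e1 mulr0 in h1; rewrite e2 mulr0 in h2.
have q1 : 0 < a / 3 by rewrite divr_gt0.
have q2 : 0 < (1 - a) / 3 by rewrite divr_gt0 ?subr_gt0.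
rewrite (h1 q1) (h2 q2); clear.
by move: (logistic_int _ _) (logistic_int _ _) (logistic_int _ _) (logistic_int _ _) (logistic_int _ _) (logistic_int _ _) => *; ring.
Qed.

Lemma cos_pi3 : cos (pi / 3) = 2^-1 :> R.
Proof.
have p0 := @pi_gt0 R.
have k0 : 0 < sin (pi / 3) :> R by apply: sin_gt0_pi; apply/andP; split; lra.
have e : sin (pi / 3 + pi / 3) = sin (pi / 3) :> R.
  have -> : pi / 3 + pi / 3 = pi - pi / 3 :> R by field.
  by rewrite sinB sinpi cospi; ring.
rewrite sinD in e.
have : sin (pi / 3) * (2 * cos (pi / 3) - 1) = 0 :> R.
  have -> : sin (pi / 3) * (2 * cos (pi / 3) - 1) =
    (sin (pi / 3) * cos (pi / 3) + cos (pi / 3) * sin (pi / 3)) - sin (pi / 3) :> R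
    by ring.
  by rewrite e subrr.
by move/eqP; rewrite mulf_eq0 gt_eqF//= => /eqP; lra.
Qed.

(** The triplication identity of [reflection_int_tri], for the function that [reflection_int] turns out
    to be. *)
Lemma inv_sin_tri x : 0 < x < pi ->
  3 / sin x = 1 / sin (x / 3) - 1 / sin ((x + pi) / 3) + 1 / sin ((x + pi * 2) / 3) :> R.
Proof.
move=> /andP[x0 xp].
have s0 : 0 < sin (x / 3) by apply: sin_gt0_pi; apply/andP; split; lra.
have s1 : 0 < sin ((x + pi) / 3) by apply: sin_gt0_pi; apply/andP; split; lra.
have s2 : 0 < sin ((x + pi * 2) / 3) by apply: sin_gt0_pi; apply/andP; split; lra.
have s3 : 0 < sin x by apply: sin_gt0_pi; rewrite x0.
have e1 : sin ((x + pi) / 3) = sin (x / 3) / 2 + cos (x / 3) * sin (pi / 3).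
  by rewrite mulrDl sinD cos_pi3.
have e2 : sin ((x + pi * 2) / 3) = - sin (x / 3) / 2 + cos (x / 3) * sin (pi / 3).
  have -> : (x + pi * 2) / 3 = x / 3 + pi - pi / 3 :> R by field.
  by rewrite sinB sinDpi cosDpi cos_pi3; ring.
have e3 : sin x = sin (x / 3) * (3 - 4 * sin (x / 3) ^+ 2).
  have {1}-> : x = x / 3 + x / 3 + x / 3 by field.
  rewrite sinD sinD cosD; have -> : cos (x / 3) * cos (x / 3) = 1 - sin (x / 3) ^+ 2.
    by rewrite -expr2 cos2sin2.
  have -> : (sin (x / 3) * cos (x / 3) + cos (x / 3) * sin (x / 3)) * cos (x / 3) =
    2 * sin (x / 3) * cos (x / 3) ^+ 2 by ring.
  by rewrite cos2sin2; ring.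
have e4 : sin ((x + pi) / 3) * sin ((x + pi * 2) / 3) = (3 - 4 * sin (x / 3) ^+ 2) / 4.
  rewrite e1 e2.
  have -> : (sin (x / 3) / 2 + cos (x / 3) * sin (pi / 3)) *
   (- sin (x / 3) / 2 + cos (x / 3) * sin (pi / 3)) =
   cos (x / 3) ^+ 2 * sin (pi / 3) ^+ 2 - sin (x / 3) ^+ 2 / 4 by field.
  rewrite (cos2sin2 (x / 3)).
  have -> : sin (pi / 3) ^+ 2 = 3 / 4 :> R.
    by rewrite sin2cos2 cos_pi3; field.
  by field.
have q0 : 3 - 4 * sin (x / 3) ^+ 2 != 0.
  by apply/negP => /eqP h; move: s3; rewrite e3 h mulr0 ltxx.
have -> : 1 / sin (x / 3) - 1 / sin ((x + pi) / 3) + 1 / sin ((x + pi * 2) / 3) =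
  1 / sin (x / 3) + (sin ((x + pi) / 3) - sin ((x + pi * 2) / 3)) /
    (sin ((x + pi) / 3) * sin ((x + pi * 2) / 3)).
  by field; rewrite !gt_eqF.
rewrite e4 e3 e1 e2; field; rewrite q0 gt_eqF//=.
Qed.

Lemma sin_le x : 0 <= x -> sin x <= x.
Proof.
move=> x0; rewrite -subr_ge0 (_ : 0 = 0 - sin 0); last by rewrite sin0 subr0.
apply: (@der_ge0_le R (fun t => t - sin t) (fun t => 1 - cos t)).
- by [].
- by move=> t _; rewrite subr_ge0 cos_le1.
Qed.

(** This bound and [sin_ge] come from integrating [sin x <= x]. *)
Lemma cos_ge x : 0 <= x -> 1 - x ^+ 2 / 2 <= cos x.
Proof.
move=> x0; rewrite -subr_ge0 (_ : 0 = cos 0 - (1 - 0 ^+ 2 / 2)); last first.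
  by rewrite cos0; ring.
apply: (@der_ge0_le R (fun t => cos t - (1 - t ^+ 2 / 2)) (fun t => t - sin t)) => // t.
  move=> _; apply: is_derive_eq; rewrite /= -![_ *: _]/(_ * _).
  by field.
by move=> /andP[t0 _]; rewrite subr_ge0 sin_le.
Qed.

Lemma sin_ge x : 0 <= x -> x - x ^+ 3 / 6 <= sin x.
Proof.
move=> x0; rewrite -subr_ge0 (_ : 0 = sin 0 - (0 - 0 ^+ 3 / 6)); last first.
  by rewrite sin0; ring.
apply: (@der_ge0_le R (fun t => sin t - (t - t ^+ 3 / 6))
  (fun t => cos t - (1 - t ^+ 2 / 2))) => // t.
  move=> _; apply: is_derive_eq; rewrite /= -![_ *: _]/(_ * _).
  by field.
by move=> /andP[t0 _]; rewrite subr_ge0 cos_ge.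
Qed.

Definition refl_gap a : R := reflection_int a - pi / sin (pi * a).

Lemma refl_gapC a : refl_gap (1 - a) = refl_gap a.
Proof.
rewrite /refl_gap /reflection_int (_ : 1 - (1 - a) = a); last by ring.
rewrite mulrBr mulr1 sinB sinpi cospi mul0r sub0r mulN1r opprK.
by rewrite [logistic_int _ _ + _]addrC.
Qed.

Lemma refl_gap_tri a : 0 < a < 1 ->
  3 * refl_gap a =
  refl_gap (a / 3) - refl_gap ((a + 1) / 3) + refl_gap ((a + 2) / 3).
Proof.
move=> a01; have p0 := @pi_gt0 R; have /andP[a0 a1] := a01.
rewrite /refl_gap mulrBr reflection_int_tri//.
have := @inv_sin_tri (pi * a).
have -> : pi * a / 3 = pi * (a / 3) by field.
have -> : (pi * a + pi) / 3 = pi * ((a + 1) / 3) by field.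
have -> : (pi * a + pi * 2) / 3 = pi * ((a + 2) / 3) by field.
rewrite mulr_gt0//= -{2}[pi]mulr1 ltr_pM2l// => /(_ a1) h.
have -> : 3 * (pi / sin (pi * a)) = pi * (3 / sin (pi * a)) by ring.
rewrite h; move: (sin (pi * (a / 3))) (sin (pi * ((a + 1) / 3))) (sin (pi * ((a + 2) / 3))).
move: (reflection_int _) (reflection_int _) (reflection_int _) (pi : R) => x y z q u v w.
by ring.
Qed.

(** Both functions have the same pole at [0]. *)
Lemma refl_gap_le a : 0 < a <= 1 / 2 -> `|refl_gap a| <= 11 * a.
Proof.
move=> /andP[a0 a2]; have p0 := @pi_gt0 R; have p4 := @pihalf_lt2 R.
have c0 : 0 < 1 - a by lra.
have e : reflection_int a = a^-1 - logistic_int (a + 1) 0 + logistic_int (1 - a) 0.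
  have := logistic_int_rec 0 a0; rewrite mulr0 expR0 mulr1 /reflection_int => <-.
  by rewrite addrK.
have g1 : 0 <= logistic_int (1 - a) 0 - logistic_int (a + 1) 0.
  by rewrite subr_ge0; apply: logistic_int0_anti => //; lra.
have g2 : logistic_int (1 - a) 0 - logistic_int (a + 1) 0 <= 8 / 3 * a.
  have h1 := logistic_int_rec 0 c0; have c1 : 0 < a + 1 by rewrite addr_gt0.
  have h2 := logistic_int_rec 0 c1; rewrite !mulr0 !expR0 !mulr1 in h1 h2.
  have h3 : logistic_int (a + 1 + 1) 0 <= logistic_int (1 - a + 1) 0 by apply: logistic_int0_anti; move: a0 a2; clear; lra.
  have h4 : (1 - a)^-1 - (a + 1)^-1 <= 8 / 3 * a.
    have -> : (1 - a)^-1 - (a + 1)^-1 = (2 * a) / ((1 - a) * (a + 1)).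
      by field; rewrite !gt_eqF.
    rewrite ler_pdivrMr ?mulr_gt0//; move: a0 a2; clear => a0 a2.
    have : 0 <= a * ((1 / 2 - a) * (1 / 2 + a)) by rewrite !mulr_ge0//; lra.
    by lra.
  move: h1 h2 h3 h4; clear.
  move: (logistic_int _ _) (logistic_int _ _) (logistic_int _ _) (logistic_int _ _) (_^-1) (_^-1) => *; lra.
have x0 : 0 < pi * a by rewrite mulr_gt0.
have x2 : pi * a < 2 by apply: le_lt_trans p4; rewrite ler_pM2l// -[2^-1]mul1r.
have s1 := sin_ge (ltW x0); have s2 := sin_le (ltW x0).
have s3 : pi * a / 3 <= sin (pi * a).
  apply: le_trans s1; move: x0 x2; clear; move: (pi * a) => z z0 z2.
  have : 0 <= z * ((2 - z) * (2 + z)) by rewrite !mulr_ge0//; lra.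
  by rewrite !exprS expr0; lra.
have s0 : 0 < sin (pi * a) by apply: lt_le_trans s3; rewrite divr_gt0.
have g3 : 0 <= pi / sin (pi * a) - a^-1 <= 8 * a.
  have -> : pi / sin (pi * a) - a^-1 = (pi * a - sin (pi * a)) / (a * sin (pi * a)).
    by field; rewrite !gt_eqF.
  rewrite divr_ge0 ?subr_ge0//=; last by rewrite mulr_ge0// ltW.
  rewrite ler_pdivrMr ?mulr_gt0//.
  have : pi * a - sin (pi * a) <= (pi * a) ^+ 3 / 6 by rewrite lerBlDl -lerBlDr.
  move/le_trans; apply.
  apply: (@le_trans _ _ (8 * a * (a * (pi * a / 3)))); last first.
    by rewrite !ler_pM2l//; lra.
  rewrite -subr_ge0.
  have -> : 8 * a * (a * (pi * a / 3)) - (pi * a) ^+ 3 / 6 =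
    (16 - pi ^+ 2) * (pi * a ^+ 3) / 6 by field.
  rewrite divr_ge0// mulr_ge0//; last by rewrite mulr_ge0 ?exprn_ge0// ltW.
  by nra.
have {g3}/andP[g3 g4] := g3.
rewrite /refl_gap e ler_norml; move: g1 g2 g3 g4 a0; clear.
by move: (logistic_int _ _) (logistic_int _ _) (a^-1) (pi / _) => k1 k2 k3 k4 *; apply/andP; split; lra.
Qed.

Lemma refl_gap_bounded a : 0 < a < 1 -> `|refl_gap a| <= 11 / 2.
Proof.
move=> /andP[a0 a1]; have [a2|a2] := leP a (1 / 2).
  by apply: le_trans (refl_gap_le _) _; rewrite ?a0//; lra.
rewrite -refl_gapC; apply: le_trans (refl_gap_le _) _; last lra.
by apply/andP; split; lra.
Qed.

(** A function obeying the triplication identity is, at any point, at most a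
    strict average of its value near [0] and of its supremum; as the gap is
    small near [0], its supremum is [0]. *)
Lemma reflection_intE a : 0 < a < 1 -> reflection_int a = pi / sin (pi * a).
Proof.
move=> a01; suff h : refl_gap a = 0.
  by move: h; rewrite /refl_gap => /eqP; rewrite subr_eq0 => /eqP.
pose S := [set `|refl_gap b| | b in [set b : R | 0 < b < 1]].
have ubS : ubound S (11 / 2) by move=> _ [b b01 <-]; exact: refl_gap_bounded.
have hsS : has_sup S by split; [exists `|refl_gap a|, a|exists (11 / 2)].
pose m := sup S.
have le_m b : 0 < b < 1 -> `|refl_gap b| <= m.
  by move=> b01; apply: ub_le_sup; [case: hsS|exists b].
have step n b : 0 < b < 1 ->
    `|refl_gap b| <= m - (m - `|refl_gap (b / 3 ^+ n)|) / 3 ^+ n.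
  elim: n b => [|n IH] b b01; first by rewrite expr0 !divr1 subKr.
  have /andP[b0 b1] := b01.
  have b301 : 0 < b / 3 < 1 by apply/andP; split; lra.
  have h1 := refl_gap_tri b01; have h2 := IH _ b301.
  have h3 := le_m ((b + 1) / 3); have h4 := le_m ((b + 2) / 3).
  have {}h3 : `|refl_gap ((b + 1) / 3)| <= m by apply: h3; apply/andP; split; lra.
  have {}h4 : `|refl_gap ((b + 2) / 3)| <= m by apply: h4; apply/andP; split; lra.
  have h5 : 3 * `|refl_gap b| <= `|refl_gap (b / 3)| + m + m.
    rewrite -[X in X * _](@ger0_norm _ 3)// -normrM h1.
    apply: le_trans (ler_normD _ _) _; rewrite lerD//.
    by apply: le_trans (ler_normB _ _) _; rewrite lerD.
  have eb : b / 3 / 3 ^+ n = b / 3 ^+ n.+1 by rewrite exprS invfM mulrA.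
  rewrite eb in h2; have eg (g : R) : (m - g) / 3 ^+ n.+1 = (m - g) / 3 ^+ n / 3.
    by rewrite exprSr invfM mulrA.
  rewrite eg.
  move: h2 h5; clear.
  move: (`|refl_gap (b / 3)|) (`|refl_gap b|) => g' g''.
  by move: ((m - _) / 3 ^+ n) => z; lra.
have small n : m <= 11 / 3 ^+ n.+1.
  have p3 : 0 < 3 ^+ n.+1 :> R by rewrite exprn_gt0.
  have ub : ubound S (m - (m - 11 / 3 ^+ n.+1) / 3 ^+ n.+1).
    move=> _ [b b01 <-]; apply: le_trans (step n.+1 b b01) _.
    rewrite lerD2l lerN2 ler_pM2r ?invr_gt0// lerD2l lerN2.
    have /andP[b0 b1] := b01.
    apply: le_trans (refl_gap_le _) _.
      rewrite divr_gt0//= ler_pdivrMr// exprS.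
      have : 1 <= 3 ^+ n :> R by rewrite exprn_ege1// ler1n.
      by nra.
    rewrite ler_pM2l// ler_pdivrMr// mulVf ?gt_eqF//; exact: ltW.
  have : m <= m - (m - 11 / 3 ^+ n.+1) / 3 ^+ n.+1.
    by apply: sup_le_ub => //; case: hsS.
  rewrite lerBrDr gerDl pmulr_lle0 ?invr_gt0// subr_le0; exact.
apply/eqP; rewrite -normr_le0; apply: le_trans (le_m _ a01) _.
apply/ler_addgt0Pr => e e0; rewrite add0r.
pose N := Num.trunc (11 / e); apply: le_trans (small N) _.
rewrite ler_pdivrMr ?exprn_gt0// -ler_pdivrMl//.
have h1 : 11 / e < N.+1%:R by exact: truncnS_gt.
apply: le_trans (_ : N.+1%:R <= _); first by rewrite mulrC ltW.
rewrite -natrX ler_nat; exact: ltnW (ltn_expl _ _).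
Qed.

End Reflection.

Section PowerSums.
Context {R : realType}.
Implicit Types (a r x y t : R).

Local Opaque logistic_int.

(** A primitive of [y |-> ln (1 + y^-1/a)] on the positive half-line, rising
    from [0] to [reflection_int a]. *)
Definition log_primitive a y : R :=
  y * ln (1 + expR (- a^-1 * ln y)) + logistic_int a (a^-1 * ln y).

Lemma log_primitive_der a y : 0 < a -> 0 < y ->
  is_derive y 1 (log_primitive a) (ln (1 + expR (- a^-1 * ln y))).
Proof.
move=> a0 y0; have hl := is_derive1_ln y0.
have h1 : is_derive y 1 (fun t => - a^-1 * ln t) (- a^-1 * y^-1).
  by apply: is_derive_eq; rewrite -![_ *: _]/(_ * _); ring.
have h2 : is_derive y 1 (fun t => expR (- a^-1 * ln t))
    (expR (- a^-1 * ln y) * (- a^-1 * y^-1)).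
  exact: (@is_derive1_comp R expR (fun t => - a^-1 * ln t)).
have h3 : is_derive y 1 (fun t => 1 + expR (- a^-1 * ln t))
    (expR (- a^-1 * ln y) * (- a^-1 * y^-1)).
  have h := @is_deriveD R R R (cst 1) _ y 1 0 _ (is_derive_cst _ _ _) h2.
  by rewrite add0r in h; exact: h.
have h4 : is_derive y 1 (fun t => ln (1 + expR (- a^-1 * ln t)))
    ((1 + expR (- a^-1 * ln y))^-1 * (expR (- a^-1 * ln y) * (- a^-1 * y^-1))).
  have h := is_derive1_ln (D1exp_gt0 (- a^-1 * ln y)).
  exact: (@is_derive1_comp R (@ln R) (fun t => 1 + expR (- a^-1 * ln t))).
have h5 : is_derive y 1 (fun t => a^-1 * ln t) (a^-1 * y^-1).
  by apply: is_derive_eq; rewrite -![_ *: _]/(_ * _); ring.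
have h6 : is_derive y 1 (fun t => logistic_int a (a^-1 * ln t))
    (logistic a (a^-1 * ln y) * (a^-1 * y^-1)).
  have h := logistic_int_der (a^-1 * ln y) a0.
  exact: (@is_derive1_comp R (logistic_int a) (fun t => a^-1 * ln t)).
apply: is_derive_eq; rewrite -![_ *: _]/(_ * _) /logistic mulVKf ?gt_eqF//.
rewrite lnK ?posrE// mulNr expRN; have e0 := expR_gt0 (a^-1 * ln y).
move: e0; move: (expR _) (ln (1 + _)) => e l e0.
by field; rewrite !gt_eqF//; nra.
Qed.

(** By the reflection [logistic_int_refl], what is missing from [reflection_int a] is an integral of
    the complementary exponent, which decays like [y^(1-1/a)]. *)
Lemma log_primitive_ge a y : 0 < a < 1 -> 0 < y ->
  reflection_int a - (1 - a)^-1 * expR (- ((1 - a) * a^-1) * ln y) <= log_primitive a y.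
Proof.
move=> a01 y0; have /andP[a0 a1] := a01; have c0 : 0 < 1 - a by rewrite subr_gt0.
have h1 := logistic_int_refl (a^-1 * ln y) a01; have h2 := logistic_int_le (- (a^-1 * ln y)) c0.
rewrite (_ : (1 - a) * - (a^-1 * ln y) = - ((1 - a) * a^-1) * ln y) in h2; last by ring.
have h3 : 0 <= y * ln (1 + expR (- a^-1 * ln y)).
  by rewrite mulr_ge0 ?ln_ge0 ?lerDl ?expR_ge0// ltW.
rewrite /reflection_int /log_primitive; move: h1 h2 h3; clear.
move: (expR (- ((1 - a) / a) * ln y)) (y * ln _) (logistic_int _ _) (logistic_int _ _) (logistic_int _ _) (logistic_int _ _) => *; lra.
Qed.

Lemma log_primitive_ge0 a y : 0 < y -> 0 <= log_primitive a y.
Proof.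
move=> y0; rewrite addr_ge0 ?logistic_int_ge0//.
by rewrite mulr_ge0 ?ln_ge0 ?lerDl ?expR_ge0// ltW.
Qed.

Lemma log_primitive_mono a y t : 0 < a -> 0 < y -> y <= t -> log_primitive a y <= log_primitive a t.
Proof.
move=> a0 y0 yt; apply: (@der_ge0_le R _ (fun z => ln (1 + expR (- a^-1 * ln z)))) => //.
- by move=> z /andP[yz _]; apply: log_primitive_der => //; apply: lt_le_trans yz.
- by move=> z _; rewrite ln_ge0// lerDl expR_ge0.
Qed.

Lemma log_primitive_le a y : 0 < a < 1 -> 0 < y -> log_primitive a y <= reflection_int a.
Proof.
move=> a01 y0; have /andP[a0 a1] := a01; have c0 : 0 < 1 - a by rewrite subr_gt0.
have d0 : 0 < a^-1 - 1 by rewrite subr_gt0 invf_gt1.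
have key t : 0 < t -> log_primitive a t <= reflection_int a + expR (- (a^-1 - 1) * ln t).
  move=> t0; have h1 := logistic_int_refl (a^-1 * ln t) a01.
  have h2 := logistic_int_ge0 (1 - a) (- (a^-1 * ln t)).
  have h3 : t * ln (1 + expR (- a^-1 * ln t)) <= expR (- (a^-1 - 1) * ln t).
    apply: (@le_trans _ _ (t * expR (- a^-1 * ln t))).
      rewrite ler_pM2l//; apply: le_ln1Dx.
      by apply: lt_le_trans (expR_ge0 _); rewrite ltrN10.
    rewrite -{1}[t]lnK ?posrE// -expRD ler_expR.
    by rewrite le_eqVlt; apply/orP; left; apply/eqP; ring.
  rewrite /reflection_int /log_primitive; move: h1 h2 h3; clear.
  move: (expR _) (t * ln _) (logistic_int _ _) (logistic_int _ _) (logistic_int _ _) (logistic_int _ _) => *; lra.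
apply/ler_addgt0Pr => e e0.
pose t := expR (- ln e / (a^-1 - 1)).
pose t' := Num.max t y.
have t'0 : 0 < t' by rewrite lt_max expR_gt0.
apply: (@le_trans _ _ (log_primitive a t')); first by apply: log_primitive_mono; rewrite ?le_max ?lexx ?orbT.
apply: le_trans (key _ t'0) _; rewrite lerD2l -[leRHS]lnK ?posrE// ler_expR mulNr lerNl.
rewrite -ler_pdivrMl// mulrC -[leLHS]expRK ler_ln ?posrE ?expR_gt0//.
by rewrite le_max lexx.
Qed.

Definition log_term r x t : R := ln (1 + x * t `^ (- r)).

Lemma log_term_anti r x t y : 0 <= r -> 0 <= x -> 0 < t -> t <= y ->
  log_term r x y <= log_term r x t.
Proof.
move=> r0 x0 t0 ty; have y0 : 0 < y by apply: lt_le_trans ty.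
rewrite /log_term ler_ln ?posrE ?ltr_wpDr ?mulr_ge0 ?powR_ge0// lerD2l ler_wpM2l//.
rewrite !powRN lef_pV2 ?posrE ?powR_gt0//.
by rewrite ge0_ler_powR ?nnegrE// ltW.
Qed.

Lemma log_term_ge0 r x t : 0 <= x -> 0 <= log_term r x t.
Proof. by move=> x0; rewrite ln_ge0// lerDl mulr_ge0 ?powR_ge0. Qed.

(** The summand is the derivative of a rescaled [log_primitive]. *)
Definition scaled_primitive a x t : R := x `^ a * log_primitive a (t / x `^ a).

Lemma scaled_primitive_der a x t : 0 < a -> 0 < x -> 0 < t ->
  is_derive t 1 (scaled_primitive a x) (log_term a^-1 x t).
Proof.
move=> a0 x0 t0; have s0 : 0 < x `^ a by rewrite powR_gt0.
have ts0 : 0 < t / x `^ a by rewrite divr_gt0.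
have hP := log_primitive_der a0 ts0.
have h1 : is_derive t 1 (fun t => t / x `^ a) (x `^ a)^-1.
  by apply: is_derive_eq; rewrite -![_ *: _]/(_ * _); ring.
have h2 : is_derive t 1 (fun t => log_primitive a (t / x `^ a))
    (ln (1 + expR (- a^-1 * ln (t / x `^ a))) * (x `^ a)^-1).
  exact: (@is_derive1_comp R (log_primitive a) (fun t => t / x `^ a)).
apply: is_derive_eq; rewrite -![_ *: _]/(_ * _) mulrCA divff ?gt_eqF// mulr1.
congr (ln (1 + _)); rewrite ln_div ?posrE// ln_powR /powR gt_eqF//.
rewrite -{2}[x]lnK ?posrE// -expRD; congr expR.
by field; rewrite gt_eqF.
Qed.

Lemma log_term_le_scaled_primitive a x t : 0 < a -> 0 < x -> 0 < t ->
  log_term a^-1 x (t + 1) <= scaled_primitive a x (t + 1) - scaled_primitive a x t <= log_term a^-1 x t.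
Proof.
move=> a0 x0 t0; have r0 : 0 <= a^-1 by rewrite invr_ge0 ltW.
have tt : t <= t + 1 by rewrite lerDl.
apply/andP; split.
  suff : scaled_primitive a x t - log_term a^-1 x (t + 1) * t <=
    scaled_primitive a x (t + 1) - log_term a^-1 x (t + 1) * (t + 1) by lra.
  apply: (@der_ge0_le R (fun z => scaled_primitive a x z - log_term a^-1 x (t + 1) * z)
    (fun z => log_term a^-1 x z - log_term a^-1 x (t + 1)) _ _ tt) => z /andP[tz zt].
    have h := scaled_primitive_der a0 x0 (lt_le_trans t0 tz).
    by apply: is_derive_eq; rewrite -![_ *: _]/(_ * _); ring.
  by rewrite subr_ge0 log_term_anti// ?(ltW x0)// (lt_le_trans t0).
suff : log_term a^-1 x t * t - scaled_primitive a x t <=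
  log_term a^-1 x t * (t + 1) - scaled_primitive a x (t + 1) by lra.
apply: (@der_ge0_le R (fun z => log_term a^-1 x t * z - scaled_primitive a x z)
  (fun z => log_term a^-1 x t - log_term a^-1 x z) _ _ tt) => z /andP[tz zt].
  have h := scaled_primitive_der a0 x0 (lt_le_trans t0 tz).
  by apply: is_derive_eq; rewrite -![_ *: _]/(_ * _); ring.
by rewrite subr_ge0 log_term_anti// ?(ltW x0).
Qed.

Lemma sum_log_term_scaled_primitive a x K : 0 < a -> 0 < x ->
  scaled_primitive a x K.+1%:R - scaled_primitive a x 1 <= \sum_(k < K) log_term a^-1 x k.+1%:R /\
  \sum_(k < K.+1) log_term a^-1 x k.+1%:R <=
    log_term a^-1 x 1 + (scaled_primitive a x K.+1%:R - scaled_primitive a x 1).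
Proof.
move=> a0 x0; elim: K => [|K [IH1 IH2]].
  by rewrite big_ord0 big_ord1 subrr addr0.
have K0 : 0 < K.+1%:R :> R by rewrite ltr0n.
have /andP[h1 h2] := log_term_le_scaled_primitive a0 x0 K0.
rewrite [in X in X /\ _]big_ord_recr [in X in _ /\ X]big_ord_recr /=.
rewrite -[K.+2%:R]natr1; move: IH1 IH2 h1 h2.
move: (scaled_primitive a x _) (scaled_primitive a x _) (scaled_primitive a x _).
move: (\sum_(_ < _) _) (\sum_(_ < _) _) (log_term _ _ _) (log_term _ _ _) (log_term _ _ _).
by move=> *; split; lra.
Qed.

(** Comparison of the decreasing summand with its integral; the first term is
    kept apart because the comparison shifts the index by one. *)
Lemma sum_log_term_ub a x K : 0 < a < 1 -> 0 < x ->
  \sum_(k < K) log_term a^-1 x k.+1%:R <= ln (1 + x) + reflection_int a * x `^ a.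
Proof.
move=> a01 x0; have /andP[a0 a1] := a01; have s0 : 0 < x `^ a by rewrite powR_gt0.
apply: (@le_trans _ _ (\sum_(k < K.+1) log_term a^-1 x k.+1%:R)).
  by rewrite big_ord_recr /= lerDl log_term_ge0// ltW.
apply: le_trans (sum_log_term_scaled_primitive K a0 x0).2 _.
rewrite {1}/log_term powR1 mulr1 lerD2l.
have h1 : 0 <= scaled_primitive a x 1 by rewrite mulr_ge0 ?log_primitive_ge0 ?divr_gt0// ltW.
have h2 : scaled_primitive a x K.+1%:R <= reflection_int a * x `^ a.
  by rewrite /scaled_primitive mulrC ler_pM2r// log_primitive_le// divr_gt0 ?ltr0n.
by apply: le_trans h2; rewrite gerDl oppr_le0.
Qed.

Lemma sum_log_term_lb a x e : 0 < a < 1 -> 0 < x -> 0 < e ->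
  exists K0, forall K, (K0 <= K)%N ->
  reflection_int a * x `^ a - ln (1 + x) - a^-1 - e <= \sum_(k < K) log_term a^-1 x k.+1%:R.
Proof.
move=> a01 x0 e0; have /andP[a0 a1] := a01; have s0 : 0 < x `^ a by rewrite powR_gt0.
have c0 : 0 < 1 - a by rewrite subr_gt0.
pose p := (1 - a) * a^-1; have p0 : 0 < p by rewrite mulr_gt0 ?invr_gt0.
pose E := x `^ a * (1 - a)^-1; have E0 : 0 < E by rewrite mulr_gt0 ?invr_gt0.
exists (Num.trunc (x `^ a * expR (ln (E / e) / p))) => K hK.
apply: le_trans (sum_log_term_scaled_primitive K a0 x0).1.
have h1 : scaled_primitive a x 1 <= ln (1 + x) + a^-1.
  rewrite /scaled_primitive /log_primitive mulrDr; apply: lerD.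
    rewrite mulrA mul1r divff ?gt_eqF// mul1r le_eqVlt; apply/orP; left; apply/eqP.
    rewrite lnV ?posrE// ln_powR.
    have -> : - a^-1 * - (a * ln x) = ln x by field; rewrite gt_eqF.
    by rewrite lnK ?posrE.
  apply: (@le_trans _ _ (x `^ a * (a^-1 * (x `^ a)^-1))).
    rewrite ler_pM2l//; apply: le_trans (logistic_int_le _ a0) _.
    by rewrite mul1r mulrA divff ?gt_eqF// mul1r lnK ?posrE ?invr_gt0.
  by rewrite mulrCA divff ?gt_eqF// mulr1.
have h2 : reflection_int a * x `^ a - e <= scaled_primitive a x K.+1%:R.
  have y0 : 0 < K.+1%:R / x `^ a by rewrite divr_gt0 ?ltr0n.
  have := log_primitive_ge a01 y0; rewrite -(ler_pM2l s0) -/(scaled_primitive _ _ _); apply: le_trans.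
  rewrite mulrBr mulrC lerD2l lerN2 mulrA -/E -/p -ler_pdivlMl//.
  have Ee : 0 < E^-1 * e by rewrite mulr_gt0 ?invr_gt0.
  rewrite -[leRHS]lnK ?posrE// ler_expR mulNr lerNl -lnV ?posrE// invfM invrK.
  rewrite -ler_pdivrMl// mulrC -[leLHS]expRK ler_ln ?posrE ?expR_gt0//.
  rewrite ler_pdivlMr// mulrC.
  apply: le_trans (ltW (truncnS_gt _)) _.
  by rewrite ler_nat ltnS [p^-1 * _]mulrC [expR _ * _]mulrC.
move: h1 h2; clear; lra.
Qed.

End PowerSums.

(** * The Tauberian passage from Laplace transforms to small balls *)

Section TauberianReal.
Context {R : realType}.
Implicit Types (a b s x y e h t : R).

Lemma powR_ge_of_root (p B y : R) : 0 < p -> 0 < B -> B `^ p^-1 <= y -> B <= y `^ p.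
Proof.
move=> p0 B0 h; have := powRrM B p^-1 p; rewrite mulVf ?gt_eqF// powRr1 ?(ltW B0)// => ->.
by rewrite ge0_ler_powR ?nnegrE ?powR_ge0// ?ltW// (lt_le_trans (powR_gt0 _ B0) h).
Qed.

(** A concave function lies below its tangent at [1]. *)
Lemma powR_le_tangent a y : 0 < a < 1 -> 0 < y -> y `^ a <= 1 + a * (y - 1).
Proof.
move=> /andP[a0 a1] y0.
have yn : 0 <= y by exact: ltW.
pose p := a^-1; pose q := (1 - a)^-1.
have := @conjugate_powR R (y `^ a) 1 p q; rewrite powR_ge0 ler01 => /(_ isT isT).
rewrite invr_gt0 a0 invr_gt0 subr_gt0 a1 !invrK addrC subrK => /(_ isT isT erefl).
rewrite mulr1 powR1 -powRrM mulfV ?gt_eqF// powRr1// mul1r; lra.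
Qed.

(** The tangent bound for [y^-1]; at [y = 1 +- h] it is exact to first order
    in [h]. *)
Lemma powR_ge_tangent a y : 0 < a < 1 -> 0 < y -> 1 - a * (y^-1 - 1) <= y `^ a.
Proof.
move=> a01 y0; have yi : 0 < y^-1 by rewrite invr_gt0.
have := powR_le_tangent a01 yi.
rewrite -powR_inv1 ?(ltW y0)// -powRrM mulN1r powRN powR_inv1 ?(ltW y0)//.
have : 0 < y `^ a by rewrite powR_gt0.
move: (a * _) (y `^ a) => z q q0; rewrite -[q^-1]mul1r ler_pdivrMr// => h.
have := sqr_ge0 z; have [z1|z1] := leP (1 - z) 0; first by move=> _; lra.
by nra.
Qed.

(** The exponents of the two deviations from the saddle point, for a tilt by
    [1 +- t / 4]: to first order in [t] both vanish, and the second-order gain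
    [A a t^2 / 8] covers the errors [d + 2 e] and [d + 3 e]. *)
Lemma saddle_exponents a A t : 0 < a < 1 -> 0 < A -> 0 < t < 1 ->
  let h := t / 4 in let e := A * a * t ^+ 2 / 48 in let d := A * a * t ^+ 2 / 16 in
  [/\ - (h * (1 + t) * a * A) + - (A - e) * (1 - h) `^ a <= - d + - (A + e),
      h * (1 - t) * a * A + - (A - e) * (1 + h) `^ a <= - d + - (A + e) &
      e <= A * t / 2].
Proof.
move=> a01 A0 /andP[t0 t1] h e d; have /andP[a0 a1] := a01.
have h0 : 0 < h by rewrite /h; lra.
have h1 : h < 1 by rewrite /h; lra.
have oh0 : 0 < 1 - h by lra.
have ph0 : 0 < 1 + h by lra.
have Aa0 : 0 < A * a by rewrite mulr_gt0.
have e0 : 0 < e by rewrite !(mulr_gt0, divr_gt0)// exprn_gt0.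
have g1 : 1 - a * (h * (1 + t / 2)) <= (1 - h) `^ a.
  apply: le_trans (powR_ge_tangent a01 oh0); rewrite lerD2l lerN2 ler_pM2l//.
  have -> : (1 - h)^-1 - 1 = h / (1 - h) by field; rewrite gt_eqF.
  rewrite ler_pdivrMr// -mulrA ler_peMr ?(ltW h0)//.
  have : 0 <= t * (1 - t) by rewrite mulr_ge0// ltW// subr_gt0.
  by rewrite /h; lra.
have g2 : 1 + a * (h * (1 - t / 2)) <= (1 + h) `^ a.
  apply: le_trans (powR_ge_tangent a01 ph0); rewrite lerD2l -[leRHS]mulrN ler_pM2l//.
  have -> : - ((1 + h)^-1 - 1) = h / (1 + h) by field; rewrite gt_eqF.
  rewrite ler_pdivlMr// -mulrA ler_piMr ?(ltW h0)//.
  have : 0 <= t * t by rewrite mulr_ge0// ltW.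
  by rewrite /h; lra.
have g3 : (1 - h) `^ a <= 1.
  by apply: (le_trans (powR_le_tangent a01 oh0)); rewrite gerDl pmulr_rle0//; lra.
have g4 : (1 + h) `^ a <= 2.
  apply: (le_trans (powR_le_tangent a01 ph0)).
  have : a * h <= 1 by rewrite mulr_ile1// ltW.
  by rewrite [1 + h]addrC addrK; lra.
have A1 : A * (1 - a * (h * (1 + t / 2))) <= A * (1 - h) `^ a by rewrite ler_pM2l.
have A2 : A * (1 + a * (h * (1 - t / 2))) <= A * (1 + h) `^ a by rewrite ler_pM2l.
have B1 : e * (1 - h) `^ a <= e by rewrite ger_pMr.
have B2 : e * (1 + h) `^ a <= e * 2 by rewrite ler_pM2l.
have E1 : - (h * (1 + t) * a * A) + A * (a * (h * (1 + t / 2))) = - (6 * e).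
  by rewrite /e /h; field.
have E2 : h * (1 - t) * a * A - A * (a * (h * (1 - t / 2))) = - (6 * e).
  by rewrite /e /h; field.
have E3 : d = 3 * e by rewrite /d /e; field.
rewrite E3; split.
- move: A1 B1 E1 e0; rewrite mulrBr mulr1 mulNr mulrBl; clear.
  move: (A * (a * (h * (1 + t / 2)))) (A * (1 - h) `^ a) (e * (1 - h) `^ a) => u v w.
  by move: (h * (1 + t) * a * A) => x; lra.
- move: A2 B2 E2 e0; rewrite mulrDr mulr1 mulNr mulrBl; clear.
  move: (A * (a * (h * (1 - t / 2)))) (A * (1 + h) `^ a) (e * (1 + h) `^ a) => u v w.
  by move: (h * (1 - t) * a * A) => x; lra.
- have : a * t ^+ 2 <= t.
    rewrite expr2 mulrA -[leRHS]mul1r ler_pM2r//; apply: ltW.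
    by apply: mulr_ilt1 => //; exact: ltW.
  move=> at2; have : A * (a * t ^+ 2) <= A * t by rewrite ler_pM2l.
  have : 0 < A * t by rewrite mulr_gt0.
  by rewrite /e -mulrA; move: (A * t) (A * _) => u v; lra.
Qed.

Lemma half_of_quarters (l u v w : R) : l <= u + v + w -> v <= 4^-1 * l ->
  w <= 4^-1 * l -> l / 2 <= u.
Proof. by move=> *; lra. Qed.

Lemma saddle_collect a A t e S l : l <= A * t / 2 * S -> e * S <= A * t / 2 * S ->
  t * a * A * S <= t * A * S ->
  - ((1 - a) * A + 2 * t * A) * S <= (1 - t) * a * A * S + - (A + e) * S + - l.
Proof.
move=> h1 h2 h3; have -> : - ((1 - a) * A + 2 * t * A) * S =
  - (A * S) + a * A * S - 4 * (A * t / 2 * S) by field.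
have -> : (1 - t) * a * A * S + - (A + e) * S + - l =
  - (A * S) + a * A * S - t * a * A * S - e * S - l by ring.
have h4 : t * A * S = 2 * (A * t / 2 * S) by field.
move: h1 h2 h3; rewrite h4; move: (t * a * A * S) (e * S) (A * t / 2 * S) => u v w.
by move: (A * S) (a * A * S) => x y; lra.
Qed.

Variables (p L : R -> R) (a A : R).
Hypotheses (a01 : 0 < a < 1) (A0 : 0 < A).
Hypothesis L_gt0 : forall s, 0 < s -> 0 < L s.
Hypothesis p_ub : forall s x, 0 < s -> p x <= expR (s * x) * L s.
Hypothesis p_lb : forall s x t h, 0 < s -> 0 < x -> 0 < t < 1 -> 0 < h < 1 ->
  L s <= expR (- (s * ((1 - t) * x))) * p ((1 + t) * x)
       + expR (- (h * s * ((1 + t) * x))) * L ((1 - h) * s)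
       + expR (h * s * ((1 - t) * x)) * L ((1 + h) * s).
Hypothesis L_asymp : forall e, 0 < e ->
  exists2 s0, 0 < s0 & forall s, s0 <= s -> `|ln (L s) + A * s `^ a| <= e * s `^ a.

Let c1 := (1 - a)^-1.
Let b := a / (1 - a).

Let a0 : 0 < a. Proof. by case/andP: a01. Qed.
Let oa0 : 0 < 1 - a. Proof. by rewrite subr_gt0; case/andP: a01. Qed.
Let c10 : 0 < c1. Proof. by rewrite invr_gt0. Qed.
Let b0 : 0 < b. Proof. by rewrite divr_gt0. Qed.

Let saddleE y : 0 < y -> (y `^ c1) `^ a = y `^ b.
Proof. by move=> y0; rewrite -powRrM /b mulrC. Qed.

Let saddle_mul y : 0 < y -> y `^ c1 * (a * A / y) = a * A * y `^ b.
Proof.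
move=> y0; have -> : c1 = b + 1 by rewrite /b /c1; field; rewrite gt_eqF.
rewrite powRD; last by rewrite (gt_eqF y0) implybT.
by rewrite powRr1 ?(ltW y0)//; field; rewrite gt_eqF.
Qed.

Let L_bounds e : 0 < e -> exists2 s0, 0 < s0 & forall s, s0 <= s ->
  expR (- (A + e) * s `^ a) <= L s <= expR (- (A - e) * s `^ a).
Proof.
move=> e0; have [s0 s00 h] := L_asymp e0; exists s0 => // s ss.
have sp : 0 < s by exact: lt_le_trans ss.
have := h s ss; rewrite ler_norml => /andP[h1 h2].
rewrite -[L s]lnK ?posrE ?L_gt0// !ler_expR; apply/andP; split; lra.
Qed.

(** Markov's inequality at the saddle point: for [x = a A / y] the exponent
    [s x - A s^a] is smallest at [s = y^(1/(1-a))]. *)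
Let saddle_ub e : 0 < e -> exists2 y0, 0 < y0 & forall y, y0 <= y ->
  p (a * A / y) <= expR (- ((1 - a) * A - e) * y `^ b).
Proof.
move=> e0; have [s0 s00 h] := L_bounds e0.
exists (s0 `^ c1^-1) => [|y hy]; first by rewrite powR_gt0.
have y0 : 0 < y by apply: lt_le_trans hy; rewrite powR_gt0.
have ss : s0 <= y `^ c1 by exact: powR_ge_of_root.
have /andP[_] := h _ ss; rewrite saddleE// => h1.
apply: le_trans (p_ub (a * A / y) (powR_gt0 c1 y0)) _; rewrite saddle_mul//.
apply: (@le_trans _ _ (expR (a * A * y `^ b) * expR (- (A - e) * y `^ b))).
  by rewrite ler_pM2l ?expR_gt0.
by rewrite -expRD ler_expR; lra.
Qed.

(** Under the tilted law the variable concentrates at the saddle point; the two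
    deviations are estimated by tilting slightly more or slightly less, and
    [h = t / 4] makes both exponents negative to second order in [t]. *)
Let saddle_lb t : 0 < t < 1 -> exists2 y0, 0 < y0 & forall y, y0 <= y ->
  expR (- ((1 - a) * A + 2 * t * A) * y `^ b) <= p ((1 + t) * (a * A / y)).
Proof.
move=> t01; have /andP[t0 t1] := t01; have a1 : a < 1 by case/andP: a01.
pose e := A * a * t ^+ 2 / 48.
have e0 : 0 < e by rewrite !(mulr_gt0, divr_gt0)// exprn_gt0.
pose h := t / 4; have h01 : 0 < h < 1 by rewrite /h; apply/andP; split; lra.
have /andP[h0 h1] := h01.
have [s0 s00 H] := L_bounds e0.
pose d := A * a * t ^+ 2 / 16.
have d0 : 0 < d by rewrite !(mulr_gt0, divr_gt0)// exprn_gt0.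
pose y1 := (s0 / (1 - h)) `^ c1^-1.
pose y2 := (ln 4 / d) `^ b^-1.
pose y3 := (ln 2 / (A * t / 2)) `^ b^-1.
have At0 : 0 < A * t / 2 by rewrite divr_gt0// mulr_gt0.
have ln4 : 0 < ln 4 :> R by rewrite ln_gt0// ltr1n.
have ln2 : 0 < ln 2 :> R by rewrite ln_gt0// ltr1n.
exists (Num.max y1 (Num.max y2 y3)).
  by rewrite !lt_max powR_gt0// divr_gt0// subr_gt0.
move=> y; rewrite !ge_max => /and3P[hy1 hy2 hy3].
have hs0 : 0 < s0 / (1 - h) by rewrite divr_gt0// subr_gt0.
have y0 : 0 < y by apply: lt_le_trans hy1; rewrite powR_gt0.
have {hy1}hy1 : s0 / (1 - h) <= y `^ c1 by exact: powR_ge_of_root.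
have {hy2}hy2 : ln 4 / d <= y `^ b by apply: powR_ge_of_root => //; exact: divr_gt0.
have {hy3}hy3 : ln 2 / (A * t / 2) <= y `^ b.
  by apply: powR_ge_of_root => //; exact: divr_gt0.
set x := a * A / y; have x0 : 0 < x by rewrite divr_gt0// mulr_gt0.
set s := y `^ c1; have sp : 0 < s by rewrite powR_gt0.
set S := y `^ b; have Sp : 0 < S by rewrite powR_gt0.
have sx : s * x = a * A * S by exact: saddle_mul.
have sa : s `^ a = S by exact: saddleE.
have := p_lb sp x0 t01 h01.
have oh0 : 0 < 1 - h by lra.
have ph0 : 0 < 1 + h by lra.
have ss1 : s0 <= (1 - h) * s by rewrite mulrC -ler_pdivrMr.
have ss2 : s0 <= s by apply: le_trans ss1 _; rewrite ger_pMl//; lra.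
have ss3 : s0 <= (1 + h) * s by apply: le_trans ss2 _; rewrite ler_peMl//; lra.
have /andP[+ _] := H _ ss2; have /andP[_ +] := H _ ss1; have /andP[_ +] := H _ ss3.
rewrite !powRM ?(ltW ph0) ?(ltW oh0) ?(ltW sp)// sa => L3 L1 L2 main.
have [x1 x2 x3] := saddle_exponents a01 A0 t01.
have E1 : - (h * s * ((1 + t) * x)) = - (h * (1 + t) * a * A) * S.
  by rewrite -(mulrA h) (mulrCA s) sx; ring.
have E2 : h * s * ((1 - t) * x) = h * (1 - t) * a * A * S.
  by rewrite -(mulrA h) (mulrCA s) sx; ring.
have E3 : - (s * ((1 - t) * x)) = - ((1 - t) * a * A) * S.
  by rewrite (mulrCA s) sx; ring.
rewrite E1 E2 E3 in main.
have dS : expR (- d * S) <= 4^-1.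
  rewrite -[4^-1]lnK ?posrE ?invr_gt0// ler_expR lnV ?posrE// mulNr lerN2.
  by rewrite mulrC -ler_pdivrMr.
have T1 : expR (- (h * (1 + t) * a * A) * S) * L ((1 - h) * s) <= 4^-1 * L s.
  apply: (@le_trans _ _ (expR (- d * S) * expR (- (A + e) * S))); last first.
    by rewrite ler_pM ?expR_ge0.
  apply: (@le_trans _ _ (expR (- (h * (1 + t) * a * A) * S) *
     expR (- (A - e) * ((1 - h) `^ a * S)))).
    by apply: ler_wpM2l; [exact: expR_ge0|exact: L1].
  by rewrite -!expRD ler_expR mulrA -!mulrDl ler_pM2r.
have T2 : expR (h * (1 - t) * a * A * S) * L ((1 + h) * s) <= 4^-1 * L s.
  apply: (@le_trans _ _ (expR (- d * S) * expR (- (A + e) * S))); last first.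
    by rewrite ler_pM ?expR_ge0.
  apply: (@le_trans _ _ (expR (h * (1 - t) * a * A * S) *
     expR (- (A - e) * ((1 + h) `^ a * S)))).
    by apply: ler_wpM2l; [exact: expR_ge0|exact: L3].
  by rewrite -!expRD ler_expR mulrA -!mulrDl ler_pM2r.
have T3 := half_of_quarters main T1 T2.
have T4 : expR ((1 - t) * a * A * S) * (expR (- (A + e) * S) / 2) <= p ((1 + t) * x).
  have ee : expR (- ((1 - t) * a * A) * S) = (expR ((1 - t) * a * A * S))^-1.
    by rewrite mulNr expRN.
  rewrite ee in T3; rewrite -ler_pdivlMl ?expR_gt0//; apply: le_trans T3.
  by rewrite ler_pM2r ?invr_gt0.
apply: le_trans T4; rewrite mulrA -expRD.
rewrite -[2^-1]lnK ?posrE ?invr_gt0// -expRD ler_expR lnV ?posrE//.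
apply: saddle_collect.
- by rewrite mulrC -ler_pdivrMr.
- by rewrite ler_pM2r.
- by rewrite ler_pM2r// ler_pM2r// ger_pMr// ltW.
Qed.

(** The exponential Tauberian theorem of de Bruijn. The hypotheses on [p] and [L]
    are those that a distribution function near zero and its Laplace transform
    satisfy, so that the argument is free of measure theory. *)
Lemma tauberian_real e : 0 < e -> exists2 x0, 0 < x0 & forall x, 0 < x < x0 ->
  let S := (a * A / x) `^ b in
  0 < p x /\ `|ln (p x) + (1 - a) * A * S| <= e * ((1 - a) * A * S).
Proof.
move=> e0; have a1 : a < 1 by case/andP: a01.
have aA0 : 0 < a * A by rewrite mulr_gt0.
have k0 : 0 < (1 - a) * A by rewrite mulr_gt0.
have [y1 y10 U] := saddle_ub (mulr_gt0 e0 k0).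
pose D := 2 + (1 - a) * (1 + e) * b.
have w0 : 0 <= (1 - a) * (1 + e) * b.
  by apply: mulr_ge0; [apply: mulr_ge0; [exact: ltW|lra]|exact: ltW].
have D0 : 2 <= D by rewrite /D; lra.
pose t := Num.min (1 / 2) (Num.min ((1 - a) * e / D) (1 / (2 * b))).
have D00 : 0 < D by exact: lt_le_trans D0.
have t0 : 0 < t by rewrite !lt_min !divr_gt0 ?mulr_gt0.
have t12 : t <= 1 / 2 by rewrite ge_min lexx.
have t1 : t < 1 by lra.
have tb : t * b <= 1 / 2.
  have : t <= 1 / (2 * b) by rewrite !ge_min lexx !orbT.
  by rewrite ler_pdivlMr ?mulr_gt0//; lra.
have tD : t * D <= (1 - a) * e.
  rewrite -ler_pdivlMr//.
  by rewrite !ge_min lexx !orbT.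
have [|y2 y20 V] := @saddle_lb t; first by rewrite t0.
exists (a * A / Num.max y1 y2); first by rewrite divr_gt0// lt_max y10.
move=> x /andP[x0]; rewrite ltr_pdivlMr ?lt_max ?y10// mulrC -ltr_pdivlMr//.
rewrite gt_max => /andP[/ltW x1 /ltW x2] S.
have z0 : 0 < a * A / x by rewrite divr_gt0.
have S0 : 0 < S by rewrite powR_gt0.
have eu : a * A / (a * A / x) = x by field; rewrite !gt_eqF.
have := U _ x1; rewrite eu -/S => hU.
have y2' : y2 <= (1 + t) * (a * A / x).
  by apply: le_trans x2 _; rewrite ler_peMl ?(ltW z0)//; lra.
have := V _ y2'.
have -> : (1 + t) * (a * A / ((1 + t) * (a * A / x))) = x.
  by field; rewrite !gt_eqF//; lra.
rewrite powRM ?(ltW z0)//; last by lra.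
rewrite -/S => hV.
have p0 : 0 < p x by apply: lt_le_trans hV; exact: expR_gt0.
split=> //; rewrite ler_norml.
have hU' : ln (p x) <= - ((1 - a) * A - e * ((1 - a) * A)) * S.
  by rewrite -[leRHS]expRK ler_ln ?posrE ?expR_gt0.
have hV' : - ((1 - a) * A + 2 * t * A) * ((1 + t) `^ b * S) <= ln (p x).
  by rewrite -[leLHS]expRK ler_ln ?posrE ?expR_gt0.
apply/andP; split; last lra.
suff : ((1 - a) * A + 2 * t * A) * ((1 + t) `^ b * S) <= (1 + e) * ((1 - a) * A * S) by lra.
have hb : (1 + t) `^ b * (1 - b * t) <= 1.
  have q0 : 0 <= 1 - b * t by lra.
  apply: (@le_trans _ _ (expR (b * t) * expR (- (b * t)))); last first.
    by rewrite -expRD subrr expR0.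
  rewrite ler_pM ?powR_ge0//; last by have := expR_ge1Dx (- (b * t)).
  rewrite /powR gt_eqF//; last lra.
  by rewrite ler_expR ler_pM2l//; apply: le_ln1Dx; lra.
have key : (1 - a) + 2 * t <= (1 + e) * (1 - a) * (1 - b * t).
  by move: tD; rewrite /D; lra.
rewrite mulrA (mulrA (1 + e)) ler_pM2r//.
rewrite -mulrDl mulrAC mulrA ler_pM2r//.
have : ((1 - a) + 2 * t) * (1 + t) `^ b <= (1 + e) * (1 - a) * (1 - b * t) * (1 + t) `^ b.
  by rewrite ler_wpM2r ?powR_ge0.
move/le_trans; apply; rewrite -mulrA [_ * (1 + t) `^ b]mulrC.
by rewrite ger_pMr// mulr_gt0//; lra.
Qed.

End TauberianReal.

(** * Gaussian integrals *)

Section GaussianIntegrals.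
Context {R : realType}.
Implicit Types (f F h : R -> R) (a b u x : R).
Local Notation mu := (@lebesgue_measure R).

Lemma integrable_cont_le f g : continuous f -> (forall x, `|f x| <= g x) ->
  mu.-integrable setT (EFin \o g) -> mu.-integrable setT (EFin \o f).
Proof.
move=> cf fg ig; apply: le_integrable ig => //.
  by apply: continuous_EFin_measurable.
by move=> x _ /=; rewrite lee_fin (le_trans (fg x))// ler_norm.
Qed.

(** Integration by parts on the whole line is used in this form, with [F] a
    product that vanishes at infinity. *)
Lemma Rintegral_derivative_eq0 F f : (forall x : R, is_derive x 1 F (f x)) ->
  continuous f -> mu.-integrable setT (EFin \o f) ->
  F n%:R @[n --> \oo] --> 0 -> F (- n%:R) @[n --> \oo] --> 0 ->
  \int[mu]_x f x = 0.
Proof.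
move=> dF cf intf Fy FNy.
pose I n : set R := `[- n.+1%:R, n.+1%:R]%classic.
have mI n : measurable (I n) by exact: measurable_itv.
pose f_ n := (EFin \o f) \_ (I n).
have cF : continuous F.
  move=> x; apply/differentiable_continuous/derivable1_diffP.
  exact: is_derive_derivable (dF x).
have E n : (\int[mu]_x f_ n x = (F n.+1%:R)%:E - (F (- n.+1%:R))%:E)%E.
  rewrite /f_ -integral_mkcond (@continuous_FTC2 _ _ F)//.
  - by rewrite gtrN ?ltr0n.
  - exact: continuous_subspaceT.
  - split.
    + by move=> x _; exact: is_derive_derivable (dF x).
    + by apply: cvg_at_right_filter; exact: cF.
    + by apply: cvg_at_left_filter; exact: cF.
  - by move=> x _; rewrite derive1E (@derive_val _ _ _ _ _ _ _ (dF x)).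
have mf : measurable_fun setT (EFin \o f) by apply: continuous_EFin_measurable.
have mf_ n : measurable_fun setT (f_ n).
  apply: (measurable_restrictT (EFin \o f) (mI n)).1.
  exact: measurable_funTS.
have [|||_ _ h] := @dominated_convergence _ _ R mu setT measurableT f_ (EFin \o f)
  (fun x => `|f x|%:E) mf_ mf.
- apply: aeW => x _; apply: cvg_near_cst.
  near=> n; rewrite /f_ patchE mem_set//= /I /= in_itv /= -ler_norml.
  apply: (le_trans (ltW (truncnS_gt _))); rewrite ler_nat ltnS.
  by near: n; exact: nbhs_infty_ge.
- by have := integrable_abse intf.
- apply: aeW => x n _ /=; rewrite /f_ patchE; case: ifP => _ //=.
  by rewrite normr0 lee_fin.
have h0 : (\int[mu]_x f_ n x)%E @[n --> \oo] --> (0 : \bar R)%E.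
  under eq_fun do rewrite E -EFinB.
  apply: cvg_EFin; first exact: nearW.
  rewrite /comp /= -[X in _ --> X](subrr 0); apply: cvgB.
    by have := Fy; rewrite -(cvg_shiftS (fun n => F n%:R)).
  by have := FNy; rewrite -(cvg_shiftS (fun n => F (- n%:R))).
rewrite /Rintegral; have -> : (\int[mu]_x (f x)%:E = 0)%E => //.
by apply: cvg_unique h h0.
Unshelve. all: by end_near. Qed.

Definition phi x : R := normal_pdf 0 1 x.

Lemma phiE x : phi x = normal_peak 1 * expR (- (x ^+ 2 / 2)).
Proof.
rewrite /phi normal_pdfE ?oner_neq0//; congr (_ * expR _).
by rewrite subr0 expr1n; field.
Qed.

Lemma phi_ge0 x : 0 <= phi x.
Proof. exact: normal_pdf_ge0. Qed.

Lemma phi_der x : is_derive x 1 phi (- x * phi x).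
Proof.
have -> : phi = fun x => normal_peak 1 * expR (- (x ^+ 2 / 2)) by apply/funext/phiE.
have h1 : is_derive x 1 (fun t => - (t ^+ 2 / 2) : R) (- x).
  by apply: is_derive_eq; rewrite /= -![_ *: _]/(_ * _); field.
have h2 : is_derive x 1 (fun t => expR (- (t ^+ 2 / 2))) (expR (- (x ^+ 2 / 2)) * - x).
  exact: (@is_derive1_comp R expR (fun t => - (t ^+ 2 / 2))).
by apply: is_derive_eq; rewrite /= -![_ *: _]/(_ * _); ring.
Qed.

Lemma phi_cont : continuous phi.
Proof.
move=> x; apply/differentiable_continuous/derivable1_diffP.
exact: is_derive_derivable (phi_der x).
Qed.

(** A quadratic factor is absorbed by passing to a Gaussian density of larger
    variance, which yields an integrable majorant. *)
Lemma phi_sqr_le x : (1 + x ^+ 2) * phi x <=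
  4 * normal_peak 1 / normal_peak (Num.sqrt 2) * normal_pdf 0 (Num.sqrt 2) x.
Proof.
have s2 : Num.sqrt 2 != 0 :> R by rewrite gt_eqF// sqrtr_gt0.
rewrite normal_pdfE// phiE mulrA divfK; last by rewrite gt_eqF// normal_peak_gt0.
rewrite mulrCA -mulrA [leRHS]mulrCA ler_pM2l ?normal_peak_gt0 ?oner_neq0//.
rewrite /normal_fun subr0 sqr_sqrtr//.
have -> : - x ^+ 2 / (2 *+ 2) = - (x ^+ 2 / 4) by field.
have -> : - (x ^+ 2 / 2) = - (x ^+ 2 / 4) + - (x ^+ 2 / 4) :> R by field.
rewrite expRD mulrA ler_pM2r ?expR_gt0// expRN ler_pdivrMr ?expR_gt0//.
have := expR_ge1Dx (x ^+ 2 / 4); lra.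
Qed.

Lemma integrable_phi h K : continuous h -> (forall x, `|h x| <= K * (1 + x ^+ 2)) ->
  mu.-integrable setT (EFin \o (fun x => h x * phi x)).
Proof.
move=> ch hK; pose C := K * (4 * normal_peak 1 / normal_peak (Num.sqrt 2)).
have iC : mu.-integrable setT (EFin \o (fun x => C * normal_pdf 0 (Num.sqrt 2) x)).
  rewrite /comp; under eq_fun do rewrite EFinM.
  by apply: integrableZl => //; exact: integrable_normal_pdf.
apply: integrable_cont_le iC => [x|x]; first by apply: cvgM; [exact: ch|exact: phi_cont].
rewrite normrM (ger0_norm (phi_ge0 x)) /C -mulrA.
have K0 : 0 <= K.
  by have := hK 0; rewrite expr0n /= addr0 mulr1; apply: le_trans.
apply: le_trans (ler_wpM2l K0 (phi_sqr_le x)); rewrite mulrA ler_wpM2r ?phi_ge0//.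
Qed.

Lemma phi_vanish h K : (forall x, `|h x| <= K * (1 + `|x|)) ->
  h n%:R * phi n%:R @[n --> \oo] --> 0 /\ h (- n%:R) * phi (- n%:R) @[n --> \oo] --> 0.
Proof.
move=> hK; have K0 : 0 <= K.
  by have := hK 0; rewrite normr0 addr0 mulr1; apply: le_trans.
pose C := 4 * K * normal_peak 1 : R.
have C0 : 0 <= C by rewrite !mulr_ge0// normal_peak_ge0.
have bd x : `|h x * phi x| <= C / (1 + `|x|).
  rewrite normrM (ger0_norm (phi_ge0 x)) ler_pdivlMr ?ltr_wpDr//.
  apply: (@le_trans _ _ (K * (1 + `|x|) * phi x * (1 + `|x|))).
    by rewrite ler_wpM2r ?addr_ge0// ler_wpM2r ?phi_ge0.
  rewrite phiE /C expRN.
  have -> : K * (1 + `|x|) * (normal_peak 1 / expR (x ^+ 2 / 2)) * (1 + `|x|) =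
     K * normal_peak 1 * ((1 + `|x|) ^+ 2 / expR (x ^+ 2 / 2)) by ring.
  have -> : 4 * K * normal_peak 1 = K * normal_peak 1 * 4 by ring.
  rewrite ler_wpM2l ?mulr_ge0 ?normal_peak_ge0// ler_pdivrMr ?expR_gt0//.
  have := expR_ge1Dx (x ^+ 2 / 2); rewrite -real_normK ?num_real//.
  have : 0 <= (`|x| - 1) ^+ 2 := sqr_ge0 _.
  by rewrite !expr2; lra.
have lim0 : C / (1 + n%:R) @[n --> \oo] --> (0 : R).
  rewrite -(mulr0 C); apply: cvgMr.
  have := @cvg_harmonic R; apply: cvg_trans; apply: near_eq_cvg; apply: nearW => n.
  by rewrite /harmonic /= -natr1 addrC.
have sq (v : nat -> R) : (forall n, `|v n| <= C / (1 + n%:R)) -> v n @[n --> \oo] --> 0.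
  move=> hv; apply: norm_cvg0.
  apply: (@squeeze_cvgr _ _ _ _ (cst 0) (fun n => C / (1 + n%:R))) => //.
    by apply: nearW => n; rewrite normr_ge0 hv.
  exact: cvg_cst.
split; apply: sq => n; apply: le_trans (bd _) _.
  by rewrite ger0_norm ?ler0n.
by rewrite normrN ger0_norm ?ler0n.
Qed.

Lemma int_phi : \int[mu]_x phi x = 1.
Proof. by rewrite /Rintegral integral_normal_pdf. Qed.

Lemma norm_le_1Dsqr x : `|x| <= 1 + x ^+ 2.
Proof.
have : 0 <= (`|x| - 1) ^+ 2 := sqr_ge0 _.
have := normr_ge0 x; rewrite -[x ^+ 2]real_normK ?num_real//; move: `|x| => y.
by rewrite !expr2; nra.
Qed.

Lemma cont_cosM u : continuous (fun x => cos (u * x)).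
Proof.
move=> x; apply: (@continuous_comp _ _ _ ( *%R u) cos); last exact: continuous_cos.
exact: mulrl_continuous.
Qed.

Lemma cont_sinM u : continuous (fun x => sin (u * x)).
Proof.
move=> x; apply: (@continuous_comp _ _ _ ( *%R u) sin); last exact: continuous_sin.
exact: mulrl_continuous.
Qed.

Lemma is_derive_sinM u x : is_derive x 1 (fun t => sin (u * t)) (u * cos (u * x)).
Proof.
have h : is_derive x 1 (fun t : R => u * t) u.
  by apply: is_derive_eq; rewrite -![_ *: _]/(_ * _); ring.
have := @is_derive1_comp R sin ( *%R u) x _ _ _ h.
by move=> /(_ _ (is_derive_sin (u * x))); rewrite mulrC.
Qed.

Lemma is_derive_cosM u x : is_derive x 1 (fun t => cos (u * t)) (- u * sin (u * x)).
Proof.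
have h : is_derive x 1 (fun t : R => u * t) u.
  by apply: is_derive_eq; rewrite -![_ *: _]/(_ * _); ring.
have := @is_derive1_comp R cos ( *%R u) x _ _ _ h.
move=> /(_ _ (is_derive_cos (u * x))); congr is_derive; ring.
Qed.

Lemma integrable_cos_phi u : mu.-integrable setT (EFin \o (fun x => cos (u * x) * phi x)).
Proof.
apply: (integrable_phi (K := 1)); first exact: cont_cosM.
by move=> x; rewrite mul1r (le_trans (cos_max _))// lerDl sqr_ge0.
Qed.

Lemma integrable_xsin_phi u :
  mu.-integrable setT (EFin \o (fun x => x * sin (u * x) * phi x)).
Proof.
apply: (integrable_phi (K := 1)).
  by move=> x; apply: cvgM; [exact: cvg_id|exact: cont_sinM].
move=> x; rewrite mul1r normrM (le_trans _ (norm_le_1Dsqr x))//.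
by rewrite ler_piMr// sin_max.
Qed.

Lemma gauss_parts u :
  \int[mu]_x (x * sin (u * x) * phi x) = u * \int[mu]_x (cos (u * x) * phi x).
Proof.
have i1 : mu.-integrable setT (EFin \o (fun x => u * (cos (u * x) * phi x))).
  rewrite /comp; under eq_fun do rewrite EFinM.
  by apply: integrableZl => //; exact: integrable_cos_phi.
have : \int[mu]_x (u * (cos (u * x) * phi x) - x * sin (u * x) * phi x) = 0.
  have [|v1 v2] := @phi_vanish (fun x => sin (u * x)) 1.
    by move=> x; rewrite mul1r (le_trans (sin_max _))// lerDl.
  apply: (@Rintegral_derivative_eq0 (fun x => sin (u * x) * phi x)) => //.
  - move=> x; have h1 := is_derive_sinM u x; have h2 := phi_der x.
    by apply: is_derive_eq; rewrite -![_ *: _]/(_ * _); ring.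
  - move=> x; apply: cvgB; last first.
      apply: cvgM; last exact: phi_cont.
      by apply: cvgM; [exact: cvg_id|exact: cont_sinM].
    apply: cvgM; first exact: cvg_cst.
    by apply: cvgM; [exact: cont_cosM|exact: phi_cont].
  - rewrite /comp; under eq_fun do rewrite EFinB.
    by apply: integrableB => //; exact: integrable_xsin_phi.
rewrite RintegralB//; last exact: integrable_xsin_phi.
rewrite RintegralZl//; last exact: integrable_cos_phi.
by move/eqP; rewrite subr_eq0 => /eqP.
Qed.

(** The characteristic function solves [f' = - u f]. *)
Lemma int_cos_phi u : \int[mu]_x (cos (u * x) * phi x) = expR (- (u ^+ 2 / 2)).
Proof.
pose f u x := cos (u * x) * phi x.
pose F u := \int[mu]_x f u x.
have pf (v : R) x : is_derive v 1 (fun v => f v x) (- (x * sin (v * x) * phi x)).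
  have h := is_derive_cosM x v.
  have e : (fun v => f v x) = (fun v => cos (x * v) * phi x).
    by apply/funext => t; rewrite /f mulrC [x * _]mulrC mulrC.
  rewrite e; apply: is_derive_eq; rewrite -![_ *: _]/(_ * _) [v * x]mulrC; ring.
have dF (v : R) : is_derive v 1 F (- v * F v).
  have vI : (`]v - 1, v + 1[ : set R)%classic v.
    by rewrite /= in_itv /= ltrBlDr ltrDl ltr01.
  have E x y : partial1of2 f x y = - (y * sin (x * y) * phi y).
    by rewrite partial1of2E (@derive_val _ _ _ _ _ _ _ (pf x y)).
  have i0 x : (`]v - 1, v + 1[ : set R)%classic x ->
      mu.-integrable setT (EFin \o f x) by move=> _; exact: integrable_cos_phi.
  have i1 x y : (`]v - 1, v + 1[ : set R)%classic x -> setT y -> derivable (f ^~ y) x 1.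
    by move=> _ _; exact: is_derive_derivable (pf x y).
  have i2 : mu.-integrable setT (EFin \o (fun y : R => (1 + y ^+ 2) * phi y)).
    apply: (integrable_phi (K := 1)).
      move=> x; apply: cvgD; first exact: cvg_cst.
      exact: exprn_continuous.
    by move=> x; rewrite mul1r ger0_norm// addr_ge0// sqr_ge0.
  have i3 y : 0 <= (1 + y ^+ 2) * phi y by rewrite mulr_ge0 ?phi_ge0// addr_ge0 ?sqr_ge0.
  have i4 x y : (`]v - 1, v + 1[ : set R)%classic x -> setT y ->
      `|partial1of2 f x y| <= (1 + y ^+ 2) * phi y.
    move=> _ _; rewrite E normrN normrM (ger0_norm (phi_ge0 y)) ler_wpM2r ?phi_ge0//.
    by rewrite normrM (le_trans _ (norm_le_1Dsqr y))// ler_piMr// sin_max.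
  apply: DeriveDef.
    exact: (derivable_under_integral measurableT vI i0 i1 i3 i2 i4).
  rewrite -derive1E (differentiation_under_integral measurableT vI i0 i1 i3 i2 i4).
  under eq_Rintegral => x _ do rewrite E.
  rewrite mulNr /F -gauss_parts.
  have := @RintegralZl _ _ _ mu setT (fun x => x * sin (v * x) * phi x) (-1) measurableT
    (integrable_xsin_phi v).
  rewrite mulN1r => <-; apply: eq_Rintegral => x _; by rewrite mulN1r.
have h : F u * expR (u ^+ 2 / 2) = 1.
  have dG (v : R) : is_derive v 1 (fun v => F v * expR (v ^+ 2 / 2)) 0.
    have h0 := dF v.
    have h1 : is_derive v 1 (fun t => t ^+ 2 / 2 : R) v.
      by apply: is_derive_eq; rewrite /= -![_ *: _]/(_ * _); field.
    have h2 : is_derive v 1 (fun t => expR (t ^+ 2 / 2)) (expR (v ^+ 2 / 2) * v).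
      exact: (@is_derive1_comp R expR (fun t => t ^+ 2 / 2)).
    by apply: is_derive_eq; rewrite /= -![_ *: _]/(_ * _); ring.
  rewrite (der0_cst u 0 dG) expr0n /= mul0r expR0 mulr1 -int_phi.
  by apply: eq_Rintegral => x _; rewrite /f mul0r cos0 mul1r.
rewrite -/(F u) expRN -[X in _ = X]mul1r -[X in _ = X * _]h mulfK//.
by rewrite gt_eqF// expR_gt0.
Qed.

Lemma int_x_phi : \int[mu]_x (x * phi x) = 0.
Proof.
have i1 : mu.-integrable setT (EFin \o (fun x => x * phi x)).
  apply: (integrable_phi (K := 1)) => [x|x]; first exact: cvg_id.
  by rewrite mul1r norm_le_1Dsqr.
have [|v1 v2] := @phi_vanish (fun=> 1) 1.
  by move=> x; rewrite normr1 mul1r lerDl.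
suff : \int[mu]_x (- 1 * (x * phi x)) = 0.
  by rewrite RintegralZl// mulN1r => /eqP; rewrite oppr_eq0 => /eqP.
apply: (@Rintegral_derivative_eq0 phi) => //.
- by move=> x; have h := phi_der x; apply: is_derive_eq; ring.
- move=> x; apply: cvgM; first exact: cvg_cst.
  by apply: cvgM; [exact: cvg_id|exact: phi_cont].
- by rewrite /comp; under eq_fun do rewrite EFinM; apply: integrableZl.
- by move: v1; under eq_fun do rewrite mul1r.
- by move: v2; under eq_fun do rewrite mul1r.
Qed.

(** The density satisfies [phi' = - x phi], so that [x^2 phi - phi] is minus the
    derivative of [x phi]. *)
Lemma int_sqr_phi : \int[mu]_x (x ^+ 2 * phi x) = 1.
Proof.
have i1 : mu.-integrable setT (EFin \o (fun x => x ^+ 2 * phi x)).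
  apply: (integrable_phi (K := 1)) => [x|x]; first exact: exprn_continuous.
  by rewrite mul1r ger0_norm ?sqr_ge0// lerDr.
have i0 : mu.-integrable setT (EFin \o phi) by exact: integrable_normal_pdf.
have [|v1 v2] := @phi_vanish id 1; first by move=> x; rewrite mul1r lerDr.
suff : \int[mu]_x (phi x - (x ^+ 2 * phi x)) = 0.
  by rewrite RintegralB// int_phi => /eqP; rewrite subr_eq0 => /eqP.
apply: (@Rintegral_derivative_eq0 (fun x => x * phi x)) => //.
- move=> x; have h := phi_der x; apply: is_derive_eq.
  by rewrite -![_ *: _]/(_ * _); ring.
- move=> x; apply: cvgB; first exact: phi_cont.
  by apply: cvgM; [exact: exprn_continuous|exact: phi_cont].
- by rewrite /comp; under eq_fun do rewrite EFinB; apply: integrableB.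
Qed.

(** Completing the square: the Gaussian factor turns one normal density into a
    multiple of another. *)
Lemma expquad_phiE al be x : 0 <= al ->
  expR (- ((2 * be * x + al * x ^+ 2) / 2)) * phi x =
  (Num.sqrt (1 + al))^-1 * expR (be ^+ 2 / (2 * (1 + al))) *
    normal_pdf (- be / (1 + al)) (Num.sqrt (1 + al))^-1 x.
Proof.
move=> al0; have a1 : 0 < 1 + al by lra.
set s := (Num.sqrt (1 + al))^-1; have s0 : 0 < s by rewrite invr_gt0 sqrtr_gt0.
have s2 : s ^+ 2 = (1 + al)^-1 by rewrite /s exprVn sqr_sqrtr ?ltW.
set m := - be / (1 + al).
rewrite phiE normal_pdfE ?gt_eqF// mulrCA -expRD.
have -> : normal_peak s = normal_peak 1 / s.
  rewrite /normal_peak expr1n mul1r -mulrnAr sqrtrM ?sqr_ge0// sqrtr_sqr gtr0_norm//.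
  by rewrite invfM mulrC.
have -> : s * expR (be ^+ 2 / (2 * (1 + al))) * (normal_peak 1 / s * normal_fun m s x) =
   normal_peak 1 * (expR (be ^+ 2 / (2 * (1 + al))) * normal_fun m s x).
  by field; rewrite gt_eqF.
rewrite /normal_fun -expRD; congr (_ * expR _).
by rewrite s2 /m; field; rewrite gt_eqF.
Qed.

Lemma integrable_expquad_phi al be : 0 <= al -> mu.-integrable setT
  (EFin \o (fun x => expR (- ((2 * be * x + al * x ^+ 2) / 2)) * phi x)).
Proof.
move=> al0; rewrite /comp; under eq_fun do rewrite (expquad_phiE _ _ al0) EFinM.
by apply: integrableZl => //; exact: integrable_normal_pdf.
Qed.

Lemma int_expquad_phi al be : 0 <= al ->
  \int[mu]_x (expR (- ((2 * be * x + al * x ^+ 2) / 2)) * phi x) =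
  (Num.sqrt (1 + al))^-1 * expR (be ^+ 2 / (2 * (1 + al))).
Proof.
move=> al0; under eq_Rintegral => x _ do rewrite expquad_phiE//.
rewrite RintegralZl//; last exact: integrable_normal_pdf.
have e m s : \int[mu]_x normal_pdf m s x = 1 by rewrite /Rintegral integral_normal_pdf.
by rewrite e mulr1.
Qed.

Lemma integral_normal_prob m s (f : R -> \bar R) U : s != 0 ->
  measurable U -> measurable_fun U f ->
  (\int[normal_prob m s]_(x in U) `|f x| < +oo)%E ->
  (\int[normal_prob m s]_(x in U) f x =
   \int[mu]_(x in U) (f x * (normal_pdf m s x)%:E))%E.
Proof.
move=> s0 mU mf finf; have dom := @normal_prob_dominates R m s.
rewrite -(Radon_Nikodym_change_of_variables dom)//=; last first.
  by apply/integrableP; split.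
apply: ae_eq_integral => //.
- apply: emeasurable_funM => //; apply: (measurable_int mu).
  apply: (integrableS _ _ (@subsetT _ _)) => //=.
  by apply: Radon_Nikodym_integrable; exact: dom.
- apply: emeasurable_funM => //=; apply/measurableT_comp => //=.
  by apply/measurable_funTS; exact: measurable_normal_pdf.
- apply: ae_eqe_mul2l => /=.
  rewrite Radon_NikodymE//=; case: cid => /= h [h1 h2 h3].
  apply: integral_ae_eq => //=.
  + exact: integrableS h2.
  + by apply/measurable_funTS/measurableT_comp => //; exact: measurable_normal_pdf.
  + by move=> E E01 mE; rewrite -h3.
Qed.

Lemma ge0_integral_normal_affine m s (g : R -> R) : 0 < s -> continuous g ->
  (forall x, 0 <= g x) ->
  (\int[mu]_x (g x * normal_pdf m s x)%:E = \int[mu]_z (g (m + s * z) * phi z)%:E)%E.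
Proof.
move=> s0 cg g0; pose A z : R := m + s * z.
have dA (z : R) : is_derive z 1 A s.
  by apply: is_derive_eq; rewrite -![_ *: _]/(_ * _) add0r; ring.
have A' : A^`()%classic = cst s.
  by apply/funext => z; rewrite derive1E (@derive_val _ _ _ _ _ _ _ (dA z)).
rewrite (@increasing_ge0_integration_by_substitutionT R A
   (fun x => g x * normal_pdf m s x)).
- apply: eq_integral => z _; congr EFin; rewrite !fctE A' /=.
  rewrite -mulrA; congr (_ * _); rewrite normal_pdfE ?gt_eqF// phiE.
  have -> : normal_peak s = normal_peak 1 / s.
    rewrite /normal_peak expr1n mul1r -mulrnAr sqrtrM ?sqr_ge0// sqrtr_sqr gtr0_norm//.
    by rewrite invfM mulrC.
  rewrite mulrAC divfK ?gt_eqF//; congr (_ * expR _).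
  by rewrite /A; field; rewrite gt_eqF.
- by move=> x y xy; rewrite /A ltrD2l ltr_pM2l.
- by rewrite A'; exact: cst_continuous.
- by rewrite A'; exact: is_cvg_cst.
- by rewrite A'; exact: is_cvg_cst.
- by move=> x; exact: is_derive_derivable (dA x).
- by apply: (@cvg_comp _ _ _ ( *%R s) (+%R m)); [exact: gt0_cvgMrNy|exact: cvg_addrl_Ny].
- by apply: (@cvg_comp _ _ _ ( *%R s) (+%R m)); [exact: gt0_cvgMry|exact: cvg_addrl].
- by move=> x; apply: cvgM; [exact: cg|exact: continuous_normal_pdf (lt0r_neq0 s0) _].
- by move=> x; rewrite mulr_ge0// normal_pdf_ge0.
Qed.

End GaussianIntegrals.

(** * The Laplace transform of a Gaussian quadratic form *)

Section OnDomain.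
Context {R : realType} {d : measure_display} {T : measurableType d}.
Variable m : {measure set T -> \bar R}.
Variable D : set T.
Hypothesis mD : measurable D.

Lemma intDD (f g : T -> R) : m.-integrable D (EFin \o f) ->
  m.-integrable D (EFin \o g) -> m.-integrable D (EFin \o (fun x => f x + g x)).
Proof.
move=> i1 i2; have -> : EFin \o (fun x => f x + g x) = (fun x => (f x)%:E + (g x)%:E)%E.
  by apply/funext.
exact: integrableD.
Qed.

Lemma intDZ (k : R) (f : T -> R) : m.-integrable D (EFin \o f) ->
  m.-integrable D (EFin \o (fun x => k * f x)).
Proof.
move=> i1; have -> : EFin \o (fun x => k * f x) = (fun x => k%:E * (EFin \o f) x)%E.
  by apply/funext.
exact: integrableZl.
Qed.

Lemma intDB (f g : T -> R) : m.-integrable D (EFin \o f) ->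
  m.-integrable D (EFin \o g) -> m.-integrable D (EFin \o (fun x => f x - g x)).
Proof.
move=> i1 i2; have -> : (fun x => f x - g x) = (fun x => f x + -1 * g x).
  by apply/funext => x; rewrite mulN1r.
by apply: intDD => //; exact: intDZ.
Qed.

Lemma intDn (f : T -> R) : m.-integrable D (EFin \o f) ->
  m.-integrable D (EFin \o (fun x => `|f x|)).
Proof.
move=> i1; have -> : EFin \o (fun x => `|f x|) = (fun x => `|(EFin \o f) x|%E).
  by apply/funext.
exact: integrable_abse.
Qed.

End OnDomain.

Section RealIntegrable.
Context {d : measure_display} {T : measurableType d} {R : realType}.
Variable m : {measure set T -> \bar R}.

Lemma intgD (f g : T -> R) : m.-integrable setT (EFin \o f) ->
  m.-integrable setT (EFin \o g) -> m.-integrable setT (EFin \o (fun x => f x + g x)).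
Proof. exact: intDD. Qed.

Lemma intgZ (k : R) (f : T -> R) : m.-integrable setT (EFin \o f) ->
  m.-integrable setT (EFin \o (fun x => k * f x)).
Proof. exact: intDZ. Qed.

Lemma RintE (f : T -> R) : m.-integrable setT (EFin \o f) ->
  (\int[m]_x (f x)%:E = (\int[m]_x f x)%:E)%E.
Proof. by move=> i1; rewrite /Rintegral fineK//; exact: integrable_fin_num. Qed.

End RealIntegrable.

Section GaussianLaw.
Context {d : measure_display} {T : measurableType d} {R : realType}.
Variable P : probability T R.
Local Notation mu := (@lebesgue_measure R).

Lemma Rint_cst (c : R) : \int[P]_w c = c.
Proof. by have := expectation_cst P c; rewrite unlock /Rintegral => ->. Qed.

Lemma gaussian_integral (Y : T -> R) (m s : R) (g : R -> R) :
  measurable_fun setT Y -> 0 <= s ->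
  (forall A : set R, measurable A ->
      pushforward P Y A = if s == 0 then dirac m A else normal_prob m s A) ->
  continuous g -> (forall x, 0 <= g x) -> (\int[P]_w (g (Y w))%:E < +oo)%E ->
  (\int[P]_w (g (Y w))%:E = \int[mu]_z (g (m + s * z) * phi z)%:E)%E.
Proof.
move=> mY s0 lawY cg g0 fin.
have mg : measurable_fun setT (EFin \o g) by apply: continuous_EFin_measurable.
pose TR := measurableTypeR R; pose Y' : T -> TR := Y.
have mY' : measurable_fun setT Y' := mY.
have mg' : measurable_fun (setT : set TR) (EFin \o g : TR -> \bar R) := mg.
have e1 : (\int[pushforward P Y']_x (g x)%:E = \int[P]_w (g (Y w))%:E)%E.
  have -> := @ge0_integral_pushforward _ _ T TR R Y' mY' P setT (EFin \o g) measurableT mg'.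
    by rewrite preimage_setT.
  by move=> x _; rewrite lee_fin.
have [s00|sn0] := eqVneq s 0.
  have -> : (\int[P]_w (g (Y w))%:E = \int[@dirac _ TR m R]_x (g x)%:E)%E.
    rewrite -e1; apply: eq_measure_integral => A mA _.
    by have := lawY A mA; rewrite s00 eqxx.
  rewrite (@integral_dirac _ TR m R setT _ (EFin \o g) mg')// diracT mul1e.
  have -> : (\int[mu]_z (g (m + s * z) * phi z)%:E = \int[mu]_z ((g m)%:E * (phi z)%:E))%E.
    by apply: eq_integral => z _; rewrite s00 mul0r addr0 EFinM.
  rewrite integralZl//; last exact: integrable_normal_pdf.
  by rewrite integral_normal_pdf mule1.
have sp : 0 < s by rewrite lt_def sn0.
have e2 X : (\int[normal_prob m s]_x (g x)%:E = X)%E ->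
    (\int[pushforward P Y']_x (g x)%:E = X)%E.
  move=> <-; apply: eq_measure_integral => A mA _.
  by have := lawY A mA; rewrite (negbTE sn0).
rewrite -e1 (e2 _ erefl) (integral_normal_prob _ measurableT); first last.
- under eq_integral => x _ do rewrite gee0_abs ?lee_fin//.
  by rewrite -(e2 _ erefl) e1.
- exact: mg.
- exact: sn0.
by rewrite -ge0_integral_normal_affine.
Qed.

(** The first two moments determine the parameters of the law, hence its
    characteristic function, which is real as the mean is zero. The moment
    identities are obtained from nonnegative integrands [(x + c)^2]. *)
Lemma gaussian_rv_cos (Y : T -> R) (v : R) : gaussian_rv P Y ->
  P.-integrable setT (EFin \o Y) -> P.-integrable setT (EFin \o (fun w => Y w ^+ 2)) ->
  \int[P]_w Y w = 0 -> \int[P]_w (Y w ^+ 2) = v ->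
  \int[P]_w cos (Y w) = expR (- (v / 2)).
Proof.
move=> [mY [m [s [s0 lawY]]]] i1 i2 EY EY2.
have I1 : P.-integrable setT (EFin \o (fun=> 1)) by exact: finite_measure_integrable_cst.
have mom (c : R) : (m + c) ^+ 2 + s ^+ 2 = v + c ^+ 2.
  have ic : P.-integrable setT (EFin \o (fun w => Y w ^+ 2 + 2 * c * Y w)).
    by apply: intgD => //; exact: intgZ.
  have ic1 : P.-integrable setT (EFin \o (fun w => c ^+ 2 * 1)).
    by exact: finite_measure_integrable_cst.
  have ic2 : P.-integrable setT (EFin \o (fun w => (Y w + c) ^+ 2)).
    have -> : (fun w => (Y w + c) ^+ 2) =
      (fun w => (Y w ^+ 2 + 2 * c * Y w) + (c ^+ 2 * 1)).
      by apply/funext => w /=; ring.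
    exact: intgD.
  have E1 : \int[P]_w ((Y w + c) ^+ 2) = v + c ^+ 2.
    transitivity (\int[P]_w ((Y w ^+ 2 + 2 * c * Y w) + c ^+ 2 * 1)).
      by apply: eq_Rintegral => w _; ring.
    rewrite RintegralD//.
    have iZ : P.-integrable setT (EFin \o (fun w => 2 * c * Y w)).
      exact: intgZ.
    rewrite RintegralD// RintegralZl// EY EY2 mulr0 addr0; congr (_ + _).
    by rewrite Rint_cst mulr1.
  have cg : continuous (fun x : R => (x + c) ^+ 2).
    move=> x; apply: (@continuous_comp _ _ _ (fun x => x + c) (fun y => y ^+ 2)).
      by apply: cvgD; [exact: cvg_id|exact: cvg_cst].
    exact: exprn_continuous.
  have := @gaussian_integral Y m s (fun x => (x + c) ^+ 2) mY s0 lawY cg (fun=> sqr_ge0 _).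
  have fi : (\int[P]_w ((Y w + c) ^+ 2)%:E = (v + c ^+ 2)%:E)%E.
    by rewrite -E1 RintE.
  rewrite fi ltry => /(_ isT) h.
  have j1 : mu.-integrable setT (EFin \o phi) by exact: integrable_normal_pdf.
  have j2 : mu.-integrable setT (EFin \o (fun z => z * phi z)).
    apply: (integrable_phi (K := 1)) => [x|x]; first exact: cvg_id.
    by rewrite mul1r norm_le_1Dsqr.
  have j3 : mu.-integrable setT (EFin \o (fun z => z ^+ 2 * phi z)).
    apply: (integrable_phi (K := 1)) => [x|x]; first exact: exprn_continuous.
    by rewrite mul1r ger0_norm ?sqr_ge0// lerDr.
  have k1 : mu.-integrable setT (EFin \o (fun z => (m + c) ^+ 2 * phi z)).
    exact: intgZ.
  have k2 : mu.-integrable setT (EFin \o (fun z => 2 * (m + c) * s * (z * phi z))).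
    exact: intgZ.
  have k3 : mu.-integrable setT (EFin \o (fun z => s ^+ 2 * (z ^+ 2 * phi z))).
    exact: intgZ.
  have k12 : mu.-integrable setT
      (EFin \o (fun z => (m + c) ^+ 2 * phi z + 2 * (m + c) * s * (z * phi z))).
    exact: intgD.
  have E2 : \int[mu]_z ((m + s * z + c) ^+ 2 * phi z) = (m + c) ^+ 2 + s ^+ 2.
    transitivity (\int[mu]_z ((m + c) ^+ 2 * phi z + 2 * (m + c) * s * (z * phi z)
        + s ^+ 2 * (z ^+ 2 * phi z))).
      by apply: eq_Rintegral => z _; ring.
    rewrite RintegralD// RintegralD// !RintegralZl// int_phi int_x_phi int_sqr_phi.
    by rewrite !mulr1 mulr0 addr0.
  by rewrite -E2 /Rintegral -h.
have m0 : m = 0 by have := mom 1; have := mom (- 1); rewrite !expr2; lra.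
have s2 : s ^+ 2 = v by have := mom 0; rewrite m0 addr0 expr0n /= add0r addr0.
have mcos : measurable_fun setT (fun w => cos (Y w)).
  apply: measurableT_comp => //; apply: continuous_measurable_fun.
  exact: continuous_cos.
have icos : P.-integrable setT (EFin \o (fun w => cos (Y w))).
  apply: le_integrable I1 => //; first exact/measurable_EFinP.
  by move=> w _ /=; rewrite lee_fin normr1 cos_max.
have i1c : P.-integrable setT (EFin \o (fun w => 1 + cos (Y w))).
  exact: intgD.
have E1 : \int[P]_w (1 + cos (Y w)) = 1 + \int[P]_w cos (Y w).
  by rewrite RintegralD// Rint_cst.
have cg : continuous (fun x : R => 1 + cos x).
  by move=> x; apply: cvgD; [exact: cvg_cst|exact: continuous_cos].
have g0 (x : R) : 0 <= 1 + cos x by have := cos_geN1 x; lra.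
have := gaussian_integral mY s0 lawY cg g0.
have fi : (\int[P]_w (1 + cos (Y w))%:E = (1 + \int[P]_w cos (Y w))%:E)%E.
  by rewrite -E1 RintE.
rewrite fi ltry => /(_ isT) h.
have E2 : \int[mu]_z ((1 + cos (m + s * z)) * phi z) = 1 + expR (- (v / 2)).
  transitivity (\int[mu]_z (phi z + cos (s * z) * phi z)).
    by apply: eq_Rintegral => z _; rewrite m0 add0r mulrDl mul1r.
  rewrite RintegralD//; last 2 first.
  - exact: integrable_normal_pdf.
  - exact: integrable_cos_phi.
  by rewrite int_phi int_cos_phi s2.
by move: E2; rewrite /Rintegral -h /= => /addrI.
Qed.

End GaussianLaw.

Section Laplace.
Context {d : measure_display} {T : measurableType d} {R : realType}.
Variable P : probability T R.
Local Notation mu := (@lebesgue_measure R).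
Variables (n : nat) (Z : 'I_n -> T -> R).
Hypothesis mZ : forall i, measurable_fun setT (Z i).

Definition lincomb (u : 'cV[R]_n) (w : T) : R := \sum_i u i 0 * Z i w.

Lemma measurable_lincomb u : measurable_fun setT (lincomb u).
Proof. by apply: measurable_sum => i; exact: measurable_funM. Qed.

Lemma lincombD u v w : lincomb (u + v) w = lincomb u w + lincomb v w.
Proof.
by rewrite /lincomb -big_split; apply: eq_bigr => i _; rewrite mxE mulrDl.
Qed.

Lemma lincombZ a u w : lincomb (a *: u) w = a * lincomb u w.
Proof.
by rewrite /lincomb mulr_sumr; apply: eq_bigr => i _; rewrite mxE mulrA.
Qed.

Lemma lincomb_delta j w : lincomb (delta_mx j 0) w = Z j w.
Proof.
rewrite /lincomb (bigD1 j)//= big1 ?addr0 => [|i ij]; rewrite mxE eqxx ?andbT.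
  by rewrite /= mul1r.
by rewrite (negbTE ij) mul0r.
Qed.

(** The covariance after weighting the law by [exp (- om x_j^2 / 2)]. *)
Definition elim_cov (Q : 'M[R]_n) j om : 'M[R]_n :=
  Q - (om / (1 + om * Q j j)) *:
    (Q *m (delta_mx j 0 : 'cV_n) *m ((delta_mx 0 j : 'rV_n) *m Q)).

Lemma bilin_delta (Q : 'M[R]_n) j : bilin Q (delta_mx j 0) (delta_mx j 0) = Q j j.
Proof. by rewrite /bilin trmx_delta -rowE -colE !mxE. Qed.

Lemma bilin_elim_cov Q j om u : Q^T = Q ->
  bilin (elim_cov Q j om) u u =
  bilin Q u u - om / (1 + om * Q j j) * bilin Q u (delta_mx j 0) ^+ 2.
Proof.
move=> sQ; rewrite /elim_cov bilinDm -scaleNr bilinZm mulNr; congr (_ - _ * _).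
rewrite /bilin !mulmxA -mulmxA -[_ *m delta_mx 0 j *m _]mulmxA [LHS]mxE big_ord1.
rewrite expr2; congr (_ * _).
by rewrite mulmxA -trmx_delta -/(bilin Q (delta_mx j 0) u) bilinC.
Qed.

Lemma psd_diag_ge0 (Q : 'M[R]_n) j : psd Q -> 0 <= Q j j.
Proof. by move=> pQ; have := pQ.2 (delta_mx j 0); rewrite bilin_delta. Qed.

Lemma psd_elim_cov Q j om : psd Q -> 0 <= om -> psd (elim_cov Q j om).
Proof.
move=> pQ om0; have sQ := pQ.1; split => [|u].
  rewrite /elim_cov linearB /= linearZ /= !trmx_mul !trmx_delta sQ.
  by rewrite !mulmxA.
rewrite bilin_elim_cov//; have q0 := psd_diag_ge0 j pQ.
set b := bilin Q u (delta_mx j 0); set q := Q j j in q0 *.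
have oq : 0 < 1 + om * q by rewrite ltr_pwDl// mulr_ge0.
have := pQ.2 (u - (om * b / (1 + om * q)) *: delta_mx j 0).
rewrite -scaleNr !(bilinDr, bilinDl, bilinZl, bilinZr) bilin_delta (bilinC (delta_mx j 0))// -/b -/q.
move=> h; apply: le_trans h _.
rewrite -subr_ge0.
have -> : bilin Q u u - om / (1 + om * q) * b ^+ 2 -
  (bilin Q u u + - (om * b / (1 + om * q)) * b +
   (- (om * b / (1 + om * q)) * b +
    - (om * b / (1 + om * q)) * (- (om * b / (1 + om * q)) * q))) =
  om * b ^+ 2 / (1 + om * q) ^+ 2.
  by field; rewrite gt_eqF.
by rewrite divr_ge0 ?sqr_ge0// mulr_ge0 ?sqr_ge0.
Qed.

(** The weight [exp (- om z^2 / 2)] is itself an average of [cos (r x z)] over a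
    standard normal [x], with [r^2 = om]. By Fubini and the addition formula,
    weighting therefore averages the characteristic function over the shifts
    [u +- r x e_j], and the quadratic exponent integrates explicitly. *)
Lemma laplace_step (D : T -> R) c Q j om : measurable_fun setT D ->
  (forall w, 0 <= D w <= 1) -> psd Q -> 0 <= om ->
  (forall u, \int[P]_w (D w * cos (lincomb u w)) = c * expR (- (bilin Q u u / 2))) ->
  forall u, \int[P]_w (D w * expR (- (om * Z j w ^+ 2 / 2)) * cos (lincomb u w)) =
    c / Num.sqrt (1 + om * Q j j) * expR (- (bilin (elim_cov Q j om) u u / 2)).
Proof.
move=> mD D01 pQ om0 H u; pose r := Num.sqrt om.
have r2 : r ^+ 2 = om by rewrite sqr_sqrtr.
have mcosl v : measurable_fun setT (fun w => cos (lincomb v w)).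
  apply: measurableT_comp; last exact: measurable_lincomb.
  by apply: continuous_measurable_fun; exact: continuous_cos.
have mDcos v : measurable_fun setT (fun w => D w * cos (lincomb v w)).
  exact: measurable_funM.
have I1 : P.-integrable setT (EFin \o (fun=> 1)) by exact: finite_measure_integrable_cst.
have iDcos v : P.-integrable setT (EFin \o (fun w => D w * cos (lincomb v w))).
  apply: le_integrable I1 => //; first exact/measurable_EFinP.
  move=> w _ /=; rewrite lee_fin normr1 normrM; have /andP[D0 D1] := D01 w.
  by rewrite (ger0_norm D0) mulr_ile1// cos_max.
pose TR := measurableTypeR R.
pose f (z : T * TR) : R := D z.1 * cos (lincomb u z.1) * (cos (r * Z j z.1 * z.2) * phi z.2).
have mf : measurable_fun setT f.
  apply: measurable_funM; first exact: (measurableT_comp (mDcos u) measurable_fst).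
  apply: measurable_funM; last first.
    apply: measurableT_comp; last exact: measurable_snd.
    by apply: continuous_measurable_fun; exact: phi_cont.
  apply: (@measurableT_comp _ _ _ _ _ _ cos).
    by apply: continuous_measurable_fun; exact: continuous_cos.
  apply: measurable_funM; last exact: measurable_snd.
  apply: measurable_funM => //.
  exact: (measurableT_comp (mZ j) measurable_fst).
have fle z : `|f z| <= phi z.2.
  rewrite /f !normrM (ger0_norm (phi_ge0 _)) mulrA.
  have /andP[D0 D1] := D01 z.1.
  rewrite ler_piMl ?phi_ge0// mulr_ile1 ?mulr_ge0 ?cos_max//.
  by rewrite mulr_ile1 ?cos_max// ger0_norm.
have if_ : (P \x mu)%E.-integrable setT (EFin \o f).
  apply/integrable12ltyP; first exact/measurable_EFinP.
  apply: (@le_lt_trans _ _ (\int[P]_w 1)%E); last first.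
    by have := expectation_cst P (1 : R); rewrite unlock => ->; rewrite ltry.
  apply: ge0_le_integral => //.
  - by move=> w _; exact: integral_ge0.
  - have mfe : measurable_fun setT (fun z => `|(EFin \o f) z|%E).
      by apply: measurableT_comp => //; exact/measurable_EFinP.
    exact: (@measurable_fun_fubini_tonelli_F _ _ T TR R mu _ mfe (fun=> abse_ge0 _)).
  - move=> w _; rewrite -(@integral_normal_pdf R 0 1); apply: ge0_le_integral => //.
    + by apply: measurableT_comp => //; apply: measurableT_comp => //; exact/measurable_EFinP.
    + by apply/measurable_EFinP; exact: measurable_normal_pdf.
    + by move=> x _; rewrite lee_fin (fle (w, x)).
have EL : \int[P]_w (D w * expR (- (om * Z j w ^+ 2 / 2)) * cos (lincomb u w)) =
    fine (\int[P]_w \int[mu]_x (f (w, x))%:E)%E.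
  rewrite /Rintegral; congr fine; apply: eq_integral => w _.
  have -> : (\int[mu]_x (f (w, x))%:E = (\int[mu]_x (D w * cos (lincomb u w) *
      (cos (r * Z j w * x) * phi x)))%:E)%E.
    by rewrite -RintE//; apply: intgZ; exact: integrable_cos_phi.
  congr EFin; rewrite RintegralZl//; last exact: integrable_cos_phi.
  by rewrite int_cos_phi exprMn r2 mulrAC.
have -> : \int[P]_w (D w * expR (- (om * Z j w ^+ 2 / 2)) * cos (lincomb u w)) =
    fine (\int[mu]_x \int[P]_w (f (w, x))%:E)%E by rewrite EL (Fubini if_).
pose b := bilin Q u (delta_mx j 0); pose q := Q j j.
pose g (e : R) x := expR (- ((2 * (e * r * b) * x + om * q * x ^+ 2) / 2)) * phi x.
pose k := c * expR (- (bilin Q u u / 2)) / 2.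
have q0 : 0 <= q := psd_diag_ge0 j pQ.
have oq0 : 0 <= om * q by rewrite mulr_ge0.
have inner x : (\int[P]_w (f (w, x))%:E = (k * g 1 x + k * g (- 1) x)%:E)%E.
  pose v e := u + (e * r * x) *: delta_mx j 0.
  have Ev e : e ^+ 2 = 1 ->
      c * expR (- (bilin Q (v e) (v e) / 2)) * phi x = 2 * k * g e x.
    move=> e1; rewrite /k /g [2 * _]mulrC divfK// -!mulrA; congr (_ * _).
    rewrite [RHS]mulrA -expRD; congr (expR _ * _).
    rewrite /v !(bilinDr, bilinDl, bilinZl, bilinZr) bilin_delta (bilinC (delta_mx j 0)) ?pQ.1// -/b -/q.
    have -> : e * r * x * (e * r * x * q) = om * q * x ^+ 2.
      have -> : e * r * x * (e * r * x * q) = e ^+ 2 * r ^+ 2 * q * x ^+ 2 by ring.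
      by rewrite e1 r2 mul1r.
    by field.
  have -> : (\int[P]_w (f (w, x))%:E = (\int[P]_w (phi x / 2 * (D w * cos (lincomb (v 1) w))
       + phi x / 2 * (D w * cos (lincomb (v (-1)) w))))%:E)%E.
    rewrite -RintE.
      apply: eq_integral => w _; congr EFin.
      rewrite /f /v !lincombD !lincombZ !lincomb_delta /= !cosD.
      have -> : -1 * r * x * Z j w = - (1 * r * x * Z j w) by ring.
      rewrite cosN sinN; have -> : 1 * r * x * Z j w = r * Z j w * x by ring.
      by field.
    by apply: intgD; apply: intgZ; exact: iDcos.
  congr EFin; rewrite RintegralD//; last 2 first.
  - by apply: intgZ; exact: iDcos.
  - by apply: intgZ; exact: iDcos.
  rewrite !RintegralZl//.
  rewrite !H; have h1 : k * g 1 x = c * expR (- (bilin Q (v 1) (v 1) / 2)) * phi x / 2.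
    by rewrite (Ev 1 (expr1n _ _)); field.
  have h2 : k * g (-1) x = c * expR (- (bilin Q (v (-1)) (v (-1)) / 2)) * phi x / 2.
    by rewrite (Ev (-1)) ?sqrrN ?expr1n//; field.
  by rewrite h1 h2; field.
under eq_integral => x _ do rewrite inner.
have ig e : mu.-integrable setT (EFin \o (fun x => k * g e x)).
  by apply: intgZ; exact: integrable_expquad_phi.
rewrite -[fine _]/(\int[mu]_x (k * g 1 x + k * g (-1) x)) RintegralD//.
rewrite !RintegralZl//; [|exact: integrable_expquad_phi|exact: integrable_expquad_phi].
rewrite !int_expquad_phi// bilin_elim_cov ?pQ.1// -/b -/q.
have e1 : (1 * r * b) ^+ 2 = om * b ^+ 2 by rewrite -r2; ring.
have e2 : (-1 * r * b) ^+ 2 = om * b ^+ 2 by rewrite -r2; ring.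
rewrite e1 e2 /k.
have -> : - ((bilin Q u u - om / (1 + om * q) * b ^+ 2) / 2) =
  - (bilin Q u u / 2) + om * b ^+ 2 / (2 * (1 + om * q)).
  by field; rewrite gt_eqF// ltr_pwDl.
by rewrite expRD; field; rewrite gt_eqF// sqrtr_gt0 ltr_pwDl.
Qed.

(** The determinant follows the same elimination as the covariance. *)
Lemma wdet_elim (Q : 'M[R]_n) j om (w : 'rV[R]_n) : 1 + om * Q j j != 0 ->
  wdet (om *: delta_mx 0 j + w) Q = (1 + om * Q j j) * wdet w (elim_cov Q j om).
Proof.
move=> nz; set e := (delta_mx j 0 : 'cV[R]_n); set f := (delta_mx 0 j : 'rV[R]_n).
have eD : diag_mx (om *: f) = om *: (e *m f).
  rewrite linearZ /= /e /f mul_delta_mx; congr (_ *: _).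
  apply/matrixP => a b; rewrite !mxE eqxx /= -mulrnA mulnb; congr (_%:R).
  by case: (a =P j) => //= ->; rewrite eq_sym.
have fQe : f *m Q *m e = (Q j j)%:M.
  by rewrite [LHS]mx11_scalar /e /f -colE mxE -rowE mxE.
have eq1 : 1 + om * Q j j = \det (1%:M + om *: (Q *m e *m f)).
  rewrite [om *: _]scalemxAl.
  rewrite det1_mulmxC det_mx11 -scalemxAr mulmxA fQe.
  by rewrite !mxE eqxx mulr1n.
have k : Q *m e *m f *m elim_cov Q j om =
    (1 - om / (1 + om * Q j j) * Q j j) *: (Q *m e *m (f *m Q)).
  rewrite /elim_cov mulmxBr -scalemxAr scalerBl scale1r; congr (_ - _).
    by rewrite mulmxA.
  rewrite -/e -/f -!mulmxA [f *m (Q *m (e *m _))]mulmxA [f *m Q *m (e *m _)]mulmxA fQe.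
  by rewrite mul_scalar_mx -!scalemxAr scalerA.
have key : elim_cov Q j om + om *: (Q *m e *m f) *m elim_cov Q j om = Q.
  rewrite -scalemxAl k scalerA {1}/elim_cov -/e -/f -addrA -scaleNr -scalerDl.
  have -> : - (om / (1 + om * Q j j)) + om * (1 - om / (1 + om * Q j j) * Q j j) = 0.
    by field.
  by rewrite scale0r addr0.
rewrite /wdet linearD /= eD det1_mulmxC (det1_mulmxC (diag_mx w)) eq1 -det_mulmx.
congr (\det _).
have k2 : (1%:M + om *: (Q *m e *m f)) *m elim_cov Q j om = Q.
  by rewrite mulmxDl mul1mx key.
rewrite [RHS]mulmxDr mulmx1 [X in _ = _ + X]mulmxA k2 mulmxDr addrA.
by congr (_ + _ + _); rewrite -scalemxAr mulmxA.
Qed.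

(** The coordinates are weighted one at a time. Only characteristic functions
    enter, so that degenerate covariances, which have no density, are covered. *)
Theorem laplace_gaussian (Q : 'M[R]_n) (w : 'rV[R]_n) : psd Q -> nneg w ->
  (forall u, \int[P]_x cos (lincomb u x) = expR (- (bilin Q u u / 2))) ->
  \int[P]_x expR (- ((\sum_i w 0 i * Z i x ^+ 2) / 2)) = (Num.sqrt (wdet w Q))^-1.
Proof.
move=> pQ w0 H.
pose ws s := \sum_(j <- s) w 0 j *: (delta_mx 0 j : 'rV[R]_n).
have main s (D : T -> R) c Q' : psd Q' -> measurable_fun setT D ->
    (forall x, 0 <= D x <= 1) ->
    (forall u, \int[P]_x (D x * cos (lincomb u x)) = c * expR (- (bilin Q' u u / 2))) ->
    \int[P]_x (D x * \prod_(j <- s) expR (- (w 0 j * Z j x ^+ 2 / 2))) =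
    c / Num.sqrt (wdet (ws s) Q').
  elim: s D c Q' => [|j s IH] D c Q' pQ' mD D01 HD.
    rewrite /ws big_nil wdetw0 sqrtr1 divr1 -[RHS]mulr1 -expR0.
    have := HD 0; rewrite /bilin mulmx0 mxE mul0r oppr0 => <-.
    apply: eq_Rintegral => x _; rewrite big_nil; congr (_ * _).
    by rewrite /lincomb big1 ?cos0 ?expR0// => i _; rewrite mxE mul0r.
  have q0 := psd_diag_ge0 j pQ'.
  have oq : 0 < 1 + w 0 j * Q' j j by rewrite ltr_pwDl// mulr_ge0.
  transitivity (\int[P]_x ((D x * expR (- (w 0 j * Z j x ^+ 2 / 2))) *
      \prod_(j <- s) expR (- (w 0 j * Z j x ^+ 2 / 2)))).
    by apply: eq_Rintegral => x _; rewrite big_cons mulrA.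
  rewrite (IH _ (c / Num.sqrt (1 + w 0 j * Q' j j)) (elim_cov Q' j (w 0 j))).
  - rewrite /ws big_cons wdet_elim ?gt_eqF// sqrtrM ?(ltW oq)//.
    by rewrite invfM mulrA.
  - exact: psd_elim_cov.
  - apply: measurable_funM => //; apply: measurableT_comp => //.
    apply: measurable_funN; apply: measurable_funM => //.
    by apply: measurable_funM => //; exact: measurable_funX.
  - move=> x; have /andP[D0 D1] := D01 x.
    rewrite mulr_ge0 ?expR_ge0//= mulr_ile1 ?expR_ge0//.
    by rewrite expR_le1 oppr_le0 divr_ge0// mulr_ge0 ?sqr_ge0.
  - exact: laplace_step.
have ew : ws (enum 'I_n) = w.
  by rewrite /ws big_enum /= -row_sum_delta.
have := main (enum 'I_n) (fun=> 1) 1 Q pQ.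
rewrite ew div1r => <- //.
- apply: eq_Rintegral => x _; rewrite mul1r big_enum /= -expR_sum.
  by rewrite mulr_suml -sumrN.
- by move=> x; rewrite ler01 lexx.
- by move=> u; rewrite mul1r -H; apply: eq_Rintegral => x _; rewrite mul1r.
Qed.

End Laplace.

(** * Symmetric summation over the integers *)

Section SymSum.
Context {R : realType}.
Implicit Types f g : int -> R.

Definition symsum f n : R := \sum_(j < n.*2.+1) f (j%:Z - n%:Z).

(** An inductive wrapper rather than the bare convergence, so that the summand can
    be recovered by unification. *)
Variant zlim f (l : R) : Prop := Zlim of symsum f n @[n --> \oo] --> l.

Lemma symsum0 f : symsum f 0 = f 0.
Proof. by rewrite /symsum big_ord1 subrr. Qed.

Lemma symsumS f n : symsum f n.+1 = symsum f n + (f n.+1%:Z + f (- n.+1%:Z)).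
Proof.
rewrite /symsum doubleS big_ord_recl big_ord_recr /= [LHS]addrC -[LHS]addrA.
congr (_ + (f _ + f _)); [|by rewrite /bump /=; lia|by lia].
by apply: eq_bigr => i _; congr f; rewrite /bump /=; lia.
Qed.

Lemma symsumE f n : symsum f n = f 0 + \sum_(k < n) (f k.+1%:Z + f (- k.+1%:Z)).
Proof.
elim: n => [|n IH]; first by rewrite symsum0 big_ord0 addr0.
by rewrite big_ord_recr /= addrA -IH symsumS.
Qed.

Lemma symsumD f g n : symsum (fun k => f k + g k) n = symsum f n + symsum g n.
Proof. by rewrite /symsum big_split. Qed.

Lemma symsumZ c f n : symsum (fun k => c * f k) n = c * symsum f n.
Proof. by rewrite /symsum mulr_sumr. Qed.

Lemma symsum_sum (I : Type) (s : seq I) (f : I -> int -> R) n :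
  symsum (fun k => \sum_(i <- s) f i k) n = \sum_(i <- s) symsum (f i) n.
Proof. by rewrite /symsum exchange_big. Qed.

Lemma ler_symsum f g n : (forall k, f k <= g k) -> symsum f n <= symsum g n.
Proof. by move=> fg; apply: ler_sum. Qed.

Lemma symsum_ge0 f n : (forall k, 0 <= f k) -> 0 <= symsum f n.
Proof. by move=> fg; apply: sumr_ge0. Qed.

Lemma symsum_nd f : (forall k, 0 <= f k) -> nondecreasing_seq (symsum f).
Proof.
by move=> f0; apply/nondecreasing_seqP => n; rewrite symsumS lerDl addr_ge0.
Qed.

Lemma zlim_uniq f l l' : zlim f l -> zlim f l' -> l = l'.
Proof. by case=> h [h']; exact: cvg_unique h h'. Qed.

Lemma zlim_ext f g l : (forall k, f k = g k) -> zlim f l -> zlim g l.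
Proof. by move=> fg; have -> : f = g by apply/funext. Qed.

Lemma zlimD f g l l' : zlim f l -> zlim g l' -> zlim (fun k => f k + g k) (l + l').
Proof.
case=> fl [gl]; split.
have -> : symsum (fun k => f k + g k) = (fun n => symsum f n + symsum g n).
  by apply/funext => n; rewrite symsumD.
exact: cvgD.
Qed.

Lemma zlimZ c f l : zlim f l -> zlim (fun k => c * f k) (c * l).
Proof.
case=> fl; split.
have -> : symsum (fun k => c * f k) = (fun n => c * symsum f n).
  by apply/funext => n; rewrite symsumZ.
exact: cvgMl_tmp.
Qed.

Lemma zlim0 : zlim (fun=> 0) 0.
Proof.
split; have -> : symsum (fun=> 0) = (fun=> 0).
  by apply/funext => n; rewrite /symsum big1.
exact: cvg_cst.
Qed.

Lemma zlim_sum (I : Type) (s : seq I) (f : I -> int -> R) l :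
  (forall i, zlim (f i) (l i)) ->
  zlim (fun k => \sum_(i <- s) f i k) (\sum_(i <- s) l i).
Proof.
move=> h; elim: s => [|i s IH].
  rewrite big_nil; apply: zlim_ext zlim0 => k; by rewrite big_nil.
rewrite big_cons; apply: zlim_ext (zlimD (h i) IH) => k; by rewrite big_cons.
Qed.

Lemma zlim_ge0 f l : (forall k, 0 <= f k) -> zlim f l -> 0 <= l.
Proof.
move=> f0 [fl]; rewrite -(cvg_lim _ fl)//; apply: limr_ge.
  by apply/cvg_ex; exists l.
by apply: nearW => n; exact: symsum_ge0.
Qed.

Lemma symsum_le_zlim f l n : (forall k, 0 <= f k) -> zlim f l -> symsum f n <= l.
Proof.
move=> f0 [fl]; rewrite -(cvg_lim _ fl)//; apply: nondecreasing_cvgn_le.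
  exact: symsum_nd.
by apply/cvg_ex; exists l.
Qed.

Lemma zlim_le f g l l' : (forall k, f k <= g k) -> zlim f l -> zlim g l' -> l <= l'.
Proof.
move=> fg [fl] [gl]; rewrite -(cvg_lim _ fl)// -(cvg_lim _ gl)//; apply: ler_lim.
- by apply/cvg_ex; exists l.
- by apply/cvg_ex; exists l'.
- by apply: nearW => n; exact: ler_symsum.
Qed.

Lemma zlim_dominated f g l : (forall k, 0 <= f k <= g k) -> zlim g l ->
  exists l', zlim f l'.
Proof.
move=> fg gl; exists (lim (symsum f @ \oo)); split.
have f0 k : 0 <= f k by case/andP: (fg k).
have g0 k : 0 <= g k by case/andP: (fg k) => /le_trans h /h.
apply: nondecreasing_is_cvgn; first exact: symsum_nd.
exists l => _ [n _ <-]; apply: le_trans (symsum_le_zlim n g0 gl).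
by apply: ler_symsum => k; case/andP: (fg k).
Qed.

(** Summing over the integers is invariant under translation; the two boundary
    terms vanish because the terms of a convergent nonnegative sum do. *)
Lemma zlim_shift1 f l : (forall k, 0 <= f k) -> zlim f l ->
  zlim (fun k => f (k + 1)) l /\ zlim (fun k => f (k - 1)) l.
Proof.
move=> f0 [fl].
have fS : symsum f n.+1 @[n --> \oo] --> l by rewrite (cvg_shiftS (symsum f)).
have d0 : (fun n => f n.+1%:Z + f (- n.+1%:Z)) @ \oo --> 0.
  have -> : (fun n => f n.+1%:Z + f (- n.+1%:Z)) = (fun n => symsum f n.+1 - symsum f n).
    by apply/funext => n; rewrite symsumS [symsum f n + _]addrC addrK.
  by rewrite -(subrr l); apply: cvgB.
have dp : (fun n => f n.+1%:Z) @ \oo --> 0.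
  apply: (@squeeze_cvgr _ _ _ _ (fun=> 0) (fun n => f n.+1%:Z + f (- n.+1%:Z))) => //.
    by apply: nearW => n; rewrite f0 lerDl f0.
  exact: cvg_cst.
have dn : (fun n => f (- n.+1%:Z)) @ \oo --> 0.
  apply: (@squeeze_cvgr _ _ _ _ (fun=> 0) (fun n => f n.+1%:Z + f (- n.+1%:Z))) => //.
    by apply: nearW => n; rewrite f0 lerDr f0.
  exact: cvg_cst.
have dn' : (fun n : nat => f (- n%:Z)) @ \oo --> 0 by rewrite -cvg_shiftS.
have dp' : (fun n : nat => f n%:Z) @ \oo --> 0 by rewrite -cvg_shiftS.
split; split.
- have -> : symsum (fun k => f (k + 1)) = (fun n => symsum f n + f n.+1%:Z - f (- n%:Z)).
    apply/funext; elim => [|n IH].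
      by rewrite !symsum0 add0r oppr0; ring.
    rewrite !symsumS IH.
    have -> : - n.+1%:Z + 1 = - n%:Z :> int by lia.
    have -> : n.+1%:Z + 1 = n.+2%:Z :> int by lia.
    by ring.
  by rewrite -[l]addr0 -[l + 0]subr0; apply: cvgB => //; apply: cvgD.
- have -> : symsum (fun k => f (k - 1)) = (fun n => symsum f n + f (- n.+1%:Z) - f n%:Z).
    apply/funext; elim => [|n IH].
      by rewrite !symsum0 add0r; ring.
    rewrite !symsumS IH.
    have -> : - n.+1%:Z - 1 = - n.+2%:Z :> int by lia.
    have -> : n.+1%:Z - 1 = n%:Z :> int by lia.
    by ring.
  by rewrite -[l]addr0 -[l + 0]subr0; apply: cvgB => //; apply: cvgD.
Qed.

Lemma zlim_shift f l (a : int) : (forall k, 0 <= f k) -> zlim f l ->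
  zlim (fun k => f (k + a)) l.
Proof.
move=> f0 fl; have main (n : nat) : zlim (fun k => f (k + n%:Z)) l /\
    zlim (fun k => f (k - n%:Z)) l.
  elim: n => [|n [IH1 IH2]].
    by split; apply: zlim_ext fl => k; rewrite ?addr0 ?subr0.
  split.
    have [h _] := zlim_shift1 (fun k => f0 (k + n%:Z)) IH1.
    by apply: zlim_ext h => k; congr f; lia.
  have [_ h] := zlim_shift1 (fun k => f0 (k - n%:Z)) IH2.
  by apply: zlim_ext h => k; congr f; lia.
case: a => n; first exact: (main n).1.
by rewrite NegzE; exact: (main n.+1).2.
Qed.

(** Finitely many terms do not affect convergence. *)
Lemma zlim_finite f N : (forall k : int, (N < `|k|)%N -> f k = 0) -> zlim f (symsum f N).
Proof.
move=> h; split; apply: cvg_near_cst; exists N => // n /= Nn.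
rewrite -(subnKC Nn); elim: (n - N)%N => [|k IH]; first by rewrite addn0.
by rewrite addnS symsumS IH !h ?addr0//; lia.
Qed.

End SymSum.

(** * Covariance matrices on uniform grids *)

Section Trig.
Context {R : realType}.

Lemma sum_cos_telescope (h : R) m : 2 * sin (h / 2) * \sum_(i < m) cos (i%:R * h) =
  sin (m%:R * h - h / 2) + sin (h / 2).
Proof.
elim: m => [|m IH]; first by rewrite big_ord0 mulr0 mul0r add0r sinN addNr.
rewrite big_ord_recr /= mulrDr IH -[m.+1%:R]natr1.
have -> : (m%:R + 1) * h - h / 2 = m%:R * h + h / 2 by field.
by rewrite sinB sinD; ring.
Qed.

Lemma sum_sin_telescope (h : R) m : 2 * sin (h / 2) * \sum_(i < m) sin (i%:R * h) =
  cos (h / 2) - cos (m%:R * h - h / 2).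
Proof.
elim: m => [|m IH]; first by rewrite big_ord0 mulr0 mul0r add0r cosN subrr.
rewrite big_ord_recr /= mulrDr IH -[m.+1%:R]natr1.
have -> : (m%:R + 1) * h - h / 2 = m%:R * h + h / 2 by field.
by rewrite cosB cosD; ring.
Qed.

Lemma cosD2pin (x : R) (k : int) : cos (x + 2 * pi * k%:~R) = cos x.
Proof.
have h (n : nat) (y : R) : cos (y + 2 * pi * n%:R) = cos y.
  have -> : y + 2 * pi * n%:R = y + (pi *+ 2) *+ n.
    by rewrite mulr_natr mulr_natl.
  by rewrite (periodicn (@cosD2pi R)).
case: k => n; first exact: h.
by rewrite NegzE mulrNz mulrN -[LHS](h n.+1) subrK.
Qed.

Lemma sinD2pin (x : R) (k : int) : sin (x + 2 * pi * k%:~R) = sin x.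
Proof. by rewrite -!cosBpihalf addrAC cosD2pin. Qed.

Lemma sin_grid_gt0 (m k : nat) : (0 < k < m)%N -> 0 < sin (2 * pi * k%:R / m%:R / 2) :> R.
Proof.
move=> /andP[k0 km].
have m0 : 0 < m%:R :> R by rewrite ltr0n (leq_trans _ km).
apply: sin_gt0_pi; have -> : 2 * pi * k%:R / m%:R / 2 = pi * (k%:R / m%:R) :> R.
  by field; rewrite gt_eqF.
have k0' : 0 < k%:R / m%:R :> R by apply: divr_gt0 => //; rewrite ltr0n.
rewrite mulr_gt0 ?pi_gt0//= -[ltRHS]mulr1 ltr_pM2l ?pi_gt0//.
by rewrite ltr_pdivrMr// mul1r ltr_nat.
Qed.

(** Multiplying by [2 sin (h / 2)] makes the sum telescope over a full period. *)
Lemma sum_cos_grid (m k : nat) : (0 < k < m)%N ->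
  \sum_(i < m) cos (i%:R * (2 * pi * k%:R / m%:R)) = 0 :> R.
Proof.
move=> /andP[k0 km]; set h : R := 2 * pi * k%:R / m%:R.
have m0 : 0 < m%:R :> R by rewrite ltr0n (leq_trans _ km).
have sp : 0 < sin (h / 2) by apply: sin_grid_gt0; rewrite k0.
have /eqP := sum_cos_telescope h m.
have -> : m%:R * h - h / 2 = - (h / 2) + 2 * pi * k%:Z%:~R.
  by rewrite /h; field; rewrite gt_eqF.
rewrite sinD2pin sinN addNr mulf_eq0 mulf_eq0 pnatr_eq0 /= gt_eqF//=.
by move/eqP.
Qed.

Lemma sum_sin_grid (m k : nat) : (0 < k < m)%N ->
  \sum_(i < m) sin (i%:R * (2 * pi * k%:R / m%:R)) = 0 :> R.
Proof.
move=> /andP[k0 km]; set h : R := 2 * pi * k%:R / m%:R.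
have m0 : 0 < m%:R :> R by rewrite ltr0n (leq_trans _ km).
have sp : 0 < sin (h / 2) by apply: sin_grid_gt0; rewrite k0.
have /eqP := sum_sin_telescope h m.
have -> : m%:R * h - h / 2 = - (h / 2) + 2 * pi * k%:Z%:~R.
  by rewrite /h; field; rewrite gt_eqF.
rewrite cosD2pin cosN subrr mulf_eq0 mulf_eq0 pnatr_eq0 /= gt_eqF//=.
by move/eqP.
Qed.

End Trig.

Section Cov.
Context {R : realType}.

Definition gridpt (m i : nat) : R := 2 * pi * i%:R / m%:R.

(** The covariance matrix, on the uniform grid with [m] points, of a stationary
    process with covariance function [c]. *)
Definition covmx (c : R -> R) m : 'M[R]_m :=
  \matrix_(i, j) c (gridpt m i - gridpt m j).

Definition cosv m (k : R) : 'cV[R]_m := \col_i cos (k * gridpt m i).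
Definition sinv m (k : R) : 'cV[R]_m := \col_i sin (k * gridpt m i).
Definition freqmx m (k : R) : 'M[R]_m := cosv m k *m (cosv m k)^T + sinv m k *m (sinv m k)^T.

Definition mass m (w : 'rV[R]_m) : R := \sum_i w 0 i.

Lemma freqmxE m k : freqmx m k = covmx (fun h => cos (k * h)) m.
Proof.
apply/matrixP => i j; rewrite !mxE !big_ord1 !mxE mulrBr cosB.
by [].
Qed.

Lemma psd_freqmx m k : psd (freqmx m k).
Proof. by apply: psdD; exact: psd_gram. Qed.

Lemma covmxD c c' m : covmx (fun h => c h + c' h) m = covmx c m + covmx c' m.
Proof. by apply/matrixP => i j; rewrite !mxE. Qed.

Lemma covmxZ a c m : covmx (fun h => a * c h) m = a *: covmx c m.
Proof. by apply/matrixP => i j; rewrite !mxE. Qed.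

Lemma covmx_sum (I : Type) (s : seq I) (c : I -> R -> R) m :
  covmx (fun h => \sum_(i <- s) c i h) m = \sum_(i <- s) covmx (c i) m.
Proof. by apply/matrixP => i j; rewrite !mxE summxE; apply: eq_bigr => k _; rewrite mxE. Qed.

Lemma mass_ge0 m (w : 'rV[R]_m) : nneg w -> 0 <= mass w.
Proof. by move=> h; apply: sumr_ge0 => i _; exact: h. Qed.

Lemma massD m (w w' : 'rV[R]_m) : mass (w + w') = mass w + mass w'.
Proof. by rewrite /mass -big_split; apply: eq_bigr => i _; rewrite mxE. Qed.

Lemma massZ m a (w : 'rV[R]_m) : mass (a *: w) = a * mass w.
Proof. by rewrite /mass mulr_sumr; apply: eq_bigr => i _; rewrite mxE. Qed.

Lemma mass_sum (I : Type) (s : seq I) m (w : I -> 'rV[R]_m) :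
  mass (\sum_(i <- s) w i) = \sum_(i <- s) mass (w i).
Proof.
elim: s => [|i s IH]; last by rewrite !big_cons massD IH.
by rewrite !big_nil /mass big1// => i _; rewrite mxE.
Qed.

(** A frequency contributes the rank-one matrices of its cosine and its sine, with
    factors [1 + 2 a C] and [1 + 2 a D] where [C + D] is the mass; their product is
    largest when [C = D]. *)
Lemma wdet_freqmx_le m (w : 'rV[R]_m) a k : nneg w -> 0 <= a ->
  wdet w ((2 * a) *: freqmx m k) <= (1 + a * mass w) ^+ 2.
Proof.
move=> w0 a0; have a20 : 0 <= 2 * a by rewrite mulr_ge0.
rewrite -wdetZ; have aw : nneg ((2 * a) *: w) by exact: nnegZ.
have /andP[_ h] := wdetDS_bounds aw (psd_gram (cosv m k)) (psd_gram (sinv m k)).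
apply: (le_trans h); rewrite !wdet_rank1.
set A := \sum_i _; set B := \sum_i _.
have e : A + B = 2 * (a * mass w).
  rewrite /A /B /mass -big_split !mulr_sumr; apply: eq_bigr => i _ /=.
  by rewrite !mxE -mulrDr cos2Dsin2 mulr1 mulrA.
have -> : a * mass w = (A + B) / 2 by rewrite e; field.
rewrite -subr_ge0.
have -> : (1 + (A + B) / 2) ^+ 2 - (1 + A) * (1 + B) = ((A - B) / 2) ^+ 2 by field.
exact: sqr_ge0.
Qed.

Lemma wdet_freqmx_prod_le (m : nat) (w : 'rV[R]_m) (I : eqType) (s : seq I) (b k : I -> R) :
  nneg w -> (forall i, 0 <= b i) ->
  wdet (2 *: w) (\sum_(i <- s) b i *: freqmx m (k i)) <=
  \prod_(i <- s) (1 + b i * mass w) ^+ 2.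
Proof.
move=> w0 b0; have w20 : nneg (2 *: w) by exact: nnegZ.
apply: le_trans (wdet_sumS_le w20 _) _ => [i _|].
  by apply: psdZ => //; exact: psd_freqmx.
apply: ler_prod => i _; rewrite wdetZ scalerA wdet_freqmx_le// andbT -wdetZ.
rewrite (le_trans ler01)// wdet_ge1//; last exact: psd_freqmx.
by apply: nnegZ => //; rewrite mulr_ge0.
Qed.

Lemma wdet_cvg m (w : 'rV[R]_m) (S : nat -> 'M[R]_m) (S0 : 'M[R]_m) :
  (forall i j, S n i j @[n --> \oo] --> S0 i j) ->
  wdet w (S n) @[n --> \oo] --> wdet w S0.
Proof.
move=> h; rewrite /wdet.
have hM i j : (1%:M + diag_mx w *m S n) i j @[n --> \oo] --> (1%:M + diag_mx w *m S0) i j.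
  have -> : (fun n => (1%:M + diag_mx w *m S n) i j) =
     (fun n => (1%:M : 'M[R]_m) i j + w 0 i * S n i j).
    by apply/funext => n; rewrite [LHS]mxE mul_diag_mx [X in _ + X]mxE.
  rewrite [X in _ --> X]mxE mul_diag_mx [X in _ --> _ + X]mxE; apply: cvgD; first exact: cvg_cst.
  exact: cvgMl_tmp.
rewrite /determinant; apply: cvg_big => [|s _]; first exact: add_continuous.
apply: cvgMl_tmp; apply: cvg_big => [|i _]; last exact: hM.
exact: mul_continuous.
Qed.

Variables (mu : int -> R) (c : R -> R).
Hypothesis mu0 : forall k, 0 <= mu k.
Hypothesis muc : forall h, zlim (fun k => mu k * cos (k%:~R * h)) (c h).

Definition covK K (h : R) : R := symsum (fun k => mu k * cos (k%:~R * h)) K.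

(** [|sum_j x_j e^(i k t_j)|^2], with [t_j] the points of the grid. *)
Definition energy m (x : 'cV[R]_m) (k : int) : R := bilin (freqmx m k%:~R) x x.

Lemma energy_ge0 m (x : 'cV[R]_m) k : 0 <= energy x k.
Proof. exact: (psd_freqmx m _).2. Qed.

Lemma bilin_covmx c' m (x : 'cV[R]_m) : bilin (covmx c' m) x x =
  \sum_i \sum_j x i 0 * x j 0 * c' (gridpt m i - gridpt m j).
Proof. by rewrite bilinE; apply: eq_bigr => i _; apply: eq_bigr => j _; rewrite mxE mulrAC. Qed.

(** The quadratic form of the covariance multiplied pointwise by a function [f]. *)
Lemma zlim_bilin_covmx m (f : R -> R) (x : 'cV[R]_m) :
  zlim (fun k => mu k * bilin (covmx (fun h => f h * cos (k%:~R * h)) m) x x)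
       (bilin (covmx (fun h => f h * c h) m) x x).
Proof.
rewrite bilin_covmx.
have h : zlim (fun k => \sum_i \sum_j x i 0 * x j 0 * f (gridpt m i - gridpt m j) *
    (mu k * cos (k%:~R * (gridpt m i - gridpt m j))))
    (\sum_i \sum_j x i 0 * x j 0 * f (gridpt m i - gridpt m j) * c (gridpt m i - gridpt m j)).
  by apply: zlim_sum => i; apply: zlim_sum => j; apply: zlimZ; exact: muc.
have -> : \sum_i \sum_j x i 0 * x j 0 * (f (gridpt m i - gridpt m j) * c (gridpt m i - gridpt m j)) =
  \sum_i \sum_j x i 0 * x j 0 * f (gridpt m i - gridpt m j) * c (gridpt m i - gridpt m j).
  by apply: eq_bigr => i _; apply: eq_bigr => j _; rewrite mulrA.
apply: zlim_ext h => k; rewrite bilin_covmx mulr_sumr; apply: eq_bigr => i _.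
rewrite mulr_sumr; apply: eq_bigr => j _; ring.
Qed.

Lemma zlim_energy m (x : 'cV[R]_m) :
  zlim (fun k => mu k * energy x k) (bilin (covmx c m) x x).
Proof.
have := zlim_bilin_covmx (fun=> 1) x.
have -> : (fun h : R => 1 * c h) = c by apply/funext => h; rewrite mul1r.
apply: zlim_ext => k; rewrite /energy freqmxE; congr (_ * bilin (covmx _ _) _ _).
by apply/funext => h; rewrite mul1r.
Qed.

Lemma cov_even h : c (- h) = c h.
Proof.
apply: zlim_uniq (muc (- h)) _; apply: zlim_ext (muc h) => k.
by rewrite mulrN cosN.
Qed.

Lemma covmx_tr (f : R -> R) m : (forall h, f (- h) = f h) -> (covmx f m)^T = covmx f m.
Proof. by move=> ef; apply/matrixP => i j; rewrite !mxE -ef opprB. Qed.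

Lemma psd_covmx m : psd (covmx c m).
Proof.
split; first by apply: covmx_tr; exact: cov_even.
move=> x; apply: zlim_ge0 (zlim_energy x) => k.
by rewrite mulr_ge0// energy_ge0.
Qed.

Lemma covmx_covK K m : covmx (covK K) m = mu 0 *: freqmx m 0 +
  \sum_(k < K) (mu k.+1%:Z + mu (- k.+1%:Z)) *: freqmx m k.+1%:R.
Proof.
apply/matrixP => i j; rewrite mxE [RHS]mxE summxE /covK symsumE mul0r cos0 mulr1.
congr (_ + _); first by rewrite freqmxE !mxE mul0r cos0 mulr1.
apply: eq_bigr => k _; rewrite mxE freqmxE mxE mulrDl mulrNz mulNr cosN.
by [].
Qed.

Lemma psd_covmx_covK K m : psd (covmx (covK K) m).
Proof.
rewrite covmx_covK; apply: psdD; first by apply: psdZ => //; exact: psd_freqmx.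
by apply: psd_sum => k _; apply: psdZ; [rewrite addr_ge0|exact: psd_freqmx].
Qed.

Lemma psd_covmxB K m : psd (covmx c m - covmx (covK K) m).
Proof.
have [s1 _] := psd_covmx m; have [s2 _] := psd_covmx_covK K m.
split; first by rewrite linearB /= s1 s2.
move=> x; rewrite bilinDm -scaleN1r bilinZm mulN1r subr_ge0.
have := @symsum_le_zlim R _ _ K _ (zlim_energy x).
have -> : symsum (fun k => mu k * energy x k) K = bilin (covmx (covK K) m) x x.
  rewrite bilin_covmx /covK /symsum; under eq_bigr => k _ do
    rewrite /energy freqmxE bilin_covmx mulr_sumr.
  rewrite exchange_big; apply: eq_bigr => i _ /=.
  under eq_bigr => k _ do rewrite mulr_sumr.
  rewrite exchange_big; apply: eq_bigr => j _ /=.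
  by rewrite mulr_sumr; apply: eq_bigr => k _; ring.
by apply => k; rewrite mulr_ge0// energy_ge0.
Qed.

(** Half of the logarithm of the determinant whose inverse square root is the
    Laplace transform at [s] of the quadratic functional with weights [w]. *)
Definition logdet m (w : 'rV[R]_m) (s : R) : R := ln (wdet (2 *: (s *: w)) (covmx c m)) / 2.

Definition pairmass k : R := mu k.+1%:Z + mu (- k.+1%:Z).

Lemma pairmass_ge0 k : 0 <= pairmass k.
Proof. by rewrite addr_ge0. Qed.

Lemma ln_le_expR (x y : R) : 0 < x -> (ln x <= y) = (x <= expR y).
Proof. by move=> x0; rewrite -[LHS]ler_expR lnK. Qed.

(** The spectrum is truncated; each pair of opposite frequencies is then estimated
    separately, and the resulting bound depends on neither the grid nor the weights
    beyond their mass. *)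
Lemma logdet_le m (w : 'rV[R]_m) s B : nneg w -> 0 <= s ->
  (forall K, ln (1 + mu 0 * (s * mass w))
     + \sum_(k < K) ln (1 + pairmass k * (s * mass w)) <= B) -> logdet w s <= B.
Proof.
move=> w0 s0 hB; have sw0 : nneg (s *: w) by exact: nnegZ.
have sm0 : 0 <= s * mass w by rewrite mulr_ge0// mass_ge0.
have w20 : nneg (2 *: (s *: w)) by exact: nnegZ.
rewrite /logdet ler_pdivrMr// ln_le_expR; last exact: wdet_gt0 (psd_covmx m).
have cv : wdet (2 *: (s *: w)) (covmx (covK n) m) @[n --> \oo] -->
    wdet (2 *: (s *: w)) (covmx c m).
  apply: wdet_cvg => i j; rewrite mxE.
  have -> : (fun n => covmx (covK n) m i j) = symsum (fun k => mu k * cos (k%:~R * (gridpt m i - gridpt m j))).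
    by apply/funext => n; rewrite mxE.
  by case: (muc (gridpt m i - gridpt m j)).
rewrite -(cvg_lim _ cv)//; apply: limr_le.
  by apply/cvg_ex; eexists; exact: cv.
apply: nearW => K /=; rewrite covmx_covK.
have p1 (b : R) : 0 <= b -> 0 < 1 + b * (s * mass w) by move=> b0; rewrite ltr_pwDl// mulr_ge0.
have /andP[_ h] := wdetDS_bounds w20 (psdZ (mu0 0) (psd_freqmx m 0))
  (psd_sum (s := enum 'I_K) (S := fun k : 'I_K => (mu k.+1%:Z + mu (- k.+1%:Z)) *: freqmx m k.+1%:R)
    (fun k _ => psdZ (pairmass_ge0 k) (psd_freqmx m k.+1%:R))).
rewrite big_enum /= in h; apply: (le_trans h).
have h1 : wdet (2 *: (s *: w)) (mu 0 *: freqmx m 0) <= (1 + mu 0 * (s * mass w)) ^+ 2.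
  by rewrite wdetZ scalerA -massZ wdet_freqmx_le.
have h2 : wdet (2 *: (s *: w)) (\sum_(k < K) (mu k.+1%:Z + mu (- k.+1%:Z)) *: freqmx m k.+1%:R) <=
    \prod_(k < K) (1 + pairmass k * (s * mass w)) ^+ 2.
  rewrite -massZ; apply: wdet_freqmx_prod_le => // k; exact: pairmass_ge0.
apply: (@le_trans _ _ ((1 + mu 0 * (s * mass w)) ^+ 2 *
    \prod_(k < K) (1 + pairmass k * (s * mass w)) ^+ 2)).
  apply: ler_pM => //; rewrite ltW// wdet_gt0//; first by apply: psdZ => //; exact: psd_freqmx.
  by apply: psd_sum => k _; apply: psdZ; [exact: pairmass_ge0|exact: psd_freqmx].
rewrite prodrXl -exprMn -(@ler_ln R) ?posrE ?expR_gt0//; last first.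
  by apply: exprn_gt0; rewrite mulr_gt0 ?p1// prodr_gt0// => k _; exact: p1 (pairmass_ge0 k).
rewrite expRK lnXn; last first.
  by rewrite mulr_gt0 ?p1// prodr_gt0// => k _; exact: p1 (pairmass_ge0 k).
rewrite lnM ?posrE ?p1//; last by rewrite prodr_gt0// => k _; exact: p1 (pairmass_ge0 k).
rewrite mulr_natr lerMn2r /=; apply: le_trans (hB K); rewrite lerD2l.
have lnp (n : nat) (b : 'I_n -> R) : (forall k, 0 < b k) -> ln (\prod_k b k) = \sum_k ln (b k).
  elim: n b => [|n IH] b b0; first by rewrite !big_ord0 ln1.
  rewrite !big_ord_recl lnM ?posrE ?b0// ?IH// prodr_gt0// => k _; exact: b0.
by rewrite lnp// => k; exact: p1 (pairmass_ge0 k).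
Qed.

Lemma wdet_logdet_gt0 m (w : 'rV[R]_m) s : nneg w -> 0 <= s ->
  0 < wdet (2 *: (s *: w)) (covmx c m).
Proof. by move=> w0 s0; apply: wdet_gt0 (psd_covmx m); do 2![apply: nnegZ => //]. Qed.

Lemma logdetZ m a (w : 'rV[R]_m) s : logdet (a *: w) s = logdet w (a * s).
Proof. by rewrite [a * s]mulrC /logdet -[(s * a) *: w]scalerA. Qed.

Lemma logdet_ge0 m (w : 'rV[R]_m) s : nneg w -> 0 <= s -> 0 <= logdet w s.
Proof.
move=> w0 s0; rewrite divr_ge0// ln_ge0// wdet_ge1//; last exact: psd_covmx.
by do 2![apply: nnegZ => //].
Qed.

Lemma logdet_le_ln m (w w' : 'rV[R]_m) s s' : nneg w -> nneg w' -> 0 <= s -> 0 <= s' ->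
  wdet (2 *: (s *: w)) (covmx c m) <= wdet (2 *: (s' *: w')) (covmx c m) ->
  logdet w s <= logdet w' s'.
Proof.
move=> w0 w0' s0 s0' h; rewrite ler_pM2r// ler_ln ?posrE; first exact: h.
- exact: wdet_logdet_gt0.
- exact: wdet_logdet_gt0.
Qed.

Lemma logdet_monow m (w w' : 'rV[R]_m) s : nneg w -> (forall i, w 0 i <= w' 0 i) ->
  0 <= s -> logdet w s <= logdet w' s.
Proof.
move=> w0 ww s0; have w0' : nneg w' by move=> i; apply: le_trans (ww i); exact: w0.
apply: logdet_le_ln => //; apply: wdet_monow; last exact: psd_covmx.
  by do 2![apply: nnegZ => //].
by move=> i; rewrite !mxE ler_pM2l// ler_wpM2l.
Qed.

Lemma logdetD_le m (w w' : 'rV[R]_m) s : nneg w -> nneg w' -> 0 <= s ->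
  logdet (w + w') s <= logdet w s + logdet w' s.
Proof.
move=> w0 w0' s0; rewrite /logdet -mulrDl ler_pM2r// -lnM ?posrE ?wdet_logdet_gt0//.
have sw : nneg (2 *: (s *: w)) by do 2![apply: nnegZ => //].
have sw' : nneg (2 *: (s *: w')) by do 2![apply: nnegZ => //].
rewrite ler_ln ?posrE ?mulr_gt0 ?wdet_logdet_gt0//; last exact: nnegD.
by rewrite !scalerDr; have /andP[] := wdetDw_bounds sw sw' (psd_covmx m).
Qed.

Lemma logdet0 m s : logdet (0 : 'rV[R]_m) s = 0.
Proof. by rewrite /logdet !scaler0 wdetw0 ln1 mul0r. Qed.

Lemma logdet_sum_le m (I : eqType) (l : seq I) (w : I -> 'rV[R]_m) s :
  (forall i, nneg (w i)) -> 0 <= s ->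
  logdet (\sum_(i <- l) w i) s <= \sum_(i <- l) logdet (w i) s.
Proof.
move=> w0 s0; elim: l => [|i l IH]; first by rewrite !big_nil logdet0.
rewrite !big_cons (le_trans (logdetD_le _ _ s0))// ?lerD2l//.
by apply: nneg_sum.
Qed.

Lemma logdet_monos m (w : 'rV[R]_m) s s' : nneg w -> 0 <= s <= s' ->
  logdet w s <= logdet w s'.
Proof.
move=> w0 /andP[s0 ss]; rewrite -[s]mulr1 -[s']mulr1 -!logdetZ.
apply: logdet_monow => //; first exact: nnegZ.
by move=> i; rewrite !mxE ler_wpM2r.
Qed.

Lemma logdet_perm m (p : {perm 'I_m}) (w w' : 'rV[R]_m) s :
  (forall i, w' 0 i = w 0 (p i)) ->
  (forall i j, covmx c m i j = covmx c m (p i) (p j)) ->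
  logdet w' s = logdet w s.
Proof.
move=> hw hc; rewrite /logdet; congr (ln _ / 2).
by apply: (wdet_perm (s := p)) => // i; rewrite !mxE hw.
Qed.

(** Discrete orthogonality: distinct frequencies below [m / 2] are orthogonal
    on the grid, so the determinant for uniform weights factorizes. *)
Lemma sum_trig_prod m (k l : nat) (k0 : (0 < k)%N) (l0 : (0 < l)%N) :
  (2 * k < m)%N -> (2 * l < m)%N ->
  [/\ \sum_(i < m) cos (k%:R * gridpt m i) * cos (l%:R * gridpt m i) =
       (k == l)%:R * (m%:R / 2) :> R,
      \sum_(i < m) sin (k%:R * gridpt m i) * sin (l%:R * gridpt m i) =
       (k == l)%:R * (m%:R / 2) :> R &
      \sum_(i < m) cos (k%:R * gridpt m i) * sin (l%:R * gridpt m i) = 0 :> R].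
Proof.
move=> km lm; have m0 : (0 < m)%N by apply: leq_ltn_trans lm.
have e (n i : nat) : n%:R * gridpt m i = i%:R * (2 * pi * n%:R / m%:R).
  by rewrite /gridpt; ring.
pose C (n : nat) : R := \sum_(i < m) cos (n%:R * gridpt m i).
pose S (n : nat) : R := \sum_(i < m) sin (n%:R * gridpt m i).
have C0 n : (0 < n < m)%N -> C n = 0.
  by move=> nm; rewrite -[RHS](sum_cos_grid nm); apply: eq_bigr => i _; rewrite e.
have S0 n : (0 < n < m)%N -> S n = 0.
  by move=> nm; rewrite -[RHS](sum_sin_grid nm); apply: eq_bigr => i _; rewrite e.
have Cp : C (k + l)%N = 0 by apply: C0; lia.
have Sp : S (k + l)%N = 0 by apply: S0; lia.
have [Cd Sd] : \sum_(i < m) cos ((k%:R - l%:R) * gridpt m i) = (k == l)%:R * m%:R :> R /\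
    \sum_(i < m) sin ((k%:R - l%:R) * gridpt m i) = 0 :> R.
  have [->|kl] := eqVneq k l.
    rewrite subrr mul1r; split.
      under eq_bigr do rewrite mul0r cos0; by rewrite sumr_const card_ord.
    by apply: big1 => i _; rewrite mul0r sin0.
  rewrite mul0r; have [kl'|lk] := ltnP k l.
    have d0 : (0 < l - k < m)%N by lia.
    have ed i : (k%:R - l%:R) * gridpt m i = - ((l - k)%N%:R * gridpt m i).
      by rewrite natrB 1?ltnW//; ring.
    split; first by rewrite -[RHS](C0 _ d0); apply: eq_bigr => i _; rewrite ed cosN.
    by rewrite -[RHS]oppr0 -[in RHS](S0 _ d0) -sumrN; apply: eq_bigr => i _; rewrite ed sinN.
  have d0 : (0 < k - l < m)%N by lia.
  have ed i : (k%:R - l%:R) * gridpt m i = (k - l)%N%:R * gridpt m i.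
    by rewrite natrB.
  split; first by rewrite -[RHS](C0 _ d0); apply: eq_bigr => i _; rewrite ed.
  by rewrite -[RHS](S0 _ d0); apply: eq_bigr => i _; rewrite ed.
split.
- have -> : (k == l)%:R * (m%:R / 2) = (C (k + l)%N + (k == l)%:R * m%:R) / 2 :> R.
    by rewrite Cp; field.
  rewrite -Cd -big_split mulr_suml; apply: eq_bigr => i _ /=.
  by rewrite natrD [(k%:R + l%:R) * _]mulrDl [(k%:R - l%:R) * _]mulrBl cosD cosB; field.
- have -> : (k == l)%:R * (m%:R / 2) = ((k == l)%:R * m%:R - C (k + l)%N) / 2 :> R.
    by rewrite Cp; field.
  rewrite -Cd -sumrB mulr_suml; apply: eq_bigr => i _ /=.
  by rewrite natrD [(k%:R + l%:R) * _]mulrDl [(k%:R - l%:R) * _]mulrBl cosB cosD; field.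
- transitivity ((S (k + l)%N - \sum_(i < m) sin ((k%:R - l%:R) * gridpt m i)) / 2); last first.
    by rewrite Sp Sd; field.
  rewrite -sumrB mulr_suml; apply: eq_bigr => i _ /=.
  by rewrite natrD [(k%:R + l%:R) * _]mulrDl [(k%:R - l%:R) * _]mulrBl sinD sinB; field.
Qed.

Definition unifw m : 'rV[R]_m := const_mx (2 * pi / m%:R).

(** For uniform weights the frequencies below half of the grid size decouple, and
    each contributes exactly the factor of the upper bound [logdet_le]; the other
    frequencies can only increase the determinant. *)
Lemma logdet_unif_ge m s K : (2 * K < m)%N -> 0 <= s ->
  \sum_(k < K) ln (1 + pairmass k * (2 * pi * s)) <= logdet (unifw m) s.
Proof.
move=> Km s0; have m0 : 0 < m%:R :> R by rewrite ltr0n; lia.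
have w0 : nneg (unifw m) by move=> i; rewrite mxE divr_ge0 ?mulr_ge0 ?pi_ge0 ?ltW.
pose W := 2 *: (s *: unifw m); have W0 : nneg W by do 2![apply: nnegZ => //].
pose W1 : R := 2 * (s * (2 * pi / m%:R)).
have WE i : W 0 i = W1 by rewrite !mxE.
pose v (a : 'I_K * bool) : 'cV[R]_m := if a.2 then cosv m a.1.+1%:R else sinv m a.1.+1%:R.
pose S (a : 'I_K * bool) := pairmass a.1 *: (v a *m (v a)^T).
have dot a b : \sum_i v a i 0 * v b i 0 = (a == b)%:R * (m%:R / 2).
  have hk (k : 'I_K) : (2 * k.+1 < m)%N by have := ltn_ord k; lia.
  case: a b => [k [] ] [l []]; rewrite /v /= xpair_eqE -val_eqE /=;
    have [h1 h2 h3] := sum_trig_prod (ltn0Sn k) (ltn0Sn l) (hk k) (hk l).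
  - rewrite andbT -eqSS -h1; apply: eq_bigr => i _; by rewrite !mxE.
  - rewrite andbF mul0r -[RHS]h3; apply: eq_bigr => i _; by rewrite !mxE.
  - have [_ _ h4] := sum_trig_prod (ltn0Sn l) (ltn0Sn k) (hk l) (hk k).
    rewrite andbF mul0r -[RHS]h4; apply: eq_bigr => i _; by rewrite !mxE mulrC.
  - rewrite andbT -eqSS -h2; apply: eq_bigr => i _; by rewrite !mxE.
have psdS a : psd (S a) by apply: psdZ; [exact: pairmass_ge0|exact: psd_gram].
have covE : covmx (covK K) m = mu 0 *: freqmx m 0 + \sum_(a : 'I_K * bool) S a.
  rewrite covmx_covK; congr (_ + _).
  rewrite -(pair_bigA _ (fun k b => S (k, b))) /=; apply: eq_bigr => k _.
  by rewrite big_bool /S /v /= -scalerDr.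
have pS : psd (\sum_(a : 'I_K * bool) S a) by apply: psd_sum.
have h1 : wdet W (\sum_(a : 'I_K * bool) S a) <= wdet W (covmx c m).
  apply: wdet_monoS => //.
  have -> : covmx c m - \sum_(a : 'I_K * bool) S a =
     (covmx c m - covmx (covK K) m) + mu 0 *: freqmx m 0.
    by rewrite covE opprD addrA addrAC subrK.
  by apply: psdD; [exact: psd_covmxB|apply: psdZ => //; exact: psd_freqmx].
have h2 : wdet W (\sum_(a : 'I_K * bool) S a) =
    \prod_(a : 'I_K * bool) (1 + pairmass a.1 * (2 * pi * s)).
  have -> : \sum_(a : 'I_K * bool) S a = \sum_(a <- enum {: 'I_K * bool}) S a.
    by rewrite big_enum.
  rewrite wdet_sumS_orth ?enum_uniq//; last first.
    move=> a b _ _ ab; rewrite /S -!scalemxAl -scalemxAr.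
    have -> : v a *m (v a)^T *m diag_mx W *m (v b *m (v b)^T) =
      v a *m ((v a)^T *m diag_mx W *m v b) *m (v b)^T by rewrite !mulmxA.
    have -> : (v a)^T *m diag_mx W *m v b = 0.
      apply/matrixP => i j; rewrite !ord1 mxE [RHS]mxE.
      transitivity (W1 * \sum_i v a i 0 * v b i 0); last by rewrite dot (negbTE ab) mul0r mulr0.
      rewrite mulr_sumr; apply: eq_bigr => k _; rewrite mul_mx_diag mxE mxE WE; ring.
    by rewrite mulmx0 mul0mx !scaler0.
  rewrite big_enum /=; apply: eq_bigr => a _.
  rewrite /S -wdetZ wdet_rank1; congr (1 + _).
  transitivity (pairmass a.1 * (W1 * \sum_i v a i 0 * v a i 0)).
    rewrite !mulr_sumr; apply: eq_bigr => i _; rewrite mxE WE expr2; ring.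
  by rewrite dot eqxx mul1r /W1; field; rewrite gt_eqF.
have p1 k : 0 < 1 + pairmass k * (2 * pi * s).
  by rewrite ltr_pwDl// mulr_ge0 ?pairmass_ge0// !mulr_ge0 ?pi_ge0.
have lnp (I : Type) (l : seq I) (b : I -> R) : (forall k, 0 < b k) ->
    ln (\prod_(k <- l) b k) = \sum_(k <- l) ln (b k).
  move=> b0; elim: l => [|k l IH]; first by rewrite !big_nil ln1.
  by rewrite !big_cons lnM ?posrE ?b0// ?IH// prodr_gt0.
rewrite /logdet ler_pdivlMr// -/W; apply: (@le_trans _ _ (ln (wdet W (\sum_(a : 'I_K * bool) S a)))).
  rewrite h2 lnp//.
  rewrite -(pair_bigA _ (fun (k : 'I_K) (b : bool) => ln (1 + pairmass k * (2 * pi * s)))) /=.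
  by rewrite mulr_suml; apply: ler_sum => k _; rewrite big_bool /= mulr_natr mulr2n.
rewrite ler_ln ?posrE; first exact: h1.
- by rewrite h2 prodr_gt0.
- exact: wdet_logdet_gt0.
Qed.

End Cov.

(** * Regularly varying sequences *)

Lemma absz_symsum_index n (j : 'I_n.*2.+1) : (`|j%:Z - n%:Z| <= n)%N.
Proof. by have := ltn_ord j; lia. Qed.

Lemma leq_abszB (k a : int) :
  (`|k| <= `|k - a| + `|a|)%N /\ (`|k - a| <= `|k| + `|a|)%N.
Proof. by split; lia. Qed.

Section Regular.
Context {R : realType}.

Lemma asymp_equiv_bounds (f g : int -> R) e : asymp_equiv absz_infty f g ->
  (forall k, k != 0 -> 0 < g k) -> 0 < e ->
  exists N, forall k : int, (N < `|k|)%N -> (1 - e) * g k <= f k <= (1 + e) * g k.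
Proof.
move=> fg g0 e0; have := fg _ (nbhsx_ballx (1 : R) e e0).
move=> [N _ h]; exists N => k Nk; have k0 : k != 0 by lia.
have := h k (ltnW Nk); rewrite /ball /= ltr_distlC => /andP[h1 h2].
have gk := g0 k k0.
by apply/andP; split; [rewrite -ler_pdivlMr// ltW|rewrite -ler_pdivrMr// ltW].
Qed.

Lemma powRN_anti (s x y : R) : 0 <= s -> 0 < x -> x <= y -> y `^ (- s) <= x `^ (- s).
Proof.
move=> s0 x0 xy; have y0 : 0 < y by apply: lt_le_trans xy.
rewrite !powRN lef_pV2 ?posrE ?powR_gt0//.
by apply: ge0_ler_powR => //; rewrite nnegrE ltW.
Qed.

Variables (mu : int -> R) (r M S : R).
Hypotheses (mu0 : forall k, 0 <= mu k) (mu_le : forall k, mu k <= S).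
Hypotheses (M0 : 0 < M) (r0 : 0 < r).
Hypothesis mu_asymp : asymp_equiv absz_infty mu (fun k => M * (`|k|%N%:R `^ (- r))).

Let rho (k : int) : R := M * (`|k|%N%:R `^ (- r)).

Let rho_gt0 k : k != 0 -> 0 < rho k.
Proof. by move=> k0; rewrite mulr_gt0// powR_gt0// ltr0n; lia. Qed.

Lemma powR_near1 e : 0 < e -> exists2 d : R, 0 < d <= 1 / 2 &
  (1 - d) `^ (- r) <= 1 + e /\ 1 - e <= (1 + d) `^ (- r).
Proof.
move=> e0; pose b := e / (2 * r * (1 + e)).
have b0 : 0 < b by rewrite divr_gt0// !mulr_gt0//; lra.
pose d := Num.min (1 / 2) b.
have d0 : 0 < d by rewrite lt_min b0 andbT; lra.
have d2 : d <= 1 / 2 by rewrite ge_min lexx.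
have db : d <= b by rewrite ge_min lexx orbT.
exists d; first by rewrite d0.
have rd : r * (2 * d) <= e / (1 + e).
  have -> : e / (1 + e) = r * (2 * b).
    by rewrite /b; field; rewrite !gt_eqF//; lra.
  by rewrite ler_pM2l// ler_pM2l.
have e1 : e / (1 + e) <= e by rewrite ler_pdivrMr; nra.
split.
  rewrite powRN /powR (gt_eqF (_ : 0 < 1 - d)); last by lra.
  rewrite -expRN -mulrN.
  have h1 : - ln (1 - d) <= 2 * d.
    rewrite lerNl; have : ln (1 - d)^-1 <= (1 - d)^-1 - 1.
      have i0 : 0 < (1 - d)^-1 by rewrite invr_gt0; lra.
      have := @le_ln1Dx R ((1 - d)^-1 - 1); have -> : 1 + ((1 - d)^-1 - 1) = (1 - d)^-1 by ring.
      by apply; move: i0; move: (_^-1) => x; lra.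
    rewrite lnV ?posrE; last by lra.
    have : (1 - d)^-1 <= 1 + 2 * d.
      by rewrite -[leLHS]mul1r ler_pdivrMr; nra.
    by lra.
  have h2 : r * - ln (1 - d) <= e / (1 + e).
    by apply: le_trans rd; rewrite ler_pM2l.
  apply: (@le_trans _ _ (expR (e / (1 + e)))); first by rewrite ler_expR.
  have -> : forall y, (y <= 1 + e) = (y <= (1 - e / (1 + e))^-1).
    move=> y; congr (_ <= _); field; rewrite (_ : 1 + e - e = 1); last by ring.
    by rewrite oner_eq0 gt_eqF//; lra.
  rewrite -[leLHS]invrK lef_pV2 ?posrE ?invr_gt0 ?expR_gt0//; last first.
    by rewrite subr_gt0 ltr_pdivrMr; lra.
  by rewrite -expRN; exact: expR_ge1Dx.
rewrite powRN /powR (gt_eqF (_ : 0 < 1 + d)); last by lra.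
rewrite -expRN; apply: le_trans (expR_ge1Dx _).
rewrite lerD2l lerN2; apply: le_trans e1.
apply: le_trans rd; rewrite ler_pM2l//.
by have := @le_ln1Dx R d; lra.
Qed.

Definition invsq (a : int) : R := (`|a|%N%:R ^+ 2)^-1.

Lemma symsum_invsq n : symsum invsq n <= 4.
Proof.
suff : symsum invsq n.+1 <= 4 - 2 / n.+1%:R.
  move=> h; apply: (@le_trans _ _ (symsum invsq n.+1)).
    rewrite symsumS lerDl addr_ge0// /invsq invr_ge0 ?exprn_ge0//.
  apply: le_trans h _; rewrite lerBlDr lerDl divr_ge0//.
elim: n => [|n IH].
  rewrite symsumS symsum0 /invsq /= expr0n /= invr0 !expr1n; lra.
rewrite symsumS; apply: (@le_trans _ _ (4 - 2 / n.+1%:R + 2 / n.+2%:R ^+ 2)).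
  by apply: lerD => //; rewrite /invsq abszN !absz_nat -mulr2n mulr_natl.
rewrite -addrA lerD2l; have n1 : 0 < n.+1%:R :> R by [].
have n2 : n.+2%:R = n.+1%:R + 1 :> R by rewrite natr1.
rewrite n2 -subr_ge0.
have -> : - (2 / (n.+1%:R + 1)) - (- (2 / n.+1%:R) + 2 / (n.+1%:R + 1) ^+ 2) =
   2 / (n.+1%:R * (n.+1%:R + 1) ^+ 2) :> R.
  by field; rewrite !gt_eqF//; lra.
by rewrite divr_ge0// mulr_ge0 ?exprn_ge0//; lra.
Qed.

Lemma smoothing_losses (e : R) : 0 <= e -> e <= 1 / 8 ->
  1 + e <= (1 + 8 * e) * ((1 - e) ^+ 2 - e) /\
  (1 + e) ^+ 2 + e <= (1 + 8 * e) * (1 - e).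
Proof.
move=> e0 e1; have h1 := mulr_ge0 e0 e0.
have h2 : e * e <= 1 / 8 * e by rewrite ler_wpM2r.
have h3 := mulr_ge0 e0 h1.
by split; rewrite -subr_ge0;
  [have -> : (1 + 8 * e) * ((1 - e) ^+ 2 - e) - (1 + e) =
     4 * e - 23 * (e * e) + 8 * (e * (e * e)) by ring
  |have -> : (1 + 8 * e) * (1 - e) - ((1 + e) ^+ 2 + e) =
     4 * e - 9 * (e * e) by ring]; lra.
Qed.

(** Averaging a regularly varying sequence against a rapidly decreasing
    probability changes its terms of large index by a factor close to one. *)
Lemma regular_smoothing (q : nat) kap e : r + 1 <= q%:R -> 0 < kap -> 0 < e <= 1 ->
  exists N, forall n (ph : int -> R), (forall a, 0 <= ph a) -> symsum ph n = 1 ->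
    (forall a, a != 0 -> (`|a| <= n)%N -> ph a <= kap / `|a|%N%:R ^+ (q + 2)) ->
    forall k : int, (N < `|k|)%N ->
    mu k <= (1 + e) * symsum (fun a => ph a * mu (k - a)) n /\
    symsum (fun a => ph a * mu (k - a)) n <= (1 + e) * mu k.
Proof.
move=> rq kap0 /andP[e0 e1]; pose e' := e / 8.
have e'0 : 0 < e' by rewrite divr_gt0.
have [d /andP[d0 d2] [hd1 hd2]] := powR_near1 e'0.
have [N1 hN1] := asymp_equiv_bounds mu_asymp rho_gt0 e'0.
have [l1 l2] : 1 + e' <= (1 + 8 * e') * ((1 - e') ^+ 2 - e') /\
    (1 + e') ^+ 2 + e' <= (1 + 8 * e') * (1 - e').
  by apply: smoothing_losses; [exact: ltW|rewrite /e'; lra].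
have e8 : e = 8 * e' by rewrite /e'; field.
have e'1 : 0 < 1 - e' by rewrite /e'; lra.
have e'2 : 0 < 1 + e' by rewrite /e'; lra.
have e'3 : 0 <= 2 - e' by rewrite /e'; lra.
have d1m : 0 < 1 - d by lra.
have d1p : 0 < 1 + d by lra.
have d1h : 1 / 2 <= 1 - d by lra.
have ep : 0 <= 1 + e by lra.
have S0 : 0 <= S by apply: le_trans (mu_le 0).
pose T := 4 * kap / d ^+ q.
have T0 : 0 < T by rewrite divr_gt0 ?exprn_gt0 ?mulr_gt0.
pose B := 2 * N1%:R + 1 + T / e' + S * T / (M * e').
have [N hN] : exists N : nat, B <= N%:R.
  exists (Num.bound B); apply/ltW/archi_boundP.
  have t1 : 0 <= T / e' by rewrite divr_ge0 ?ltW.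
  have t2 : 0 <= S * T / (M * e') by apply: divr_ge0; [rewrite mulr_ge0// ltW|rewrite ltW// mulr_gt0].
  by rewrite /B !addr_ge0// mulr_ge0.
exists N => n ph ph0 ph1 phk k Nk.
set y : R := `|k|%N%:R.
have By : B <= y by apply: (le_trans hN); rewrite /y ler_nat ltnW.
have t1 : 0 <= T / e' by rewrite divr_ge0 ?ltW.
have t2 : 0 <= S * T / (M * e') by apply: divr_ge0; [rewrite mulr_ge0// ltW|rewrite ltW// mulr_gt0].
have y1 : 2 * N1%:R + 1 <= y by apply: le_trans By; rewrite /B; lra.
have y2 : T / e' <= y by apply: le_trans By; rewrite /B; have : 0 <= N1%:R :> R by []; lra.
have y3 : S * T / (M * e') <= y.
  by apply: le_trans By; rewrite /B; have : 0 <= N1%:R :> R by []; lra.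
have yp : 1 <= y by have : 0 <= N1%:R :> R by []; lra.
have y0 : 0 < y by lra.
have Ny : N1%:R < 1 / 2 * y by lra.
have kn0 : k != 0 by apply/eqP => k0; move: y0; rewrite /y k0 absz0 ltxx.
have rk := rho_gt0 kn0.
have /andP[muk1 muk2] : (1 - e') * rho k <= mu k <= (1 + e') * rho k.
  apply: hN1; have : N1%:R < y by have : 0 <= N1%:R :> R by []; lra.
  by rewrite /y ltr_nat.
have yqr : (y ^+ q)^-1 <= y `^ (- r) / y.
  have -> : (y ^+ q)^-1 = y `^ (- q%:R) by rewrite powRN powR_mulrn// ltW.
  have -> : y `^ (- r) / y = y `^ (- r - 1).
    by rewrite powRD ?powR_inv1 ?ltW//; apply/implyP => _; rewrite gt_eqF.
  by apply: ler_powR => //; lra.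
have tt : 0 <= T / 4 / y ^+ q.
  apply: divr_ge0; last by apply: exprn_ge0; exact: ltW.
  by apply: divr_ge0 => //; exact: ltW.
(* the mass of the averaging kernel at distances exceeding d |k| *)
pose far (a : int) : R := if `|a|%N%:R <= d * y then 0 else ph a.
have far_le : symsum far n <= T / y ^+ q.
  apply: (@le_trans _ _ (symsum (fun a => T / 4 / y ^+ q * invsq a) n)); last first.
    rewrite symsumZ; have -> : T / y ^+ q = T / 4 / y ^+ q * 4.
      by field; rewrite gt_eqF// exprn_gt0.
    by rewrite ler_wpM2l// symsum_invsq.
  rewrite /symsum; apply: ler_sum => j _; rewrite /far; set a := _ - _.
  have inv0 : 0 <= invsq a by rewrite invr_ge0 exprn_ge0.
  case: (leP (`|a|%N%:R : R) (d * y)) => [_|da]; first exact: mulr_ge0.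
  have dy0 : 0 < d * y by rewrite mulr_gt0.
  have a0 : a != 0 by apply/eqP => a0; move: da; rewrite a0 absz0 ltNge ltW.
  have an : (`|a| <= n)%N by exact: absz_symsum_index.
  apply: (le_trans (phk a a0 an)).
  have aa : 0 < `|a|%N%:R :> R := lt_trans dy0 da.
  have -> : T / 4 / y ^+ q * invsq a = kap / ((d * y) ^+ q * `|a|%N%:R ^+ 2).
    rewrite /T /invsq exprMn; field.
    by rewrite !gt_eqF ?exprn_gt0.
  rewrite exprD ler_pM2l// lef_pV2 ?posrE ?mulr_gt0 ?exprn_gt0//.
  rewrite ler_pM2r ?exprn_gt0//; apply: lerXn2r; rewrite ?nnegrE ?ltW//.
have far0 : 0 <= symsum far n.
  by apply: symsum_ge0 => a; rewrite /far; case: ifP.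
have rhoE : rho k = M * y `^ (- r) by [].
have pw0 : 0 < y `^ (- r) by rewrite powR_gt0.
have farr : symsum far n <= T / y * y `^ (- r).
  apply: (le_trans far_le); rewrite -mulrA ler_pM2l// [y^-1 * _]mulrC.
  exact: yqr.
have far1 : symsum far n <= e'.
  apply: (le_trans farr).
  have pw1 : y `^ (- r) <= 1 by have := @ler_powR R y yp (- r) 0; rewrite powRr0; apply; rewrite oppr_le0 ltW.
  have Ty : T / y <= e' by rewrite ler_pdivrMr// mulrC -ler_pdivrMr.
  have Ty0 : 0 <= T / y by rewrite divr_ge0 ?ltW.
  by apply: le_trans Ty; rewrite ler_piMr.
have far2 : S * symsum far n <= e' * rho k.
  apply: (@le_trans _ _ (S * (T / y * y `^ (- r)))); first by rewrite ler_wpM2l.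
  rewrite rhoE !mulrA ler_pM2r//.
  rewrite ler_pdivrMr// (_ : e' * M * y = y * (M * e')); last by ring.
  have Me : 0 < M * e' by rewrite mulr_gt0.
  move: y3; rewrite (ler_pdivrMr _ _ Me). by rewrite /T !mulrA.
(* terms at distance at most d |k| *)
have near (a : int) : `|a|%N%:R <= d * y ->
    (1 - e') ^+ 2 * rho k <= mu (k - a) <= (1 + e') ^+ 2 * rho k.
  move=> da.
  have z1 : (1 - d) * y <= `|k - a|%N%:R.
    have : (`|k| <= `|k - a| + `|a|)%N by case: (leq_abszB k a).
    rewrite -(ler_nat R) natrD -/y mulrBl mul1r lerBlDr => h.
    by apply: (le_trans h); rewrite lerD2l.
  have z2 : `|k - a|%N%:R <= (1 + d) * y.
    have : (`|k - a| <= `|k| + `|a|)%N by case: (leq_abszB k a).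
    rewrite -(ler_nat R) natrD -/y mulrDl mul1r => h.
    by apply: (le_trans h); rewrite lerD2l.
  have zN : (N1 < `|k - a|)%N.
    rewrite -(ltr_nat R); apply: lt_le_trans z1.
    by apply: (lt_le_trans Ny); rewrite ler_pM2r.
  have /andP[h1 h2] := hN1 _ zN.
  set z : R := `|k - a|%N%:R in z1 z2.
  have dy1 : 0 < (1 - d) * y by rewrite mulr_gt0.
  have zp : 0 < z by apply: lt_le_trans z1.
  have rz1 : rho (k - a) <= (1 + e') * rho k.
    rewrite {1}/rho -/z rhoE mulrCA ler_pM2l//.
    apply: (@le_trans _ _ (((1 - d) * y) `^ (- r))).
      exact: powRN_anti (ltW r0) dy1 z1.
    by rewrite (powRM _ (ltW d1m) (ltW y0)) ler_pM2r.
  have rz2 : (1 - e') * rho k <= rho (k - a).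
    rewrite {2}/rho -/z rhoE mulrCA ler_pM2l//.
    apply: (@le_trans _ _ (((1 + d) * y) `^ (- r))).
      by rewrite (powRM _ (ltW d1p) (ltW y0)) ler_pM2r.
    have dy2 : 0 < (1 + d) * y by rewrite mulr_gt0.
    exact: powRN_anti (ltW r0) zp z2.
  rewrite !expr2 -!mulrA; apply/andP; split.
    by apply: le_trans h1; rewrite ler_pM2l.
  by apply: (le_trans h2); rewrite ler_pM2l.
have up : symsum (fun a => ph a * mu (k - a)) n <= (1 + e') ^+ 2 * rho k + e' * rho k.
  apply: (@le_trans _ _ (symsum (fun a => (1 + e') ^+ 2 * rho k * ph a + S * far a) n)).
    apply: ler_symsum => a; rewrite /far; case: (leP (`|a|%N%:R : R) (d * y)) => da.
      rewrite mulr0 addr0 mulrC ler_wpM2r//; by case/andP: (near a da).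
    apply: (@le_trans _ _ (S * ph a)).
      by rewrite mulrC ler_wpM2r.
    have rk0 := ltW rk; by rewrite lerDr mulr_ge0// mulr_ge0// sqr_ge0.
  by rewrite symsumD !symsumZ ph1 mulr1 lerD2l.
have lo : (1 - e') ^+ 2 * rho k - e' * rho k <= symsum (fun a => ph a * mu (k - a)) n.
  apply: (@le_trans _ _ (symsum (fun a => (1 - e') ^+ 2 * rho k * ph a + (- rho k) * far a) n)).
    rewrite symsumD !symsumZ ph1 mulr1 lerD2l mulNr lerN2 mulrC ler_wpM2r//.
    exact: ltW.
  apply: ler_symsum => a; rewrite /far; case: (leP (`|a|%N%:R : R) (d * y)) => da.
    rewrite mulr0 addr0 [leRHS]mulrC ler_wpM2r//; by case/andP: (near a da).
  apply: (@le_trans _ _ 0); last exact: mulr_ge0.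
  have -> : (1 - e') ^+ 2 * rho k * ph a + - rho k * ph a =
      - (e' * (2 - e') * (rho k * ph a)) by ring.
  rewrite oppr_le0; apply: mulr_ge0; apply: mulr_ge0 => //; exact: ltW.
split.
  apply: (@le_trans _ _ ((1 + e) * ((1 - e') ^+ 2 * rho k - e' * rho k))); last first.
    by rewrite ler_wpM2l.
  by apply: (le_trans muk2); rewrite -mulrBl [leRHS]mulrA (ler_pM2r rk) e8.
apply: (le_trans up); apply: (@le_trans _ _ ((1 + e) * ((1 - e') * rho k))); last first.
  by rewrite ler_wpM2l.
by rewrite -mulrDl [leRHS]mulrA (ler_pM2r rk) e8.
Qed.

End Regular.

(** * Powers of the Fejer kernel on the grid *)

Lemma absz_sign (a : int) : a = `|a|%N%:Z \/ a = - `|a|%N%:Z.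
Proof. by lia. Qed.

Section Fejer.
Context {R : realType}.

Definition fejer L (t : R) : R :=
  (\sum_(j < L) cos (j%:R * t)) ^+ 2 + (\sum_(j < L) sin (j%:R * t)) ^+ 2.

Lemma fejer_ge0 L t : 0 <= fejer L t.
Proof. by rewrite addr_ge0 ?sqr_ge0. Qed.

Lemma fejerN L t : fejer L (- t) = fejer L t.
Proof.
rewrite /fejer; congr (_ ^+ 2 + _).
  by apply: eq_bigr => j _; rewrite mulrN cosN.
rewrite -sqrrN -sumrN; congr (_ ^+ 2).
by apply: eq_bigr => j _; rewrite mulrN sinN opprK.
Qed.

Lemma fejer0 L : fejer L 0 = L%:R ^+ 2.
Proof.
rewrite /fejer; under eq_bigr do rewrite mulr0 cos0.
under [X in _ + X ^+ 2]eq_bigr do rewrite mulr0 sin0.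
by rewrite [X in _ + X ^+ 2]big1// expr0n addr0 sumr_const card_ord.
Qed.

Lemma fejerE L t : fejer L t =
  \sum_(j < L) \sum_(l < L) cos ((j%:R - l%:R) * t).
Proof.
rewrite /fejer !expr2 !mulr_suml -big_split; apply: eq_bigr => j _ /=.
rewrite !mulr_sumr -big_split; apply: eq_bigr => l _ /=.
by rewrite mulrBl cosB.
Qed.

Lemma fejer_le L t : sin (t / 2) ^+ 2 * fejer L t <= 1.
Proof.
pose s := sin (t / 2).
have h1 := sum_cos_telescope t L; have h2 := sum_sin_telescope t L.
have -> : s ^+ 2 * fejer L t = ((2 * s * \sum_(j < L) cos (j%:R * t)) ^+ 2 +
   (2 * s * \sum_(j < L) sin (j%:R * t)) ^+ 2) / 4.
  by rewrite /fejer; field.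
rewrite h1 h2 ler_pdivrMr// mul1r.
have e1 := cos2Dsin2 (t / 2); have e2 := cos2Dsin2 (L%:R * t - t / 2).
move: e1 e2; set a := cos _; set b := sin _; set c := cos _; set d := sin _.
move=> e1 e2; rewrite -subr_ge0.
have -> : 4 - ((d + b) ^+ 2 + (a - c) ^+ 2) =
  2 * (2 - (a ^+ 2 + b ^+ 2) - (c ^+ 2 + d ^+ 2)) + ((d - b) ^+ 2 + (a + c) ^+ 2) by ring.
by rewrite e1 e2 addr_ge0// ?addr_ge0 ?sqr_ge0//; lra.
Qed.

Variable n : nat.
Let m := n.*2.+1.

Lemma symsum_cos_grid (j : int) : ~~ (m%:Z %| j)%Z ->
  symsum (fun a => cos (j%:~R * (2 * pi * a%:~R / m%:R))) n = 0 :> R.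
Proof.
move=> mj.
have m0 : m%:R != 0 :> R by rewrite pnatr_eq0.
pose i : nat := absz (j %% m%:Z)%Z.
have iE : (j %% m%:Z)%Z = i%:Z by rewrite /i gez0_abs// modz_ge0.
have im : (0 < i < m)%N.
  rewrite -!ltz_nat -iE ltz_mod// andbT lt_neqAle modz_ge0// andbT eq_sym.
  by apply: contra mj => /eqP h; apply/dvdz_mod0P.
have jE : j%:~R = i%:R + m%:R * (j %/ m%:Z)%Z%:~R :> R.
  rewrite {1}(divz_eq j m%:Z) intrD intrM iE addrC mulrC.
  by rewrite -!pmulrn.
transitivity (\sum_(l < m) cos (l%:R * (2 * pi * i%:R / m%:R) - n%:R * (2 * pi * i%:R / m%:R)) : R).
  apply: eq_bigr => l _; rewrite intrB -!pmulrn jE.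
  rewrite -[RHS](cosD2pin _ ((j %/ m%:Z)%Z * (l%:Z - n%:Z))); congr cos.
  rewrite intrM intrB -!pmulrn; by field.
under eq_bigr do rewrite cosB.
rewrite big_split -!mulr_suml /=.
by rewrite sum_cos_grid// sum_sin_grid// !mul0r addr0.
Qed.

(** The [p]-th power of the kernel is a trigonometric polynomial with frequencies
    of size at most [p L], and a frequency that is not a multiple of [m] sums to
    zero over the grid. *)
Lemma fejer_pow_orth L p (j : int) :
  (forall e : int, (`|e| <= p * L)%N -> ~~ (m%:Z %| j + e)%Z) ->
  symsum (fun a => fejer L (2 * pi * a%:~R / m%:R) ^+ p *
    cos (j%:~R * (2 * pi * a%:~R / m%:R))) n = 0 :> R.
Proof.
elim: p j => [|p IH] j hj.
  under eq_fun do rewrite expr0 mul1r.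
  by apply: symsum_cos_grid; have := hj 0 isT; rewrite addr0.
have -> : (fun a : int => fejer L (2 * pi * a%:~R / m%:R) ^+ p.+1 *
    cos (j%:~R * (2 * pi * a%:~R / m%:R)) : R) =
  (fun a => \sum_(i < L) \sum_(l < L) (2^-1 *
     (fejer L (2 * pi * a%:~R / m%:R) ^+ p *
      cos ((j + (i%:Z - l%:Z))%:~R * (2 * pi * a%:~R / m%:R)) +
      fejer L (2 * pi * a%:~R / m%:R) ^+ p *
      cos ((j + (l%:Z - i%:Z))%:~R * (2 * pi * a%:~R / m%:R))))).
  apply/funext => a; set t := 2 * pi * a%:~R / m%:R.
  rewrite exprSr -mulrA {2}fejerE mulr_suml mulr_sumr; apply: eq_bigr => i _; rewrite mulr_suml mulr_sumr.
  apply: eq_bigr => l _;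
  have e1 : (j + (i%:Z - l%:Z))%:~R = j%:~R + (i%:R - l%:R) :> R.
    by rewrite !intrD mulrNz -!pmulrn.
  have e2 : (j + (l%:Z - i%:Z))%:~R = j%:~R - (i%:R - l%:R) :> R.
    by rewrite !intrD mulrNz -!pmulrn opprB.
  rewrite e1 e2 [(j%:~R + _) * t]mulrDl [(j%:~R - _) * t]mulrBl.
  by rewrite !cosD cosN sinN; field.
rewrite symsum_sum big1// => i _; rewrite symsum_sum big1// => l _.
have il := ltn_ord i; have ll := ltn_ord l.
rewrite symsumZ symsumD !IH ?addr0 ?mulr0//.
- by move=> e he; rewrite -addrA; apply: hj; rewrite mulSn; lia.
- by move=> e he; rewrite -addrA; apply: hj; rewrite mulSn; lia.
Qed.

(** Normalized so that its values on the [m] grid frequencies add up to one,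
    a power of the Fejer kernel is a positive definite function on the grid that
    is supported near the diagonal. *)
Definition fejer_mass L p : R := symsum (fun a => fejer L (2 * pi * a%:~R / m%:R) ^+ p) n.

Definition fejer_wt L p (a : int) : R := fejer L (2 * pi * a%:~R / m%:R) ^+ p / fejer_mass L p.

Definition fejer_cutoff L p (h : R) : R := symsum (fun a => fejer_wt L p a * cos (a%:~R * h)) n.

Lemma fejer_mass_ge L p : L%:R ^+ (2 * p) <= fejer_mass L p.
Proof.
rewrite /fejer_mass symsumE mulr0 mul0r fejer0 -exprM lerDl sumr_ge0// => k _.
by rewrite addr_ge0// exprn_ge0// fejer_ge0.
Qed.

Lemma fejer_mass_gt0 L p : (0 < L)%N -> 0 < fejer_mass L p.
Proof. by move=> L0; apply: lt_le_trans (fejer_mass_ge L p); rewrite exprn_gt0// ltr0n. Qed.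

Lemma fejer_wt_ge0 L p a : 0 <= fejer_wt L p a.
Proof.
rewrite divr_ge0 ?exprn_ge0 ?fejer_ge0//; apply: le_trans (fejer_mass_ge L p).
by rewrite exprn_ge0.
Qed.

Lemma fejer_wt_sum L p : (0 < L)%N -> symsum (fejer_wt L p) n = 1.
Proof.
move=> L0; rewrite /fejer_wt.
under [X in symsum X]eq_fun do rewrite mulrC.
by rewrite symsumZ mulVf// gt_eqF// fejer_mass_gt0.
Qed.

Lemma fejer_wtN L p a : fejer_wt L p (- a) = fejer_wt L p a.
Proof. by rewrite /fejer_wt mulrNz mulrN mulNr fejerN. Qed.

(** The kernel is at most [1 / sin^2], and [sin_ge] bounds the sine below by a
    multiple of its argument; the normalization is at least [L^(2 p)] because of the value at zero. *)
Lemma fejer_wt_le L p a (la : R) : 0 < la -> la * m%:R <= L%:R -> a != 0 -> (`|a| <= n)%N ->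
  fejer_wt L p a <= (2 / la) ^+ (2 * p) / `|a|%N%:R ^+ (2 * p).
Proof.
move=> la0 Lm a0 an.
have m0 : 0 < m%:R :> R by [].
have L0 : 0 < L%:R :> R by apply: lt_le_trans Lm; rewrite mulr_gt0.
pose x : R := `|a|%N%:R; have x0 : 0 < x by rewrite ltr0n; lia.
have xm : 2 * x <= m%:R.
  by rewrite -natrM ler_nat /m -addnn; lia.
pose y := pi * x / m%:R.
have pi4 : pi < 4 :> R by have := @pihalf_lt2 R; rewrite ltr_pdivrMr//; lra.
have pi2 := @pi_ge2 R.
have y0 : 0 < y by rewrite divr_gt0// mulr_gt0//; lra.
have y2 : y <= 2.
  by rewrite ler_pdivrMr//; nra.
have sy : x / (2 * m%:R) <= sin y.
  have h := sin_ge (ltW y0); apply: le_trans h.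
  have -> : x / (2 * m%:R) = y / (2 * pi).
    have gen (u v w : R) : 0 < u -> 0 < w -> v / (2 * w) = u * v / w / (2 * u).
      by move=> u0 w0; field; rewrite !gt_eqF.
    by apply: gen => //; exact: pi_gt0.
  have h1 : y / (2 * pi) <= y / 4 by rewrite ler_pM2l// lef_pV2 ?posrE; lra.
  apply: (le_trans h1); rewrite !exprS expr0 mulr1; nra.
have s0 : 0 < sin y by apply: lt_le_trans sy; rewrite divr_gt0// mulr_gt0.
have fE : fejer L (2 * pi * a%:~R / m%:R) = fejer L (2 * y).
  have -> : 2 * y = 2 * pi * x / m%:R by rewrite /y; ring.
  have [aE|aE] := absz_sign a.
    by rewrite aE -pmulrn.
  by rewrite aE mulrNz -pmulrn mulrN mulNr fejerN.
have fb : fejer L (2 * pi * a%:~R / m%:R) <= (2 * m%:R / x) ^+ 2.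
  have := fejer_le L (2 * y); have -> : 2 * y / 2 = y by rewrite mulrC mulKf.
  rewrite -fE mulrC.
  rewrite -ler_pdivlMr ?exprn_gt0// => h; apply: (le_trans h).
  rewrite div1r -exprVn -[leRHS]mul1r -ler_pdivrMr ?exprn_gt0 ?divr_gt0 ?mulr_gt0//.
  rewrite -expr_div_n; apply: exprn_ile1.
    by rewrite divr_ge0 ?invr_ge0 ?ltW// divr_gt0// mulr_gt0.
  rewrite ler_pdivrMr ?divr_gt0 ?mulr_gt0// mul1r.
  by rewrite -[leRHS]invf_div lef_pV2 ?posrE// divr_gt0// mulr_gt0.
rewrite /fejer_wt ler_pdivrMr ?fejer_mass_gt0//; last by rewrite -(ltr_nat R).
apply: (@le_trans _ _ ((2 * m%:R / x) ^+ (2 * p))).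
  by rewrite exprM lerXn2r// nnegrE ?fejer_ge0// sqr_ge0.
apply: (@le_trans _ _ ((2 / la) ^+ (2 * p) / x ^+ (2 * p) * L%:R ^+ (2 * p))); last first.
  by rewrite ler_wpM2l ?fejer_mass_ge// divr_ge0// exprn_ge0// ?divr_ge0// ltW.
have la2 : 0 < 2 / la by rewrite divr_gt0.
rewrite -expr_div_n -exprMn; apply: lerXn2r; rewrite ?nnegrE.
- by rewrite ltW// divr_gt0// mulr_gt0.
- by rewrite ltW// mulr_gt0// divr_gt0.
have -> : 2 / la / x * L%:R = 2 * (L%:R / la) / x by ring.
by rewrite ler_pM2r ?invr_gt0// ler_pM2l// ler_pdivlMr// mulrC.
Qed.

Lemma fejer_cutoff_eq0 L p (j : int) :
  (forall e : int, (`|e| <= p * L)%N -> ~~ (m%:Z %| j + e)%Z) ->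
  fejer_cutoff L p (2 * pi * j%:~R / m%:R) = 0.
Proof.
move=> hj; rewrite /fejer_cutoff /fejer_wt.
have -> : (fun a : int => fejer L (2 * pi * a%:~R / m%:R) ^+ p / fejer_mass L p *
    cos (a%:~R * (2 * pi * j%:~R / m%:R))) =
  (fun a => (fejer_mass L p)^-1 * (fejer L (2 * pi * a%:~R / m%:R) ^+ p *
    cos (j%:~R * (2 * pi * a%:~R / m%:R)))).
  apply/funext => a; have -> : a%:~R * (2 * pi * j%:~R / m%:R) = j%:~R * (2 * pi * a%:~R / m%:R) :> R.
    by ring.
  by ring.
by rewrite symsumZ fejer_pow_orth// mulr0.
Qed.

End Fejer.

(** * Almost independence of distant arcs *)

Section Localize.
Context {R : realType}.
Variables (mu : int -> R) (c : R -> R).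
Hypothesis mu0 : forall k, 0 <= mu k.
Hypothesis muc : forall h, zlim (fun k => mu k * cos (k%:~R * h)) (c h).

Lemma zlim_mu : zlim mu (c 0).
Proof. by apply: zlim_ext (muc 0) => k; rewrite mulr0 cos0 mulr1. Qed.

Lemma mu_le_c0 k : mu k <= c 0.
Proof.
case: (absz_sign k) => ->; case: `|k|%N => [|i]; rewrite ?oppr0.
- by apply: le_trans (symsum_le_zlim 0 mu0 zlim_mu); rewrite symsum0.
- apply: le_trans (symsum_le_zlim i.+1 mu0 zlim_mu).
  by rewrite symsumS addrCA lerDl addr_ge0// symsum_ge0.
- by apply: le_trans (symsum_le_zlim 0 mu0 zlim_mu); rewrite symsum0.
- apply: le_trans (symsum_le_zlim i.+1 mu0 zlim_mu).
  by rewrite symsumS addrA lerDr addr_ge0// symsum_ge0.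
Qed.

Lemma c0_ge0 : 0 <= c 0.
Proof. by apply: le_trans (mu0 0) (mu_le_c0 0). Qed.

Lemma bilin_sum m (I : Type) (s : seq I) (A : I -> 'M[R]_m) x y :
  bilin (\sum_(i <- s) A i) x y = \sum_(i <- s) bilin (A i) x y.
Proof.
elim: s => [|i s IH]; last by rewrite !big_cons bilinDm IH.
by rewrite !big_nil /bilin mulmx0 mul0mx mxE.
Qed.

Lemma energy_le m (x : 'cV[R]_m) k : energy x k <= (\sum_i `|x i 0|) ^+ 2.
Proof.
rewrite /energy freqmxE bilin_covmx expr2 mulr_suml; apply: ler_sum => i _.
rewrite mulr_sumr; apply: ler_sum => j _.
apply: le_trans (ler_norm _) _; rewrite !normrM -[leRHS]mulr1.
by rewrite ler_wpM2l ?mulr_ge0// cos_max.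
Qed.

(** Multiplying the covariance function pointwise by a cutoff amounts to convolving
    the spectral measure with the weights of the cutoff. *)
Lemma zlim_smoothed n m (ph : int -> R) (x : 'cV[R]_m) :
  (forall a, 0 <= ph a) -> (forall a, ph (- a) = ph a) ->
  zlim (fun k => symsum (fun a => ph a * mu (k - a)) n * energy x k)
   (bilin (covmx (fun h => symsum (fun a => ph a * cos (a%:~R * h)) n * c h) m) x x).
Proof.
move=> ph0 phN.
have smu k : 0 <= energy x k by exact: energy_ge0.
pose idx (j : 'I_n.*2.+1) : int := j%:Z - n%:Z.
have ex a : exists l, zlim (fun k => mu k * energy x (k + a)) l.
  apply: (@zlim_dominated _ _ (fun k => (\sum_i `|x i 0|) ^+ 2 * mu k)) _ => [k|].
    by rewrite mulr_ge0//= mulrC ler_wpM2r// energy_le.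
  by apply: zlimZ; exact: zlim_mu.
have [l hl] := choice ex.
have h1 : zlim (fun k => \sum_j ph (idx j) * (mu k * energy x (k + idx j)))
    (\sum_j ph (idx j) * l (idx j)).
  by apply: zlim_sum => j; apply: zlimZ; exact: hl.
have h2 : zlim (fun k => symsum (fun a => ph a * mu (k - a)) n * energy x k)
    (\sum_j ph (idx j) * l (idx j)).
  have h : zlim (fun k => \sum_j ph (idx j) * (mu (k - idx j) * energy x k))
      (\sum_j ph (idx j) * l (idx j)).
    apply: zlim_sum => j; apply: zlimZ.
    have := @zlim_shift _ _ _ (- idx j) (fun k => mulr_ge0 (mu0 k) (smu (k + idx j))) (hl (idx j)).
    by apply: zlim_ext => k; rewrite subrK.
  apply: zlim_ext h => k; rewrite /symsum mulr_suml.
  by apply: eq_bigr => j _; rewrite mulrA.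
suff h3 : zlim (fun k => \sum_j ph (idx j) * (mu k * energy x (k + idx j)))
    (bilin (covmx (fun h => symsum (fun a => ph a * cos (a%:~R * h)) n * c h) m) x x).
  by rewrite -(zlim_uniq h1 h3).
apply: zlim_ext (zlim_bilin_covmx muc (fun h => symsum (fun a => ph a * cos (a%:~R * h)) n) x) => k.
have sN f : symsum (fun a => f (- a)) n = symsum f n :> R.
  rewrite !symsumE oppr0; congr (_ + _); apply: eq_bigr => i _.
  by rewrite opprK addrC.
transitivity (symsum (fun a => ph a * (mu k * energy x (k + a))) n); last by [].
have -> : symsum (fun a => ph a * (mu k * energy x (k + a))) n =
   symsum (fun a => 2^-1 * (ph a * (mu k * energy x (k + a)) + ph a * (mu k * energy x (k - a)))) n.
  rewrite symsumZ symsumD.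
  have -> : symsum (fun a => ph a * (mu k * energy x (k - a))) n =
     symsum (fun a => ph a * (mu k * energy x (k + a))) n.
    rewrite -[RHS]sN; congr symsum; apply/funext => a; by rewrite phN.
  by field.
have -> : covmx (fun h => symsum (fun a => ph a * cos (a%:~R * h)) n * cos (k%:~R * h)) m =
    \sum_j (ph (idx j) / 2) *: (freqmx m (k + idx j)%:~R + freqmx m (k - idx j)%:~R).
  transitivity (covmx (fun h => \sum_j ph (idx j) / 2 *
      (cos ((k + idx j)%:~R * h) + cos ((k - idx j)%:~R * h))) m).
    apply/matrixP => a b; rewrite [LHS]mxE [RHS]mxE; set h := (_ - _ : R).
    rewrite /symsum mulr_suml; apply: eq_bigr => j _.
    have e1 : (k + idx j)%:~R = k%:~R + (idx j)%:~R :> R by rewrite intrD.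
    have e2 : (k - idx j)%:~R = k%:~R - (idx j)%:~R :> R by rewrite intrB.
    rewrite e1 e2 [(_ + _) * h]mulrDl [(_ - _) * h]mulrBl cosB cosD -/(idx j).
    by field.
  rewrite covmx_sum; apply: eq_bigr => j _.
  by rewrite covmxZ covmxD !freqmxE.
rewrite bilin_sum mulr_sumr /symsum; apply: eq_bigr => j _.
by rewrite bilinZm bilinDm /energy -/(idx j); field.
Qed.

(** A matrix of bounded rank, with all frequencies up to [N] at level [b]; it
    absorbs the frequencies at which two spectral measures are not comparable. *)
Definition lowmx m N (b : R) : 'M[R]_m :=
  \sum_(j < N.*2.+1) b *: freqmx m (j%:Z - N%:Z)%:~R.

Lemma psd_lowmx m N b : 0 <= b -> psd (lowmx m N b).
Proof. by move=> b0; apply: psd_sum => j _; apply: psdZ => //; exact: psd_freqmx. Qed.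

Lemma zlim_lowmx m N b (x : 'cV[R]_m) :
  zlim (fun k => (if (`|k| <= N)%N then b else 0) * energy x k) (bilin (lowmx m N b) x x).
Proof.
have -> : bilin (lowmx m N b) x x =
    symsum (fun k => (if (`|k| <= N)%N then b else 0) * energy x k) N.
  rewrite bilin_sum; apply: eq_bigr => j _.
  by rewrite bilinZm absz_symsum_index.
by apply: zlim_finite => k Nk; rewrite leqNgt Nk mul0r.
Qed.

Lemma psd_compare m (A B : 'M[R]_m) (u v : int -> R) N b t :
  A^T = A -> B^T = B -> (forall k, 0 <= v k) -> 0 <= t ->
  (forall x, zlim (fun k => u k * energy x k) (bilin A x x)) ->
  (forall x, zlim (fun k => v k * energy x k) (bilin B x x)) ->
  (forall k, u k <= b) -> (forall k : int, (N < `|k|)%N -> u k <= t * v k) ->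
  psd (t *: B + lowmx m N b - A).
Proof.
move=> sA sB v0 t0 zA zB ub uv; split.
  have -> : (t *: B + lowmx m N b - A)^T = t *: B^T + (lowmx m N b)^T - A^T.
    by rewrite linearB linearD linearZ.
  rewrite sA sB; congr (_ + _ - _).
  rewrite /lowmx linear_sum; apply: eq_bigr => j _; rewrite linearZ /=; congr (_ *: _).
  exact: (psd_freqmx m _).1.
move=> x; rewrite bilinDm bilinDm bilinZm -scaleN1r bilinZm mulN1r subr_ge0.
apply: zlim_le (zA x) (zlimD (zlimZ t (zB x)) (zlim_lowmx N b x)) => k.
rewrite mulrA -mulrDl ler_wpM2r ?energy_ge0//.
case: leqP => kN; last by rewrite addr0 uv.
by apply: (le_trans (ub k)); rewrite lerDr mulr_ge0.
Qed.

(** Only logarithmic growth in the weights, since the rank is bounded. *)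
Lemma wdet_lowmx_le m N b (w : 'rV[R]_m) : nneg w -> 0 <= b ->
  wdet (2 *: w) (lowmx m N b) <= (1 + b * mass w) ^+ (2 * N.*2.+1).
Proof.
move=> w0 b0.
have := @wdet_freqmx_prod_le _ m w _ (enum 'I_N.*2.+1) (fun=> b)
  (fun j : 'I_N.*2.+1 => (j%:Z - N%:Z)%:~R) w0 (fun=> b0).
by rewrite !big_enum /= prodr_const card_ord -exprM.
Qed.

Variables (r M : R).
Hypotheses (M0 : 0 < M) (r0 : 0 < r).
Hypothesis mu_asymp : asymp_equiv absz_infty mu (fun k => M * (`|k|%N%:R `^ (- r))).

Local Notation ldet := (logdet c).

(** Multiplied by a Fejer cutoff, the covariance vanishes between the arcs, so that
    the determinant becomes a product over them. The price is a spectral measure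
    averaged over nearby frequencies: by [regular_smoothing] it is within a factor
    [1 + e] of the original one at high frequencies, and the remaining ones are
    absorbed by a matrix of bounded rank. *)
Lemma logdet_localize (d e : R) : 0 < d -> 0 < e <= 1 ->
  exists C m0, 0 <= C /\ forall n (I : eqType) (l : seq I) (w : I -> 'rV[R]_n.*2.+1),
    (m0 <= n)%N -> uniq l -> (forall i, nneg (w i)) ->
    (forall i j, i \in l -> j \in l -> i != j -> forall a b, w i 0 a != 0 -> w j 0 b != 0 ->
       d * n.*2.+1%:R <= `|a%:R - b%:R| <= (1 - d) * n.*2.+1%:R) ->
    forall s, 0 <= s ->
    \sum_(i <- l) ldet (w i) s <= ldet (\sum_(i <- l) w i) ((1 + e) * s) +
      (size l).+1%:R * (C * ln (1 + C * (s * mass (\sum_(i <- l) w i)))).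
Proof.
move=> d0 /andP[e0 e1].
pose e' := e / 4; have e'0 : 0 < e' by rewrite divr_gt0.
have e'1 : e' <= 1 by rewrite /e'; lra.
have e'2 : (1 + e') ^+ 2 <= 1 + e by rewrite /e'; nra.
pose p0 := Num.bound (r + 1); pose p := p0.+1; pose q := (2 * p0)%N.
have rq : r + 1 <= q%:R.
  apply: (@le_trans _ _ p0%:R); last by rewrite ler_nat /q mul2n -addnn leq_addr.
  by apply/ltW/archi_boundP; rewrite addr_ge0// ltW.
have p_gt0 : 0 < p%:R :> R by [].
pose la := d / (4 * p%:R).
have la0 : 0 < la by rewrite divr_gt0// mulr_gt0.
pose kap := (2 / la) ^+ (2 * p).
have kap0 : 0 < kap by rewrite exprn_gt0// divr_gt0.
have [N hN] := regular_smoothing mu0 mu_le_c0 M0 r0 mu_asymp rq kap0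
  (introT andP (conj e'0 e'1)).
pose b := c 0; have b0 : 0 <= b := c0_ge0.
pose C := (N.*2.+1)%:R + 2 * b.
have C0 : 0 <= C by rewrite addr_ge0// mulr_ge0.
exists C, (Num.bound (la^-1)); split => // n I l w m0n ul w0 sep s s0.
set m := n.*2.+1 in w w0 sep *.
have m0 : 0 < m%:R :> R by [].
have lam : 1 <= la * m%:R.
  rewrite -ler_pdivrMl// mulr1.
  have h : la^-1 <= (Num.bound (la^-1))%:R by apply/ltW/archi_boundP; rewrite invr_ge0 ltW.
  by apply: (le_trans h); rewrite ler_nat /m (leq_trans m0n)// -addnn -addnS leq_addr.
have [L [L1 L2]] : exists L : nat, la * m%:R <= L%:R /\ L%:R <= 2 * (la * m%:R).
  exists (Num.truncn (la * m%:R)).+1; split; first by rewrite ltW// truncnS_gt.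
  have : (Num.truncn (la * m%:R))%:R <= la * m%:R by rewrite truncn_le; lra.
  by rewrite -natr1; lra.
have L0 : (0 < L)%N by rewrite -(ltr_nat R); lra.
pose ph : int -> R := fejer_wt n L p.
have ph0 a : 0 <= ph a by exact: fejer_wt_ge0.
have ph1 : symsum ph n = 1 by exact: fejer_wt_sum.
have phle a : a != 0 -> (`|a| <= n)%N -> ph a <= kap / `|a|%N%:R ^+ (q + 2).
  have -> : (q + 2 = 2 * p)%N by rewrite /q /p mulnS addnC.
  exact: fejer_wt_le.
pose nu k := symsum (fun a => ph a * mu (k - a)) n.
have nu_ge0 k : 0 <= nu k by apply: symsum_ge0 => a; rewrite mulr_ge0.
have nu_le k : nu k <= b.
  rewrite -[b]mulr1 -ph1 -symsumZ; apply: ler_symsum => a.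
  by rewrite mulrC ler_wpM2r// mu_le_c0.
have hnu k : (N < `|k|)%N -> mu k <= (1 + e') * nu k /\ nu k <= (1 + e') * mu k.
  exact: hN n ph ph0 ph1 phle k.
pose f h := symsum (fun a => ph a * cos (a%:~R * h)) n.
pose SY := covmx (fun h => f h * c h) m; pose S := covmx c m.
have sS : S^T = S := (psd_covmx mu0 muc m).1.
have sSY : SY^T = SY.
  apply: covmx_tr => h; rewrite (cov_even muc); congr (_ * _).
  by rewrite /f /symsum; apply: eq_bigr => j _; rewrite mulrN cosN.
have zS x : zlim (fun k => mu k * energy x k) (bilin S x x) := zlim_energy muc x.
have zSY x : zlim (fun k => nu k * energy x k) (bilin SY x x).
  by apply: zlim_smoothed => // a; exact: fejer_wtN.
have pS : psd S := psd_covmx mu0 muc m.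
have pSY : psd SY.
  split => // x; apply: zlim_ge0 (zSY x) => k; by rewrite mulr_ge0// energy_ge0.
have t0 : 0 <= 1 + e' by lra.
pose Low := lowmx m N b.
have pLow : psd Low by exact: psd_lowmx.
have cmp1 : psd ((1 + e') *: SY + Low - S).
  apply: psd_compare zS zSY _ _ => //; first exact: mu_le_c0.
  by move=> k /hnu[].
have cmp2 : psd ((1 + e') *: S + Low - SY).
  apply: psd_compare zSY zS _ _ => //.
  by move=> k /hnu[].
pose W := \sum_(i <- l) w i.
have W0 : nneg W by apply: nneg_sum.
have nn2 (v : 'rV[R]_m) t : nneg v -> 0 <= t -> nneg (2 *: (t *: v)).
  by move=> v0 tt; do 2![apply: nnegZ => //].
have low_le (v : 'rV[R]_m) t : nneg v -> 0 <= t ->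
    ln (wdet (2 *: (t *: v)) Low) / 2 <= C * ln (1 + b * (t * mass v)).
  move=> v0 tt; have tv : nneg (t *: v) by exact: nnegZ.
  have base : 1 <= 1 + b * (t * mass v) by rewrite lerDl !mulr_ge0// mass_ge0.
  rewrite ler_pdivrMr//; apply: (@le_trans _ _ (ln ((1 + b * (t * mass v)) ^+ (2 * N.*2.+1)))).
    rewrite ler_ln ?posrE ?exprn_gt0 ?wdet_gt0//; last first.
    - by apply: lt_le_trans base.
    - exact: nn2.
    by rewrite -massZ; exact: wdet_lowmx_le.
  rewrite lnXn; last by apply: lt_le_trans base.
  rewrite -(mulr_natl _ (2 * N.*2.+1)) natrM [leRHS]mulrC -[leLHS]mulrA ler_pM2l//.
  by rewrite ler_wpM2r ?ln_ge0// /C lerDl mulr_ge0.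
have step i : i \in l -> ldet (w i) s <=
    ln (wdet (2 *: (s *: w i)) ((1 + e') *: SY)) / 2 + C * ln (1 + b * (s * mass W)).
  move=> il; have wi := nn2 _ _ (w0 i) s0.
  have pZ : psd ((1 + e') *: SY) by exact: psdZ.
  apply: (@le_trans _ _ (ln (wdet (2 *: (s *: w i)) ((1 + e') *: SY)) / 2 +
      ln (wdet (2 *: (s *: w i)) Low) / 2)).
    rewrite -mulrDl ler_pM2r// -lnM ?posrE ?wdet_gt0// ler_ln ?posrE ?mulr_gt0 ?wdet_gt0//.
    apply: le_trans (wdet_monoS wi pS cmp1) _.
    by have /andP[] := wdetDS_bounds wi pZ pLow.
  rewrite lerD2l; apply: le_trans (low_le _ _ (w0 i) s0) _.
  rewrite ler_wpM2l// ler_ln ?posrE ?ltr_pwDl ?mulr_ge0 ?mass_ge0//.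
  rewrite lerD2l ler_wpM2l// ler_wpM2l//.
  by rewrite /W mass_sum (big_rem i)//= lerDl sumr_ge0// => j _; exact: mass_ge0.
have blk : \sum_(i <- l) ln (wdet (2 *: (s *: w i)) ((1 + e') *: SY)) / 2 =
    ln (wdet (2 *: (s *: W)) ((1 + e') *: SY)) / 2.
  rewrite -mulr_suml; congr (_ / 2).
  have pZ : psd ((1 + e') *: SY) by exact: psdZ.
  have -> : 2 *: (s *: W) = \sum_(i <- l) 2 *: (s *: w i) by rewrite /W !scaler_sumr.
  rewrite wdet_sumw_block//.
    elim: (l) => [|i l' IH]; first by rewrite !big_nil ln1.
    rewrite !big_cons lnM ?posrE ?IH//; first exact: wdet_gt0 (nn2 _ _ (w0 i) s0) pZ.
    by apply: prodr_gt0 => j _; exact: wdet_gt0 (nn2 _ _ (w0 j) s0) pZ.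
  move=> i j il jl ij a a'; rewrite !mxE.
  have [->|wa] := eqVneq (w i 0 a) 0; first by rewrite !mulr0 !mul0r.
  have [->|wb] := eqVneq (w j 0 a') 0; first by rewrite !mulr0.
  have /andP[h1 h2] := sep i j il jl ij a a' wa wb.
  have -> : f (gridpt m a - gridpt m a') = 0; last by rewrite mul0r !mulr0 mul0r.
  have -> : gridpt m a - gridpt m a' = 2 * pi * (a%:Z - a'%:Z)%:~R / m%:R :> R.
    by rewrite /gridpt intrB -!pmulrn; ring.
  apply: fejer_cutoff_eq0 => z zL; apply/negP => /dvdzP[y yE].
  have zR : `|z%:~R| < d * m%:R :> R.
    rewrite -intr_norm; apply: (@le_lt_trans _ _ (p%:R * L%:R)).
      rewrite -natrM -abszE -pmulrn ler_nat; exact: zL.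
    apply: (@le_lt_trans _ _ (p%:R * (2 * (la * m%:R)))); first by rewrite ler_pM2l.
    have -> : p%:R * (2 * (la * m%:R)) = d * m%:R / 2.
      by rewrite /la; move: (m%:R : R) p_gt0 => mm; move: (p%:R : R) => pp pp0; field; rewrite gt_eqF.
    by rewrite ltr_pdivrMr// ltr_pMr ?mulr_gt0//; lra.
  have dR : (a%:R - a'%:R + z%:~R = y%:~R * m%:R :> R).
    have := congr1 (fun k : int => k%:~R : R) yE; rewrite intrD intrB intrM -!pmulrn.
    exact.
  have [y0|y0] := eqVneq y 0.
    move: dR; rewrite y0 mul0r => /eqP; rewrite addr_eq0 => /eqP dR.
    by move: h1; rewrite dR normrN leNgt zR.
  have ym : m%:R <= `|y%:~R * m%:R| :> R.
    rewrite normrM (ger0_norm (ltW m0)) ler_peMl ?(ltW m0)//.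
    by rewrite -intr_norm -[1]/(1%:~R) ler_int -gtz0_ge1 normr_gt0.
  have := le_lt_trans (ler_normD (a%:R - a'%:R) z%:~R) (ler_ltD h2 zR).
  by rewrite dR => /(le_lt_trans ym); lra.
have fin : ln (wdet (2 *: (s *: W)) ((1 + e') *: SY)) / 2 <=
    ldet W ((1 + e) * s) + C * ln (1 + b * ((1 + e') * s * mass W)).
  have s1 : 0 <= (1 + e') * s by rewrite mulr_ge0.
  have pZ : psd ((1 + e') *: S) by exact: psdZ.
  rewrite -wdetZ.
  have -> : (1 + e') *: (2 *: (s *: W)) = 2 *: (((1 + e') * s) *: W).
    by rewrite !scalerA; congr (_ *: _); ring.
  have Wn := nn2 _ _ W0 s1.
  apply: (@le_trans _ _ (ln (wdet (2 *: (((1 + e') * s) *: W)) ((1 + e') *: S)) / 2 +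
      ln (wdet (2 *: (((1 + e') * s) *: W)) Low) / 2)).
    rewrite -mulrDl ler_pM2r// -lnM ?posrE ?wdet_gt0// ler_ln ?posrE ?mulr_gt0 ?wdet_gt0//.
    apply: le_trans (wdet_monoS Wn pSY cmp2) _.
    by have /andP[] := wdetDS_bounds Wn pZ pLow.
  apply: lerD; last exact: low_le.
  apply: (@le_trans _ _ (ldet W ((1 + e') ^+ 2 * s))).
    rewrite -wdetZ /logdet.
    have -> : (1 + e') *: (2 *: (((1 + e') * s) *: W)) = 2 *: (((1 + e') ^+ 2 * s) *: W).
      by rewrite !scalerA; congr (_ *: _); ring.
    exact: lexx.
  apply: (logdet_monos mu0 muc) => //.
  by rewrite mulr_ge0 ?sqr_ge0//= ler_wpM2r.
have mW : 0 <= mass W by exact: mass_ge0.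
have sW : 0 <= s * mass W by rewrite mulr_ge0.
have lnC t : 0 <= t <= 2 -> C * ln (1 + b * (t * s * mass W)) <= C * ln (1 + C * (s * mass W)).
  move=> /andP[tt t2]; rewrite ler_wpM2l// ler_ln ?posrE ?ltr_pwDl ?mulr_ge0//.
  rewrite lerD2l; have -> : b * (t * s * mass W) = b * t * (s * mass W) by ring.
  rewrite ler_wpM2r//.
  have : b * t <= b * 2 by rewrite ler_wpM2l.
  have : 0 <= (N.*2.+1)%:R :> R by [].
  by rewrite /C; lra.
apply: (@le_trans _ _ (\sum_(i <- l) (ln (wdet (2 *: (s *: w i)) ((1 + e') *: SY)) / 2 +
   C * ln (1 + b * (s * mass W))))).
  by rewrite big_seq [leRHS]big_seq; apply: ler_sum.
rewrite big_split /= blk big_const_seq count_predT iter_addr_0.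
have l1 : C * ln (1 + b * (s * mass W)) <= C * ln (1 + C * (s * mass W)).
  by have := lnC 1; rewrite mul1r; apply; lra.
have l2 : C * ln (1 + b * ((1 + e') * s * mass W)) <= C * ln (1 + C * (s * mass W)).
  by apply: lnC; lra.
set K := C * ln (1 + C * (s * mass W)).
have -> : (size l).+1%:R * K = K + (size l)%:R * K by rewrite -natr1 mulrDl mul1r addrC.
rewrite -/W addrA; apply: lerD; last by rewrite -[leLHS]mulr_natl ler_wpM2l.
by apply: (le_trans fin); rewrite lerD2l.
Qed.

End Localize.

(** * Growth of the logarithmic determinants *)

Section PowBounds.
Context {R : realType}.
Implicit Types a e x y D : R.

(** Logarithmic error terms are negligible against [x^a]. *)
Lemma ln_le_pow a e D : 0 < a -> 0 < e -> 0 <= D ->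
  exists2 C, 0 <= C & forall x, 0 <= x -> ln (1 + D * x) <= e * x `^ a + C.
Proof.
move=> a0 e0 D0; have ea : 0 < e * a by rewrite mulr_gt0.
exists (ln (1 + D) + `|ln (e * a)| / a).
  by rewrite addr_ge0 ?ln_ge0 ?lerDl ?divr_ge0// ltW.
move=> x x0; have D1 : 0 < 1 + D by rewrite ltr_pwDl.
have [x1|x1] := leP x 1.
  apply: (@le_trans _ _ (ln (1 + D))).
    rewrite ler_ln ?posrE ?ltr_pwDl ?mulr_ge0// lerD2l.
    by rewrite -[leRHS]mulr1 ler_wpM2l.
  rewrite addrCA lerDl; apply: addr_ge0; first by rewrite mulr_ge0 ?powR_ge0 ?ltW.
  by rewrite divr_ge0// ltW.
have xp : 0 < x by apply: lt_trans x1.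
apply: (@le_trans _ _ (ln (1 + D) + ln x)).
  rewrite -lnM ?posrE// ler_ln ?posrE ?ltr_pwDl ?mulr_ge0 ?mulr_gt0//.
  by rewrite mulrDl mul1r lerD2r ltW.
rewrite addrCA lerD2l.
have h : ln (e * a * x `^ a) <= e * a * x `^ a.
  by apply/ltW/ln_sublinear; rewrite mulr_gt0// powR_gt0.
rewrite lnM ?posrE ?powR_gt0// ln_powR in h.
have h2 : - ln (e * a) <= `|ln (e * a)| by rewrite -normrN ler_norm.
rewrite -(ler_pM2l a0) mulrDr [a * (`|_| / a)]mulrC divfK ?gt_eqF//.
by rewrite mulrA [a * e]mulrC; lra.
Qed.

Lemma powR_le1D a x : 0 <= a <= 1 -> 0 <= x -> (1 + x) `^ a <= 1 + x.
Proof.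
move=> /andP[a0 a1] x0; rewrite -[leRHS]powRr1; last by rewrite addr_ge0.
by rewrite ler_powR// lerDl.
Qed.

Lemma powR_ge1B a x : 0 <= a <= 1 -> 0 <= x <= 1 -> 1 - x <= (1 - x) `^ a.
Proof.
move=> /andP[a0 a1] /andP[x0 x1].
have [->|xn] := eqVneq x 1; first by rewrite subrr powR_ge0.
have y0 : 0 < 1 - x by rewrite subr_gt0 lt_def eq_sym xn.
rewrite -{1}[1 - x]powRr1 ?(ltW y0)// /powR (gt_eqF y0) ler_expR.
by rewrite ler_wnM2r// ln_le0//; lra.
Qed.

Lemma powR_homo a x y : 0 <= a -> 0 <= x -> x <= y -> x `^ a <= y `^ a.
Proof.
by move=> a0 x0 xy; apply: ge0_ler_powR => //; rewrite nnegrE// (le_trans x0).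
Qed.

(** A substitute for the Hoelder inequality. *)
Lemma powR_le_affine a t y : 0 <= a <= 1 -> 0 < t -> 0 <= y ->
  y `^ a <= t `^ a + t `^ (a - 1) * y.
Proof.
move=> /andP[a0 a1] t0 y0; have [yt|ty] := leP y t.
  apply: le_trans (powR_homo a0 y0 yt) _.
  by rewrite lerDl mulr_ge0 ?powR_ge0.
have yp : 0 < y by apply: lt_trans ty.
apply: (@le_trans _ _ (t `^ (a - 1) * y)); last by rewrite lerDr powR_ge0.
have -> : y `^ a = y `^ (a - 1) * y.
  rewrite -{3}[y]powRr1 ?ltW// -powRD ?subrK//.
  by apply/implyP => _; rewrite gt_eqF.
rewrite ler_wpM2r ?(ltW yp)//.
have -> : a - 1 = - (1 - a) by ring.
by apply: powRN_anti (ltW ty) => //; lra.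
Qed.

End PowBounds.

Section Growth.
Context {R : realType}.
Variables (mu : int -> R) (c : R -> R) (r M : R).
Hypothesis mu0 : forall k, 0 <= mu k.
Hypothesis muc : forall h, zlim (fun k => mu k * cos (k%:~R * h)) (c h).
Hypotheses (M0 : 0 < M) (r1 : 1 < r).
Hypothesis mu_asymp : asymp_equiv absz_infty mu (fun k => M * (`|k|%N%:R `^ (- r))).

Local Notation ldet := (logdet c).
Local Notation a := (r^-1).

Let r0 : 0 < r. Proof. by apply: lt_trans r1. Qed.
Let a0 : 0 < a. Proof. by rewrite invr_gt0. Qed.
Let a1 : a < 1. Proof. by rewrite invf_lt1. Qed.
Let a01 : 0 < a < 1. Proof. by rewrite a0 a1. Qed.
Let a01' : 0 <= a <= 1. Proof. by rewrite !ltW. Qed.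

(** By [reflection_intE], [(2 M)^(1/r) pi / sin (pi / r)], the growth constant of
    [sum_k ln (1 + 2 M k^(-r) x)]. The factor [2] comes from the pairing of opposite
    frequencies. *)
Definition growth : R := (2 * M) `^ a * reflection_int a.

Lemma reflection_int_ge0 : 0 <= reflection_int a.
Proof.
rewrite reflection_intE// divr_ge0 ?pi_ge0// ltW// sin_gt0_pi//.
by rewrite mulr_gt0 ?pi_gt0//= gtr_pMr ?pi_gt0.
Qed.

Lemma growth_ge0 : 0 <= growth.
Proof. by rewrite mulr_ge0 ?powR_ge0 ?reflection_int_ge0. Qed.

Lemma growth_scale (t x : R) : 0 <= t -> 0 <= x ->
  reflection_int a * (t * (2 * M) * x) `^ a = t `^ a * (growth * x `^ a).
Proof.
move=> t0 x0; have m2 : 0 <= 2 * M by rewrite mulr_ge0// ltW.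
have e1 : (t * (2 * M) * x) `^ a = (t * (2 * M)) `^ a * x `^ a.
  by apply: powRM => //; rewrite mulr_ge0.
have e2 : (t * (2 * M)) `^ a = t `^ a * (2 * M) `^ a by exact: powRM.
by rewrite e1 e2 /growth; ring.
Qed.

Lemma pairmass_bounds e : 0 < e -> exists N : nat, forall k, (N <= k)%N ->
  (1 - e) * (2 * M) * k.+1%:R `^ (- r) <= pairmass mu k <=
  (1 + e) * (2 * M) * k.+1%:R `^ (- r).
Proof.
move=> e0.
have rho0 (k : int) : k != 0 -> 0 < M * (`|k|%N%:R `^ (- r)).
  by move=> k0; rewrite mulr_gt0// powR_gt0// ltr0n absz_gt0.
have [N hN] := asymp_equiv_bounds mu_asymp rho0 e0.
exists N => k Nk.
have := hN k.+1%:Z; rewrite absz_nat ltnS => /(_ Nk) /andP[h1 h2].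
have := hN (- k.+1%:Z); rewrite abszN absz_nat ltnS => /(_ Nk) /andP[h3 h4].
rewrite /pairmass; move: h1 h2 h3 h4; move: (_ `^ _) => z h1 h2 h3 h4.
by apply/andP; split; lra.
Qed.

Lemma sum_if_lt (N K : nat) (l : R) :
  \sum_(k < K) (if (k < N)%N then l else 0) = (minn K N)%:R * l.
Proof.
elim: K => [|K IH]; first by rewrite big_ord0 min0n mul0r.
rewrite big_ord_recr /= IH; case: ltnP => h.
  have -> : minn K.+1 N = K.+1 by apply/minn_idPl.
  by rewrite -natr1 mulrDl mul1r.
have -> : minn K.+1 N = N by apply/minn_idPr; exact: leqW.
by rewrite addr0.
Qed.

Let small_factor e : 0 < e -> exists2 e1, 0 < e1 <= 1 & growth * e1 <= e.
Proof.
move=> e0; have g0 := growth_ge0; have g1 : 0 < growth + 1 by lra.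
exists (Num.min 1 (e / (growth + 1))); first by rewrite lt_min ltr01 divr_gt0//= ge_min lexx.
apply: (@le_trans _ _ (growth * (e / (growth + 1)))).
  by rewrite ler_wpM2l// ge_min lexx orbT.
by rewrite mulrA ler_pdivrMr//; nra.
Qed.

Lemma pairmass_le k : pairmass mu k <= 2 * c 0.
Proof. by rewrite /pairmass mulr_natl mulr2n lerD//; apply: mu_le_c0. Qed.

(** The bound [logdet_le] with the sum evaluated asymptotically: frequencies up to
    a fixed index contribute a logarithm, the other ones are compared with the
    model sequence [(1 + e) 2 M k^(-r)]. *)
Lemma logdet_ub e : 0 < e -> exists2 C, 0 <= C & forall m (w : 'rV[R]_m) s,
  nneg w -> 0 <= s -> ldet w s <= (growth + e) * (s * mass w) `^ a + C.
Proof.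
move=> e0; have e20 : 0 < e / 2 by rewrite divr_gt0.
have [e1 /andP[e10 e11] ge1] := small_factor e20.
have [N hN] := pairmass_bounds e10.
pose b := c 0; have b0 : 0 <= b := c0_ge0 mu0 muc.
have [T TE] : {T | T = (1 + e1) * (2 * M)} by exists ((1 + e1) * (2 * M)).
pose D := 2 * b + T.
have T0 : 0 < T by rewrite TE mulr_gt0 ?mulr_gt0 ?addr_gt0.
have {}hN k : (N <= k)%N -> pairmass mu k <= T * k.+1%:R `^ (- r).
  by move=> /hN /andP[_]; rewrite TE.
have D0 : 0 <= D by rewrite addr_ge0 ?(ltW T0)// mulr_ge0.
pose n2 : R := N.+2%:R; have n20 : 0 < n2 by [].
have e2 : 0 < e / 2 / n2 by rewrite divr_gt0.
have [C C0 hC] := ln_le_pow a0 e2 D0.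
exists (n2 * C); first by rewrite mulr_ge0// ltW.
move=> m w s w0 s0; have [x xE] : {x | x = s * mass w} by exists (s * mass w).
have x0 : 0 <= x by rewrite xE mulr_ge0// mass_ge0.
rewrite -xE; apply: (logdet_le mu0 muc) => // K; rewrite -xE.
pose l := ln (1 + D * x); have l0 : 0 <= l by rewrite ln_ge0// lerDl mulr_ge0.
have lnl t : 0 <= t <= D -> ln (1 + t * x) <= l.
  move=> /andP[t0 tD]; rewrite ler_ln ?posrE ?ltr_pwDl ?mulr_ge0//.
  by rewrite lerD2l ler_wpM2r.
have h1 : ln (1 + mu 0 * x) <= l.
  by apply: lnl; rewrite mu0 (le_trans (mu_le_c0 mu0 muc 0))// /D -/b; lra.
have h2 : \sum_(k < K) ln (1 + pairmass mu k * x) <=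
    \sum_(k < K) ((if (k < N)%N then l else 0) + log_term r (T * x) k.+1%:R).
  apply: ler_sum => k _; case: ltnP => kN.
    apply: (@le_trans _ _ l); last by rewrite lerDl log_term_ge0// mulr_ge0// ltW.
    apply: lnl; rewrite pairmass_ge0//=; apply: (le_trans (pairmass_le k)).
    by rewrite lerDl ltW.
  rewrite add0r /log_term ler_ln ?posrE ?ltr_pwDl ?mulr_ge0 ?pairmass_ge0 ?powR_ge0 ?(ltW T0)//.
  by rewrite lerD2l mulrAC ler_wpM2r// hN.
have h3 : \sum_(k < K) log_term r (T * x) k.+1%:R <= l + reflection_int a * (T * x) `^ a.
  have [xz|xn] := eqVneq x 0.
    rewrite big1 ?addr_ge0 ?mulr_ge0 ?reflection_int_ge0 ?powR_ge0// => k _.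
    by rewrite /log_term xz mulr0 mul0r addr0 ln1.
  have Tx : 0 < T * x by rewrite mulr_gt0// lt_def xn.
  have := sum_log_term_ub K a01 Tx; rewrite invrK => h; apply: (le_trans h).
  rewrite lerD2r lnl// ltW//=; rewrite /D; lra.
have h4 : reflection_int a * (T * x) `^ a <= (growth + e / 2) * x `^ a.
  rewrite TE growth_scale//; last by lra.
  rewrite mulrA ler_wpM2r ?powR_ge0//.
  apply: (@le_trans _ _ ((1 + e1) * growth)); last by lra.
  by rewrite ler_wpM2r ?growth_ge0// powR_le1D// ltW.
have h5 : \sum_(k < K) (if (k < N)%N then l else 0) <= N%:R * l.
  by rewrite sum_if_lt ler_wpM2r// ler_nat geq_minr.
have h6 : n2 * l <= n2 * (e / 2 / n2 * x `^ a + C).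
  by rewrite ler_pM2l// hC.
rewrite big_split /= in h2.
have n2E : n2 = N%:R + 2 by rewrite /n2 -addn2 natrD.
have h7 : n2 * (e / 2 / n2 * x `^ a + C) = e / 2 * x `^ a + n2 * C.
  by rewrite mulrDr; congr (_ + _); field; rewrite gt_eqF.
rewrite h7 {1}n2E in h6.
move: h1 h2 h3 h4 h5 h6.
move: (\sum_(k < K) _) (\sum_(k < K) _) (\sum_(k < K) _) (x `^ a) (n2 * C) (ln _) (reflection_int a * _) (N%:R) => A1 A2 A3 xa nC l1 I1 NN.
by move=> *; lra.
Qed.

(** The same evaluation for the lower bound [logdet_unif_ge]; leaving out the first
    frequencies, where the model sequence is no lower bound, costs a logarithm. *)
Lemma logdet_unif_lb e : 0 < e -> exists2 C, 0 <= C & forall x, 0 <= x ->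
  exists m0, forall m, (m0 <= m)%N ->
  (growth - e) * (2 * pi * x) `^ a - C <= ldet (unifw m) x.
Proof.
move=> e0; have e20 : 0 < e / 2 by rewrite divr_gt0.
have [e1 /andP[e10 e11] ge1] := small_factor e20.
have [N hN] := pairmass_bounds e10.
have [T TE] : {T | T = (1 - e1) * (2 * M)} by exists ((1 - e1) * (2 * M)).
have T0 : 0 <= T.
  by rewrite TE; apply: mulr_ge0; [lra|rewrite mulr_ge0// ltW].
have {}hN k : (N <= k)%N -> T * k.+1%:R `^ (- r) <= pairmass mu k.
  by move=> /hN /andP[h _]; rewrite TE.
pose n1 : R := N.+1%:R; have n10 : 0 < n1 by [].
have e2 : 0 < e / 2 / n1 by rewrite divr_gt0.
have [C C0 hC] := ln_le_pow a0 e2 T0.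
exists (n1 * C + r + 1).
  by rewrite !addr_ge0// ?mulr_ge0// ltW.
move=> x x0; have [y yE] : {y | y = 2 * pi * x} by exists (2 * pi * x).
have y0 : 0 <= y by rewrite yE !mulr_ge0// pi_ge0.
rewrite -yE.
have [Ty|Ty] := eqVneq (T * y) 0.
  exists 0%N => m _; apply: (@le_trans _ _ 0); last first.
    by apply: (logdet_ge0 mu0 muc) => // i; rewrite mxE divr_ge0 ?mulr_ge0 ?pi_ge0.
  have : growth * y `^ a <= e / 2 * y `^ a.
    have [->|yn] := eqVneq y 0.
      by rewrite powR0 ?mulr0// gt_eqF.
    move/eqP: Ty; rewrite mulf_eq0 (negbTE yn) orbF TE mulf_eq0 [_ * M == 0]mulf_eq0.
    rewrite (gt_eqF M0) pnatr_eq0 /= orbF subr_eq0 => /eqP e1E.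
    by rewrite ler_wpM2r ?powR_ge0//; move: ge1; rewrite -e1E mulr1.
  have : 0 <= y `^ a := powR_ge0 _ _.
  have : 0 <= n1 * C by rewrite mulr_ge0// ltW.
  move: (y `^ a) (n1 * C) => ya nC h1 h2 h3.
  have : 0 <= e * ya by rewrite mulr_ge0// ltW.
  by move=> h4; rewrite mulrBl; move: h3 (ltW r0); move: (growth * ya) => g *; lra.
have Typ : 0 < T * y by rewrite lt_def Ty mulr_ge0.
have [K0 hK0] := sum_log_term_lb a01 Typ ltr01.
pose K := maxn K0 N; exists (2 * K).+1 => m Km.
apply: le_trans (logdet_unif_ge mu0 muc Km x0); rewrite -yE.
pose l := ln (1 + T * y); have l0 : 0 <= l by rewrite ln_ge0// lerDl mulr_ge0.
have h1 : \sum_(k < K) log_term r (T * y) k.+1%:R <=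
    \sum_(k < K) ((if (k < N)%N then l else 0) + ln (1 + pairmass mu k * y)).
  apply: ler_sum => k _; case: ltnP => kN.
    apply: (@le_trans _ _ l).
      rewrite /log_term /l ler_ln ?posrE ?ltr_pwDl ?mulr_ge0 ?powR_ge0// lerD2l.
      rewrite -[leRHS]mulr1 ler_wpM2l ?mulr_ge0//.
      have := @ler_powR R k.+1%:R; rewrite ler1n => /(_ isT (- r) 0).
      by rewrite powRr0; apply; rewrite oppr_le0 ltW.
    by rewrite lerDl ln_ge0// lerDl mulr_ge0// pairmass_ge0.
  rewrite add0r /log_term ler_ln ?posrE ?ltr_pwDl ?mulr_ge0 ?pairmass_ge0 ?powR_ge0//.
  by rewrite lerD2l mulrAC ler_wpM2r// hN.
have h2 : reflection_int a * (T * y) `^ a - l - r - 1 <= \sum_(k < K) log_term r (T * y) k.+1%:R.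
  by have := hK0 K (leq_maxl _ _); rewrite invrK.
have h4 : (growth - e / 2) * y `^ a <= reflection_int a * (T * y) `^ a.
  rewrite TE growth_scale//; last by lra.
  rewrite mulrA ler_wpM2r ?powR_ge0//.
  apply: (@le_trans _ _ ((1 - e1) * growth)); first by lra.
  by rewrite ler_wpM2r ?growth_ge0// powR_ge1B// e11 ltW.
have h5 : \sum_(k < K) (if (k < N)%N then l else 0) <= N%:R * l.
  by rewrite sum_if_lt ler_wpM2r// ler_nat geq_minr.
have h6 : n1 * l <= n1 * (e / 2 / n1 * y `^ a + C).
  by rewrite ler_pM2l// hC.
rewrite big_split /= in h1.
have n1E : n1 = N%:R + 1 by rewrite /n1 -natr1.
have h7 : n1 * (e / 2 / n1 * y `^ a + C) = e / 2 * y `^ a + n1 * C.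
  by rewrite mulrDr; congr (_ + _); field; rewrite gt_eqF.
rewrite h7 {1}n1E in h6.
move: h1 h2 h4 h5 h6.
move: (\sum_(k < K) _) (\sum_(k < K) _) (\sum_(k < K) _) (y `^ a) (n1 * C) (reflection_int a * _) (N%:R) => A1 A2 A3 ya nC I1 NN.
by move=> *; lra.
Qed.

(** The localization estimate with the logarithmic error term absorbed. *)
Lemma logdet_localize_pow (d e : R) (K : nat) : 0 < d -> 0 < e <= 1 ->
  exists C m0, 0 <= C /\ forall m (I : eqType) (l : seq I) (w : I -> 'rV[R]_m),
    (m0 <= m)%N -> odd m -> (size l <= K)%N -> uniq l -> (forall i, nneg (w i)) ->
    (forall i j, i \in l -> j \in l -> i != j -> forall u v, w i 0 u != 0 -> w j 0 v != 0 ->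
       d * m%:R <= `|u%:R - v%:R| <= (1 - d) * m%:R) ->
    forall s, 0 <= s ->
    \sum_(i <- l) ldet (w i) s <= ldet (\sum_(i <- l) w i) ((1 + e) * s) +
      e * (s * mass (\sum_(i <- l) w i)) `^ a + C.
Proof.
move=> d0 e01; have /andP[e0 _] := e01.
have [C [m0 [C0 h]]] := logdet_localize mu0 muc M0 r0 mu_asymp d0 e01.
pose KC := K.+1%:R * C; have KC0 : 0 <= KC by rewrite mulr_ge0.
have e2 : 0 < e / (KC + 1) by rewrite divr_gt0// ltr_wpDl.
have [C' C'0 hC'] := ln_le_pow a0 e2 C0.
exists (KC * C'), (m0.*2.+1); split; first by rewrite mulr_ge0.
move=> m I l w m0m mo lK ul w0 sep s s0.
have [n mE] : exists n, m = n.*2.+1.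
  by exists m./2; rewrite -[LHS]odd_double_half mo.
move: m0m w w0 sep; rewrite mE ltnS leq_double => m0n w w0 sep {mo}.
apply: (le_trans (h n I l w m0n ul w0 sep s s0)); rewrite -addrA lerD2l.
set x := s * mass _.
have x0 : 0 <= x by rewrite mulr_ge0// mass_ge0// ; apply: nneg_sum.
have l0 : 0 <= ln (1 + C * x) by rewrite ln_ge0// lerDl mulr_ge0.
apply: (@le_trans _ _ (KC * ln (1 + C * x))).
  by rewrite /KC -mulrA ler_wpM2r ?mulr_ge0// ler_nat ltnS.
apply: (@le_trans _ _ (KC * (e / (KC + 1) * x `^ a + C'))).
  by rewrite ler_wpM2l// hC'.
rewrite mulrDr lerD2r mulrA ler_wpM2r ?powR_ge0//.
have kc : 0 < KC + 1 by rewrite ltr_wpDl.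
rewrite mulrA ler_pdivrMr// mulrC ler_pM2l//.
by rewrite lerDl.
Qed.

End Growth.

(** * Piecewise constant weights *)

Section Arcs.
Context {R : realType}.

(** Each grid point carries the mass [2 pi / m] of its cell, so that the whole
    circle has mass [2 pi]. *)
Definition arcw m b len : 'rV[R]_m :=
  \row_j (if (b <= j < b + len)%N then 2 * pi / m%:R else 0).

Lemma arcw_nneg m b len : nneg (arcw m b len).
Proof.
by move=> j; rewrite mxE; case: ifP => _ //; rewrite divr_ge0 ?mulr_ge0 ?pi_ge0.
Qed.

Lemma arcwD m b l1 l2 : arcw m b (l1 + l2) = arcw m b l1 + arcw m (b + l1) l2.
Proof.
apply/rowP => j; rewrite !mxE.
case: ifP => h1; case: ifP => h2; case: ifP => h3; rewrite ?addr0 ?add0r//;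
  exfalso; move: h1 h2 h3; lia.
Qed.

Lemma arcw_le m b l1 l2 i : (l1 <= l2)%N -> arcw m b l1 0 i <= arcw m b l2 0 i.
Proof. by move=> l12; rewrite -(subnKC l12) arcwD [leRHS]mxE lerDl; exact: arcw_nneg. Qed.

Lemma mass_arcw m b len : (b + len <= m)%N -> mass (arcw m b len) = 2 * pi * len%:R / m%:R.
Proof.
move=> blm; rewrite /mass.
under eq_bigr do rewrite mxE.
rewrite -(big_mkord xpredT (fun j => if (b <= j < b + len)%N then 2 * pi / m%:R else 0 : R)).
rewrite (@big_cat_nat _ _ _ b)//=; last by rewrite (leq_trans _ blm)// leq_addr.
rewrite (@big_cat_nat _ _ _ (b + len) b)//=; last exact: leq_addr.
rewrite big_nat big1 => [|j]; last by case: ifP => //; lia.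
rewrite [X in _ + (_ + X)]big_nat [X in _ + (_ + X)]big1 => [|j]; last by case: ifP => //; lia.
rewrite add0r addr0 big_nat.
rewrite (eq_bigr (fun=> 2 * pi / m%:R)) => [|j ->//].
rewrite -big_nat sumr_const_nat addKn.
by rewrite -[LHS]mulr_natr mulrAC.
Qed.

Definition stepw n m' (q : 'I_n -> R) : 'rV[R]_(n * m') :=
  \sum_i q i *: arcw (n * m') (i * m') m'.

Lemma stepw_nneg n m' (q : 'I_n -> R) : (forall i, 0 <= q i) -> nneg (stepw m' q).
Proof. by move=> q0; apply: nneg_sum => i _; apply: nnegZ => //; exact: arcw_nneg. Qed.

Lemma stepwE n m' (q : 'I_n -> R) (i : 'I_n) (j : 'I_(n * m')) :
  (i * m' <= j < i * m' + m')%N -> stepw m' q 0 j = q i * (2 * pi / (n * m')%:R).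
Proof.
move=> ij; rewrite summxE (bigD1 i)//= big1 => [|k ki].
  by rewrite !mxE ij addr0.
rewrite !mxE; case: ifP => kj; last by rewrite mulr0.
exfalso; move: ki; rewrite -val_eqE /=; apply/negP; rewrite negbK; apply/eqP.
move: ij kj => /andP[h1 h2] /andP[h3 h4].
have := leq_ltn_trans h1 h4; have := leq_ltn_trans h3 h2.
rewrite -!mulSnr !ltn_pmul2r; lia.
Qed.

Lemma unifw_stepw n m' : unifw (n * m') = stepw m' (fun _ : 'I_n => 1 : R).
Proof.
apply/rowP => j; have j1 := ltn_ord j.
have m0 : (0 < m')%N by move: (leq_ltn_trans (leq0n _) j1); rewrite muln_gt0 => /andP[].
have jn : (j %/ m' < n)%N by rewrite ltn_divLR.
rewrite (@stepwE _ _ _ (Ordinal jn)) /=; first by rewrite mxE mul1r.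
by rewrite leq_trunc_div /= {1}(divn_eq j m') ltn_add2l ltn_pmod.
Qed.

Variables (mu : int -> R) (c : R -> R).
Hypothesis mu0 : forall k, 0 <= mu k.
Hypothesis muc : forall h, zlim (fun k => mu k * cos (k%:~R * h)) (c h).

Local Notation ldet := (logdet c).

Lemma cov_periodic h (z : int) : c (h + 2 * pi * z%:~R) = c h.
Proof.
apply: zlim_uniq (muc _) _; apply: zlim_ext (muc h) => k; congr (_ * _).
rewrite mulrDr.
have -> : k%:~R * (2 * pi * z%:~R) = 2 * pi * (k * z)%:~R :> R by rewrite intrM; ring.
by rewrite cosD2pin.
Qed.

(** The process is stationary, so the determinant depends only on the length of
    an arc. *)
Lemma logdet_arcw_shift m b len s : (b + len <= m)%N ->
  ldet (arcw m b len) s = ldet (arcw m 0 len) s.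
Proof.
move=> blm; have [m0|m0] := posnP m.
  by congr (ldet _ s); apply/rowP => j; have := ltn_ord j; rewrite {2}m0.
pose p (j : 'I_m) : 'I_m := Ordinal (ltn_pmod (j + (m - b)) m0).
have pinj : injective p.
  move=> j k /(congr1 val) /eqP; rewrite /= eqn_modDr !modn_small// => /eqP h.
  exact: val_inj.
have pE (j : 'I_m) : exists z : nat, (p j + m * z = j + (m - b))%N.
  by exists ((j + (m - b)) %/ m)%N; rewrite /= addnC mulnC -divn_eq.
apply: (@logdet_perm _ _ _ (perm pinj)) => [j|j k].
  rewrite !mxE permE /= add0n.
  have jm := ltn_ord j; have [bj|jb] := leqP b j.
    have -> : (j + (m - b) = j - b + m)%N by lia.
    rewrite modnDr modn_small; last by lia.
    by congr (if _ then _ else _); apply/idP/idP; lia.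
  rewrite modn_small; last by lia.
  by case: ifP => //; lia.
rewrite !mxE !permE; have [z1 e1] := pE j; have [z2 e2] := pE k.
have mr : m%:R != 0 :> R by rewrite pnatr_eq0 -lt0n.
have E (x : 'I_m) z : (p x + m * z = x + (m - b))%N ->
    gridpt m (p x) = gridpt m x + gridpt m (m - b) - 2 * pi * z%:R :> R.
  move=> /(congr1 (fun k : nat => k%:R : R)); rewrite !natrD natrM => h.
  rewrite /gridpt; have -> : (p x)%:R = x%:R + (m - b)%N%:R - m%:R * z%:R :> R.
    by rewrite -h addrK.
  have gen (P x1 x2 mm zz : R) : mm != 0 -> 2 * P * (x1 + x2 - mm * zz) / mm =
    2 * P * x1 / mm + 2 * P * x2 / mm - 2 * P * zz by move=> mm0; field.
  exact: gen.
rewrite (E _ _ e1) (E _ _ e2) -[LHS](cov_periodic _ (z2%:Z - z1%:Z)); congr c.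
rewrite intrB -!pmulrn; ring.
Qed.

Lemma arc_in n m' (i : 'I_n) : (i * m' + m' <= n * m')%N.
Proof. by rewrite -mulSnr leq_mul2r ltn_ord orbT. Qed.

(** Subadditivity in the weights, with stationarity bringing all arcs to the same
    place. *)
Lemma logdet_stepw_le n m' (q : 'I_n -> R) s : (forall i, 0 <= q i) -> 0 <= s ->
  ldet (stepw m' q) s <= \sum_i ldet (arcw (n * m') 0 m') (q i * s).
Proof.
move=> q0 s0; rewrite /stepw -big_enum -[leRHS]big_enum /=.
apply: (le_trans (logdet_sum_le mu0 muc _ _ s0)).
  by move=> i; apply: nnegZ => //; exact: arcw_nneg.
apply: ler_sum => i _; rewrite logdetZ logdet_arcw_shift//; exact: arc_in.
Qed.

(** Arcs of [n m'] grid points trimmed by [g] are at least [g] apart, also across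
    the origin of the circle. *)
Lemma trimmed_separated n m' g (i j : 'I_n) (u v : nat) : (g <= m')%N -> i != j ->
  (i * m' <= u < i * m' + (m' - g))%N -> (j * m' <= v < j * m' + (m' - g))%N ->
  (g%:R : R) <= `|u%:R - v%:R : R| <= (n * m')%:R - g%:R.
Proof.
move=> gm; wlog ij : i j u v / (i < j)%N => [hw|] ij'.
  move=> hu hv; have [ij|ji|ij] := ltngtP i j.
  - exact: hw hu hv.
  - by rewrite distrC; apply: (hw j i) => //; rewrite eq_sym.
  - by move: ij'; rewrite -val_eqE /= ij eqxx.
move=> /andP[u1 u2] /andP[v1 v2].
have h1 : (i.+1 * m' <= j * m')%N by rewrite leq_mul2r ij orbT.
have h2 : (j.+1 * m' <= n * m')%N by rewrite leq_mul2r ltn_ord orbT.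
rewrite !mulSn in h1 h2.
have uv : (u + g <= v)%N by lia.
have uv2 : (v - u + g <= n * m')%N by lia.
have uvle : (u <= v)%N by lia.
rewrite distrC -(natrB _ uvle) normr_nat lerBrDr -natrD !ler_nat uv2 andbT; lia.
Qed.

Variables (r M : R).
Hypotheses (M0 : 0 < M) (r1 : 1 < r).
Hypothesis mu_asymp : asymp_equiv absz_infty mu (fun k => M * (`|k|%N%:R `^ (- r))).

Local Notation a := (r^-1).
Local Notation growth := (growth r M).

Let r0 : 0 < r. Proof. by apply: lt_trans r1. Qed.
Let a0 : 0 < a. Proof. by rewrite invr_gt0. Qed.
Let a1 : a < 1. Proof. by rewrite invf_lt1. Qed.

(** A short arc has small mass, to which the upper bound of the logarithmic
    determinant applies. *)
Lemma logdet_short_arc (n : nat) e : (0 < n)%N -> 0 < e ->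
  exists d : R, 0 < d <= 1 / 2 /\ exists2 C : R, 0 <= C &
  forall (m' g b : nat) (x : R), g%:R <= d * m'%:R -> (b + g <= n * m')%N -> 0 <= x ->
  ldet (arcw (n * m') b g) x <= e * x `^ a + C.
Proof.
move=> n0 e0; have [C C0 hC] := logdet_ub mu0 muc M0 r1 mu_asymp ltr01.
have G0 := growth_ge0 M r1.
pose e1 := e / (growth + 1); have e10 : 0 < e1 by rewrite divr_gt0// ltr_wpDl.
have p0 : 0 < 2 * pi :> R by rewrite mulr_gt0// pi_gt0.
pose d := Num.min (1 / 2) (e1 `^ r / (2 * pi)).
have d0 : 0 < d by rewrite lt_min divr_gt0//= divr_gt0// powR_gt0.
exists d; split; first by rewrite d0 ge_min lexx.
exists C => // m' g b x gd bg x0.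
apply: le_trans (hC _ _ _ (@arcw_nneg (n * m') b g) x0) _; rewrite lerD2r mass_arcw//.
have -> : e = (growth + 1) * e1 by rewrite /e1 mulrC divfK// gt_eqF// ltr_wpDl.
rewrite -[leRHS]mulrA ler_wpM2l ?addr_ge0//.
have [gz|gp] := posnP g.
  by rewrite gz mulr0 mul0r mulr0 powR0 ?gt_eqF// mulr_ge0 ?powR_ge0// ltW.
have nm0 : (0 < n * m')%N by apply: leq_trans bg; rewrite addn_gt0 gp orbT.
have y0 : 0 <= 2 * pi * g%:R / (n * m')%:R :> R.
  by rewrite divr_ge0 ?mulr_ge0 ?pi_ge0.
rewrite mulrC powRM// ler_wpM2r ?powR_ge0//.
apply: (@le_trans _ _ ((e1 `^ r) `^ a)).
  apply: powR_homo => //; first exact: ltW.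
  rewrite ler_pdivrMr ?ltr0n//.
  apply: (@le_trans _ _ (2 * pi * (d * m'%:R))); first by rewrite ler_pM2l.
  rewrite mulrA; apply: ler_pM => //; first by rewrite mulr_ge0 ?ltW.
    by rewrite mulrC -ler_pdivlMr// ge_min lexx orbT.
  by rewrite ler_nat leq_pmull.
by rewrite -powRrM mulfV ?gt_eqF// powRr1 // ltW.
Qed.

(** Cutting short gaps between the arcs makes them almost independent, while the
    gaps themselves contribute little. *)
Lemma logdet_stepw_ge n e : odd n -> 0 < e <= 1 ->
  exists C m0, 0 <= C /\ forall m' (q : 'I_n -> R) s, (m0 <= m')%N -> odd m' ->
    (forall i, 0 <= q i) -> 0 <= s ->
  \sum_i ldet (arcw (n * m') 0 m') (q i * s) <=
  ldet (stepw m' q) ((1 + e) * s) + e * (s * \sum_i q i) `^ a + C.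
Proof.
move=> on /andP[e0 e1]; have n0 : (0 < n)%N by case: (n) on.
have nr0 : 0 < n%:R :> R by rewrite ltr0n.
have p0 : 0 < 2 * pi :> R by rewrite mulr_gt0// pi_gt0.
have P0 : 0 < (2 * pi) `^ a by rewrite powR_gt0.
pose e2 := e / 2 / n%:R; have e20 : 0 < e2 by rewrite !divr_gt0.
have [d [/andP[d0 d2] [C1 C10 h1]]] := logdet_short_arc n0 e20.
pose e3 := Num.min e (e / 2 / (2 * pi) `^ a).
have e30 : 0 < e3 by rewrite lt_min e0 !divr_gt0.
have e31 : e3 <= 1 by rewrite ge_min e1.
have e3e : e3 <= e by rewrite ge_min lexx.
have e3p : e3 * (2 * pi) `^ a <= e / 2 by rewrite -ler_pdivlMr// ge_min lexx orbT.
have d' : 0 < d / (2 * n%:R) by rewrite divr_gt0// mulr_gt0.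
have [C2 [m1 [C20 h2]]] := logdet_localize_pow mu0 muc M0 r1 mu_asymp n d'
  (introT andP (conj e30 e31)).
exists (n%:R * C1 + C2), (maxn m1 (Num.bound (2 / d))).
split; first by rewrite addr_ge0 ?mulr_ge0.
move=> m' q s; rewrite geq_max => /andP[m1m bm] om q0 s0.
have m'0 : (0 < m')%N by case: (m') om.
have mr0 : 0 < m'%:R :> R by rewrite ltr0n.
have dm2 : 2 <= d * m'%:R.
  rewrite mulrC -ler_pdivrMr//; apply: (@le_trans _ _ (Num.bound (2 / d))%:R).
    by apply/ltW/archi_boundP; rewrite divr_ge0// ltW.
  by rewrite ler_nat.
pose g := Num.truncn (d * m'%:R).
have g1 : g%:R <= d * m'%:R by rewrite truncn_le; lra.
have g2 : d / 2 * m'%:R <= g%:R.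
  have : d * m'%:R < g.+1%:R by rewrite truncnS_gt.
  by rewrite -natr1; lra.
have gm : (g <= m')%N by rewrite -(ler_nat R) (le_trans g1)// ler_piMl//; lra.
pose w i := q i *: arcw (n * m') (i * m') (m' - g) : 'rV[R]_(n * m').
have w0 i : nneg (w i) by apply: nnegZ => //; exact: arcw_nneg.
have loc : \sum_i ldet (w i) s <= ldet (\sum_i w i) ((1 + e3) * s) +
    e3 * (s * mass (\sum_i w i)) `^ a + C2.
  rewrite -[X in X <= _]big_enum -big_enum /=; apply: h2 => //.
  - by rewrite (leq_trans m1m)// leq_pmull.
  - by rewrite oddM on om.
  - by rewrite -cardE card_ord.
  - exact: enum_uniq.
  move=> i j _ _ ij u v; rewrite !mxE => wu wv.
  have uA : (i * m' <= u < i * m' + (m' - g))%N.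
    by move: wu; case: ifP => //; rewrite mulr0 eqxx.
  have vA : (j * m' <= v < j * m' + (m' - g))%N.
    by move: wv; case: ifP => //; rewrite mulr0 eqxx.
  have /andP[k1 k2] := trimmed_separated gm ij uA vA.
  have dE : d / (2 * n%:R) * (n * m')%:R = d / 2 * m'%:R.
    by rewrite natrM; field; rewrite gt_eqF.
  rewrite mulrBl mul1r dE; apply/andP; split; first exact: le_trans k1.
  by apply: (le_trans k2); rewrite lerD2l lerN2.
have trim i : ldet (arcw (n * m') 0 m') (q i * s) <=
    ldet (w i) s + (e2 * (q i * s) `^ a + C1).
  have qs : 0 <= q i * s by rewrite mulr_ge0.
  have -> : arcw (n * m') 0 m' = arcw (n * m') 0 (m' - g) + arcw (n * m') (0 + (m' - g)) g.
    by rewrite -arcwD subnK.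
  apply: (le_trans (logdetD_le mu0 muc _ _ qs)); [exact: arcw_nneg|exact: arcw_nneg|].
  apply: lerD; last by apply: h1 => //; rewrite add0n subnK// leq_pmull.
  rewrite logdetZ logdet_arcw_shift//.
  by apply: leq_trans (arc_in m' i); rewrite leq_add2l leq_subr.
have qle i : (q i * s) `^ a <= (s * \sum_i q i) `^ a.
  apply: powR_homo; [exact: ltW|by rewrite mulr_ge0|].
  by rewrite mulrC ler_wpM2l// (bigD1 i)//= lerDl sumr_ge0.
set Z := (s * \sum_i q i) `^ a in qle *.
have Z0 : 0 <= Z by exact: powR_ge0.
have s1 : \sum_i ldet (arcw (n * m') 0 m') (q i * s) <=
    \sum_i ldet (w i) s + n%:R * (e2 * Z + C1).
  apply: (@le_trans _ _ (\sum_i (ldet (w i) s + (e2 * Z + C1)))).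
    apply: ler_sum => i _; apply: (le_trans (trim i)).
    by rewrite lerD2l lerD2r ler_wpM2l// ltW.
  by rewrite big_split /= sumr_const card_ord -[X in _ + X]mulr_natl.
have s2 : ldet (\sum_i w i) ((1 + e3) * s) <= ldet (stepw m' q) ((1 + e) * s).
  apply: (@le_trans _ _ (ldet (stepw m' q) ((1 + e3) * s))).
    apply: (logdet_monow mu0 muc) => //.
    - by apply: nneg_sum.
    - move=> j; rewrite !summxE; apply: ler_sum => i _; rewrite [leLHS]mxE [leRHS]mxE ler_wpM2l//.
      exact: arcw_le (leq_subr _ _).
    - by rewrite mulr_ge0// addr_ge0// ltW.
  apply: (logdet_monos mu0 muc); first exact: stepw_nneg.
  by rewrite ler_wpM2r ?lerD2l// andbT mulr_ge0// addr_ge0// ltW.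
have s3 : e3 * (s * mass (\sum_i w i)) `^ a <= e / 2 * Z.
  have mw : mass (\sum_i w i) <= 2 * pi * \sum_i q i.
    rewrite mass_sum mulr_sumr; apply: ler_sum => i _.
    rewrite massZ mulrC ler_wpM2r// mass_arcw; last first.
      by apply: leq_trans (arc_in m' i); rewrite leq_add2l leq_subr.
    rewrite ler_pdivrMr ?ltr0n ?muln_gt0 ?n0// ler_pM2l// ler_nat.
    by rewrite (leq_trans (leq_subr _ _))// leq_pmull.
  have mw0 : 0 <= mass (\sum_i w i) by apply: mass_ge0; apply: nneg_sum.
  apply: (@le_trans _ _ (e3 * ((2 * pi) `^ a * Z))).
    rewrite ler_wpM2l ?(ltW e30)// /Z -powRM ?(ltW p0) ?mulr_ge0 ?sumr_ge0//.
    apply: powR_homo; [exact: ltW|by rewrite mulr_ge0|].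
    by rewrite mulrCA ler_wpM2l.
  by rewrite mulrA ler_wpM2r.
have nE : n%:R * (e2 * Z + C1) = e / 2 * Z + n%:R * C1.
  by rewrite mulrDr /e2; congr (_ + _); field; rewrite gt_eqF.
rewrite nE in s1.
have eZ : e * Z = e / 2 * Z + e / 2 * Z by field.
rewrite eZ; apply: (le_trans s1); rewrite [n%:R * C1 + _]addrC [leLHS]addrA [leRHS]addrA.
rewrite lerD2r; apply: le_trans (lerD loc (lexx _)) _.
rewrite [leLHS]addrAC lerD2r -[leLHS]addrA; apply: lerD => //.
by rewrite lerD2r.
Qed.

End Arcs.

(** * Asymptotics of the logarithmic determinants *)

Section Asymptotics.
Context {R : realType}.
Variables (mu : int -> R) (c : R -> R).
Hypothesis mu0 : forall k, 0 <= mu k.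
Hypothesis muc : forall h, zlim (fun k => mu k * cos (k%:~R * h)) (c h).
Variables (r M : R).
Hypotheses (M0 : 0 < M) (r1 : 1 < r).
Hypothesis mu_asymp : asymp_equiv absz_infty mu (fun k => M * (`|k|%N%:R `^ (- r))).

Local Notation ldet := (logdet c).
Local Notation a := (r^-1).

Let r0 : 0 < r. Proof. by apply: lt_trans r1. Qed.
Let a0 : 0 < a. Proof. by rewrite invr_gt0. Qed.
Let a1 : a < 1. Proof. by rewrite invf_lt1. Qed.
Let a01 : 0 <= a <= 1. Proof. by rewrite !ltW. Qed.

Let G : R := growth r M.
Let G0 : 0 <= G. Proof. exact: growth_ge0 M r1. Qed.
Let p0 : 0 < 2 * pi :> R. Proof. by rewrite mulr_gt0// pi_gt0. Qed.

Let powRMl (t x : R) : 0 <= t -> 0 <= x -> (t * x) `^ a = t `^ a * x `^ a.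
Proof. by move=> t0 x0; rewrite powRM. Qed.

Lemma factor_le (K e : R) : 0 <= K -> 0 < e -> exists2 e1, 0 < e1 <= 1 & e1 * K <= e.
Proof.
move=> K0 e0; have K1 : 0 < K + 1 by lra.
exists (Num.min 1 (e / (K + 1))); first by rewrite lt_min ltr01 divr_gt0//= ge_min lexx.
apply: (@le_trans _ _ (e / (K + 1) * K)).
  by rewrite ler_wpM2r// ge_min lexx orbT.
by rewrite mulrAC ler_pdivrMr//; nra.
Qed.

Lemma mass_unifw m : (0 < m)%N -> mass (unifw m) = 2 * pi :> R.
Proof.
move=> m0; rewrite /mass; under eq_bigr do rewrite mxE.
by rewrite sumr_const card_ord -[LHS]mulr_natr divfK// pnatr_eq0 -lt0n.
Qed.

(** The [n] arcs are translates of one another and almost independent, and together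
    they carry the uniform weight on the circle. Hence each of them accounts for
    one [n]-th of the growth of the full determinant. *)
Lemma arc_bounds n e : odd n -> 0 < e -> exists2 C, 0 <= C & forall x, 0 <= x ->
  exists m0, forall m', (m0 <= m')%N -> odd m' ->
  `|ldet (arcw (n * m') 0 m') x - G * (2 * pi) `^ a / n%:R * x `^ a| <= e * x `^ a + C.
Proof.
move=> on e0; have n0 : (0 < n)%N by case: (n) on.
have nr0 : 0 < n%:R :> R by rewrite ltr0n.
pose P := (2 * pi : R) `^ a; have P0 : 0 <= P by exact: powR_ge0.
pose K := (G + 2) * P + n%:R `^ a.
have K0 : 0 <= K by rewrite addr_ge0 ?mulr_ge0 ?powR_ge0 ?addr_ge0.
have ne : 0 < n%:R * e by rewrite mulr_gt0.
have [e1 /andP[e10 e11] e1K] := factor_le K0 ne.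
have [C1 [m1 [C10 h1]]] := logdet_stepw_ge mu0 muc M0 r1 mu_asymp on
  (introT andP (conj e10 e11)).
have [C2 C20 h2] := logdet_ub mu0 muc M0 r1 mu_asymp e10.
have [C3 C30 h3] := logdet_unif_lb mu0 muc M0 r1 mu_asymp e10.
exists (C1 + C2 + C3); first by rewrite !addr_ge0.
move=> x x0; have [m2 hm2] := h3 x x0.
exists (maxn m1 m2) => m'; rewrite geq_max => /andP[m1m m2m] om.
have m'0 : (0 < m')%N by case: (m') om.
set f := ldet _ x; pose X := x `^ a; have X0 : 0 <= X by exact: powR_ge0.
have sumf s : \sum_(i < n) ldet (arcw (n * m') 0 m') (1 * s) =
    n%:R * ldet (arcw (n * m') 0 m') s.
  by rewrite mul1r sumr_const card_ord mulr_natl.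
have up : n%:R * f <= G * P * X + e1 * K * X + (C1 + C2).
  have := h1 m' (fun=> 1) x m1m om (fun=> ler01) x0.
  rewrite sumf -/f -unifw_stepw sumr_const card_ord => h.
  have u0 : nneg (unifw (n * m') : 'rV[R]_(n * m')).
    by move=> i; rewrite mxE divr_ge0// ltW.
  have e1x : 0 <= (1 + e1) * x by rewrite mulr_ge0//; lra.
  have := h2 _ _ _ u0 e1x; rewrite mass_unifw ?muln_gt0 ?n0// => h'.
  apply: (le_trans h).
  have q1 : ((1 + e1) * x * (2 * pi)) `^ a <= (1 + e1) * (P * X).
    rewrite -mulrA powRMl; [|lra|by rewrite mulr_ge0// ltW].
    have -> : (x * (2 * pi)) `^ a = P * X by rewrite mulrC powRMl// ltW.
    by rewrite ler_wpM2r ?mulr_ge0// powR_le1D// ltW.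
  have q2 : (x * n%:R) `^ a = n%:R `^ a * X by rewrite mulrC powRMl.
  have PX : 0 <= P * X by rewrite mulr_ge0.
  have q3 : (G + e1) * ((1 + e1) * x * (2 * pi)) `^ a <= (G + e1 * (G + 2)) * (P * X).
    apply: (@le_trans _ _ ((G + e1) * ((1 + e1) * (P * X)))).
      by rewrite ler_wpM2l// addr_ge0// ltW.
    rewrite [leLHS]mulrA ler_wpM2r// -subr_ge0.
    have -> : G + e1 * (G + 2) - (G + e1) * (1 + e1) = e1 * (1 - e1) by ring.
    by rewrite mulr_ge0 ?subr_ge0// ltW.
  rewrite q2; move: h' q3; rewrite /K -/G.
  move: (ldet _ _) ((_ * _) `^ a) (n%:R `^ a) => l1 z na h' q3.
  have -> : G * P * X + e1 * ((G + 2) * P + na) * X + (C1 + C2) =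
    (G + e1 * (G + 2)) * (P * X) + C2 + e1 * (na * X) + C1 by ring.
  by rewrite lerD2r lerD2r; apply: (le_trans h'); rewrite lerD2r.
have lo : G * P * X - e1 * K * X - C3 <= n%:R * f.
  have nm : (m2 <= n * m')%N by rewrite (leq_trans m2m)// leq_pmull.
  have := hm2 _ nm; rewrite unifw_stepw => h.
  have := logdet_stepw_le mu0 muc m' (fun _ : 'I_n => ler01) x0.
  rewrite sumf -/f => h'; have := le_trans h h'; apply: le_trans.
  have -> : (2 * pi * x) `^ a = P * X by rewrite powRMl// ltW.
  rewrite lerD2r -/G mulrBl mulrA lerD2l lerN2 -mulrA mulrA -mulrA.
  rewrite ler_wpM2l ?(ltW e10)// ler_wpM2r//.
  rewrite /K; have : 0 <= n%:R `^ a :> R by exact: powR_ge0.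
  have : 0 <= G * P by rewrite mulr_ge0.
  by move: (n%:R `^ a) => na *; lra.
have eK : e1 * K * X <= n%:R * e * X by rewrite ler_wpM2r.
have -> : f - G * P / n%:R * X = (n%:R * f - G * P * X) / n%:R.
  by field; rewrite gt_eqF.
rewrite normrM normfV (ger0_norm (ltW nr0)) ler_pdivrMr//.
have C1n : C1 + C2 + C3 <= (C1 + C2 + C3) * n%:R.
  by rewrite ler_peMr ?ler1n// !addr_ge0.
rewrite -/X ler_norml; move: up lo eK C1n.
move: (n%:R : R) (e1 * K * X) (G * P * X) f => nn A B f1 up lo eK C1n.
have E : (e * X + (C1 + C2 + C3)) * nn = nn * e * X + (C1 + C2 + C3) * nn by ring.
rewrite E; move: (nn * e * X) ((C1 + C2 + C3) * nn) eK C1n => D F eK C1n.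
by apply/andP; split; lra.
Qed.

Definition limit_constant : R := G * (2 * pi) `^ a.

(** Almost independence again: an arc of density [q_i] behaves as the arc of
    density one at [q_i s]. *)
Lemma step_bounds n (q : 'I_n -> R) e : odd n -> (forall i, 0 <= q i) -> 0 < e ->
  exists2 C, 0 <= C & forall s, 0 <= s -> exists m0, forall m', (m0 <= m')%N -> odd m' ->
  `|ldet (stepw m' q) s - limit_constant * ((\sum_i q i `^ a) / n%:R) * s `^ a|
    <= e * s `^ a + C.
Proof.
move=> on q0 e0; have n0 : (0 < n)%N by case: (n) on.
have nr0 : 0 < n%:R :> R by rewrite ltr0n.
pose Q := \sum_i q i; have Q0 : 0 <= Q by exact: sumr_ge0.
pose Qa := Q `^ a; have Qa0 : 0 <= Qa by exact: powR_ge0.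
pose kap := limit_constant; have kap0 : 0 <= kap by rewrite mulr_ge0 ?powR_ge0.
pose K := kap * ((\sum_i q i `^ a) / n%:R).
have K0 : 0 <= K by rewrite mulr_ge0// divr_ge0// sumr_ge0// => i _; exact: powR_ge0.
have e20 : 0 < e / 2 by rewrite divr_gt0.
have KQ : 0 <= K + Qa by rewrite addr_ge0.
have [e1 /andP[e10 e11] e1K] := factor_le KQ e20.
have nQ : 0 <= n%:R * Qa by rewrite mulr_ge0.
have [e2 /andP[e2p e21] e2K] := factor_le nQ e20.
have [C1 [m1 [C10 h1]]] := logdet_stepw_ge mu0 muc M0 r1 mu_asymp on
  (introT andP (conj e10 e11)).
have [C2 C20 h2] := arc_bounds on e2p.
exists (C1 + n%:R * C2); first by rewrite addr_ge0// mulr_ge0.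
move=> s s0; pose s' := s / (1 + e1).
have e1p : 0 < 1 + e1 by lra.
have s'0 : 0 <= s' by rewrite divr_ge0// ltW.
have s's : s' <= s by rewrite ler_pdivrMr// ler_peMr//; lra.
pose X := s `^ a; have X0 : 0 <= X by exact: powR_ge0.
have qs t i : 0 <= t -> 0 <= q i * t by move=> t0; rewrite mulr_ge0.
have [ma hma] := choice (fun i => h2 _ (qs _ i s0)).
have [mb hmb] := choice (fun i => h2 _ (qs _ i s'0)).
exists (maxn m1 (maxn (\max_i ma i) (\max_i mb i))) => m'.
rewrite !geq_max => /and3P[m1m mam mbm] om.
have sumE t : 0 <= t -> \sum_i kap / n%:R * (q i * t) `^ a = K * t `^ a.
  move=> t0; under eq_bigr => i _ do rewrite powRMl// mulrA.
  by rewrite -mulr_suml /K -mulr_sumr; congr (_ * _); rewrite mulrAC mulrA.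
have sume t : 0 <= t <= s -> \sum_i (e2 * (q i * t) `^ a + C2) <= e / 2 * X + n%:R * C2.
  move=> /andP[t0 ts]; apply: (@le_trans _ _ (\sum_(i < n) (e2 * (Qa * X) + C2))).
    apply: ler_sum => i _; rewrite lerD2r ler_wpM2l ?(ltW e2p)//.
    rewrite -powRMl//; apply: powR_homo; [exact: ltW|exact: qs|].
    by apply: ler_pM => //; rewrite /Q (bigD1 i)//= lerDl sumr_ge0.
  rewrite sumr_const card_ord -[leLHS]mulr_natl mulrDr lerD2r.
  have -> : n%:R * (e2 * (Qa * X)) = e2 * (n%:R * Qa) * X by ring.
  by rewrite ler_wpM2r.
have up : ldet (stepw m' q) s <= K * X + (e / 2 * X + n%:R * C2).
  apply: (le_trans (logdet_stepw_le mu0 muc m' q0 s0)).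
  rewrite -(sumE s s0); apply: (@le_trans _ _ (\sum_i (kap / n%:R * (q i * s) `^ a +
      (e2 * (q i * s) `^ a + C2)))).
    apply: ler_sum => i _.
    have mai : (ma i <= m')%N by apply: leq_trans mam; exact: leq_bigmax.
    by have := hma i m' mai om; rewrite ler_norml lerBlDl => /andP[_].
  by rewrite big_split /= lerD2l sume// s0 lexx.
have lo : K * X - e1 * (K + Qa) * X - (e / 2 * X + n%:R * C2) - C1 <= ldet (stepw m' q) s.
  have := h1 m' q s' m1m om q0 s'0.
  have -> : (1 + e1) * s' = s by rewrite /s' mulrC divfK// gt_eqF.
  rewrite -/Q => h.
  have w1 : \sum_i kap / n%:R * (q i * s') `^ a - \sum_i (e2 * (q i * s') `^ a + C2) <=
      \sum_i ldet (arcw (n * m') 0 m') (q i * s').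
    rewrite -sumrB; apply: ler_sum => i _.
    have mbi : (mb i <= m')%N by apply: leq_trans mbm; exact: leq_bigmax.
    have := hmb i m' mbi om; rewrite ler_norml => /andP[+ _].
    by rewrite lerBrDl addrC.
  rewrite sumE// in w1.
  have w2 : (1 - e1) * X <= s' `^ a.
    rewrite /s' mulrC powRMl ?invr_ge0 ?(ltW e1p)// -/X.
    rewrite ler_wpM2l//; apply: (@le_trans _ _ ((1 - e1) `^ a)).
      by rewrite powR_ge1B// e11 ltW.
    apply: powR_homo; [exact: ltW|lra|].
    by rewrite -[leRHS]div1r ler_pdivlMr//; nra.
  have w3 : (s' * Q) `^ a <= Qa * X.
    rewrite mulrC powRMl// ler_wpM2l//.
    by apply: powR_homo => //; exact: ltW.
  have w4 := sume s' (introT andP (conj s'0 s's)).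
  have w5 : K * ((1 - e1) * X) <= K * s' `^ a by rewrite ler_wpM2l.
  have w6 : e1 * (s' * Q) `^ a <= e1 * (Qa * X) by rewrite ler_wpM2l// ltW.
  have -> : K * X - e1 * (K + Qa) * X - (e / 2 * X + n%:R * C2) - C1 =
    K * ((1 - e1) * X) - (e / 2 * X + n%:R * C2) - e1 * (Qa * X) - C1 by ring.
  move: w1 w4 w5 w6 h.
  move: (\sum_i _) (\sum_i _) (K * s' `^ a) (e1 * (s' * Q) `^ a) (ldet _ _) (K * ((1 - e1) * X)) (e1 * (Qa * X)) (e / 2 * X + _).
  by move=> *; lra.
have e1KX : e1 * (K + Qa) * X <= e / 2 * X by rewrite ler_wpM2r.
have eX : e * X = e / 2 * X + e / 2 * X by field.
have eX0 : 0 <= e / 2 * X by rewrite mulr_ge0// ltW.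
rewrite -/kap -/K -/X eX ler_norml; move: up lo e1KX eX0 C10.
move: (K * X) (e1 * _ * X) (ldet _ _) (n%:R * C2) (e / 2 * X) => *.
by apply/andP; split; lra.
Qed.

Definition absw m (w : 'rV[R]_m) : 'rV[R]_m := \row_i `|w 0 i|.

(** Monotonicity and subadditivity make the logarithmic determinant Lipschitz in
    the weights, in the sense measured by the determinant itself. *)
Lemma logdet_stability m (w w' : 'rV[R]_m) s : nneg w -> nneg w' -> 0 <= s ->
  `|ldet w s - ldet w' s| <= ldet (absw (w - w')) s.
Proof.
move=> w0 w0' s0.
have a0' (v : 'rV[R]_m) : nneg (absw v) by move=> i; rewrite mxE.
have main (v v' : 'rV[R]_m) : nneg v -> nneg v' ->
    ldet v s - ldet v' s <= ldet (absw (v - v')) s.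
  move=> v0 v0'; rewrite lerBlDl.
  apply: le_trans (logdetD_le mu0 muc v0' (a0' _) s0).
  apply: (logdet_monow mu0 muc) => // i; rewrite !mxE -lerBlDl.
  exact: ler_norm.
rewrite ler_norml main// andbT lerNl opprB.
have -> : absw (w - w') = absw (w' - w) by apply/rowP => i; rewrite !mxE distrC.
exact: main.
Qed.

(** Weights that are approximated in mean by step functions inherit the
    asymptotics of the latter. *)
Lemma logdet_asymptotics (W : forall m, 'rV[R]_m) (Th e : R) :
  (forall m, nneg (W m)) -> 0 < e ->
  (forall d, 0 < d -> exists n (q : 'I_n -> R), [/\ odd n, forall i, 0 <= q i,
     `|(\sum_i q i `^ a) / n%:R - Th| <= d &
     exists m0, forall m', (m0 <= m')%N -> mass (absw (W (n * m')%N - stepw m' q)) <= d]) ->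
  exists2 C, 0 <= C & forall s, 0 <= s -> forall m0, exists2 m, (m0 <= m)%N &
    `|ldet (W m) s - limit_constant * Th * s `^ a| <= e * s `^ a + C.
Proof.
move=> W0 e0 app; pose kap := limit_constant.
have kap0 : 0 <= kap by rewrite mulr_ge0 ?powR_ge0.
have e30 : 0 < e / 3 by rewrite divr_gt0.
have [C1 C10 h1] := logdet_ub mu0 muc M0 r1 mu_asymp ltr01.
have G1 : 0 < G + 1 by rewrite ltr_wpDl.
have [d1 /andP[d10 _] d1k] := factor_le kap0 e30.
pose d2 := (e / 3 / (G + 1)) `^ r.
have d20 : 0 < d2 by rewrite powR_gt0// divr_gt0.
have d2E : (G + 1) * d2 `^ a = e / 3.
  rewrite /d2 -powRrM mulfV ?gt_eqF// powRr1; last by rewrite ltW// divr_gt0.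
  by rewrite mulrC divfK// gt_eqF.
have dd : 0 < Num.min d1 d2 by rewrite lt_min d10.
have [n [q [on q0 qTh [m1 hm1]]]] := app _ dd.
have n0 : (0 < n)%N by case: (n) on.
have [C2 C20 h2] := step_bounds on q0 e30.
exists (C1 + C2); first by rewrite addr_ge0.
move=> s s0 m0; have [m2 hm2] := h2 s s0.
pose k := maxn m0 (maxn m1 m2); pose m' := k.*2.+1.
have km : (k <= m')%N by rewrite /m' -addnn -addnS leq_addr.
have om : odd m' by rewrite /m' /= odd_double.
have [k0 k1 k2] : [/\ (m0 <= m')%N, (m1 <= m')%N & (m2 <= m')%N].
  by move: km; rewrite /k !geq_max => /and3P[].
exists (n * m')%N; first by rewrite (leq_trans k0)// leq_pmull.
set X := s `^ a; have X0 : 0 <= X by exact: powR_ge0.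
have A1 := hm2 m' k2 om.
have A2 : `|ldet (W (n * m')%N) s - ldet (stepw m' q) s| <= e / 3 * X + C1.
  have st0 : nneg (stepw m' q) by exact: stepw_nneg.
  apply: (le_trans (logdet_stability (W0 _) st0 s0)).
  have ab0 : nneg (absw (W (n * m')%N - stepw m' q)) by move=> i; rewrite mxE.
  apply: (le_trans (h1 _ _ _ ab0 s0)); rewrite lerD2r -/G -d2E -mulrA.
  rewrite ler_wpM2l ?(ltW G1)//; have m_ge0 := mass_ge0 ab0.
  rewrite mulrC powRMl// ler_wpM2r//; apply: powR_homo => //; first exact: ltW.
  by apply: (le_trans (hm1 m' k1)); rewrite ge_min lexx orbT.
have A3 : `|kap * ((\sum_i q i `^ a) / n%:R) * X - kap * Th * X| <= e / 3 * X.
  rewrite -mulrBl -mulrBr normrM (ger0_norm X0) ler_wpM2r// normrM (ger0_norm kap0).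
  apply: le_trans d1k; rewrite mulrC ler_wpM2r//.
  by apply: (le_trans qTh); rewrite ge_min lexx.
have chain (x y z t : R) : x - t = (x - y) + (y - z) + (z - t) by ring.
rewrite (chain _ (ldet (stepw m' q) s) (kap * ((\sum_i q i `^ a) / n%:R) * X)).
apply: le_trans (ler_normD _ _) _.
apply: le_trans (lerD (ler_normD _ _) (lexx _)) _.
apply: (@le_trans _ _ (e / 3 * X + C1 + (e / 3 * X + C2) + e / 3 * X)).
  by apply: lerD => //; apply: lerD.
by have -> : e / 3 * X + C1 + (e / 3 * X + C2) + e / 3 * X = e * X + (C1 + C2) by field.
Qed.

End Asymptotics.

(** * Approximation of the weight by step functions *)

Section StepApprox.
Context {R : realType}.
Local Notation mu := (@lebesgue_measure R).

Lemma gridpt_le m i j : (i <= j)%N -> gridpt m i <= gridpt m j :> R.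
Proof.
move=> ij; rewrite /gridpt ler_wpM2r ?invr_ge0// ler_wpM2l ?mulr_ge0 ?pi_ge0//.
by rewrite ler_nat.
Qed.

Lemma gridptS m i : gridpt m i.+1 = gridpt m i + 2 * pi / m%:R :> R.
Proof. by rewrite /gridpt -[i.+1%:R]natr1 mulrDr mulr1 mulrDl. Qed.

Lemma gridpt0 m : gridpt m 0 = 0 :> R.
Proof. by rewrite /gridpt mulr0 mul0r. Qed.

Lemma gridptm m : (0 < m)%N -> gridpt m m = 2 * pi :> R.
Proof. by move=> m0; rewrite /gridpt mulfK// pnatr_eq0 -lt0n. Qed.

(** The half-open fundamental domain, which the cells of a grid partition. *)
Definition circ : set R := `[0, 2 * pi[%classic.
Definition cell m i : set R := `[gridpt m i, gridpt m i.+1[%classic.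

Lemma cell_circ m i : (i < m)%N -> cell m i `<=` circ.
Proof.
move=> im; apply: subset_itv; rewrite bnd_simp.
  by rewrite -(gridpt0 m) gridpt_le.
have m0 : (0 < m)%N by apply: leq_ltn_trans im.
by rewrite -(gridptm m0) gridpt_le.
Qed.

Lemma measure_cell m i : (0 < m)%N -> fine (mu (cell m i)) = 2 * pi / m%:R.
Proof.
move=> m0; have P0 : 0 < 2 * pi / m%:R :> R by rewrite divr_gt0 ?mulr_gt0 ?pi_gt0// ltr0n.
rewrite /cell gridptS lebesgue_measure_itv/= lte_fin ltrDl P0 /=.
by rewrite addrAC subrr add0r.
Qed.

Lemma measurable_circ : @measurable _ (measurableTypeR R) circ.
Proof. exact: measurable_itv. Qed.

Lemma measurable_cell m i : @measurable _ (measurableTypeR R) (cell m i).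
Proof. exact: measurable_itv. Qed.

Lemma integrable_circS (A : set R) (f : R -> \bar R) :
  @measurable _ (measurableTypeR R) A -> A `<=` circ ->
  mu.-integrable circ f -> mu.-integrable A f.
Proof.
by move=> mA Ac; exact: (@integrableS _ (measurableTypeR R) R mu circ A f measurable_circ mA Ac).
Qed.

Lemma Rint_cells (f : R -> R) m k : (k <= m)%N -> mu.-integrable circ (EFin \o f) ->
  \int[mu]_(t in `[0, gridpt m k[%classic) f t = \sum_(i < k) \int[mu]_(t in cell m i) f t.
Proof.
move=> km fi; elim: k km => [|k IH] km.
  by rewrite big_ord0 gridpt0 set_itvco0 Rintegral_set0.
have m0 : (0 < m)%N by apply: leq_trans km.
rewrite big_ord_recr /= -(IH (ltnW km)).
have g0 : 0 <= gridpt m k :> R by rewrite -(gridpt0 m) gridpt_le.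
have gk := gridpt_le m (leqnSn k).
have -> : `[0, gridpt m k.+1[%classic = `[0, gridpt m k[%classic `|` cell m k :> set R.
  rewrite /cell -itv_bndbnd_setU//; by rewrite bnd_simp.
rewrite Rintegral_setU//=.
- exact: measurable_cell.
- apply: (integrable_circS _ _ fi); first by apply: measurableU; exact: measurable_itv.
  rewrite subUset; split; last exact: cell_circ.
  apply: subset_itvl; rewrite bnd_simp -(gridptm m0); apply: gridpt_le; exact: ltnW.
- apply/disj_setPS => y []; rewrite /cell /= !in_itv /= => /andP[_ yx] /andP[].
  by rewrite leNgt yx.
Qed.

Lemma Rint_circ (f : R -> R) m : (0 < m)%N -> mu.-integrable circ (EFin \o f) ->
  \int[mu]_(t in circ) f t = \sum_(i < m) \int[mu]_(t in cell m i) f t.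
Proof. by move=> m0 fi; rewrite -Rint_cells// gridptm. Qed.

Lemma cell_sub n m' i j : (0 < n)%N -> (j * m' <= i < j * m' + m')%N ->
  cell (n * m') i `<=` cell n j.
Proof.
move=> n0 /andP[ji ij]; have m0 : (0 < m')%N by rewrite -(ltn_add2l (j * m')) addn0 (leq_ltn_trans ji).
have nr : 0 < n%:R :> R by rewrite ltr0n.
have mr : 0 < m'%:R :> R by rewrite ltr0n.
have E k : gridpt n k = gridpt (n * m') (k * m') :> R.
  by rewrite /gridpt !natrM; field; rewrite !gt_eqF.
apply: subset_itv; rewrite bnd_simp E gridpt_le//.
by rewrite mulSnr.
Qed.

Lemma unif_continuous_itv (h : R -> R) e (u v : R) : continuous h -> 0 < e ->
  exists2 d, 0 < d & forall x y, u <= x <= v -> `|x - y| < d -> `|h x - h y| <= e.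
Proof.
move=> ch e0.
have /compact_near_coveringP := @segment_compact R u v.
move=> /(_ R (0^'+) (fun d x => forall y, `|x - y| < d -> `|h x - h y| <= e) _).
case.
- move=> x xuv; have e2 : 0 < e / 2 by rewrite divr_gt0.
  have /cvgrPdist_lt /(_ _ e2) := ch x.
  move=> [d /= d0 hd]; have d2 : 0 < d / 2 by rewrite divr_gt0.
  exists (ball x (d / 2), [set z : R | 0 < z < d / 2]) => /=.
    split; first exact: nbhsx_ballx.
    near=> z; apply/andP; split; near: z.
      exact: nbhs_right_gt.
    exact: nbhs_right_lt.
  move=> [x' z] /= [xx' /andP[z0 zd]] y x'y.
  rewrite /ball /= in xx'.
  have h1 := hd x'; have h2 := hd y.
  have d2d : d / 2 + d / 2 = d by field.
  have k1 : `|h x - h x'| < e / 2.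
    apply: h1; rewrite /ball_ /=; apply: (lt_le_trans xx'); lra.
  have k2 : `|h x - h y| < e / 2.
    apply: h2; rewrite /ball_ /=.
    have -> : x - y = (x - x') + (x' - y) by ring.
    apply: (le_lt_trans (ler_normD _ _)); rewrite -d2d ltrD//.
    exact: lt_trans zd.
  have -> : h x' - h y = - (h x - h x') + (h x - h y) by ring.
  apply: (le_trans (ler_normD _ _)); rewrite normrN ltW//.
  have -> : e = e / 2 + e / 2 by field.
  exact: ltrD.
move=> d0 /= d00 hd; exists (d0 / 2); first by rewrite divr_gt0.
move=> x y xuv xy; apply: (hd (d0 / 2)) => //=.
- by rewrite sub0r normrN gtr0_norm ?divr_gt0// ltr_pdivrMr// ltr_pMr//; lra.
- by rewrite divr_gt0.
Unshelve. all: by end_near.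
Qed.

(** Subadditivity of concave powers, from
    [(x + y)^a = x (x + y)^(a-1) + y (x + y)^(a-1)]. *)
Lemma powRD_le (a x y : R) : 0 < a <= 1 -> 0 <= x -> 0 <= y ->
  (x + y) `^ a <= x `^ a + y `^ a.
Proof.
move=> /andP[a0 a1] x0 y0.
have [->|xn] := eqVneq x 0; first by rewrite add0r powR0 ?add0r ?gt_eqF.
have [->|yn] := eqVneq y 0; first by rewrite addr0 powR0 ?addr0 ?gt_eqF.
have xp : 0 < x by rewrite lt_def xn.
have yp : 0 < y by rewrite lt_def yn.
have E z : 0 <= z -> z `^ a = z * z `^ (a - 1) by move=> z0; rewrite mulr_powRB1.
rewrite (E _ (addr_ge0 x0 y0)) (E _ x0) (E _ y0) mulrDl.
have -> : a - 1 = - (1 - a) by ring.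
by rewrite lerD// ler_wpM2l// powRN_anti ?lerDl ?lerDr// subr_ge0.
Qed.

Lemma powR_dist (a x y : R) : 0 < a <= 1 -> 0 <= x -> 0 <= y ->
  `|x `^ a - y `^ a| <= `|x - y| `^ a.
Proof.
move=> a01 x0 y0; have /andP[a0 _] := a01.
wlog xy : x y x0 y0 / y <= x.
  move=> hw; have [yx|/ltW xy] := leP y x; first exact: hw.
  by rewrite distrC [`|x - y|]distrC; exact: hw.
have d0 : 0 <= x - y by rewrite subr_ge0.
rewrite (ger0_norm d0) ger0_norm; last by rewrite subr_ge0 powR_homo// ltW.
by rewrite lerBlDl -{1}[x](subrK y) addrC powRD_le.
Qed.

Variable q : R -> R.
Hypothesis q0 : forall t, 0 <= q t.
Hypothesis qi : mu.-integrable circ (EFin \o q).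

Definition cellw m : 'rV[R]_m := \row_i \int[mu]_(t in cell m i) q t.

Lemma cellw_nneg m : nneg (cellw m).
Proof. by move=> i; rewrite mxE; apply: Rintegral_ge0. Qed.

Lemma mu_circ : mu circ = (2 * pi)%:E.
Proof.
rewrite /circ lebesgue_measure_itv/= lte_fin mulr_gt0 ?pi_gt0//.
by rewrite oppr0 adde0.
Qed.

Lemma integrable_cst_circ (k : R) : mu.-integrable circ (EFin \o (fun=> k)).
Proof.
have mc := measurable_circ; apply/integrableP; split; first exact/measurable_EFinP.
rewrite integral_cst//= mu_circ.
by rewrite -EFinM ltry.
Qed.

Lemma Rint_dist_cst (f g : R -> R) k (A : set R) :
  @measurable _ (measurableTypeR R) A -> A `<=` circ ->
  mu.-integrable circ (EFin \o f) -> mu.-integrable circ (EFin \o g) ->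
  (forall t, A t -> `|f t - k| <= g t) ->
  `|\int[mu]_(t in A) f t - k * fine (mu A)| <= \int[mu]_(t in A) g t.
Proof.
move=> mA Ac fi gi fg.
have fA := integrable_circS mA Ac fi; have gA := integrable_circS mA Ac gi.
have kA := integrable_circS mA Ac (integrable_cst_circ k).
have dA : mu.-integrable A (EFin \o (fun t => f t - k)) by exact: intDB.
have nA : mu.-integrable A (EFin \o (fun t => `|f t - k|)) by exact: intDn.
have <- : \int[mu]_(t in A) (f t - k) = \int[mu]_(t in A) f t - k * fine (mu A).
  by rewrite RintegralB// Rintegral_cst.
apply: (le_trans (le_normr_Rintegral mA dA)).
exact: le_Rintegral.
Qed.

Lemma integrable_powR_circ a : 0 < a < 1 -> mu.-integrable circ (EFin \o (fun t => q t `^ a)).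
Proof.
move=> /andP[a0 a1].
have i1 : mu.-integrable circ (EFin \o (fun t => 1 + q t)).
  by apply: intDD => //; [exact: measurable_circ|exact: integrable_cst_circ].
apply: le_integrable i1; first exact: measurable_circ.
  have /integrableP[/measurable_EFinP mq _] := qi.
  by apply/measurable_EFinP; exact: (measurableT_comp (measurable_powR a) mq).
move=> t _ /=; rewrite lee_fin !ger0_norm ?addr_ge0 ?powR_ge0//.
have a01 : 0 <= a <= 1 by rewrite !ltW.
by have := powR_le_affine a01 ltr01 (q0 t); rewrite !powR1 mul1r.
Qed.

(** Density of continuous functions in the mean. *)
Lemma continuous_approximation e : 0 < e -> exists h : R -> R, [/\ continuous h,
  mu.-integrable circ (EFin \o h) & \int[mu]_(t in circ) `|q t - h t| <= e].
Proof.
move=> e0; have muc : (mu circ < +oo)%E by rewrite mu_circ ltry.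
have [g [cg ig cv]] := approximation_continuous_integrable measurable_circ muc qi.
have := cv; move=> /fine_cvgP[_ /cvgrPdist_le /(_ e e0) [N _ hN]].
exists (g N); split => //.
have := hN N (leqnn N); rewrite /= sub0r normrN => h.
by apply: le_trans h; apply: le_trans (ler_norm _).
Qed.

(** The weight is approximated in mean by a continuous function [h], and [h] by its
    positive part at the points of a fine grid. On each cell [|q - v_i|] is then
    bounded by the same integrable function [H] of small integral, which controls
    both the masses of the cells and, by the tangent bound [powR_le_affine], the
    means of the [a]-th powers. *)
Lemma step_approximation a d : 0 < a < 1 -> 0 < d ->
  exists n (v : 'I_n -> R), [/\ odd n, forall i, 0 <= v i,
     `|(\sum_i v i `^ a) / n%:R - (2 * pi)^-1 * \int[mu]_(t in circ) (q t `^ a)| <= d &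
     exists m0, forall m', (m0 <= m')%N ->
       mass (absw (cellw (n * m')%N - stepw m' v)) <= d].
Proof.
move=> a01 d0; have /andP[a0 a1] := a01; have pi0 := @pi_gt0 R.
have p0 : 0 < 2 * pi :> R by rewrite mulr_gt0.
have d2 : 0 < d / 2 by rewrite divr_gt0.
pose tau := (d / 2) `^ a^-1; have tau0 : 0 < tau by rewrite powR_gt0.
have tauE : tau `^ a = d / 2.
  by rewrite /tau -powRrM mulVf ?gt_eqF// powRr1// ltW.
pose T := tau `^ (a - 1); have T0 : 0 < T by rewrite powR_gt0.
pose eta := Num.min d (d / 2 * (2 * pi) / T).
have eta0 : 0 < eta by rewrite lt_min d0 divr_gt0// mulr_gt0.
have eta2 : 0 < eta / 2 by rewrite divr_gt0.
have [h [ch hi hq]] := continuous_approximation eta2.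
pose ep := eta / 2 / (2 * pi); have ep0 : 0 < ep by rewrite divr_gt0.
have [dl dl0 hdl] := @unif_continuous_itv h ep 0 (2 * pi) ch ep0.
pose N := Num.bound (2 * pi / dl); pose n := N.*2.+1.
have n0 : (0 < n)%N by [].
have nr0 : 0 < n%:R :> R by [].
have ndl : 2 * pi / n%:R < dl.
  rewrite ltr_pdivrMr// [dl * _]mulrC -ltr_pdivrMr//.
  apply: (@lt_le_trans _ _ N%:R); first by apply: archi_boundP; rewrite divr_ge0// ltW.
  by rewrite ler_nat /n -addnn -addnS leq_addr.
pose v (i : 'I_n) := Num.max (h (gridpt n i)) 0.
have v0 i : 0 <= v i by rewrite le_max lexx orbT.
pose H t := `|q t - h t| + ep.
have Hi0 : mu.-integrable circ (EFin \o (fun t => `|q t - h t|)).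
  by apply: intDn; apply: intDB => //; exact: measurable_circ.
have Hi : mu.-integrable circ (EFin \o H).
  by apply: intDD => //; [exact: measurable_circ|exact: integrable_cst_circ].
have IH : \int[mu]_(t in circ) H t <= eta.
  rewrite RintegralD//; [|exact: measurable_circ|exact: integrable_cst_circ].
  rewrite Rintegral_cst; last exact: measurable_circ.
  rewrite [fine _](_ : _ = 2 * pi); last by have := mu_circ; rewrite /= => ->.
  have -> : ep * (2 * pi) = eta / 2 by rewrite /ep divfK// gt_eqF.
  by rewrite [leRHS](_ : eta = eta / 2 + eta / 2) ?lerD2r//; field.
have IHd : \int[mu]_(t in circ) H t <= d by rewrite (le_trans IH)// ge_min lexx.
have Hv (i : 'I_n) t : cell n i t -> `|q t - v i| <= H t.
  move=> ti; have tc : circ t by apply: cell_circ ti.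
  have th : `|h t - h (gridpt n i)| <= ep.
    move: tc ti; rewrite /circ /cell /= !in_itv /= => /andP[t0 t2] /andP[ti it].
    apply: hdl; first by rewrite t0 ltW.
    rewrite ger0_norm ?subr_ge0//; apply: le_lt_trans ndl.
    by rewrite lerBlDl -gridptS ltW.
  have qh : `|q t - h (gridpt n i)| <= H t.
    have -> : q t - h (gridpt n i) = (q t - h t) + (h t - h (gridpt n i)) by ring.
    by apply: (le_trans (ler_normD _ _)); rewrite lerD2l.
  rewrite /v; case: (leP (h (gridpt n i)) 0) => // hn.
  apply: le_trans qh; rewrite subr0 ger0_norm// (le_trans _ (ler_norm _))//.
  by rewrite lerDl oppr_ge0.
exists n, v; split => //; first by rewrite /n /= odd_double.
  have qa := integrable_powR_circ a01.
  pose g t := tau `^ a + T * H t.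
  have gi : mu.-integrable circ (EFin \o g).
    apply: intDD; [exact: measurable_circ|exact: integrable_cst_circ|].
    by apply: intDZ => //; exact: measurable_circ.
  rewrite (Rint_circ n0 qa).
  have -> : (\sum_i v i `^ a) / n%:R - (2 * pi)^-1 * (\sum_(i < n) \int[mu]_(t in cell n i) q t `^ a) =
     - ((2 * pi)^-1 * \sum_(i < n) (\int[mu]_(t in cell n i) q t `^ a - v i `^ a * fine (mu (cell n i)))).
    rewrite sumrB mulrBr opprB; congr (_ - _).
    rewrite mulr_sumr mulr_suml; apply: eq_bigr => i _.
    rewrite measure_cell//; move: (2 * pi : R) p0 => P P0.
    by field; rewrite !gt_eqF.
  rewrite normrN normrM gtr0_norm ?invr_gt0//.
  apply: (@le_trans _ _ ((2 * pi)^-1 * \int[mu]_(t in circ) g t)).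
    rewrite ler_pM2l ?invr_gt0// (Rint_circ n0 gi).
    apply: (le_trans (ler_norm_sum _ _ _)); apply: ler_sum => i _.
    apply: Rint_dist_cst => //; [exact: measurable_cell|exact: cell_circ|].
    move=> t ti; have a01' : 0 < a <= 1 by rewrite a0 ltW.
    apply: (le_trans (powR_dist a01' (q0 t) (v0 i))).
    have a01'' : 0 <= a <= 1 by rewrite !ltW.
    apply: (le_trans (powR_le_affine a01'' tau0 (normr_ge0 _))).
    by rewrite lerD2l ler_wpM2l ?(ltW T0)// Hv.
  rewrite RintegralD//; last 3 first.
  - exact: measurable_circ.
  - exact: integrable_cst_circ.
  - by apply: intDZ => //; exact: measurable_circ.
  rewrite RintegralZl//; last exact: measurable_circ.
  rewrite Rintegral_cst; last exact: measurable_circ.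
  rewrite [fine _](_ : _ = 2 * pi); last by have := mu_circ; rewrite /= => ->.
  rewrite tauE mulrC ler_pdivrMr//.
  have TI : T * \int[mu]_(t in circ) H t <= d / 2 * (2 * pi).
    rewrite mulrC -ler_pdivlMr//; apply: (le_trans IH).
    by rewrite ge_min lexx orbT.
  move: TI; move: (T * _) (2 * pi : R) => I P; lra.
exists 1%N => m' m'0.
have nm0 : (0 < n * m')%N by rewrite muln_gt0 n0.
apply: le_trans IHd; rewrite (Rint_circ nm0 Hi) /mass; apply: ler_sum => i _.
have jn : (i %/ m' < n)%N by rewrite ltn_divLR.
have ij : (i %/ m' * m' <= i < i %/ m' * m' + m')%N.
  by rewrite leq_trunc_div /= {1}(divn_eq i m') ltn_add2l ltn_pmod.
have -> : absw (cellw (n * m') - stepw m' v) 0 i = `|cellw (n * m') 0 i - stepw m' v 0 i|.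
  by rewrite [LHS]mxE; congr (`|_|); rewrite [LHS]mxE; congr (_ + _); rewrite [LHS]mxE.
rewrite [cellw _ 0 i]mxE (@stepwE _ _ _ v (Ordinal jn) i ij).
rewrite -(measure_cell i nm0).
apply: Rint_dist_cst => //; [exact: measurable_cell|by apply: cell_circ|].
move=> t ti; apply: Hv; exact: (cell_sub n0 ij).
Qed.

End StepApprox.

(** * Covariances and the Laplace transform of grid sums *)

Section Covariance.
Context {d : measure_display} {T : measurableType d} {R : realType}.
Variable P : probability T R.
Variables (X : R -> {RV P >-> R}) (mu : int -> R).

Lemma integrable_fsum (I : finType) (f : I -> T -> R) :
  (forall i, P.-integrable setT (EFin \o f i)) ->
  P.-integrable setT (EFin \o (fun w => \sum_i f i w)).
Proof.
move=> fi; rewrite (_ : EFin \o _ = fun w => (\sum_i (f i w)%:E)%E).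
  by apply: integrable_sum => // i _; exact: fi.
by apply/funext => w /=; rewrite sumEFin.
Qed.

Lemma Rintegral_fsum (I : finType) (f : I -> T -> R) :
  (forall i, P.-integrable setT (EFin \o f i)) ->
  \int[P]_w (\sum_i f i w) = \sum_i \int[P]_w f i w.
Proof.
move=> fi; have si := integrable_fsum fi.
apply: EFin_inj; rewrite -RintE// -sumEFin.
under eq_integral do rewrite -sumEFin.
rewrite integral_sum//; apply: eq_bigr => i _.
by rewrite RintE.
Qed.

Hypothesis X_stat : stationary_process X.
Hypothesis X_centered : centered_process X.
Hypothesis X_spec : spectral_measure X mu.
Hypothesis X_gauss : gaussian_process X.

Definition cov (h : R) : R := fine (covariance P (X h) (X 0)).

(** The real part of the spectral representation, at [s = h] and [t = 0]. *)
Lemma zlim_cov h : zlim (fun k => mu k * cos (k%:~R * h)) (cov h).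
Proof.
have [_ _ /(_ h 0)] := X_spec; rewrite subr0 -/(cov h) => lim; split.
apply/cvgrPdist_le => e e0.
have ec : 0 < e%:C%C by rewrite ltcR.
have := lim; move=> /cvgrPdist_le /(_ _ ec); apply: filterS => n /= hn.
rewrite -lecR; apply: le_trans hn; apply: le_trans (normc_ge_Re _).
have E : complex.Re (\sum_(j < n.*2.+1) ((mu (j%:Z - n%:Z))%:C%C * expi ((j%:Z - n%:Z)%:~R * h))) =
    symsum (fun k : int => mu k * cos (k%:~R * h)) n.
  by rewrite raddf_sum; apply: eq_bigr => j _ /=; rewrite mul0r subr0.
by rewrite lecR raddfB /= E.
Qed.

Lemma process_Lfun1 t : (X t : T -> R) \in Lfun P 1.
Proof.
have [X2 _ _] := X_stat; apply: Lfun_subset12 (X2 t).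
by rewrite fin_num_measure.
Qed.

Lemma process_mul_Lfun1 s t : (X s \* X t : T -> R) \in Lfun P 1.
Proof. by have [X2 _ _] := X_stat; exact: Lfun2_mul_Lfun1. Qed.

Lemma process_integrable t : P.-integrable setT (EFin \o X t).
Proof. by apply/Lfun1_integrable; exact: process_Lfun1. Qed.

Lemma process_mul_integrable s t : P.-integrable setT (EFin \o (fun w => X s w * X t w)).
Proof. by apply/Lfun1_integrable; exact: process_mul_Lfun1. Qed.

Lemma process_mean t : \int[P]_w X t w = 0.
Proof. by have := X_centered t; rewrite unlock /Rintegral => ->. Qed.

Lemma process_cov s t : \int[P]_w (X s w * X t w) = cov (s - t).
Proof.
have [_ _ st] := X_stat.
rewrite /cov -(st t) subrK add0r covarianceE ?process_Lfun1//; last exact: process_mul_Lfun1.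
by rewrite !X_centered mule0 sube0 unlock.
Qed.

Lemma cov_grid_law m (u : 'cV[R]_m) :
  \int[P]_w cos (lincomb (fun i : 'I_m => X (gridpt m i) : T -> R) u w) =
  expR (- (bilin (covmx cov m) u u / 2)).
Proof.
have sqE w : (lincomb (fun i : 'I_m => X (gridpt m i) : T -> R) u w) ^+ 2 =
    \sum_i \sum_j u i 0 * u j 0 * (X (gridpt m i) w * X (gridpt m j) w).
  rewrite /lincomb expr2 mulr_suml; apply: eq_bigr => i _.
  by rewrite mulr_sumr; apply: eq_bigr => j _; ring.
have i1 i : P.-integrable setT (EFin \o (fun w => u i 0 * X (gridpt m i) w)).
  exact: intgZ (process_integrable _).
have i2 i j : P.-integrable setT
    (EFin \o (fun w => u i 0 * u j 0 * (X (gridpt m i) w * X (gridpt m j) w))).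
  exact: intgZ (process_mul_integrable _ _).
have i3 i : P.-integrable setT
    (EFin \o (fun w => \sum_j u i 0 * u j 0 * (X (gridpt m i) w * X (gridpt m j) w))).
  exact: integrable_fsum.
apply: gaussian_rv_cos.
- exact: (X_gauss (fun i => gridpt m i) (fun i => u i 0)).
- exact: integrable_fsum.
- rewrite (_ : (fun w => _ ^+ 2) = fun w => \sum_i \sum_j u i 0 * u j 0 * (X (gridpt m i) w * X (gridpt m j) w)); last exact/funext.
  exact: integrable_fsum.
- rewrite Rintegral_fsum// big1// => i _.
  by rewrite RintegralZl// ?process_mean ?mulr0//; exact: process_integrable.
- under eq_Rintegral do rewrite sqE.
  rewrite Rintegral_fsum// bilinE; apply: eq_bigr => i _.
  rewrite Rintegral_fsum//; apply: eq_bigr => j _.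
  rewrite RintegralZl//; last exact: process_mul_integrable.
  by rewrite process_cov mxE; ring.
Qed.

(** A finite linear combination of values of the process is a centered Gaussian
    variable with variance given by the covariance matrix of the grid, as
    [laplace_gaussian] requires. *)
Lemma laplace_grid m (w : 'rV[R]_m) s : nneg w -> 0 <= s ->
  \int[P]_x expR (- (s * \sum_i w 0 i * X (gridpt m i) x ^+ 2)) =
  expR (- logdet cov w s).
Proof.
have [mu0 _ _] := X_spec => w0 s0.
have n2 : nneg (2 *: (s *: w)) by do 2![apply: nnegZ => //].
have W0 := wdet_logdet_gt0 mu0 zlim_cov w0 s0.
have mX i : measurable_fun setT (X (gridpt m i) : T -> R) by [].
have := laplace_gaussian (P := P) (fun i : 'I_m => mX i) (psd_covmx mu0 zlim_cov m) n2 (@cov_grid_law m).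
have -> : (Num.sqrt (wdet (2 *: (s *: w)) (covmx cov m)))^-1 = expR (- logdet cov w s).
  rewrite expRN /logdet; congr (_^-1).
  rewrite -[wdet _ _ in LHS]lnK//.
  set l := ln _; have -> : expR l = expR (l / 2) ^+ 2.
    by rewrite expr2 -expRD; congr expR; field.
  by rewrite sqrtr_sqr ger0_norm// expR_ge0.
move=> <-; apply: eq_Rintegral => x _; congr (expR (- _)).
rewrite mulr_sumr mulr_suml; apply: eq_bigr => i _.
by rewrite 2!mxE; field.
Qed.

End Covariance.

(** * Discretization of the quadratic functional *)

Section TonelliOn.
Context {d1 d2 : measure_display} {T1 : measurableType d1} {T2 : measurableType d2}.
Context {R : realType}.
Variable m1 : {sigma_finite_measure set T1 -> \bar R}.
Variable m2 : {sigma_finite_measure set T2 -> \bar R}.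
Variable f : T1 * T2 -> \bar R.
Hypothesis mf : measurable_fun setT f.
Hypothesis f0 : forall z, (0 <= f z)%E.
Variable A : set T2.
Hypothesis mA : measurable A.

Let fA (z : T1 * T2) : \bar R := (f z * (\1_A z.2)%:E)%E.

Let mfA : measurable_fun setT fA.
Proof.
apply: emeasurable_funM => //; apply/measurable_EFinP.
by apply: (measurableT_comp (measurable_indic mA)); exact: measurable_snd.
Qed.

Let fA0 z : (0 <= fA z)%E.
Proof. by rewrite mule_ge0// lee_fin indicE. Qed.

Let fAE x : (\int[m2]_(y in A) f (x, y) = \int[m2]_y fA (x, y))%E.
Proof. by rewrite integral_mkcond epatch_indic. Qed.

Lemma measurable_section_integral :
  measurable_fun setT (fun x => \int[m2]_(y in A) f (x, y))%E.
Proof.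
rewrite (_ : (fun x => _) = fun x => (\int[m2]_y fA (x, y))%E); last exact/funext.
exact: measurable_fun_fubini_tonelli_F.
Qed.

Lemma tonelli_on :
  (\int[m1]_x \int[m2]_(y in A) f (x, y) = \int[m2]_(y in A) \int[m1]_x f (x, y))%E.
Proof.
under eq_integral do rewrite fAE.
rewrite (fubini_tonelli fA mfA fA0) [RHS]integral_mkcond.
apply: eq_integral => y _; rewrite epatch_indic /= /fA /=.
rewrite -ge0_integralZr// ?lee_fin ?indicE//.
exact: (measurableT_comp mf (pair2_measurable y)).
Qed.

End TonelliOn.

Section Discretization.
Context {d : measure_display} {T : measurableType d} {R : realType}.
Variable P : probability T R.
Local Notation leb := (@lebesgue_measure R).
Variables (X : R -> {RV P >-> R}) (mu : int -> R).
Hypothesis X_meas : jointly_measurable X.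
Hypothesis X_stat : stationary_process X.
Hypothesis X_centered : centered_process X.
Hypothesis X_spec : spectral_measure X mu.
Hypothesis X_gauss : gaussian_process X.
Hypothesis X_msc : ms_continuous X.

Lemma sqdiff_integrable s t :
  P.-integrable setT (EFin \o (fun w => `|X s w ^+ 2 - X t w ^+ 2|)).
Proof.
by apply: intDn; apply: intDB => //; apply: process_mul_integrable X_stat _ _.
Qed.

Lemma process_var t : \int[P]_w (X t w ^+ 2) = cov X 0.
Proof. by have := process_cov X_stat X_centered t t; rewrite subrr. Qed.

Lemma process_combine s t k :
  P.-integrable setT (EFin \o (fun w => (X s w + k * X t w) ^+ 2)) /\
  \int[P]_w ((X s w + k * X t w) ^+ 2) =
    (1 + k ^+ 2) * cov X 0 + 2 * k * cov X (s - t).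
Proof.
have i1 := process_mul_integrable X_stat s s.
have i2 := process_mul_integrable X_stat t t.
have i3 := process_mul_integrable X_stat s t.
have E : (fun w => (X s w + k * X t w) ^+ 2) = (fun w => X s w * X s w +
    (k ^+ 2 * (X t w * X t w) + 2 * k * (X s w * X t w))).
  by apply/funext => w; ring.
have j2 := intgZ (k ^+ 2) i2; have j3 := intgZ (2 * k) i3.
have j23 := intgD j2 j3.
rewrite E; split; first exact: intgD.
rewrite RintegralD// RintegralD// RintegralZl// RintegralZl//.
rewrite !(process_cov X_stat X_centered) !subrr; ring.
Qed.

Lemma cov_le h : cov X h <= cov X 0.
Proof.
have [_] := process_combine h 0 (-1); rewrite subr0 => E.
have : 0 <= \int[P]_w ((X h w + -1 * X 0 w) ^+ 2).
  by apply: Rintegral_ge0 => w _; exact: sqr_ge0.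
rewrite E; move: (cov X h) (cov X 0) => a b; lra.
Qed.

Lemma cov_continuous0 e : 0 < e ->
  exists2 h0, 0 < h0 & forall h, `|h| < h0 -> cov X 0 - cov X h <= e.
Proof.
move=> e0; have /fine_cvgP[_ /cvgrPdist_le /(_ e e0)] := X_msc 0.
move=> [h0 /= h00 H]; exists h0 => // h hh.
have := H h; rewrite /ball_ /= sub0r normrN => /(_ hh).
have [ic] := process_combine h 0 (-1); rewrite subr0 => E.
rewrite sub0r normrN unlock => K.
have {}K : `|\int[P]_w ((X h w + -1 * X 0 w) ^+ 2)| <= e.
  apply: le_trans K; rewrite /Rintegral /=.
  have -> // : (fun w => ((X h w + -1 * X 0 w) ^+ 2)%:E) = EFin \o (fun w => (X h w - X 0 w) ^+ 2).
  by apply/funext => w /=; rewrite mulN1r.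
move: K; rewrite E => K; have := le_trans (ler_norm _) K.
have := cov_le h; move: (cov X h) (cov X 0) => a b; lra.
Qed.

(** [x^2 - y^2 = (x - y) (x + y)], and the product is split by Young's inequality,
    so that a small mean square of [x - y] makes up for a bounded one of [x + y]. *)
Lemma sqdiff_young (x y k : R) : 0 < k ->
  `|x ^+ 2 - y ^+ 2| <= k / 2 * (x + 1 * y) ^+ 2 + (2 * k)^-1 * (x + -1 * y) ^+ 2.
Proof.
move=> k0; have k1 : k^-1 * k = 1 by rewrite mulVf ?gt_eqF.
have k2 : 0 <= k^-1 by rewrite invr_ge0 ltW.
rewrite invfM mul1r mulN1r.
have h1 := sqr_ge0 (k * (x + y) - (x - y)).
have h2 := sqr_ge0 (k * (x + y) + (x - y)).
have h3 := mulr_ge0 k2 h1; have h4 := mulr_ge0 k2 h2.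
have E1 : k^-1 * (k * (x + y) - (x - y)) ^+ 2 =
    (k^-1 * k) * k * (x + y) ^+ 2 + k^-1 * (x - y) ^+ 2 - (k^-1 * k) * 2 * (x ^+ 2 - y ^+ 2) by ring.
have E2 : k^-1 * (k * (x + y) + (x - y)) ^+ 2 =
    (k^-1 * k) * k * (x + y) ^+ 2 + k^-1 * (x - y) ^+ 2 + (k^-1 * k) * 2 * (x ^+ 2 - y ^+ 2) by ring.
move: h3 h4; rewrite E1 E2 k1 ler_norml.
move: (k^-1) (x ^+ 2 - y ^+ 2) ((x + y) ^+ 2) ((x - y) ^+ 2) => a b c e.
by move=> *; apply/andP; split; nra.
Qed.

Lemma sqdiff_mean e : 0 < e -> exists2 h0, 0 < h0 & forall s t, `|s - t| < h0 ->
  \int[P]_w `|X s w ^+ 2 - X t w ^+ 2| <= e.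
Proof.
move=> e0; have c0 : 0 <= cov X 0.
  by rewrite -(process_var 0); apply: Rintegral_ge0 => w _; exact: sqr_ge0.
pose k := e / (4 * (cov X 0 + 1)).
have c1 : 0 < 4 * (cov X 0 + 1) by rewrite mulr_gt0// ltr_wpDl.
have k0 : 0 < k by rewrite divr_gt0.
have [h0 h00 H] := cov_continuous0 (mulr_gt0 k0 (divr_gt0 e0 (ltr0n R 2))).
exists h0 => // s t st; have {}H := H _ st.
have [i1 E1] := process_combine s t 1; have [i2 E2] := process_combine s t (-1).
have j1 := intgZ (k / 2) i1; have j2 := intgZ ((2 * k)^-1) i2.
apply: (@le_trans _ _ (\int[P]_w (k / 2 * (X s w + 1 * X t w) ^+ 2 +
      (2 * k)^-1 * (X s w + -1 * X t w) ^+ 2))).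
  apply: le_Rintegral => //; [exact: sqdiff_integrable|exact: intgD|].
  by move=> w _; exact: sqdiff_young.
rewrite RintegralD// !RintegralZl// E1 E2.
have -> : (2 * k)^-1 * ((1 + (-1) ^+ 2) * cov X 0 + 2 * -1 * cov X (s - t)) =
   k^-1 * (cov X 0 - cov X (s - t)) by field; rewrite gt_eqF.
have a1 : k^-1 * (cov X 0 - cov X (s - t)) <= e / 2 by rewrite ler_pdivrMl.
have a2 : k / 2 * ((1 + 1 ^+ 2) * cov X 0 + 2 * 1 * cov X (s - t)) <= e / 2.
  apply: (@le_trans _ _ (k * (2 * cov X 0))).
    have -> : k / 2 * ((1 + 1 ^+ 2) * cov X 0 + 2 * 1 * cov X (s - t)) = k * (cov X 0 + cov X (s - t)).
      by field.
    rewrite ler_pM2l//; have := cov_le (s - t); move: (cov X _) (cov X _) => a b; lra.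
  rewrite /k mulrAC ler_pdivrMr//; move: (cov X 0) c0 => c c0; nra.
by rewrite [leRHS](_ : e = e / 2 + e / 2) ?lerD//; field.
Qed.

Variable q : R -> R.
Hypothesis q0 : forall t, 0 <= q t.
Hypothesis mq : measurable_fun setT (q : measurableTypeR R -> R).
Hypothesis qi : leb.-integrable circ (EFin \o q).

Lemma measurable_weighted (f : T * measurableTypeR R -> R) :
  measurable_fun setT f -> measurable_fun setT (fun z : T * measurableTypeR R => (q z.2 * f z)%:E).
Proof.
move=> mf; apply/measurable_EFinP; apply: measurable_funM => //.
by apply: (measurableT_comp mq); exact: measurable_snd.
Qed.

(** Extended-real, since no path is known to have a finite weighted integral; almost
    all of them do, by [energyV_fin_ae]. *)
Definition energyV w : \bar R := (\int[leb]_(t in circ) (q t * X t w ^+ 2)%:E)%E.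

Let mX2 : measurable_fun setT (fun z : T * measurableTypeR R => X z.2 z.1 ^+ 2).
Proof. by apply: measurable_funX; exact: X_meas. Qed.

Lemma measurable_energyV : measurable_fun setT energyV.
Proof.
apply: (@measurable_section_integral _ _ T (measurableTypeR R) R leb
  (fun z => (q z.2 * X z.2 z.1 ^+ 2)%:E)); last exact: measurable_circ.
- exact: measurable_weighted.
- by move=> z; rewrite lee_fin mulr_ge0// sqr_ge0.
Qed.

Lemma mean_energyV : (\int[P]_w energyV w < +oo)%E.
Proof.
rewrite /energyV (@tonelli_on _ _ T (measurableTypeR R) R P leb
  (fun z => (q z.2 * X z.2 z.1 ^+ 2)%:E)); last 3 first.
- exact: measurable_weighted.
- by move=> z; rewrite lee_fin mulr_ge0// sqr_ge0.
- exact: measurable_circ.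
have iX t : P.-integrable setT (EFin \o (fun w => X t w ^+ 2)).
  exact: (process_mul_integrable X_stat).
under eq_integral => t _.
  rewrite (RintE (intgZ (q t) (iX t))) RintegralZl// process_var.
  over.
have : leb.-integrable circ (EFin \o (fun t => cov X 0 * q t)).
  by apply: intDZ => //; exact: measurable_circ.
move=> /integrableP[_]; apply: le_lt_trans; apply: ge0_le_integral => //.
- exact: measurable_circ.
- move=> t _; rewrite lee_fin mulr_ge0// -(process_var 0).
  by apply: Rintegral_ge0 => w _; exact: sqr_ge0.
- by apply/measurable_EFinP; apply: measurable_funM => //; exact: measurable_funTS.
- apply/measurable_EFinP; apply: measurableT_comp => //; apply: measurable_funM => //.
  exact: measurable_funTS.
- by move=> t _; rewrite lee_fin /= mulrC ler_norm.
Qed.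

Lemma energyV_ge0 w : (0 <= energyV w)%E.
Proof. by apply: integral_ge0 => t _; rewrite lee_fin mulr_ge0// sqr_ge0. Qed.

Lemma energyV_fin_ae : {ae P, forall w, energyV w \is a fin_num}.
Proof.
have : P.-integrable setT energyV.
  apply/integrableP; split; first exact: measurable_energyV.
  under eq_integral do rewrite gee0_abs ?energyV_ge0//.
  exact: mean_energyV.
by move=> /(integrable_ae measurableT); apply: filterS => w; exact.
Qed.


Lemma measurable_path w : measurable_fun setT (fun t : measurableTypeR R => X t w).
Proof. exact: (measurableT_comp X_meas (pair1_measurable w)). Qed.

Lemma path_integrable w : energyV w \is a fin_num ->
  leb.-integrable circ (EFin \o (fun t => q t * X t w ^+ 2)).
Proof.
move=> Vf; apply/integrableP; split.
  apply/measurable_EFinP; apply: measurable_funTS; apply: measurable_funM => //.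
  by apply: measurable_funX; exact: measurable_path.
rewrite [X in (X < _)%E](_ : _ = energyV w) ?ltey_eq ?Vf//.
by apply: eq_integral => t _; rewrite gee0_abs// lee_fin mulr_ge0// sqr_ge0.
Qed.

Definition grid_error m w : \bar R :=
  (\sum_(i < m) \int[leb]_(t in cell m i)
     (q t * `|X t w ^+ 2 - X (gridpt m i) w ^+ 2|)%:E)%E.

Lemma energyV_grid m w : (0 < m)%N -> energyV w \is a fin_num ->
  (`|fine (energyV w) - \sum_i cellw q m 0 i * X (gridpt m i) w ^+ 2|%:E <= grid_error m w)%E.
Proof.
move=> m0 Vf; have iV := path_integrable Vf.
have -> : fine (energyV w) = \sum_(i < m) \int[leb]_(t in cell m i) (q t * X t w ^+ 2).
  by rewrite -Rint_circ.
rewrite -sumrB; apply: (@le_trans _ _ (\sum_(i < m)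
    `|\int[leb]_(t in cell m i) (q t * X t w ^+ 2) - cellw q m 0 i * X (gridpt m i) w ^+ 2|)%:E).
  by rewrite lee_fin ler_norm_sum.
rewrite -sumEFin; apply: lee_sum => i _.
have ic : leb.-integrable (cell m i) (EFin \o (fun t => q t * X t w ^+ 2)).
  by apply: integrable_circS iV; [exact: measurable_cell|exact: cell_circ].
have iq : leb.-integrable (cell m i) (EFin \o q).
  by apply: integrable_circS qi; [exact: measurable_cell|exact: cell_circ].
set x := X (gridpt m i) w ^+ 2.
have ix : leb.-integrable (cell m i) (EFin \o (fun t => x * q t)).
  by apply: intDZ => //; exact: measurable_cell.
have ib : leb.-integrable (cell m i) (EFin \o (fun t => q t * X t w ^+ 2 - x * q t)).
  by apply: intDB => //; exact: measurable_cell.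
rewrite [cellw _ _ _ _]mxE [_ * x]mulrC -RintegralZl//; last exact: measurable_cell.
rewrite -RintegralB//; last exact: measurable_cell.
apply: (@le_trans _ _ (\int[leb]_(t in cell m i) `|q t * X t w ^+ 2 - x * q t|)%:E).
  by rewrite lee_fin; apply: le_normr_Rintegral => //; exact: measurable_cell.
have E : \int[leb]_(t in cell m i) `|q t * X t w ^+ 2 - x * q t| =
    \int[leb]_(t in cell m i) (q t * `|X t w ^+ 2 - x|).
  apply: eq_Rintegral => t _; rewrite [x * _]mulrC -mulrBr normrM [`|q t|]ger0_norm//.
rewrite E /Rintegral fineK//; apply: integrable_fin_num; first exact: measurable_cell.
have -> : (fun t => (q t * `|X t w ^+ 2 - x|)%:E) =
    EFin \o (fun t => `|q t * X t w ^+ 2 - x * q t|).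
  by apply/funext => t /=; rewrite [x * _]mulrC -mulrBr normrM [`|q t|]ger0_norm.
exact: intDn.
Qed.

Let mcell i m : measurable_fun setT (fun z : T * measurableTypeR R =>
  (q z.2 * `|X z.2 z.1 ^+ 2 - X (gridpt m i) z.1 ^+ 2|)%:E).
Proof.
apply: measurable_weighted; apply: measurableT_comp => //.
apply: measurable_funB => //; apply: measurable_funX.
exact: (measurableT_comp _ measurable_fst).
Qed.

Lemma measurable_grid_error m : measurable_fun setT (grid_error m).
Proof.
apply: emeasurable_sum => i.
apply: (@measurable_section_integral _ _ T (measurableTypeR R) R leb
  (fun z => (q z.2 * `|X z.2 z.1 ^+ 2 - X (gridpt m i) z.1 ^+ 2|)%:E)).
- exact: mcell.
- by move=> z; rewrite lee_fin mulr_ge0.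
- exact: measurable_cell.
Qed.

Lemma grid_error_ge0 m w : (0 <= grid_error m w)%E.
Proof.
by apply: sume_ge0 => i _; apply: integral_ge0 => t _; rewrite lee_fin mulr_ge0.
Qed.

Lemma mean_grid_error m e : (0 < m)%N ->
  (forall (i : 'I_m) t, cell m i t -> \int[P]_w `|X t w ^+ 2 - X (gridpt m i) w ^+ 2| <= e) ->
  (\int[P]_w grid_error m w <= (e * \int[leb]_(t in circ) q t)%:E)%E.
Proof.
move=> m0 he; rewrite ge0_integral_sum//; last 2 first.
- move=> i; apply: (@measurable_section_integral _ _ T (measurableTypeR R) R leb
    (fun z => (q z.2 * `|X z.2 z.1 ^+ 2 - X (gridpt m i) z.1 ^+ 2|)%:E)).
  + exact: mcell.
  + by move=> z; rewrite lee_fin mulr_ge0.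
  + exact: measurable_cell.
- by move=> i w _; apply: integral_ge0 => t _; rewrite lee_fin mulr_ge0.
rewrite (Rint_circ m0 qi) mulr_sumr -sumEFin; apply: lee_sum => i _.
rewrite (@tonelli_on _ _ T (measurableTypeR R) R P leb
  (fun z => (q z.2 * `|X z.2 z.1 ^+ 2 - X (gridpt m i) z.1 ^+ 2|)%:E)); last 3 first.
- exact: mcell.
- by move=> z; rewrite lee_fin mulr_ge0.
- exact: measurable_cell.
have iq : leb.-integrable (cell m i) (EFin \o q).
  by apply: integrable_circS qi; [exact: measurable_cell|exact: cell_circ].
have ie : leb.-integrable (cell m i) (EFin \o (fun t => e * q t)).
  by apply: intDZ => //; exact: measurable_cell.
rewrite -RintegralZl//; last exact: measurable_cell.
rewrite /Rintegral fineK; last by apply: integrable_fin_num => //; exact: measurable_cell.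
have E t : (\int[P]_w (q t * `|X t w ^+ 2 - X (gridpt m i) w ^+ 2|)%:E)%E =
   (q t * \int[P]_w `|X t w ^+ 2 - X (gridpt m i) w ^+ 2|)%:E.
  have i1 := sqdiff_integrable t (gridpt m i).
  by rewrite (RintE (intgZ (q t) i1)) RintegralZl.
apply: ge0_le_integral.
- exact: measurable_cell.
- by move=> t _; apply: integral_ge0 => w _; rewrite lee_fin mulr_ge0.
- apply: measurable_funTS.
  apply: (@measurable_fun_fubini_tonelli_G _ _ T (measurableTypeR R) R P
    (fun z => (q z.2 * `|X z.2 z.1 ^+ 2 - X (gridpt m i) z.1 ^+ 2|)%:E)).
  + exact: mcell.
  + by move=> z; rewrite lee_fin mulr_ge0.
- by apply/measurable_EFinP; apply: measurable_funM => //; exact: measurable_funTS.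
- by move=> t ti; rewrite E lee_fin mulrC ler_wpM2r// he.
Qed.

Lemma expRN_lipschitz (x y : R) : 0 <= x -> 0 <= y ->
  `|expR (- x) - expR (- y)| <= `|x - y|.
Proof.
wlog xy : x y / x <= y.
  move=> hw x0 y0; have [xy|/ltW yx] := leP x y; first exact: hw.
  by rewrite distrC [`|x - y|]distrC; exact: hw.
move=> x0 y0; rewrite ger0_norm; last by rewrite subr_ge0 ler_expR lerN2.
rewrite distrC ger0_norm ?subr_ge0//.
have -> : - y = - x + (x - y) by ring.
rewrite expRD -{1}[expR (- x)]mulr1 -mulrBr.
have h1 := expR_ge1Dx (x - y).
have h2 : expR (- x) <= 1 by rewrite -expR0 ler_expR oppr_le0.
apply: (@le_trans _ _ (1 * (1 - expR (x - y)))).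
  by rewrite ler_wpM2r// subr_ge0 -expR0 ler_expR subr_le0.
by rewrite mul1r; move: h1; move: (expR _) => E; lra.
Qed.

Lemma expRN_integrable (Y : T -> R) : measurable_fun setT Y -> (forall w, 0 <= Y w) ->
  P.-integrable setT (EFin \o (fun w => expR (- Y w))).
Proof.
move=> mY Y0; have i1 : P.-integrable setT (EFin \o (fun=> 1)).
  exact: finite_measure_integrable_cst.
apply: le_integrable i1 => //.
  by apply/measurable_EFinP; apply: measurableT_comp => //; exact: measurableT_comp.
by move=> w _; rewrite lee_fin normr1 ger0_norm ?expR_ge0// -expR0 ler_expR oppr_le0.
Qed.

Definition laplaceV s := \int[P]_w expR (- (s * fine (energyV w))).

Lemma measurable_fine_energyV : measurable_fun setT (fun w => fine (energyV w)).
Proof. exact: measurableT_comp measurable_energyV. Qed.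

(** Mean-square continuity makes the expected discretization error small, and
    [exp (- s x)] is [s]-Lipschitz. *)
Lemma laplace_discretization e : 0 < e -> exists m0, forall m, (m0 <= m)%N ->
  forall s, 0 <= s ->
  `|laplaceV s - expR (- logdet (cov X) (cellw q m) s)| <= s * e.
Proof.
move=> e0; pose I := \int[leb]_(t in circ) q t.
have I0 : 0 <= I by apply: Rintegral_ge0 => t _; exact: q0.
have e1 : 0 < e / (I + 1) by rewrite divr_gt0// ltr_wpDl.
have [h0 h00 H] := sqdiff_mean e1.
exists (Num.bound (2 * pi / h0)).+1 => m mm s s0.
have m0 : (0 < m)%N by apply: leq_trans mm.
have mr : 0 < m%:R :> R by rewrite ltr0n.
have hm : 2 * pi / m%:R < h0.
  rewrite ltr_pdivrMr// [h0 * _]mulrC -ltr_pdivrMr//.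
  apply: (@lt_le_trans _ _ (Num.bound (2 * pi / h0))%:R).
    by apply: archi_boundP; rewrite divr_ge0 ?mulr_ge0 ?pi_ge0// ltW.
  by rewrite ler_nat ltnW.
have err : (\int[P]_w grid_error m w <= e%:E)%E.
  apply: (@le_trans _ _ (e / (I + 1) * I)%:E).
    apply: mean_grid_error => // i t; rewrite /cell /= in_itv /= => /andP[ti it].
    apply: H; rewrite ger0_norm ?subr_ge0//; apply: le_lt_trans hm.
    by rewrite lerBlDl -gridptS ltW.
  rewrite lee_fin mulrAC ler_pdivrMr ?ltr_wpDl// ler_pM2l//.
  by rewrite lerDl.
rewrite -(laplace_grid X_stat X_centered X_spec X_gauss (cellw_nneg q0 (m := m)) s0).
pose S w := \sum_i cellw q m 0 i * X (gridpt m i) w ^+ 2.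
have mS : measurable_fun setT S.
  by apply: measurable_sum => i; apply: measurable_funM => //; exact: measurable_funX.
have S0 w : 0 <= S w.
  by apply: sumr_ge0 => i _; rewrite mulr_ge0 ?sqr_ge0//; exact: cellw_nneg.
have V0 w : 0 <= fine (energyV w) by rewrite fine_ge0// energyV_ge0.
have mV := measurable_fine_energyV.
have msV : measurable_fun setT (fun w => s * fine (energyV w)) by exact: measurable_funM.
have msS : measurable_fun setT (fun w => s * S w) by exact: measurable_funM.
have iV := expRN_integrable msV (fun w => mulr_ge0 s0 (V0 w)).
have iS := expRN_integrable msS (fun w => mulr_ge0 s0 (S0 w)).
have iD : P.-integrable setT (EFin \o (fun w => expR (- (s * fine (energyV w))) - expR (- (s * S w)))).
  by apply: intDB.
rewrite /laplaceV -RintegralB//.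
apply: (le_trans (le_normr_Rintegral _ iD)) => //.
have iN := intDn iD.
rewrite -lee_fin -RintE//.
apply: (@le_trans _ _ (\int[P]_w (s%:E * grid_error m w))%E).
  apply: ae_ge0_le_integral => //.
  - by case/integrableP: iN.
  - by move=> w _; rewrite mule_ge0 ?lee_fin// grid_error_ge0.
  - by apply: measurable_funeM; exact: measurable_grid_error.
  - move: energyV_fin_ae; apply: filterS => w Vf _.
    apply: (@le_trans _ _ (s%:E * `|fine (energyV w) - S w|%:E)%E).
      rewrite -EFinM lee_fin -{3}[s]ger0_norm// -normrM mulrBr.
      by apply: expRN_lipschitz; apply: mulr_ge0.
    by apply: lee_wpmul2l; [rewrite lee_fin|exact: energyV_grid].
rewrite ge0_integralZl//; last 2 first.
- exact: measurable_grid_error.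
- by move=> w _; exact: grid_error_ge0.
by rewrite EFinM; apply: lee_wpmul2l; rewrite ?lee_fin.
Qed.

End Discretization.

(** * Small deviations from the Laplace transform *)

Lemma tilt_expand {R : realType} (s x h v : R) : h * s * x <= h * s * v ->
  - (s * v) <= - (h * s * x) + - ((1 - h) * s * v).
Proof.
rewrite [(1 - h) * s]mulrBl mul1r [(s - h * s) * v]mulrBl.
by move: (s * v) (h * s * v) (h * s * x) => a b c; lra.
Qed.

Section LaplaceTransform.
Context {d : measure_display} {T : measurableType d} {R : realType}.
Variable P : probability T R.
Variable Y : T -> R.
Hypothesis mY : measurable_fun setT Y.
Hypothesis Y0 : forall w, 0 <= Y w.

Let L s := \int[P]_w expR (- (s * Y w)).
Let p x := fine (P [set w | Y w <= x]).

Let mle x : measurable [set w | Y w <= x].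
Proof.
rewrite -[[set _ | _]]setTI; have -> : [set w | Y w <= x] = Y @^-1` `]-oo, x]%classic.
  by apply/funext => w; apply/propext; rewrite /= in_itv.
by apply: mY => //; exact: measurable_itv.
Qed.

Let iL s : 0 <= s -> P.-integrable setT (EFin \o (fun w => expR (- (s * Y w)))).
Proof.
move=> s0; apply: expRN_integrable; first exact: measurable_funM.
by move=> w; rewrite mulr_ge0.
Qed.

Let ip x : P.-integrable setT (EFin \o (fun w => \1_[set w | Y w <= x] w : R)).
Proof. by apply: integrable_indic => //; rewrite fin_num_fun_lty//; exact: fin_num_measure. Qed.

Let pE x : p x = \int[P]_w (\1_[set w | Y w <= x] w : R).
Proof. by rewrite /Rintegral integral_indic// setIT. Qed.

Let intZ k (f : T -> R) : P.-integrable setT (EFin \o f) ->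
  \int[P]_w (k * f w) = k * \int[P]_w f w.
Proof. by move=> fi; rewrite RintegralZl. Qed.

Lemma markov_laplace s x : 0 < s -> p x <= expR (s * x) * L s.
Proof.
move=> s0; rewrite pE -RintegralZl//; last exact: iL (ltW s0).
apply: le_Rintegral => //; first by apply: intgZ; exact: iL (ltW s0).
move=> w _; rewrite indicE; case: (boolP (w \in _)) => [|_]; last by rewrite mulr_ge0 ?expR_ge0.
rewrite inE /= => Yx; rewrite -expRD -expR0 ler_expR subr_ge0.
by rewrite ler_pM2l.
Qed.

(** Values above [(1 + t) x] are estimated by tilting less, values below
    [(1 - t) x] by tilting more. *)
Lemma laplace_split s x t h : 0 < s -> 0 < x -> 0 < t < 1 -> 0 < h < 1 ->
  L s <= expR (- (s * ((1 - t) * x))) * p ((1 + t) * x)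
       + expR (- (h * s * ((1 + t) * x))) * L ((1 - h) * s)
       + expR (h * s * ((1 - t) * x)) * L ((1 + h) * s).
Proof.
move=> s0 x0 /andP[t0 t1] /andP[h0 h1].
have s1 : 0 <= (1 - h) * s by apply: mulr_ge0; rewrite ?subr_ge0; exact: ltW.
have s2 : 0 <= (1 + h) * s by apply: mulr_ge0; [rewrite addr_ge0// ltW|exact: ltW].
have hs : 0 < h * s by rewrite mulr_gt0.
have i1 := intgZ (expR (- (s * ((1 - t) * x)))) (ip ((1 + t) * x)).
have i2 := intgZ (expR (- (h * s * ((1 + t) * x)))) (iL s1).
have i3 := intgZ (expR (h * s * ((1 - t) * x))) (iL s2).
have i12 := intgD i1 i2; have i123 := intgD i12 i3.
have Z1 := intZ (expR (- (s * ((1 - t) * x)))) (ip ((1 + t) * x)).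
have Z2 := intZ (expR (- (h * s * ((1 + t) * x)))) (iL s1).
have Z3 := intZ (expR (h * s * ((1 - t) * x))) (iL s2).
rewrite pE -Z1 -Z2 -Z3 -RintegralD// -RintegralD//.
apply: le_Rintegral => //; first exact: iL (ltW s0).
move=> w _; have E1 : 0 <= expR (- (h * s * ((1 + t) * x))) * expR (- ((1 - h) * s * Y w)).
  by rewrite mulr_ge0 ?expR_ge0.
have E2 : 0 <= expR (h * s * ((1 - t) * x)) * expR (- ((1 + h) * s * Y w)).
  by rewrite mulr_ge0 ?expR_ge0.
have [lo|hi] := leP (Y w) ((1 + t) * x); last first.
  rewrite -addrA; apply: (@le_trans _ _ (expR (- (h * s * ((1 + t) * x))) * expR (- ((1 - h) * s * Y w)))).
    rewrite -expRD ler_expR.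
    by apply: tilt_expand; apply: ler_wpM2l; exact: ltW.
  by rewrite addrCA lerDl addr_ge0// mulr_ge0 ?expR_ge0.
have [mid|small] := leP ((1 - t) * x) (Y w).
  apply: (@le_trans _ _ (expR (- (s * ((1 - t) * x))) * \1_[set w | Y w <= (1 + t) * x] w)).
    rewrite indicE mem_set//= mulr1 ler_expR lerN2.
    by rewrite ler_pM2l.
  by rewrite -addrA lerDl addr_ge0.
apply: (@le_trans _ _ (expR (h * s * ((1 - t) * x)) * expR (- ((1 + h) * s * Y w)))).
  rewrite -expRD ler_expR.
  have := @tilt_expand _ s ((1 - t) * x) (- h) (Y w).
  rewrite !mulNr !opprK; apply.
  by rewrite lerN2; apply: ler_wpM2l; exact: ltW.
by rewrite lerDr addr_ge0// mulr_ge0// ?expR_ge0// indicE.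
Qed.

End LaplaceTransform.

Section Constants.
Context {R : realType}.

(** With [B] the base of the power on the right, [a A] is
    [2^(a-1) (2 pi)^a B], and its power of exponent [1 / (1 - a) = r / (r - 1)] is
    [2^-1 (2 pi)^(1/(r-1)) B^(r/(r-1))]. *)
Lemma limiting_constantE (r M I x : R) : 1 < r -> 0 < M -> 0 <= I -> 0 < x ->
  let a := r^-1 in let A := limit_constant r M * ((2 * pi)^-1 * I) in
  (1 - a) * A * (a * A / x ^+ 2) `^ (a / (1 - a)) =
  (M `^ r^-1 / (r * sin (pi / r)) * I) `^ (r / (r - 1)) *
    (((r - 1) * (2 * pi) `^ (r - 1)^-1) / (2 * x `^ (2 / (r - 1)))).
Proof.
move=> r1 M0 I0 x0 a A; have r0 : 0 < r by apply: lt_trans r1.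
have rm : 0 < r - 1 by rewrite subr_gt0.
have a01 : 0 < a < 1 by rewrite invr_gt0 r0 invf_lt1.
have sp : 0 < sin (pi / r) :> R.
  rewrite sin_gt0_pi// divr_gt0 ?pi_gt0//= ltr_pdivrMr// ltr_pMr ?pi_gt0//.
have p2 : 0 < 2 * pi :> R by rewrite mulr_gt0 ?pi_gt0.
have [g gE] : {g | g = (r - 1)^-1} by exists (r - 1)^-1.
have g0 : 0 < g by rewrite gE invr_gt0.
have gE1 : a / (1 - a) = g by rewrite /a gE; field; rewrite !gt_eqF.
have gE2 : r / (r - 1) = 1 + g by rewrite gE; field; rewrite gt_eqF.
have gE3 : 2 / (r - 1) = 2 * g by rewrite gE.
have ag : a * (1 + g) = g by rewrite /a gE; field; rewrite !gt_eqF.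
set B := M `^ r^-1 / (r * sin (pi / r)) * I.
have B0 : 0 <= B by apply: mulr_ge0 => //; apply: divr_ge0; [exact: powR_ge0|rewrite ltW// mulr_gt0].
have AE : a * A = 2 `^ (a - 1) * (2 * pi) `^ a * B.
  rewrite /A /B /limit_constant /growth reflection_intE// -/a powRM// ?(ltW M0)//.
  have spa : 0 < sin (pi * a) by [].
  have -> : 2 `^ a = 2 * 2 `^ (a - 1) :> R by rewrite mulr_powRB1//; case/andP: a01.
  rewrite /a; move: (2 `^ _) ((2 * pi) `^ _) (M `^ _) => u v m.
  move: spa; rewrite /a; move: (sin _) => z z0.
  have := @pi_gt0 R; move: pi => q q0.
  by field; rewrite !gt_eqF.
have AE' : (1 - a) * A = (r - 1) * (a * A) by rewrite /a; field; rewrite gt_eqF.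
rewrite AE' gE1 gE2 gE3 -gE.
have Y0 : 0 <= a * A by rewrite AE; apply: mulr_ge0 => //; rewrite mulr_ge0 ?powR_ge0.
rewrite [(a * A / _) `^ g]powRM ?invr_ge0 ?sqr_ge0//.
have -> : (x ^+ 2)^-1 `^ g = (x `^ (2 * g))^-1.
  rewrite -powRN -[in LHS]powR_inv1 ?sqr_ge0// -powRrM -powR_mulrn ?ltW// -powRrM.
  by congr (_ `^ _); ring.
have -> : (r - 1) * (a * A) * ((a * A) `^ g * (x `^ (2 * g))^-1) =
   (r - 1) * ((a * A) `^ (1 + g)) / x `^ (2 * g).
  have -> : (a * A) `^ (1 + g) = a * A * (a * A) `^ g.
    rewrite -[1 + g]addrC -{2}[g](addrK 1) -[LHS]mulr_powRB1//.
    by rewrite addr_gt0.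
  by rewrite -/a; ring.
have -> : (a * A) `^ (1 + g) = 2^-1 * (2 * pi) `^ g * B `^ (1 + g).
  rewrite AE [LHS]powRM//; last by rewrite mulr_ge0 ?powR_ge0.
  rewrite [(2 `^ _ * _) `^ _]powRM ?powR_ge0// -!powRrM ag.
  have -> : (a - 1) * (1 + g) = - 1 by rewrite /a gE; field; rewrite !gt_eqF.
  by rewrite powR_inv1.
have : 0 < x `^ (2 * g) by exact: powR_gt0.
move: (x `^ _) (B `^ _) ((2 * pi) `^ _) => X Z W X0.
by field; rewrite gt_eqF.
Qed.

End Constants.

Section LaplaceAsymptotics.
Context {d : measure_display} {T : measurableType d} {R : realType}.
Variable P : probability T R.
Local Notation leb := (@lebesgue_measure R).
Variables (X : R -> {RV P >-> R}) (mu : int -> R).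
Hypothesis X_meas : jointly_measurable X.
Hypothesis X_stat : stationary_process X.
Hypothesis X_centered : centered_process X.
Hypothesis X_spec : spectral_measure X mu.
Hypothesis X_gauss : gaussian_process X.
Hypothesis X_msc : ms_continuous X.
Variables (r M : R).
Hypotheses (r_gt1 : 1 < r) (M_gt0 : 0 < M).
Hypothesis mu_asymp : asymp_equiv absz_infty mu (fun k => M * (`|k|%N%:R `^ (- r))).
Variable q : R -> R.
Hypothesis q0 : forall t, 0 <= q t.
Hypothesis mq : measurable_fun setT (q : measurableTypeR R -> R).
Hypothesis qi : leb.-integrable circ (EFin \o q).

Let a := r^-1.

(** The Laplace transform at [s] behaves as [exp (- rate s^(1/r))]. *)
Definition rate : R :=
  limit_constant r M * ((2 * pi)^-1 * \int[leb]_(t in circ) (q t `^ a)).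

(** For fixed [s] the discretization error disappears as the grid is refined, while
    the bounds on the logarithmic determinants hold with the same [C] on infinitely
    many grids. *)
Lemma laplaceV_bounds e : 0 < e -> exists2 C, 0 <= C & forall s, 0 <= s ->
  expR (- (rate * s `^ a + (e * s `^ a + C))) <= laplaceV X q s <=
  expR (- (rate * s `^ a - (e * s `^ a + C))).
Proof.
move=> e0; have [mu0 _ _] := X_spec.
have a01 : 0 < a < 1 by rewrite invr_gt0 (lt_trans _ r_gt1)//= invf_lt1// (lt_trans _ r_gt1).
have [C C0 H] := logdet_asymptotics mu0 (zlim_cov X_spec) M_gt0 r_gt1 mu_asymp
  (cellw_nneg q0) e0 (fun dl dl0 => step_approximation q0 qi a01 dl0).
exists C => // s s0; have {}H := H s s0.
suff K dl : 0 < dl -> expR (- (rate * s `^ a + (e * s `^ a + C))) <= laplaceV X q s + dl /\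
    laplaceV X q s <= expR (- (rate * s `^ a - (e * s `^ a + C))) + dl.
  by apply/andP; split; apply/ler_addgt0Pr => dl /K[].
move=> dl0; have s1 : 0 < s + 1 by rewrite ltr_wpDl.
have d1 : 0 < dl / (s + 1) by rewrite divr_gt0.
have [m0 D] := laplace_discretization X_meas X_stat X_centered X_spec X_gauss X_msc q0 mq qi d1.
have [m mm ld] := H m0; have {}D := D m mm s s0.
have sd : s * (dl / (s + 1)) <= dl.
  by rewrite mulrA ler_pdivrMr// mulrC ler_pM2l// lerDl.
have {sd}D := le_trans D sd.
move: ld; rewrite -/a -/rate ler_distl => /andP[ld1 ld2].
move: D; rewrite ler_distl => /andP[D1 D2].
split.
  apply: (@le_trans _ _ (expR (- logdet (cov X) (cellw q m) s))); last by rewrite -lerBlDr.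
  by rewrite ler_expR lerN2.
apply: (le_trans D2); rewrite lerD2r ler_expR lerN2.
by [].
Qed.

Lemma laplaceV_gt0 s : 0 < s -> 0 < laplaceV X q s.
Proof.
move=> s0; have [C _ /(_ s (ltW s0)) /andP[h _]] := laplaceV_bounds ltr01.
by apply: lt_le_trans h; exact: expR_gt0.
Qed.

Lemma ln_laplaceV e : 0 < e -> exists2 s0, 0 < s0 & forall s, s0 <= s ->
  `|ln (laplaceV X q s) + rate * s `^ a| <= e * s `^ a.
Proof.
move=> e0; have e2 : 0 < e / 2 by rewrite divr_gt0.
have a0 : 0 < a by rewrite invr_gt0 (lt_trans _ r_gt1).
have [C C0 H] := laplaceV_bounds e2.
exists ((C / (e / 2) + 1) `^ r).
  by rewrite powR_gt0// ltr_wpDl// divr_ge0// ltW.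
move=> s ss; have s0 : 0 < s.
  by apply: lt_le_trans ss; rewrite powR_gt0// ltr_wpDl// divr_ge0// ltW.
have /andP[h1 h2] := H s (ltW s0); have Lp := laplaceV_gt0 s0.
have Cs : C <= e / 2 * s `^ a.
  rewrite mulrC -ler_pdivrMr//; apply: (@le_trans _ _ (C / (e / 2) + 1)).
    by rewrite lerDl.
  have b0 : 0 <= C / (e / 2) + 1 by rewrite addr_ge0// divr_ge0// ltW.
  have := powR_homo (ltW a0) (powR_ge0 _ _) ss; rewrite -powRrM /a mulfV ?powRr1//.
  by rewrite gt_eqF// (lt_trans _ r_gt1).
have g1 : - (rate * s `^ a + (e / 2 * s `^ a + C)) <= ln (laplaceV X q s).
  by rewrite -[leLHS]expRK ler_ln ?posrE ?expR_gt0.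
have g2 : ln (laplaceV X q s) <= - (rate * s `^ a - (e / 2 * s `^ a + C)).
  by rewrite -[leRHS]expRK ler_ln ?posrE ?expR_gt0.
have ee : e * s `^ a = e / 2 * s `^ a + e / 2 * s `^ a by field.
rewrite ee ler_norml; move: g1 g2 Cs.
move: (ln _) (rate * _) (e / 2 * _) => x y z; move=> *; apply/andP; split; lra.
Qed.

Lemma small_deviation e : 0 < rate -> 0 < e -> exists2 x0, 0 < x0 &
  forall x, 0 < x < x0 ->
  let p := fine (P [set w | (energyV X q w <= x%:E)%E]) in
  let G := (1 - a) * rate * (a * rate / x) `^ (a / (1 - a)) in
  0 < p /\ `|ln p + G| <= e * G.
Proof.
move=> rate0 e0.
have a01 : 0 < a < 1 by rewrite invr_gt0 (lt_trans _ r_gt1)//= invf_lt1// (lt_trans _ r_gt1).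
have mV := measurable_fine_energyV X_meas q0 mq.
have V0 w : 0 <= fine (energyV X q w) by rewrite fine_ge0// energyV_ge0.
have pE x : fine (P [set w | (energyV X q w <= x%:E)%E]) = fine (P [set w | fine (energyV X q w) <= x]).
  have mle : measurable [set w | fine (energyV X q w) <= x].
    rewrite -[[set _ | _]]setTI.
    have -> : [set w | fine (energyV X q w) <= x] = (fun w => fine (energyV X q w)) @^-1` `]-oo, x]%classic.
      by apply/funext => w; apply/propext; rewrite /= in_itv.
    by apply: mV => //; exact: measurable_itv.
  have mle' : measurable [set w | (energyV X q w <= x%:E)%E].
    rewrite -[[set _ | _]]setTI.
    by apply: emeasurable_fun_infty_c => //; exact: measurable_energyV.
  have ind A : measurable A -> P A = (\int[P]_w (\1_A w)%:E)%E.
    by move=> mA; rewrite integral_indic// setIT.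
  rewrite ind// [in RHS]ind//; congr fine; apply: ae_eq_integral => //.
  - by apply/measurable_EFinP; exact: measurable_indic.
  - by apply/measurable_EFinP; exact: measurable_indic.
  have := energyV_fin_ae X_meas X_stat X_centered q0 mq qi.
  apply: filterS => w Vf _; congr (_%:E); rewrite !indicE; congr (nat_of_bool _)%:R.
  apply/idP/idP; rewrite !inE /=.
    by rewrite -lee_fin fineK.
  by rewrite -[in X in X -> _]lee_fin fineK.
have [x0 x00 H] := tauberian_real a01 rate0 laplaceV_gt0 (@markov_laplace _ T R P _ mV V0)
  (@laplace_split _ T R P _ mV V0) ln_laplaceV e0.
by exists x0 => // x /H; rewrite -pE.
Qed.

End LaplaceAsymptotics.

Section Weight.
Context {R : realType}.
Local Notation leb := (@lebesgue_measure R).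

Lemma leb_ae_imp (A B : R -> Prop) : (forall t, A t -> B t) ->
  {ae leb, forall t, A t} -> {ae leb, forall t, B t}.
Proof.
move=> AB [N [mN N0 sub]]; exists N; split => // t /= nB; apply: sub => /= At.
exact/nB/AB.
Qed.

Lemma leb_ae_and (A B : R -> Prop) : {ae leb, forall t, A t} ->
  {ae leb, forall t, B t} -> {ae leb, forall t, A t /\ B t}.
Proof.
move=> aA aB; exact: (@filterS2 _ _ (ae_filter_ringOfSetsType leb) _ _ _ (fun t a b => conj a b) aA aB).
Qed.

Lemma ae_neq (x : R) : {ae leb, forall t, t != x}.
Proof.
exists [set x]; split; [exact: measurable_set1|exact: lebesgue_measure_set1|].
by move=> t /= /negP; rewrite negbK => /eqP.
Qed.

Lemma circ_itv (t : R) : circ t -> t \in `[0, 2 * pi].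
Proof. by rewrite /circ /= !in_itv /= => /andP[-> /ltW]. Qed.

Lemma itv_circ (t : R) : t != 2 * pi -> t \in `[0, 2 * pi] -> circ t.
Proof. by move=> tn; rewrite /circ /= !in_itv /= => /andP[-> h]; rewrite lt_neqAle tn. Qed.

(** A version of the weight that is nonnegative and measurable everywhere, needed
    for joint measurability of the integrand. *)
Lemma weight_modification (q : R -> R) :
  leb.-integrable `[0, 2 * pi] (EFin \o q) ->
  {ae leb, forall t, t \in `[0, 2 * pi] -> 0 <= q t} ->
  exists q1 : R -> R, [/\ forall t, 0 <= q1 t,
    measurable_fun setT (q1 : measurableTypeR R -> R),
    leb.-integrable circ (EFin \o q1) &
    {ae leb, forall t, circ t -> q t = q1 t}].
Proof.
move=> qi q0; have ci : leb.-integrable circ (EFin \o q).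
  apply: (integrableS _ measurable_circ _ qi); first exact: measurable_itv.
  by move=> t /circ_itv.
pose qp t := Num.max (q t) 0; pose q1 : measurableTypeR R -> R := qp \_ circ.
have mqc : measurable_fun circ (q : measurableTypeR R -> R).
  by case/integrableP: ci => /measurable_EFinP.
have m1 : measurable_fun setT q1.
  apply/(measurable_restrictT _ measurable_circ); exact: measurable_maxr.
have q10 t : 0 <= q1 t.
  by rewrite /q1 patchE; case: ifP => // _; rewrite /qp le_max lexx orbT.
exists q1; split => //.
  apply: le_integrable ci; first exact: measurable_circ.
    by apply/measurable_EFinP; exact: measurable_funTS.
  move=> t tc /=; rewrite lee_fin (ger0_norm (q10 _)) /q1 patchE mem_set// /qp.
  by rewrite ge_max ler_norm normr_ge0.
apply: leb_ae_imp q0 => t qt tc; rewrite /q1 patchE mem_set// /qp.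
by apply/esym/max_idPl; apply: qt; exact: circ_itv.
Qed.

Lemma rate_gt0 (r M : R) (q : R -> R) : 1 < r -> 0 < M ->
  0 < \int[leb]_(t in circ) (q t `^ r^-1) -> 0 < rate r M q.
Proof.
move=> r1 M0 I0; have r0 : 0 < r by apply: lt_trans r1.
have p2 : 0 < 2 * pi :> R by rewrite mulr_gt0// pi_gt0.
have a01 : 0 < r^-1 < 1 by rewrite invr_gt0 r0/= invf_lt1.
have s0 : 0 < sin (pi * r^-1) :> R.
  rewrite sin_gt0_pi// divr_gt0 ?pi_gt0//= ltr_pdivrMr// ltr_pMr ?pi_gt0//.
apply: mulr_gt0; last by apply: mulr_gt0; [rewrite invr_gt0|exact: I0].
apply: mulr_gt0; last exact: powR_gt0.
apply: mulr_gt0; first by apply: powR_gt0; exact: mulr_gt0.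
by rewrite reflection_intE//; apply: divr_gt0 => //; exact: pi_gt0.
Qed.

Lemma asymp_equiv_at_right (F G : R -> R) :
  (forall e, 0 < e -> exists2 x0, 0 < x0 & forall x, 0 < x < x0 ->
     0 < G x /\ `|F x + G x| <= e * G x) ->
  asymp_equiv 0^'+ F (fun x => - G x).
Proof.
move=> H; apply/cvgrPdist_le => e e0; have [x0 x00 K] := H e e0.
near=> x; have [G0 h] : 0 < G x /\ `|F x + G x| <= e * G x.
  by apply: K; apply/andP; split; near: x; [exact: nbhs_right_gt|exact: nbhs_right_lt].
rewrite -ler_pdivrMr// in h; apply: le_trans h.
have -> : 1 - F x / - G x = (F x + G x) / G x by field; rewrite gt_eqF.
by rewrite normrM normfV (gtr0_norm G0).
Unshelve. all: by end_near.
Qed.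

End Weight.
Theorem theorem2p2 (R : realType) (d : measure_display) (T : measurableType d)
    (P : probability T R) (X : R -> {RV P >-> R}) (mu : int -> R)
    (r M : R) (q : R -> R)
    (X_meas : jointly_measurable X)
    (X_gauss : gaussian_process X)
    (X_centered : centered_process X)
    (X_stat : stationary_process X)
    (X_msc : ms_continuous X)
    (X_per : periodic_process (2 * pi) X)
    (X_spec : spectral_measure X mu)
    (r_gt1 : 1 < r) (M_gt0 : 0 < M)
    (mu_asymp : asymp_equiv absz_infty mu (fun k => M * (`|k|%N%:R `^ (- r))))
    (q_L1 : (@lebesgue_measure R).-integrable `[0, 2 * pi] (EFin \o q))
    (q_ge0 : {ae @lebesgue_measure R, forall t, t \in `[0, 2 * pi] -> 0 <= q t})
    (q_neq0 :
      ~ {ae @lebesgue_measure R, forall t, t \in `[0, 2 * pi] -> q t = 0}) :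
  asymp_equiv 0^'+
    (fun eps : R =>
       ln (fine (P [set w | (\int[@lebesgue_measure R]_(t in `[0%R, (2 * pi)%R])
                               (q t * `|X t w| ^+ 2)%:E <= (eps ^+ 2)%:E)%E])))
    (fun eps : R =>
       - ((M `^ r^-1 / (r * sin (pi / r))
           * \int[@lebesgue_measure R]_(t in `[0, 2 * pi]) (q t `^ r^-1))
            `^ (r / (r - 1))
          * (((r - 1) * (2 * pi) `^ (r - 1)^-1)
             / (2 * eps `^ (2 / (r - 1)))))).

Proof.
have [q1 [q10 mq1 qi1 qq1]] := weight_modification q_L1 q_ge0.
pose leb := @lebesgue_measure R.
have r0 : 0 < r by apply: lt_trans r_gt1.
have a01 : 0 < r^-1 < 1 by rewrite invr_gt0 r0/= invf_lt1.
have mqc : measurable_fun circ (q : measurableTypeR R -> R).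
  case/integrableP: q_L1 => /measurable_EFinP + _; apply: measurable_funS.
    exact: measurable_itv.
  by move=> t /circ_itv.
have mq1c : measurable_fun circ (q1 : measurableTypeR R -> R) by exact: measurable_funTS.
have VE w : (\int[leb]_(t in `[0%R, (2 * pi)%R]) (q t * `|X t w| ^+ 2)%:E)%E = energyV X q1 w.
  have mX : measurable_fun circ (fun t : measurableTypeR R => X t w).
    by apply: measurable_funTS; exact: measurable_path X_meas w.
  have m1 : measurable_fun circ (fun t : measurableTypeR R => (q t * `|X t w| ^+ 2)%:E).
    apply/measurable_EFinP; apply: measurable_funM => //; apply: measurable_funX.
    exact: measurableT_comp.
  rewrite -integral_itv_bndo_bndc//; apply: ae_eq_integral => //.
  - apply/measurable_EFinP; apply: measurable_funM => //; exact: measurable_funX.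
  - apply: leb_ae_imp qq1 => t qt tc.
    by rewrite real_normK ?num_real// qt.
have iE : \int[leb]_(t in `[0, 2 * pi]) (q t `^ r^-1) = \int[leb]_(t in circ) (q1 t `^ r^-1).
  have m1 : measurable_fun circ (fun t : measurableTypeR R => (q t `^ r^-1)%:E).
    by apply/measurable_EFinP; exact: (measurableT_comp (measurable_powR _) mqc).
  rewrite /Rintegral -integral_itv_bndo_bndc; last exact: m1.
  congr fine; apply: ae_eq_integral; [exact: measurable_circ|exact: m1| |].
  - by apply/measurable_EFinP; exact: (measurableT_comp (measurable_powR _) mq1c).
  - by apply: leb_ae_imp qq1 => t qt tc; rewrite qt.
have I0 : 0 < \int[leb]_(t in circ) (q1 t `^ r^-1).
  rewrite lt_def; apply/andP; split; last by apply: Rintegral_ge0 => t _; exact: powR_ge0.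
  apply/eqP => I0; apply: q_neq0.
  have ip := integrable_powR_circ q10 qi1 a01.
  have mp : measurable_fun circ (fun t : measurableTypeR R => (q1 t `^ r^-1)%:E).
    by apply/measurable_EFinP; exact: (measurableT_comp (measurable_powR _) mq1c).
  have : (\int[leb]_(t in circ) `|(q1 t `^ r^-1)%:E| = 0)%E.
    under eq_integral do rewrite abse_EFin (ger0_norm (powR_ge0 _ _)).
    have := I0; rewrite /Rintegral => /(congr1 (@EFin R)); rewrite fineK; first exact.
    by apply: integrable_fin_num ip; exact: measurable_circ.
  move=> /(ae_eq_integral_abs _ measurable_circ mp) z.
  have := leb_ae_and (leb_ae_and z qq1) (ae_neq (2 * pi)).
  apply: leb_ae_imp => t [[zt qt] tn] ti; have tc := itv_circ tn ti.
  rewrite qt//; have := zt tc => /= -[] /eqP; rewrite powR_eq0 => /andP[/eqP].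
  by [].
have rate0 : 0 < rate r M q1 := rate_gt0 r_gt1 M_gt0 I0.
pose G x := (1 - r^-1) * rate r M q1 * (r^-1 * rate r M q1 / x ^+ 2) `^ (r^-1 / (1 - r^-1)).
have GE x : 0 < x -> G x = (M `^ r^-1 / (r * sin (pi / r))
           * \int[leb]_(t in `[0, 2 * pi]) (q t `^ r^-1))
            `^ (r / (r - 1))
          * (((r - 1) * (2 * pi) `^ (r - 1)^-1)
             / (2 * x `^ (2 / (r - 1)))).
  move=> x0; rewrite iE; exact: (limiting_constantE r_gt1 M_gt0 (ltW I0) x0).
have G0 x : 0 < x -> 0 < G x.
  move=> x0; have /andP[a0 a1] := a01.
  rewrite /G; apply: mulr_gt0; first by apply: mulr_gt0 => //; rewrite subr_gt0.
  by apply: powR_gt0; apply: divr_gt0; [exact: mulr_gt0|exact: exprn_gt0].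
apply: asymp_equiv_at_right => e e0.
have [x0 x00 H] := small_deviation X_meas X_stat X_centered X_spec X_gauss X_msc
  r_gt1 M_gt0 mu_asymp q10 mq1 qi1 rate0 e0.
exists (Num.min 1 x0); first by rewrite lt_min ltr01.
move=> x /andP[xp]; rewrite lt_min => /andP[x1 xx0].
rewrite -(GE _ xp); split; first exact: G0 _ xp.
have x2 : 0 < x ^+ 2 < x0.
  apply/andP; split; first exact: exprn_gt0.
  apply: le_lt_trans xx0; rewrite expr2 -[leRHS]mul1r.
  apply: ler_wpM2r; exact: ltW.
have [_] := H _ x2; rewrite -/(G x).
by under eq_set do rewrite -VE.
Qed.
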